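(* Let $f:\overline{\Omega}\times\mathbb{R}^{m\times n}\to\mathbb{R}_{\ge 0}$ be Borel measurable, convex in the second variable, and assume there are constants $c_0,C_0>0$ with $c_0|Ay|\le f(x,y)\le C_0(1+|Ay|)$ for all $(x,y)$. Let $\mathbb{A}$ be $\mathbb{C}$-elliptic and $u_1\in L^1(\partial\Omega,\mathbb{R}^m)$. Let $u,r\in L^2(\Omega,\mathbb{R}^m)$. Then the following are equivalent: (a) $r\in\partial F^{u_1}_{dual}(u)$ (subdifferential in $L^2(\Omega,\mathbb{R}^m)$). (b) There is $z\in\mathcal{Z}$ with $r=-\operatorname{div}z$ such that for all $w\in\mathrm{BV}^{\mathbb{A}}(\Omega)\cap L^2(\Omega,\mathbb{R}^m)$ $$\int_\Omega\langle w-u,r\rangle\,dx\le-\int_\Omega f^*(x,z)\,dx+\int_\Omega (z,\mathbb{A}w)-\int_{\partial\Omega}\langle\langle z,\nu\rangle,w-u_1\rangle\,d\mathcal{H}^{n-1}-F^{u_1}_{dual}(u).$$ (c) There is $z\in\mathcal{Z}$ with $r=-\operatorname{div}z$ such that for all $w\in\mathrm{BV}^{\mathbb{A}}(\Omega)\cap L^2(\Omega,\mathbb{R}^m)$ $$\int_\Omega\langle w-u,r\rangle\,dx=-\int_\Omega f^*(x,z)\,dx+\int_\Omega (z,\mathbb{A}w)-\int_{\partial\Omega}\langle\langle z,\nu\rangle,w-u_1\rangle\,d\mathcal{H}^{n-1}-F^{u_1}_{dual}(u).$$ (d) $u\in\mathrm{BV}^{\mathbb{A}}(\Omega)$ and there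 is $z\in\mathcal{Z}$ with $r=-\operatorname{div}z$ and $$F^{u_1}_{dual}(u)=\int_\Omega -f^*(x,z)\,dx+\int_\Omega (z,\mathbb{A}u)-\int_{\partial\Omega}\langle\langle z,\nu\rangle,u-u_1\rangle\,d\mathcal{H}^{n-1}.$$
   Context: Setting: $\Omega\subset\mathbb{R}^n$ is a bounded open set with Lipschitz boundary and outer unit normal $\nu$. $A:\mathbb{R}^{m\times n}\to\mathbb{R}^{m\times n}$ is a fixed linear map, symmetric with respect to the Frobenius product $y:y'=\sum_{i,j}y_{ij}y'_{ij}$, with $A^2=A$. For $u:\Omega\to\mathbb{R}^m$ set $\mathbb{A}u:=A\,\mathrm{D}u$ (distributional). $\mathrm{BV}^{\mathbb{A}}(\Omega)$ is the space of $u\in L^1(\Omega,\mathbb{R}^m)$ for which $\mathbb{A}u$ is a bounded $\mathbb{R}^{m\times n}$-valued Radon measure on $\Omega$. $\mathbb{A}$ is called $\mathbb{C}$-elliptic if for every $\xi\in\mathbb{C}^n\setminus\{0\}$ the linear map $\mathbb{C}^m\ni v\mapsto A(v\otimes\xi)$, $(v\otimes\xi)_{ij}=v_i\xi_j$, is injective ($A$ extended complex-linearly). In that case there is a bounded linear trace operator from $\mathrm{BV}^{\mathbb{A}}(\Omega)$ to $L^1(\partial\Omega,\mathbb{R}^m)$, continuous also w.r.t. strict convergence ($u_l\to u$ in $L^1$ and $|\mathbb{A}u_l|(\Omega)\to|\mathbb{A}u|(\Omega)$), equal to the restriction on $C^1(\overline\Omega,\mathbb{R}^m)$; the trace of $w$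 is again written $w$. The divergence of matrix fields is row-wise, $(\operatorname{div}z)_i=\sum_j\partial_jz_{ij}$, distributional. $X_2(\Omega):=\{z\in L^\infty(\Omega,\mathbb{R}^{m\times n}): Az=z,\ \operatorname{div}z\in L^2(\Omega,\mathbb{R}^m)\}$. For $u\in\mathrm{BV}^{\mathbb{A}}(\Omega)\cap L^2(\Omega,\mathbb{R}^m)$ and $z\in X_2(\Omega)$ the pairing $(z,\mathbb{A}u)$ is the distribution $\langle (z,\mathbb{A}u),\phi\rangle:=-\int_\Omega\sum_{i,j}(\phi\,\partial_jz_{ij}u_i+\partial_j\phi\, z_{ij}u_i)\,dx$, $\phi\in C_c^\infty(\Omega)$, which is a bounded Radon measure on $\Omega$. For $z\in X_2(\Omega)$, the normal trace $\langle z,\nu\rangle\in L^\infty(\partial\Omega,\mathbb{R}^m)$ is the unique function with $\int_\Omega\langle\operatorname{div}z,\phi\rangle+z:\mathrm{D}\phi\,dx=\int_{\partial\Omega}\langle\phi,\langle z,\nu\rangle\rangle\,d\mathcal{H}^{n-1}$ for all $\phi\in (W^{1,1}\cap L^{2})(\Omega,\mathbb{R}^m)$. $f^*(x,z)=\sup_{y}(z:y-f(x,y))$. $\mathcal{Z}:=\{z\in X_2(\Omega): f^*(x,z(x))\in L^1(\Omega)\}$. For $u\in L^2(\Omega,\mathbb{R}^m)$: $$F^{u_1}_{dual}(u):=\sup_{z\in\mathcal{Z}}\int_\Omega -f^*(x,z)-\langle u,\operatorname{div}z\rangle\,dx+\int_{\partial\Omega}\langle\langle z,\nu\rangle,u_1\rangle\,d\mathcal{H}^{n-1}$$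 (this is $+\infty$ if $u\notin\mathrm{BV}^{\mathbb{A}}(\Omega)$). On a Hilbert space $H$, $v\in\partial\mathcal{G}(u)$ iff $\langle v,w-u\rangle\le\mathcal{G}(w)-\mathcal{G}(u)$ for all $w\in H$. *)

(* Defs.v *)
From HB Require Import structures.
From mathcomp Require Import all_boot all_order all_algebra.
From mathcomp Require Import lra complex.
From mathcomp Require Import all_classical all_reals all_analysis.
From mathcomp Require Import measurable_realfun.
Set Implicit Arguments.
Unset Strict Implicit.
Unset Printing Implicit Defensive.
Import Order.TTheory GRing.Theory Num.Theory.
Import numFieldNormedType.Exports.
Local Open Scope classical_set_scope.
Local Open Scope ring_scope.

(* Matrices (hence row vectors) carry the Borel sigma-algebra. *)
Definition borel_mx_display : measure_display.
Proof. exact: default_measure_display. Qed.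

HB.instance Definition _ (R : realType) (p q : nat) :=
  @isMeasurable.Build borel_mx_display 'M[R]_(p, q)
    <<s (@open 'M[R]_(p, q)) >>
    (@sigma_algebra0 _ setT _) (@sigma_algebraC _ _)
    (@sigma_algebra_bigcup _ setT _).

Section borel_mx.
Context {R : realType}.

Lemma measurable_coord p q (i : 'I_p) (j : 'I_q) :
  measurable_fun setT (fun M : 'M[R]_(p, q) => M i j).
Proof.
apply: (@measurability _ _ _ R setT _ _ (@RGenOpens.measurableE R)).
move=> _ [_ [x [y ->]] <-]; rewrite setTI; apply: sub_sigma_algebra.
apply: open_comp; last exact: interval_open.
by move=> M _; exact: coord_continuous.
Qed.

Definition rat_ball p q (cr : 'M[rat]_(p, q) * rat) : set 'M[R]_(p, q) :=
  ball (map_mx ratr cr.1 : 'M[R]_(p, q)) (ratr cr.2).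

Lemma open_mx_bigcup_rat p q (U : set 'M[R]_(p, q)) : open U ->
  U = \bigcup_(cr in [set cr | @rat_ball p q cr `<=` U]) rat_ball cr.
Proof.
move=> oU; apply/seteqP; split => [M UM|M [cr /= + Mcr]]; last exact.
have /nbhs_ballP[e /= e0 eU] : nbhs M U by exact: open_nbhs_nbhs.
have [r] := @rat_in_itvoo R 0 (e / 2) (divr_gt0 e0 (ltr0Sn _ _)).
rewrite in_itv/= => /andP[r0 re].
have /choice[c cP] : forall ij : 'I_p * 'I_q, exists c : rat,
    (ratr c : R) \in `]M ij.1 ij.2 - ratr r, M ij.1 ij.2 + ratr r[.
  move=> ij; apply: rat_in_itvoo.
  by rewrite ltrBlDr -addrA ltrDl addr_gt0.
have cM : rat_ball (\matrix_(i, j) c (i, j), r) M.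
  split=> // i j; rewrite !mxE /ball/=.
  have := cP (i, j); rewrite in_itv/= => /andP[c1 c2].
  by rewrite ltr_norml; apply/andP; split; lra.
exists (\matrix_(i, j) c (i, j), r) => //= N Nr.
apply: eU; have := ball_triangle (ball_sym cM) Nr.
by apply: le_ball; rewrite (splitr e) lerD// ltW.
Qed.

Lemma measurable_fun_mx d (T : measurableType d) p q (f : T -> 'M[R]_(p, q)) :
  (forall i j, measurable_fun setT (fun x => f x i j)) -> measurable_fun setT f.
Proof.
move=> mf; apply: (@measurability _ _ _ _ setT f _ erefl).
move=> _ [U oU <-]; rewrite setTI (open_mx_bigcup_rat oU) preimage_bigcup.
rewrite bigcup_mkcond; apply: countable_bigcupT_measurable => // -[c r].
case: ifPn => // _.
have [r0|r0] := ltP 0 (ratr r : R); last first.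
  rewrite (_ : _ @^-1` _ = set0)//; apply/seteqP; split => // x [/=].
  by rewrite ltNge r0.
rewrite (_ : _ @^-1` _ = \bigcap_(ij in [set: 'I_p * 'I_q])
    ((fun x => f x ij.1 ij.2) @^-1` ball (ratr (c ij.1 ij.2) : R) (ratr r))).
  apply: fin_bigcap_measurable => //.
  move=> ij _; rewrite -[X in measurable X]setTI; apply: mf => //.
  exact: measurable_ball.
apply/seteqP; split => [x [_ xb] [i j] _|x xb].
  by have := xb i j; rewrite mxE.
by split => // i j; rewrite mxE; exact: (xb (i, j)).
Qed.

Section cons_rV.
Context {n : nat}.

Definition cons_rV (xv : measurableTypeR R * 'rV[R]_n) : 'rV[R]_n.+1 :=
  row_mx xv.1%:M xv.2 : 'rV_(1 + n).

Definition uncons_rV (v : 'rV[R]_n.+1) : measurableTypeR R * 'rV[R]_n :=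
  (v ord0 ord0, rsubmx (v : 'rV_(1 + n))).

Lemma uncons_rVK : cancel uncons_rV cons_rV.
Proof.
move=> v; rewrite /cons_rV /uncons_rV /= -[RHS](@hsubmxK _ _ 1 n).
rewrite (_ : lsubmx _ = (v ord0 ord0)%:M)//.
apply/rowP => i; rewrite !mxE ord1 eqxx mulr1n.
by congr (v _ _); exact/val_inj.
Qed.

Lemma cons_rVK : cancel cons_rV uncons_rV.
Proof.
move=> [x v]; rewrite /cons_rV /uncons_rV row_mxKr; congr (_, _).
rewrite (_ : ord0 = lshift n ord0 :> 'I_(1 + n)); last exact/val_inj.
by rewrite (@row_mxEl _ 1 1 n) mxE.
Qed.

Lemma measurable_cons_rV : measurable_fun setT cons_rV.
Proof.
apply: measurable_fun_mx => i j.
have [k ->|k ->] := @split_ordP 1 n j.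
  rewrite (_ : (fun _ => _) = fst); first exact: measurable_fst.
  apply/funext => xv; rewrite /cons_rV (@row_mxEl _ 1 1 n) mxE.
  by rewrite (ord1 i) (ord1 k) eqxx.
rewrite (_ : (fun _ => _) = (fun v : 'rV[R]_n => v i k) \o snd).
  exact: measurableT_comp (measurable_coord _ _) measurable_snd.
by apply/funext => xv; rewrite /cons_rV (@row_mxEr _ 1 1 n).
Qed.

Lemma measurable_uncons_rV : measurable_fun setT uncons_rV.
Proof.
apply: measurable_fun_pair; first exact: measurable_coord.
apply: measurable_fun_mx => i j; under eq_fun do rewrite mxE.
exact: measurable_coord.
Qed.

Variable mu : {sigma_finite_measure set 'rV[R]_n -> \bar R}.

Definition lebesgue_cons : set 'rV[R]_n.+1 -> \bar R :=
  pushforward (@lebesgue_measure R \x mu)%E cons_rV.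

Let lebesgue_cons0 : lebesgue_cons set0 = 0%E.
Proof. by rewrite /lebesgue_cons /pushforward preimage_set0 measure0. Qed.

Let lebesgue_cons_ge0 A : (0 <= lebesgue_cons A)%E.
Proof. by rewrite /lebesgue_cons /pushforward; exact: measure_ge0. Qed.

Let measurable_preimage_cons A : measurable A -> measurable (cons_rV @^-1` A).
Proof.
by move=> mA; rewrite -[X in measurable X]setTI; exact: measurable_cons_rV.
Qed.

Let lebesgue_cons_sigma_additive : semi_sigma_additive lebesgue_cons.
Proof.
move=> F mF tF mUF; rewrite /lebesgue_cons /pushforward preimage_bigcup.
apply: measure_semi_sigma_additive.
- by move=> k; exact: measurable_preimage_cons.
- apply/trivIsetP => /= i j _ _ ij; rewrite -preimage_setI.
  by move/trivIsetP : tF => /(_ _ _ _ _ ij) ->//; rewrite preimage_set0.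
- by rewrite -preimage_bigcup; exact: measurable_preimage_cons.
Qed.

HB.instance Definition _ := isMeasure.Build _ _ _ lebesgue_cons
  lebesgue_cons0 lebesgue_cons_ge0 lebesgue_cons_sigma_additive.

Let lebesgue_cons_sigma_finite : sigma_finite setT lebesgue_cons.
Proof.
have /sigma_finiteP[F [TF ndF Foo]] := sigma_finiteT (@lebesgue_measure R).
have /sigma_finiteP[G [TG ndG Goo]] := sigma_finiteT mu.
exists (fun k => uncons_rV @^-1` (F k `*` G k)).
  apply/esym; rewrite -subTset => v _ /=.
  have [i _ Fi] : (\bigcup_k F k) (uncons_rV v).1 by rewrite -TF.
  have [j _ Gj] : (\bigcup_k G k) (uncons_rV v).2 by rewrite -TG.
  exists (maxn i j) => //; split.
  - by move: Fi; exact/subsetPset/ndF/leq_maxl.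
  - by move: Gj; exact/subsetPset/ndG/leq_maxr.
move=> k; have [mF Fk] := Foo k; have [mG Gk] := Goo k; split.
  rewrite -[X in measurable X]setTI; apply: measurable_uncons_rV => //.
  exact: measurableX.
rewrite /lebesgue_cons /pushforward -comp_preimage.
rewrite (_ : _ \o _ = id) ?preimage_id; last by apply/funext; exact: cons_rVK.
by rewrite product_measure1E// lte_mul_pinfty// ge0_fin_numE.
Qed.

HB.instance Definition _ := @Measure_isSigmaFinite.Build _ _ _ lebesgue_cons
  lebesgue_cons_sigma_finite.

End cons_rV.

(* The n-dimensional Lebesgue measure on the Borel sets of R^n. *)
Fixpoint lebesgue_rV (n : nat) : {sigma_finite_measure set 'rV[R]_n -> \bar R} :=
  if n is n'.+1 then lebesgue_cons (lebesgue_rV n') else \d_(0 : 'rV[R]_0).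

End borel_mx.

Definition mxdot {R : realType} {p q : nat} (M N : 'M[R]_(p, q)) : R :=
  \sum_i \sum_j M i j * N i j.

(* Euclidean/Frobenius norm; the canonical norm `|M| is the max norm. *)
Definition enorm {R : realType} {p q : nat} (M : 'M[R]_(p, q)) : R :=
  Num.sqrt (mxdot M M).

Definition tensor {R : pzRingType} {m n : nat} (v : 'rV[R]_m) (xi : 'rV[R]_n) :
  'M[R]_(m, n) := \matrix_(i, j) (v 0 i * xi 0 j).

Section hausdorff_measure.
Context {R : realType} (n k : nat).
Local Open Scope ereal_scope.
Implicit Types (U A : set 'rV[R]_n) (delta : R).

Definition ediam U : \bar R := ereal_sup [set (enorm (x - y))%:E | x in U & y in U].

Definition ball_volume : R :=
  fine (lebesgue_rV k [set x : 'rV[R]_k | (enorm x <= 1)%R]).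

(* The empty set is singled out so that, for k = 0, nonempty sets (and only
   they) get the value 1. *)
Definition hausdorff_gauge delta U : \bar R :=
  if `[< U = set0 >] then 0
  else if ediam U <= delta%:E
    then (ball_volume * (fine (ediam U) / 2) ^+ k)%:E else +oo.

Definition hausdorff_pre delta A : \bar R :=
  ereal_inf [set \sum_(i <oo) hausdorff_gauge delta (U i) |
    U in [set U : (set 'rV[R]_n)^nat | A `<=` \bigcup_i U i]].

Definition hausdorff A : \bar R :=
  ereal_sup [set hausdorff_pre delta A | delta in [set delta | (0 < delta)%R]].

Let gauge0 delta : hausdorff_gauge delta set0 = 0.
Proof. by rewrite /hausdorff_gauge asboolT. Qed.

Let gauge_ge0 delta U : 0 <= hausdorff_gauge delta U.
Proof.
rewrite /hausdorff_gauge; case: asboolP => // U0; case: ifP => // _.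
rewrite lee_fin mulr_ge0//; first exact/fine_ge0/measure_ge0.
rewrite exprn_ge0// divr_ge0// fine_ge0//.
have [x Ux] : U !=set0 by exact/set0P/eqP.
apply: le_ereal_sup_tmp; exists (enorm (x - x))%:E; first by exists x => //; exists x.
by rewrite lee_fin sqrtr_ge0.
Qed.

Let preE delta : hausdorff_pre delta =
  mu_ext (hausdorff_gauge delta : set (g_sigma_algebraType setT) -> \bar R).
Proof.
apply/funext => A; congr ereal_inf; apply/seteqP.
split => _ [U /= AU <-]; exists U => //; last by case: AU.
by split => // i; exact: sub_sigma_algebra.
Qed.

Let hausdorff0 : hausdorff set0 = 0.
Proof.
apply/eqP; rewrite eq_le; apply/andP; split.
  apply: ge_ereal_sup => _ [delta d0 <-].
  by rewrite preE mu_ext0.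
apply: le_ereal_sup_tmp; exists (hausdorff_pre 1 set0); first by exists 1%R => /=.
by rewrite preE mu_ext_ge0.
Qed.

Let hausdorff_ge0 A : 0 <= hausdorff A.
Proof.
apply: le_ereal_sup_tmp; exists (hausdorff_pre 1 A); first by exists 1%R => /=.
by rewrite preE mu_ext_ge0.
Qed.

Let le_hausdorff : {homo hausdorff : A B / A `<=` B >-> A <= B}.
Proof.
move=> A B AB; apply: ge_ereal_sup => _ [delta d0 <-].
apply: le_ereal_sup_tmp; exists (hausdorff_pre delta B); first by exists delta.
by rewrite preE; exact: le_mu_ext.
Qed.

Let hausdorff_sigma_subadditive : sigma_subadditive hausdorff.
Proof.
move=> F; apply: ge_ereal_sup => _ [delta d0 <-].
apply: (@le_trans _ _ (\sum_(i <oo) hausdorff_pre delta (F i))).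
  by rewrite preE; apply: mu_ext_sigma_subadditive.
apply: lee_nneseries => i _; first by move=> _; rewrite preE mu_ext_ge0.
by apply: ereal_sup_ubound; exists delta.
Qed.

HB.instance Definition _ := isOuterMeasure.Build R _ hausdorff
  hausdorff0 hausdorff_ge0 le_hausdorff hausdorff_sigma_subadditive.

End hausdorff_measure.

Section function_spaces.
Context {R : realType} {d : measure_display} {T : measurableType d}.
Variables (mu : {measure set T -> \bar R}) (D : set T).
Context {p q : nat}.
Implicit Type u : T -> 'M[R]_(p, q).

Definition in_L (s : nat) u : Prop :=
  measurable_fun D u /\ (\int[mu]_(x in D) (enorm (u x) ^+ s)%:E < +oo)%E.

Definition in_Linf u : Prop :=
  measurable_fun D u /\
  exists M : R, {ae mu, forall x, D x -> enorm (u x) <= M}.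

End function_spaces.

Section charges.
Context {R : realType} {d : measure_display} {T : measurableType d}.
Local Open Scope ereal_scope.

Definition charge_integral (nu : {charge set T -> \bar R}) (D : set T)
    (f : T -> \bar R) : \bar R :=
  let hP := cid (Hahn_decomposition nu) in
  let hN := cid (svalP hP) in
  (\int[jordan_pos (svalP hN)]_(x in D) f x) -
  (\int[jordan_neg (svalP hN)]_(x in D) f x).

(* |mu|(D) for the matrix-valued measure with entries mu i j, with respect to
   the Frobenius norm. *)
Definition mx_variation p q (mu : 'I_p -> 'I_q -> {charge set T -> \bar R})
    (D : set T) : \bar R :=
  ereal_sup [set \sum_(k <oo) (enorm (\matrix_(i, j) fine (mu i j (E k))))%:E |
    E in [set E : (set T)^nat | [/\ forall k, measurable (E k),
      trivIset setT E & \bigcup_k E k = D]]].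

End charges.

(* Definite description: some x satisfying P, or x0 if there is none. *)
Definition the {T : Type} (x0 : T) (P : T -> Prop) : T :=
  if pselect (exists x, P x) is left h then sval (cid h) else x0.

Section differentiation.
Context {R : realType} {n : nat}.
Implicit Types (Omega : set 'rV[R]_n) (phi : 'rV[R]_n -> R).

Definition partial (j : 'I_n) phi : 'rV[R]_n -> R := 'D_(delta_mx 0 j) phi.

Definition grad phi (x : 'rV[R]_n) : 'rV[R]_n := \row_j partial j phi x.

Definition smooth phi : Prop := forall s : seq 'I_n,
  let psi := foldr partial phi s in
  continuous psi /\ forall j x, derivable psi x (delta_mx 0 j).

Definition test_function Omega phi : Prop :=
  smooth phi /\
  exists K, [/\ compact K, K `<=` Omega & forall x, ~ K x -> phi x = 0].

Definition bd Omega : set 'rV[R]_n := closure Omega `\` interior Omega.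

(* Near each boundary point, Omega is the strict epigraph of a Lipschitz
   function of the coordinates orthogonal to a unit vector e, in direction e. *)
Definition lipschitz_boundary Omega : Prop := forall x0, bd Omega x0 ->
  exists (e : 'rV[R]_n) (gamma : 'rV[R]_n -> R) (L rho : R),
  [/\ enorm e = 1, 0 < rho,
      forall x y, `|gamma x - gamma y| <= L * enorm (x - y),
      forall x t, gamma (x + t *: e) = gamma x &
      forall x, enorm (x - x0) < rho -> (Omega x <-> gamma x < mxdot x e)].

End differentiation.

Section spaces_on_Omega.
Context {R : realType} {m n : nat}.
Variable Omega : set 'rV[R]_n.
Local Notation leb := (lebesgue_rV n).
Local Notation field := ('rV[R]_n -> 'rV[R]_m).
Local Notation mxfield := ('rV[R]_n -> 'M[R]_(m, n)).
Local Open Scope ereal_scope.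

Definition is_weak_gradient (u : field) (G : mxfield) : Prop :=
  forall phi, test_function Omega phi -> forall i j,
    \int[leb]_(x in Omega) (u x 0%R i * partial j phi x)%:E =
    - \int[leb]_(x in Omega) (G x i j * phi x)%:E.

Definition is_weak_div (z : mxfield) (dz : field) : Prop :=
  forall phi, test_function Omega phi -> forall i,
    \int[leb]_(x in Omega) (\sum_j z x i j * partial j phi x)%:E =
    - \int[leb]_(x in Omega) (dz x 0%R i * phi x)%:E.

Definition wdiv (z : mxfield) : field :=
  the (fun _ => 0%R) (fun dz => in_L leb Omega 2 dz /\ is_weak_div z dz).

Definition C1_closure (u : field) : Prop :=
  {within closure Omega, continuous u} /\
  exists G : mxfield, {within closure Omega, continuous G} /\
    forall x, Omega x -> forall i j,
      is_derive x (delta_mx 0%R j : 'rV[R]_n) (fun y => u y 0%R i) (G x i j).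

Section operator.
Variable A : 'M[R]_(m, n) -> 'M[R]_(m, n).

(* mu = A Du in the sense of distributions; since A is constant, A Du sends a
   scalar test function phi to - \int A (u \otimes grad phi). *)
Definition represents_Adiff (u : field)
    (mu : 'I_m -> 'I_n -> {charge set 'rV[R]_n -> \bar R}) : Prop :=
  forall phi, test_function Omega phi -> forall i j,
    charge_integral (mu i j) Omega (EFin \o phi) =
    - \int[leb]_(x in Omega) (A (tensor (u x) (grad phi x)) i j)%:E.

Definition in_BVA (u : field) : Prop :=
  in_L leb Omega 1 u /\ exists mu, represents_Adiff u mu.

Definition Adiff (u : field) : 'I_m -> 'I_n -> {charge set 'rV[R]_n -> \bar R} :=
  the (fun _ _ => czero : {charge set _ -> \bar R}) (represents_Adiff u).

Definition Avariation (u : field) : \bar R := mx_variation (Adiff u) Omega.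

Definition in_X2 (z : mxfield) : Prop :=
  [/\ in_Linf leb Omega z,
      {ae leb, forall x, Omega x -> A (z x) = z x} &
      exists dz, in_L leb Omega 2 dz /\ is_weak_div z dz].

End operator.

(* nu is the distribution (z, A Du), whose formula does not involve A. *)
Definition represents_pairing (z : mxfield) (u : field)
    (nu : {charge set 'rV[R]_n -> \bar R}) : Prop :=
  forall phi, test_function Omega phi ->
    charge_integral nu Omega (EFin \o phi) =
    - \int[leb]_(x in Omega) (phi x * mxdot (wdiv z x) (u x) +
        mxdot (z x) (tensor (u x) (grad phi x)))%:E.

Definition pairing (z : mxfield) (u : field) : {charge set 'rV[R]_n -> \bar R} :=
  the (czero : {charge set _ -> \bar R}) (represents_pairing z u).

End spaces_on_Omega.

(* R^n with the sigma-algebra of H^(n-1)-measurable sets, and H^(n-1) on it. *)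
Definition surface_outer {R : realType} (n : nat) :
  {outer_measure set 'rV[R]_n -> \bar R} := @hausdorff R n n.-1.

Notation surface_type R n := (caratheodory_type (@surface_outer R n)).

Definition surface {R : realType} (n : nat) :
    {measure set (surface_type R n) -> \bar R} :=
  (@surface_outer R n : set (surface_type R n) -> \bar R).

Section traces.
Context {R : realType} {m n : nat}.
Variables (A : 'M[R]_(m, n) -> 'M[R]_(m, n)) (Omega : set 'rV[R]_n).
Local Notation leb := (lebesgue_rV n).
Local Notation field := ('rV[R]_n -> 'rV[R]_m).
Local Notation bdfield := (surface_type R n -> 'rV[R]_m).
Local Open Scope ereal_scope.

(* Fields are total functions, but only the values on Omega (for the argument of
   tr) and on its boundary (for the result) matter. *)
Record trace_operator (tr : field -> bdfield) : Prop := {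
  trace_L1 : forall u, in_BVA Omega A u -> in_L (surface n) (bd Omega) 1 (tr u) ;
  trace_linear : forall (a : R) u v, in_BVA Omega A u -> in_BVA Omega A v ->
    {ae surface n, forall x, bd Omega x ->
      tr (fun y => a *: u y + v y)%R x = (a *: tr u x + tr v x)%R} ;
  trace_bounded : exists C : R, forall u, in_BVA Omega A u ->
    \int[surface n]_(x in bd Omega) (enorm (tr u x))%:E <=
    C%:E * ((\int[leb]_(x in Omega) (enorm (u x))%:E) + Avariation Omega A u) ;
  trace_strict : forall (u_ : nat -> field) u,
    (forall l, in_BVA Omega A (u_ l)) -> in_BVA Omega A u ->
    (fun l => \int[leb]_(x in Omega) (enorm (u_ l x - u x))%:E) @ \oo --> 0 ->
    (fun l => Avariation Omega A (u_ l)) @ \oo --> Avariation Omega A u ->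
    (fun l => \int[surface n]_(x in bd Omega) (enorm (tr (u_ l) x - tr u x))%:E)
      @ \oo --> 0 ;
  trace_C1 : forall u, C1_closure Omega u ->
    {ae surface n, forall x, bd Omega x -> tr u x = u x} }.

(* phi ranges over W^{1,1} and L^2; since W^{1,1} embeds in BV^A, its trace is
   tr phi. *)
Definition is_normal_trace (tr : field -> bdfield)
    (z : 'rV[R]_n -> 'M[R]_(m, n)) (g : bdfield) : Prop :=
  in_Linf (surface n) (bd Omega) g /\
  forall phi G, in_L leb Omega 1 phi -> in_L leb Omega 2 phi ->
    in_L leb Omega 1 G -> is_weak_gradient Omega phi G ->
    \int[leb]_(x in Omega)
      (mxdot (wdiv Omega z x) (phi x) + mxdot (z x) (G x))%:E =
    \int[surface n]_(x in bd Omega) (mxdot (tr phi x) (g x))%:E.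

Definition normal_trace (tr : field -> bdfield)
    (z : 'rV[R]_n -> 'M[R]_(m, n)) : bdfield :=
  the (fun _ => 0%R) (is_normal_trace tr z).

End traces.

(* The complex-linear extension of A. *)
Definition complexify {R : realType} {m n : nat}
    (A : 'M[R]_(m, n) -> 'M[R]_(m, n)) (M : 'M[R[i]]_(m, n)) : 'M[R[i]]_(m, n) :=
  \matrix_(i, j) (A (map_mx (@complex.Re R) M) i j +i*
                  A (map_mx (@complex.Im R) M) i j)%C.

Definition C_elliptic {R : realType} {m n : nat}
    (A : 'M[R]_(m, n) -> 'M[R]_(m, n)) : Prop :=
  forall xi : 'rV[R[i]]_n, xi != 0 ->
    injective (fun v : 'rV[R[i]]_m => complexify A (tensor v xi)).

Section dual_functional.
Context {R : realType} {m n : nat}.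
Variables (A : 'M[R]_(m, n) -> 'M[R]_(m, n)) (Omega : set 'rV[R]_n).
Variable f : 'rV[R]_n -> 'M[R]_(m, n) -> R.
Local Notation leb := (lebesgue_rV n).
Local Notation field := ('rV[R]_n -> 'rV[R]_m).
Local Notation bdfield := (surface_type R n -> 'rV[R]_m).
Local Open Scope ereal_scope.

Definition conjugate (x : 'rV[R]_n) (z : 'M[R]_(m, n)) : \bar R :=
  ereal_sup [set (mxdot z y - f x y)%:E | y in [set: 'M[R]_(m, n)]].

Definition in_Z (z : 'rV[R]_n -> 'M[R]_(m, n)) : Prop :=
  in_X2 Omega A z /\ leb.-integrable Omega (fun x => conjugate x (z x)).

Definition F_dual (tr : field -> bdfield) (u1 : bdfield) (u : field) : \bar R :=
  ereal_sup [set
    (\int[leb]_(x in Omega)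
       (- conjugate x (z x) - (mxdot (u x) (wdiv Omega z x))%:E)) +
    (\int[surface n]_(x in bd Omega)
       (mxdot (normal_trace Omega tr z x) (u1 x))%:E) |
    z in [set z | in_Z z]].

End dual_functional.

(* As +oo - +oo = -oo in \bar R, the subdifferential is empty at points where
   G = +oo. *)
Definition subdifferential {R : realType} {m n : nat} (Omega : set 'rV[R]_n)
    (G : ('rV[R]_n -> 'rV[R]_m) -> \bar R) (u v : 'rV[R]_n -> 'rV[R]_m) : Prop :=
  forall w, in_L (lebesgue_rV n) Omega 2 w ->
    (\int[lebesgue_rV n]_(x in Omega) (mxdot (v x) (w x - u x))%:E <= G w - G u)%E.

(* Main.v *)
(* By the Gauss-Green formula, the right-hand side of (b) and (c) plus F u equals
 G z + <w,r>, where G z is - int f^*(x,z) plus the boundary integral of <z,nu> u1.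
 So (b), (c) and (d) all say that F u = G z + <u,r>: z attains the supremum, and (a)
 follows from F w >= G z + <w,r>.
 Conversely, given (a), let z minimise F u - G z + <u,div z> + |r + div z|^2 / 2 over
 Z.  Fields of finite conjugate are bounded by C0, so near-minimisers of least norm
 converge in L^2 together with their divergences.  First-order optimality and the
 subdifferential inequality at w = u + r + div z give r = - div z and attainment.
 Finiteness of F u forces u in BV^A: the fields A P with |A P| <= c0 have f^* <= 0.
 Gauss-Green comes from smoothing near the boundary (a partition of unity, inner
 shifts, mollification), which converges strictly because no mass escapes to the
 boundary.  The normal trace is the density of the flux functional with respect to
 H^(n-1) on the boundary: covers by small balls bound the flux by the Hausdorff
 measure, and a Riesz representation and Radon-Nikodym do the rest. *)
From HB Require Import structures.
Require Import Defs.
From mathcomp Require Import all_boot all_order all_algebra.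
From mathcomp Require Import complex lra ring finmap.
From mathcomp Require Import all_classical all_reals all_analysis.
From mathcomp Require Import measurable_realfun.
Set Implicit Arguments.
Unset Strict Implicit.
Unset Printing Implicit Defensive.
Import Order.TTheory GRing.Theory Num.Theory.
Import numFieldNormedType.Exports.
Local Open Scope classical_set_scope.
Local Open Scope ring_scope.

(** Attainment would normally rest on weak compactness of Z. The quadratic term replaces it: it
    makes the residuals r + div z of near-minimisers Cauchy, and the choice of least norm makes the
    fields Cauchy too, so convergence is strong and, along a subsequence, almost everywhere, as
    Fatou's lemma for the conjugate requires. At the minimiser, g = r + div z satisfies D(z) + |g|^2
    <= D(z') + <g, r + div z'> for all z' in Z, where D is the defect of attainment at u. Taking the
    supremum over z' gives F(u + g) <= F(u) + <g, r> - D(z) - |g|^2, and the subdifferential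
    inequality leaves D(z) = 0 and g = 0. Divergence and normal trace are definite descriptions, so
    linearity and continuity in z have to be earned. As u1 is merely an L^1 function on the
    boundary, its pairing with the normal trace is approximated by fluxes against smooth fields,
    uniformly for z under a common bound. This needs a finite surface measure, which the trace of a
    constant field provides. *)

Local Notation test := test_function.
Local Notation mfun := measurable_fun.
Local Notation mcomp := measurableT_comp.
Local Notation mEFinP := measurable_EFinP.
Local Notation mfunM := measurable_funM.
Local Notation mfunTS := measurable_funTS.
Local Notation mfunB := measurable_funB.
Local Notation mcst := measurable_cst.

(** * Calculus of smooth functions *)

Section smooth_algebra.
Context {R : realType} {n : nat}.
Local Notation V := 'rV[R]_n.
Local Notation e_ := (fun j : 'I_n => delta_mx 0 j : V).
Implicit Types f g : V -> R.

(** [smooth] speaks of all iterated partial derivatives, so a direct induction breaks down on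
    products. The algebra generated by G is stable under [partial], by the Leibniz rule, as soon as
    the partials of the generators lie in it; all its members are then smooth. *)
Inductive gen_alg (G : set (V -> R)) : (V -> R) -> Prop :=
| gen_alg_gen g : G g -> gen_alg G g
| gen_alg_cst c : gen_alg G (fun=> c)
| gen_algD f g : gen_alg G f -> gen_alg G g -> gen_alg G (fun x => f x + g x)
| gen_algM f g : gen_alg G f -> gen_alg G g -> gen_alg G (fun x => f x * g x).

Lemma partial_isder (j : 'I_n) f x d : is_derive x (e_ j) f d -> partial j f x = d.
by move=> h; rewrite /partial derive_val. Qed.

Lemma isder_partial (j : 'I_n) f x : derivable f x (e_ j) ->
 is_derive x (e_ j) f (partial j f x).
by move=> h; apply: DeriveDef. Qed.

Lemma gen_alg_smooth (G : set (V -> R)) :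
 (forall g, G g -> continuous g /\ forall j, (forall x, derivable g x (e_ j)) /\
  gen_alg G (partial j g)) ->
 forall f, gen_alg G f -> smooth f.
move=> GP.
have step f : gen_alg G f -> continuous f /\ forall j,
  (forall x, derivable f x (e_ j)) /\ gen_alg G (partial j f).
 elim=> {f} [g /GP//|c|f g Gf [cf df] Gg [cg dg]|f g Gf [cf df] Gg [cg dg]].
 - split; first exact: cst_continuous.
  move=> j; split => [x|]; first exact: derivable_cst.
  rewrite (_ : partial j _ = fun=> 0); first exact: gen_alg_cst.
  by apply/funext => x; exact: derive_cst.
 - split; first by move=> x; apply: continuousD; [exact: cf|exact: cg].
  move=> j; have [dfj Gfj] := df j; have [dgj Ggj] := dg j; split => [x|].
   exact: derivableD.
  rewrite (_ : partial j _ = fun x => partial j f x + partial j g x).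
   exact: gen_algD.
  by apply/funext => x; exact: deriveD.
 - split; first by move=> x; apply: continuousM; [exact: cf|exact: cg].
  move=> j; have [dfj Gfj] := df j; have [dgj Ggj] := dg j; split => [x|].
   exact: derivableM.
  rewrite (_ : partial j _ = fun x => f x * partial j g x + g x * partial j f x).
   by apply: gen_algD; exact: gen_algM.
  by apply/funext => x; exact: deriveM.
move=> f Gf s; suff Gs : gen_alg G (foldr partial f s).
 by have [? d] := step _ Gs; split => // j x; apply (d j).1.
by elim: s => //= j s /step[_ /(_ j)[]].
Qed.

(** Conversely, the iterated partials of a smooth function serve as generators. *)
Lemma smooth_gen_alg f : smooth f <-> exists2 G : set (V -> R),
 (forall g, G g -> continuous g /\ forall j, (forall x, derivable g x (e_ j)) /\
  gen_alg G (partial j g)) & gen_alg G f.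
split=> [sf|[G GP Gf]]; last exact: (gen_alg_smooth GP).
exists [set g | exists s, g = foldr partial f s]; last first.
 by apply: gen_alg_gen; exists [::].
move=> _ [s ->]; have [cs ds] := sf s; split => // j; split => [x|]; first exact: ds.
by apply: gen_alg_gen; exists (j :: s).
Qed.

Lemma gen_alg_sub (G H : set (V -> R)) f : G `<=` H -> gen_alg G f -> gen_alg H f.
move=> GH; elim=> {f} [g /GH|c|f g _ ? _ ?|f g _ ? _ ?].
- exact: gen_alg_gen.
- exact: gen_alg_cst.
- exact: gen_algD.
- exact: gen_algM.
Qed.

(** The union of two generating sets contains both functions in one algebra, so sums and products of
    smooth functions are smooth. *)
Lemma smooth_join f g : smooth f -> smooth g -> exists G : set (V -> R),
 [/\ (forall g, G g -> continuous g /\ forall j,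
    (forall x, derivable g x (e_ j)) /\ gen_alg G (partial j g)),
   gen_alg G f & gen_alg G g].
move=> /smooth_gen_alg[G GP Gf] /smooth_gen_alg[H HP Hg].
exists (G `|` H); split; last 2 first.
- by apply: gen_alg_sub Gf; exact: subsetUl.
- by apply: gen_alg_sub Hg; exact: subsetUr.
move=> k [/GP|/HP] [ck dk]; split => // j; have [? ?] := dk j; split => //.
 by apply: gen_alg_sub; [exact: subsetUl|].
by apply: gen_alg_sub; [exact: subsetUr|].
Qed.

Lemma smooth_cst c : smooth (fun _ : V => c).
apply/smooth_gen_alg; exists set0; last exact: gen_alg_cst.
by [].
Qed.

Lemma smoothD f g : smooth f -> smooth g -> smooth (fun x => f x + g x).
move=> sf sg; have [G [GP Gf Gg]] := smooth_join sf sg.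
by apply/smooth_gen_alg; exists G => //; exact: gen_algD.
Qed.

Lemma smoothM f g : smooth f -> smooth g -> smooth (fun x => f x * g x).
move=> sf sg; have [G [GP Gf Gg]] := smooth_join sf sg.
by apply/smooth_gen_alg; exists G => //; exact: gen_algM.
Qed.

Lemma smoothZ c f : smooth f -> smooth (fun x => c * f x).
by move=> sf; exact: (smoothM (smooth_cst c) sf). Qed.

Lemma smoothB f g : smooth f -> smooth g -> smooth (fun x => f x - g x).
move=> sf sg; rewrite (_ : (fun _ => _) = fun x => f x + (-1) * g x).
 exact: (smoothD sf (smoothZ _ sg)).
by apply/funext => x; rewrite mulN1r.
Qed.

Lemma smooth_sum (I : Type) (r : seq I) (P : pred I) (F : I -> V -> R) :
 (forall i, P i -> smooth (F i)) -> smooth (fun x => \sum_(i <- r | P i) F i x).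
move=> sF; elim: r => [|i r IH].
 rewrite (_ : (fun _ => _) = fun=> 0); first exact: (smooth_cst 0).
 by apply/funext => x; rewrite big_nil.
case Pi: (P i); last first.
 rewrite (_ : (fun _ => _) = fun x => \sum_(i <- r | P i) F i x)//.
 by apply/funext => x; rewrite big_cons Pi.
rewrite (_ : (fun _ => _) = fun x => F i x + \sum_(i <- r | P i) F i x).
 exact: (smoothD (sF _ Pi) IH).
by apply/funext => x; rewrite big_cons Pi.
Qed.

Lemma smooth_prod (I : Type) (r : seq I) (P : pred I) (F : I -> V -> R) :
 (forall i, P i -> smooth (F i)) -> smooth (fun x => \prod_(i <- r | P i) F i x).
move=> sF; elim: r => [|i r IH].
 rewrite (_ : (fun _ => _) = fun=> 1); first exact: (smooth_cst 1).
 by apply/funext => x; rewrite big_nil.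
case Pi: (P i); last first.
 rewrite (_ : (fun _ => _) = fun x => \prod_(i <- r | P i) F i x)//.
 by apply/funext => x; rewrite big_cons Pi.
rewrite (_ : (fun _ => _) = fun x => F i x * \prod_(i <- r | P i) F i x).
 exact: (smoothM (sF _ Pi) IH).
by apply/funext => x; rewrite big_cons Pi.
Qed.

Lemma sm_partial j f : smooth f -> smooth (partial j f).
by move=> sf s; have := sf (rcons s j); rewrite foldr_rcons. Qed.

Lemma smooth_cont f : smooth f -> continuous f.
by move=> /(_ [::])[]. Qed.

Lemma smooth_deriv f j x : smooth f -> derivable f x (e_ j).
by move=> /(_ [::])[]. Qed.

Lemma smooth_isder f j x : smooth f -> is_derive x (e_ j) f (partial j f x).
by move=> sf; apply: isder_partial; exact: smooth_deriv. Qed.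

Lemma partialD j f g x : smooth f -> smooth g ->
 partial j (fun x => f x + g x) x = partial j f x + partial j g x.
by move=> sf sg; apply: deriveD; exact: smooth_deriv. Qed.

Lemma partialM j f g x : smooth f -> smooth g ->
 partial j (fun x => f x * g x) x = f x * partial j g x + g x * partial j f x.
by move=> sf sg; apply: deriveM; exact: smooth_deriv. Qed.

Lemma partial_cst j c x : partial j (fun _ : V => c) x = 0.
exact: derive_cst. Qed.

Lemma partialZ j c f x : smooth f ->
 partial j (fun x => c * f x) x = c * partial j f x.
by move=> sf; rewrite (partialM _ _ (smooth_cst c) sf) partial_cst mulr0 addr0.
Qed.

Lemma partialB j f g x : smooth f -> smooth g ->
 partial j (fun x => f x - g x) x = partial j f x - partial j g x.
by move=> sf sg; apply: deriveB; exact: smooth_deriv. Qed.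

Lemma partial_sum j (I : Type) (r : seq I) (P : pred I) (F : I -> V -> R) x :
 (forall i, P i -> smooth (F i)) ->
 partial j (fun x => \sum_(i <- r | P i) F i x) x =
 \sum_(i <- r | P i) partial j (F i) x.
move=> sF; elim: r => [|i r IH].
 rewrite big_nil -[RHS](partial_cst j 0 x); congr (partial _ _ _).
 by apply/funext => y; rewrite big_nil.
rewrite big_cons; case Pi: (P i).
 rewrite -IH -(partialD _ _ (sF _ Pi) (smooth_sum _ sF)).
 by congr (partial _ _ _); apply/funext => y; rewrite big_cons Pi.
by rewrite -IH; congr (partial _ _ _); apply/funext => y; rewrite big_cons Pi.
Qed.

(** The two difference quotients coincide; this gives access to the chain rule of one variable. *)
Lemma isder_line f x (v : V) d :
 is_derive x v f d <-> is_derive (0 : R) 1 (fun t : R => f (t *: v + x)) d.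
have E : (fun h : R => h^-1 *: ((f \o shift x) (h *: v) - f x)) =
 (fun h : R => h^-1 *: (((fun t : R => f (t *: v + x)) \o shift 0) (h *: 1)
  - f (0 *: v + x))).
 by apply/funext => h /=; rewrite addr0 scale0r add0r /GRing.scale/= mulr1.
by split=> -[h1 h2]; apply: DeriveDef; move: h1 h2; rewrite /derivable /derive E.
Qed.

Lemma partial_near j f g x : (\near x, f x = g x) -> partial j f x = partial j g x.
move=> fg; rewrite /partial; have [->|ej] := eqVneq (e_ j) 0.
 by rewrite !derive0.
by apply: near_eq_derive.
Qed.

Lemma partial_open j f g (U : set V) x : open U -> U x ->
 (forall y, U y -> f y = g y) -> partial j f x = partial j g x.
move=> oU Ux fg; apply: partial_near; near=> y; apply: fg.
by near: y; exact: open_nbhs_nbhs.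
Unshelve. all: by end_near. Qed.

Lemma isder_affine j (a : R) (c : V) f x d : is_derive (a *: x + c) (e_ j) f d ->
 is_derive x (e_ j) (fun x => f (a *: x + c)) (a * d).
move=> /isder_line df; apply/isder_line.
rewrite (_ : (fun _ => _) = (fun t : R => f (t *: e_ j + (a *: x + c))) \o (fun t => a * t)).
 rewrite mulrC; apply: is_derive1_comp; first by rewrite mulr0.
 by rewrite -[X in is_derive _ _ _ X](mulr1 a); exact: is_deriveZ.
by apply/funext => t /=; rewrite scalerDr scalerA addrA.
Qed.

Lemma smooth_affine (a : R) (c : V) f : smooth f -> smooth (fun x => f (a *: x + c)).
move=> sf; apply/smooth_gen_alg.
exists [set g | exists h, smooth h /\ g = fun x => h (a *: x + c)]; last first.
 by apply: gen_alg_gen; exists f.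
move=> _ [h [sh ->]]; split.
 move=> x; apply: continuous_comp; last exact: smooth_cont sh _.
 apply: continuousD; last exact: cst_continuous.
 exact: scaler_continuous.
move=> j; split => [x|].
 by have [] := isder_affine (smooth_isder j (a *: x + c) sh).
rewrite (_ : partial j _ = fun x => a * partial j h (a *: x + c)).
 apply: gen_algM; first exact: gen_alg_cst.
 by apply: gen_alg_gen; exists (partial j h); split; [exact: sm_partial|by []].
by apply/funext => x; apply: partial_isder; exact: isder_affine (smooth_isder _ _ sh).
Qed.

Lemma partial_affine j (a : R) (c : V) f x : smooth f ->
 partial j (fun x => f (a *: x + c)) x = a * partial j f (a *: x + c).
by move=> sf; apply: partial_isder; exact: isder_affine (smooth_isder _ _ sf).
Qed.

End smooth_algebra.

(** * A smooth transition on the line *)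

Section cutoff1.
Context {R : realType}.
Implicit Types (p : {poly R}) (x y : R).

(** The family p(1/x) exp(-1/x) is closed under differentiation, which replaces p by X^2 (p - p');
    the single function exp(-1/x) is not. *)
Definition expfun p x : R := if 0 < x then p.[x^-1] * expR (- x^-1) else 0.

(** Each factor y is paid for by half of the exponential, since y exp(-a y / 2) <= 2 / a. The rate a
    must therefore vary in the induction. *)
Lemma poly_expR_bounded p (a : R) : 0 < a ->
 exists2 C : R, 0 <= C & forall y, 0 < y -> `|p.[y]| * expR (- (a * y)) <= C.
elim/poly_ind: p a => [|p c IH] a a0.
 by exists 0 => // y _; rewrite horner0 normr0 mul0r.
have [C C0 hC] := IH (a / 2) (divr_gt0 a0 (ltr0Sn _ _)).
exists (C * (2 / a) + `|c|).
 by rewrite addr_ge0// mulr_ge0// divr_ge0// ltW.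
move=> y y0; rewrite hornerMXaddC.
apply: le_trans (ler_wpM2r (expR_ge0 _) (ler_normD _ _)) _.
rewrite mulrDl lerD//; last first.
 rewrite -[leRHS]mulr1 ler_wpM2l// -expR0 ler_expR oppr_le0 mulr_ge0//; exact: ltW.
rewrite (_ : a * y = a / 2 * y + a / 2 * y); last by field.
rewrite opprD expRD normrM (gtr0_norm y0).
rewrite (_ : _ * _ = (`|p.[y]| * expR (- (a / 2 * y))) * (y * expR (- (a / 2 * y)))); last by ring.
have h1 : 0 <= `|p.[y]| * expR (- (a / 2 * y)) by rewrite mulr_ge0 ?expR_ge0.
have h2 : 0 <= y * expR (- (a / 2 * y)) by rewrite mulr_ge0 ?expR_ge0 ?ltW.
apply: (ler_pM h1 h2 (hC _ y0)).
rewrite expRN ler_pdivrMr ?expR_gt0//.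
have h3 : a / 2 * y <= expR (a / 2 * y).
 by apply: le_trans (expR_ge1Dx _); rewrite lerDr.
have -> : (y <= 2 / a * expR (a / 2 * y)) = (2 / a * (a / 2 * y) <= 2 / a * expR (a / 2 * y)).
 by congr (_ <= _); field; rewrite gt_eqF.
by apply: ler_wpM2l => //; rewrite divr_ge0// ltW.
Qed.

(** Quadratic decay at 0 gives the derivative 0 there, where the formula for x > 0 is of no help. *)
Lemma expfun_sq_bound p : exists2 C : R, 0 <= C & forall x, `|expfun p x| <= C * x ^+ 2.
have [C C0 hC] := @poly_expR_bounded (p * 'X^2) 1 ltr01.
exists C => // x; rewrite /expfun; case: ifPn => [x0|_]; last first.
 by rewrite normr0 mulr_ge0// sqr_ge0.
have := hC x^-1; rewrite invr_gt0 => /(_ x0).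
rewrite mul1r hornerM hornerXn normrM => h.
rewrite normrM (gtr0_norm (expR_gt0 _)).
move: h; rewrite (@ger0_norm _ (x^-1 ^+ 2)) ?sqr_ge0// exprVn => h.
rewrite -ler_pdivrMr ?exprn_gt0//; apply: le_trans h.
by rewrite mulrAC.
Qed.

Lemma isder_expfun p x :
 is_derive x 1 (expfun p) (expfun ('X^2 * (p - p^`())) x).
have [x0|x0|->] := ltgtP x 0.
- rewrite [X in is_derive _ _ _ X](_ : _ = 0); last first.
  by rewrite /expfun ltNge (ltW x0).
 apply: (@near_eq_is_derive _ _ _ (cst 0)) => //.
 near=> y; rewrite /cst /expfun ltNge ifF//.
 by apply/negbTE; rewrite negbK ltW//; near: y; exact: lt_nbhsl.
- have dV : is_derive x 1 (fun y : R => y^-1) (- x ^- 2).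
  have := @is_deriveV R id x 1 1; rewrite gt_eqF//= => /(_ isT) h.
  by rewrite -[X in is_derive _ _ _ X]mulr1; apply: h; exact: is_derive_id.
 have dP : is_derive x 1 (fun y : R => p.[y^-1]) (p^`().[x^-1] * - x ^- 2).
  exact: (is_derive1_comp (is_derive_poly p x^-1) dV).
 have dE : is_derive x 1 (fun y : R => expR (- y^-1)) (expR (- x^-1) * x ^- 2).
  rewrite (_ : _ / _ = expR (- x^-1) * - (- x ^- 2)); last by rewrite opprK.
  apply: (is_derive1_comp (f := expR) (g := fun y => - y^-1)).
  
 apply: (@near_eq_is_derive _ _ _ (fun y => p.[y^-1] * expR (- y^-1))) => //.
  near=> y; rewrite /expfun ifT//; near: y; exact: lt_nbhsr.
 apply: is_derive_eq; rewrite /GRing.scale/= /expfun x0.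
 rewrite hornerM hornerXn hornerD hornerN exprVn.
 by ring.
rewrite [X in is_derive _ _ _ X](_ : _ = 0); last by rewrite /expfun ltxx.
have [C C0 hC] := expfun_sq_bound p.
have f0 : expfun p 0 = 0 by rewrite /expfun ltxx.
have lim : (fun h : R => h^-1 *: ((expfun p \o shift 0) (h *: 1) - expfun p 0))
  @ 0^' --> (0 : R).
 apply/cvgrPdist_le => /= e e0; near=> h.
 rewrite f0 addr0 subr0 sub0r normrN /GRing.scale/= mulr1 normrM normfV.
 have h0 : h != 0 by near: h; exact: nbhs_dnbhs_neq.
 rewrite ler_pdivrMl ?normr_gt0//.
 apply: le_trans (hC h) _; rewrite -real_normK ?num_real// expr2 mulrA.
 rewrite mulrC ler_wpM2l//.
 have : `|h| <= e / (C + 1).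
  near: h; apply: dnbhs0_le.
  by rewrite divr_gt0// ltr_wpDl.
 rewrite ler_pdivlMr ?ltr_wpDl// => h2; apply: le_trans h2.
 by rewrite mulrC ler_wpM2l// lerDl.
by apply: DeriveDef; [apply/cvg_ex; exists 0|exact/cvg_lim].
Unshelve. all: by end_near. Qed.

(** Denominator of the usual transition from 0 to 1. One of x and 1 - x is at least 1/2, so it stays
    above exp(-2). *)
Definition expden x : R := expfun 1 x + expfun 1 (1 - x).
Definition step x : R := expfun 1 x * (expden x)^-1.

Lemma expfun_bounded p : exists2 C : R, 0 <= C & forall x, `|expfun p x| <= C.
have [C C0 hC] := @poly_expR_bounded p 1 ltr01; exists C => // x.
rewrite /expfun; case: ifPn => [x0|_]; last by rewrite normr0.
rewrite normrM (gtr0_norm (expR_gt0 _)).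
by have := hC x^-1; rewrite invr_gt0 mul1r => /(_ x0).
Qed.

Lemma expfun1_ge0 x : 0 <= expfun 1 x.
by rewrite /expfun; case: ifP => // _; rewrite hornerC mul1r expR_ge0. Qed.

Lemma expfun1_half x : 2^-1 <= x -> expR (- 2) <= expfun 1 x.
move=> x2; have x0 : 0 < x by apply: lt_le_trans x2; rewrite invr_gt0.
rewrite /expfun x0 hornerC mul1r ler_expR lerN2.
by rewrite -[leRHS]invrK lef_pV2// posrE invr_gt0.
Qed.

Lemma expden_ge x : expR (- 2) <= expden x.
rewrite /expden; have [x2|x2] := leP 2^-1 x.
 by apply: le_trans (expfun1_half x2) _; rewrite lerDl expfun1_ge0.
apply: le_trans (_ : expfun 1 (1 - x) <= _); last by rewrite lerDr expfun1_ge0.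
apply: expfun1_half; lra.
Qed.

Lemma expden_gt0 x : 0 < expden x.
by apply: lt_le_trans (expden_ge x); exact: expR_gt0. Qed.

Lemma step_ge0 x : 0 <= step x.
by rewrite mulr_ge0 ?expfun1_ge0// invr_ge0 ltW// expden_gt0. Qed.

Lemma step_le1 x : step x <= 1.
by rewrite ler_pdivrMr ?expden_gt0// mul1r lerDl expfun1_ge0. Qed.

Lemma step0 x : x <= 0 -> step x = 0.
by move=> x0; rewrite /step /expfun ltNge x0 mul0r. Qed.

Lemma step1 x : 1 <= x -> step x = 1.
move=> x1; rewrite /step /expden [expfun 1 (1 - x)]/expfun.
rewrite ltNge subr_le0 x1/= addr0 divff// gt_eqF//.
by apply: lt_le_trans (expfun1_half (x:=x) _); [exact: expR_gt0|lra].
Qed.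

Lemma isder_expden x :
 is_derive x 1 expden (expfun 'X^2 x - expfun 'X^2 (1 - x)).
have E y : is_derive y 1 (expfun 1) (expfun 'X^2 y).
 have := isder_expfun 1 y; rewrite (_ : 'X^2 * _ = 'X^2)//.
 by rewrite derivC subr0 mulr1.
have E1 : is_derive x 1 (fun y => expfun 1 (1 - y)) (expfun 'X^2 (1 - x) * (0 - 1)).
 apply: (is_derive1_comp (f := expfun 1) (g := fun y => 1 - y)).
by have := is_deriveD (E x) E1; rewrite sub0r mulrN1.
Qed.

Lemma isder_invden x : is_derive x 1 (fun y => (expden y)^-1)
 ((expfun 'X^2 (1 - x) - expfun 'X^2 x) * ((expden x)^-1 * (expden x)^-1)).
have := is_deriveV (lt0r_neq0 (expden_gt0 x)) (isder_expden x).
congr (is_derive _ _ _ _); rewrite /GRing.scale/= -invfM -expr2; ring.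
Qed.

Lemma isder_step x : exists2 d : R, is_derive x 1 step d & d =
 expfun 1 x * ((expfun 'X^2 (1 - x) - expfun 'X^2 x) * ((expden x)^-1 * (expden x)^-1))
 + (expden x)^-1 * expfun 'X^2 x.
have E : is_derive x 1 (expfun 1) (expfun 'X^2 x).
 have := isder_expfun 1 x; rewrite (_ : 'X^2 * _ = 'X^2)//.
 by rewrite derivC subr0 mulr1.
eexists; first exact: (is_deriveM E (isder_invden x)).
by rewrite /GRing.scale/=.
Qed.

Lemma step_derive_bounded : exists2 C : R, 0 <= C &
 forall x, exists2 d : R, is_derive x 1 step d & `|d| <= C.
have [C1 C10 h1] := expfun_bounded 1; have [C2 C20 h2] := expfun_bounded 'X^2.
have hk (x : R) : 0 <= (expden x)^-1 <= (expR (- 2) : R)^-1.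
 rewrite invr_ge0 (ltW (expden_gt0 x))/= lef_pV2 ?posrE ?expR_gt0 ?expden_gt0//.
 exact: expden_ge.
set K := (expR (- 2) : R)^-1; have K0 : 0 <= K by rewrite invr_ge0 expR_ge0.
exists (C1 * ((C2 + C2) * (K * K)) + K * C2).
 by rewrite addr_ge0// ?mulr_ge0// ?addr_ge0// mulr_ge0.
move=> x; have [d dd dE] := isder_step x; exists d => //; rewrite dE.
have hx : `|(expden x)^-1| <= K.
 by have /andP[a b] := hk x; rewrite ger0_norm.
apply: le_trans (ler_normD _ _) _; rewrite !normrM; apply: lerD; last exact: ler_pM.
apply: ler_pM => //; apply: ler_pM => //; last exact: ler_pM.
by apply: le_trans (ler_normB _ _) _; exact: lerD.
Qed.

End cutoff1.

(** * Smooth cutoffs of cubes *)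

Section cutoffV.
Context {R : realType} {n : nat}.
Local Notation V := 'rV[R]_n.
Local Notation e_ := (fun j : 'I_n => delta_mx 0 j : V).

Lemma isder_coord_affine (i j : 'I_n) (a b : R) (q : R -> R) d (x : V) :
 is_derive (a * x 0 i + b) 1 q d ->
 is_derive x (e_ j) (fun x : V => q (a * x 0 i + b)) (d * (a * (i == j)%:R)).
move=> dq; apply/isder_line.
rewrite (_ : (fun _ => _) = q \o (fun t => t * (a * (i == j)%:R) + (a * x 0 i + b))).
 apply: is_derive1_comp; first by rewrite mul0r add0r.
 rewrite -[X in is_derive _ _ _ X]addr0; apply: is_deriveD.
 rewrite (_ : (fun _ => _) = (a * (i == j)%:R) \*: id); last first.
  by apply/funext => t; rewrite /= mulrC.
 by rewrite -[X in is_derive _ _ _ X]mulr1; exact: is_deriveZ.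
apply/funext => t /=; rewrite !mxE eqxx andTb; congr (q _); ring.
Qed.

Lemma cont_coord_affine (i : 'I_n) (a b : R) (q : R -> R) :
 continuous q -> continuous (fun x : V => q (a * x 0 i + b)).
move=> cq x; apply: continuous_comp; last exact: cq.
apply: continuousD; last exact: cst_continuous.
apply: continuousM; first exact: cst_continuous.
exact: coord_continuous.
Qed.

Lemma smooth_step (i : 'I_n) (a b : R) : smooth (fun x : V => step (a * x 0 i + b)).
(* Inverses of [expden] have to be generators themselves: the derivative of 1/D is -D'/D^2, which is
   then a product of members of the algebra. *)
pose G : set (V -> R) := [set g | exists (a b : R) (i : 'I_n),
 (exists p, g = fun x : V => expfun p (a * x 0 i + b)) \/
 g = fun x : V => (expden (a * x 0 i + b))^-1].
apply/smooth_gen_alg; exists G; last first.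
 apply: gen_algM; apply: gen_alg_gen; exists a, b, i; first by left; exists 1.
 by right.
have isder_cont (q q' : R -> R) : (forall y : R, is_derive y 1 q (q' y)) -> continuous q.
 move=> dq y; apply: differentiable_continuous; apply/derivable1_diffP.
 by have [] := dq y.
have expfunG a' b' i' p : gen_alg G (fun x : V => expfun p (a' * x 0 i' + b')).
 by apply: gen_alg_gen; exists a', b', i'; left; exists p.
move=> _ [a' [b' [i' [[p ->]|->]]]]; split.
- by apply: cont_coord_affine; apply: isder_cont => y; exact: isder_expfun.
- move=> j; have D (x : V) := isder_coord_affine j (isder_expfun p (a' * x 0 i' + b')).
 split => [x|]; first by have [] := D x.
 rewrite (_ : partial j _ = fun x => expfun ('X^2 * (p - p^`())) (a' * x 0 i' + b')
   * (a' * (i' == j)%:R)).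
  by apply: gen_algM => //; exact: gen_alg_cst.
 by apply/funext => x; apply: partial_isder.
- apply: (@cont_coord_affine i' a' b' (fun y => (expden y)^-1)).
 by apply: isder_cont => y; exact: isder_invden.
- move=> j; have D (x : V) := isder_coord_affine j (isder_invden (a' * x 0 i' + b')).
 split => [x|]; first by have [] := D x.
 rewrite (_ : partial j _ = fun x =>
  ((expfun 'X^2 (- a' * x 0 i' + (1 - b')) + -1 * expfun 'X^2 (a' * x 0 i' + b')) *
  ((expden (a' * x 0 i' + b'))^-1 * (expden (a' * x 0 i' + b'))^-1))
   * (a' * (i' == j)%:R)).
  apply: gen_algM; last exact: gen_alg_cst.
  have H : gen_alg G (fun x : V => (expden (a' * x 0 i' + b'))^-1).
   by apply: gen_alg_gen; exists a', b', i'; right.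
  apply: gen_algM; last exact: gen_algM.
  by apply: gen_algD => //; apply: gen_algM => //; exact: gen_alg_cst.
 apply/funext => x; rewrite (partial_isder (D x)) mulN1r.
 by congr ((expfun _ _ - _) * _ * _); ring.
Qed.

(** A bump equal to 1 on [-1, 1] and to 0 outside ]-2, 2[. Products over the coordinates fit the
    balls of the max norm. *)
Definition tent (s : R) : R := step (2 + s) * step (2 - s).

Definition cutoff (c : V) (r : R) (x : V) : R := \prod_i tent ((x 0 i - c 0 i) / r).

Lemma ball_rVP (c : V) (r : R) (x : V) :
 ball c r x <-> 0 < r /\ forall i, `|c 0 i - x 0 i| < r.
split=> -[r0 h]; split => // i; first exact: h.
by move=> j; rewrite (ord1 i); exact: h.
Qed.

Lemma tent_ge0 s : 0 <= tent s.
by rewrite mulr_ge0// step_ge0. Qed.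

Lemma tent_le1 s : tent s <= 1.
by rewrite -[leRHS]mulr1 ler_pM// ?step_ge0 ?step_le1. Qed.

Lemma tent1 s : `|s| <= 1 -> tent s = 1.
by rewrite ler_norml => /andP[? ?]; rewrite /tent !step1 ?mulr1//; lra. Qed.

Lemma tent0 s : 2 <= `|s| -> tent s = 0.
rewrite ler_normr => /orP[] h; rewrite /tent.
 by rewrite [X in _ * X]step0 ?mulr0//; lra.
by rewrite [X in X * _]step0 ?mul0r//; lra.
Qed.

Lemma cutoff_smooth c r : smooth (cutoff c r).
apply: smooth_prod => i _; apply: smoothM.
 rewrite (_ : (fun _ => _) = fun x : V => step (r^-1 * x 0 i + (2 - c 0 i / r))).
  exact: smooth_step.
 by apply/funext => x; congr step; ring.
rewrite (_ : (fun _ => _) = fun x : V => step (- r^-1 * x 0 i + (2 + c 0 i / r))).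
 exact: smooth_step.
by apply/funext => x; congr step; ring.
Qed.

Lemma cutoff_ge0 c r x : 0 <= cutoff c r x.
by apply: prodr_ge0 => i _; exact: tent_ge0. Qed.

Lemma cutoff_le1 c r x : cutoff c r x <= 1.
by apply: prodr_ile1 => i _; rewrite tent_ge0 tent_le1. Qed.

Lemma cutoff1 c r x : 0 < r -> ball c r x -> cutoff c r x = 1.
move=> r0 cx; rewrite /cutoff big1// => i _; apply: tent1.
rewrite normrM normfV (gtr0_norm r0) ler_pdivrMr// mul1r distrC; apply/ltW.
by have /ball_rVP[_] := cx; exact.
Qed.

Lemma cutoff0 c r x : 0 < r -> ~ ball c (2 * r) x -> cutoff c r x = 0.
move=> r0 cx; have [i hi] : exists i, 2 * r <= `|c 0 i - x 0 i|.
 apply: contrapT => H; apply: cx; apply/ball_rVP; split; first by rewrite mulr_gt0.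
 by move=> j; rewrite ltNge; apply/negP => h; apply: H; exists j.
rewrite /cutoff (bigD1 i)//= tent0 ?mul0r//.
by rewrite normrM normfV (gtr0_norm r0) ler_pdivlMr// distrC.
Qed.

Lemma tent_derive_bounded : exists2 C : R, 0 <= C &
 forall x : R, exists2 d : R, is_derive x 1 tent d & `|d| <= C.
have [C C0 hC] := @step_derive_bounded R; exists (C + C); first exact: addr_ge0.
move=> x; have [d1 D1 b1] := hC (2 + x); have [d2 D2 b2] := hC (2 - x).
have E1 : is_derive x 1 (fun y : R => step (2 + y)) d1.
 rewrite -[X in is_derive _ _ _ X]mulr1.
 apply: (is_derive1_comp (f := step) (g := fun y : R => 2 + y)).
 by rewrite -[X in is_derive _ _ _ X]add0r; exact: is_deriveD.
have E2 : is_derive x 1 (fun y : R => step (2 - y)) (- d2).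
 rewrite -mulrN1.
 apply: (is_derive1_comp (f := step) (g := fun y : R => 2 - y)).
 by rewrite -[X in is_derive _ _ _ X]add0r; exact: is_deriveD.
exists (step (2 + x) * - d2 + step (2 - x) * d1).
 exact: (is_deriveM E1 E2).
apply: le_trans (ler_normD _ _) _; apply: lerD.
 by rewrite normrM -[leRHS]mul1r ler_pM// ?normrN// ger0_norm ?step_ge0 ?step_le1.
by rewrite normrM -[leRHS]mul1r ler_pM// ger0_norm ?step_ge0 ?step_le1.
Qed.

End cutoffV.

(** Only the factor of coordinate j is differentiated and the others lie in [0, 1], so C bounds the
    derivative of [tent] and the scaling contributes 1/r. *)
Lemma partial_cutoff_bound (R : realType) (n : nat) : exists2 C : R, 0 <= C &
 forall (c : 'rV[R]_n) r j x, 0 < r -> `|partial j (cutoff c r) x| <= C / r.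
have [C C0 hC] := @tent_derive_bounded R; exists C => // c r j x r0.
have [d D hd] := hC (r^-1 * x 0 j + - (c 0 j / r)).
pose P := \prod_(i < n | i != j) tent ((x 0 i - c 0 i) / r).
have -> : partial j (cutoff c r) x = d * r^-1 * P.
 apply: partial_isder; apply/isder_line.
 have /isder_line D1 := isder_coord_affine j D.
 rewrite (_ : (fun _ => _) = P \*: (fun t : R => tent (r^-1 * (t *: (delta_mx 0 j : 'rV_n) + x) 0 j + - (c 0 j / r)))).
  rewrite (_ : d / r * P = P *: (d * (r^-1 * (j == j)%:R))); first exact: is_deriveZ.
  by rewrite eqxx mulr1 /GRing.scale/= mulrC.
 apply/funext => t; rewrite /cutoff /GRing.scale/= (bigD1 j)//= mulrC; congr (_ * _).
  apply: eq_bigr => i ij; rewrite !mxE eqxx andTb (negbTE ij) mulr0 add0r//.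
 congr tent; rewrite !mxE; ring.
rewrite !normrM normfV (gtr0_norm r0) -[leRHS]mulr1; apply: ler_pM => //.
- by rewrite mulr_ge0// invr_ge0 ltW.
- by apply: ler_wpM2r => //; rewrite invr_ge0 ltW.
rewrite ger0_norm; last by apply: prodr_ge0 => i _; exact: tent_ge0.
by apply: prodr_ile1 => i _; rewrite tent_ge0 tent_le1.
Qed.

Opaque smooth.

(** * Test functions and partitions of unity *)

Section test_functions.
Context {R : realType} {n : nat}.
Local Notation V := 'rV[R]_n.
Implicit Types (U : set V) (phi psi : V -> R).

Definition cube (c : V) (r : R) : set V := [set x | forall i, `|c 0 i - x 0 i| <= r].

Lemma cube_compact c r : compact (cube c r).
rewrite (_ : cube c r = [set x : V | forall i, `[c 0 i - r, c 0 i + r]%classic (x ord0 i)]).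
 apply: (@rV_compact R n (fun i => `[c 0 i - r, c 0 i + r]%classic)) => i.
 exact: segment_compact.
apply/seteqP; split => x /= h i; have := h i; rewrite /= in_itv/= distrC ler_distl//.
Qed.

Lemma rV_hd : hausdorff_space V.
exact: norm_hausdorff. Qed.

Lemma compact_closed_rV (K : set V) : compact K -> closed K.
exact: compact_closed rV_hd. Qed.

Lemma test_smooth U phi : test U phi -> smooth phi.
by case. Qed.

Lemma test_subset U U' phi : U `<=` U' -> test U phi -> test U' phi.
move=> UU [sp [K [cK KU K0]]]; split => //; exists K; split => //.
exact: subset_trans UU.
Qed.

Lemma testM U phi psi : test U phi -> smooth psi ->
 test U (fun x => phi x * psi x).
move=> [sp [K [cK KU K0]]] ss; split; first exact: smoothM.
by exists K; split => // x Kx; rewrite K0// mul0r.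
Qed.

Lemma testMl U phi psi : test U phi -> smooth psi ->
 test U (fun x => psi x * phi x).
by move=> tp ss; under eq_fun do rewrite mulrC; exact: testM.
Qed.

Lemma testZ U c phi : test U phi -> test U (fun x => c * phi x).
by move=> tp; apply: testMl tp (smooth_cst c). Qed.

Lemma testD U phi psi : test U phi -> test U psi ->
 test U (fun x => phi x + psi x).
move=> [sp [K [cK KU K0]]] [sq [L [cL LU L0]]]; split; first exact: smoothD.
exists (K `|` L); split; [exact: compactU|by rewrite subUset|].
by move=> x /not_orP[Kx Lx]; rewrite K0// L0// addr0.
Qed.

Lemma testB U phi psi : test U phi -> test U psi ->
 test U (fun x => phi x - psi x).
move=> tp tq; rewrite (_ : (fun _ => _) = fun x => phi x + (-1) * psi x).
 by apply: testD => //; exact: testZ.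
by apply/funext => x; rewrite mulN1r.
Qed.

Lemma test0 U : test U (fun=> 0).
by split; [exact: smooth_cst|exists set0; split => //; exact: compact0]. Qed.

Lemma test_sum U (I : Type) (r : seq I) (P : pred I) (F : I -> V -> R) :
 (forall i, P i -> test U (F i)) ->
 test U (fun x => \sum_(i <- r | P i) F i x).
move=> tF; elim: r => [|i r IH].
 rewrite (_ : (fun _ => _) = fun=> 0); first exact: test0.
 by apply/funext => x; rewrite big_nil.
case Pi: (P i); last first.
 rewrite (_ : (fun _ => _) = fun x => \sum_(i <- r | P i) F i x)//.
 by apply/funext => x; rewrite big_cons Pi.
rewrite (_ : (fun _ => _) = fun x => F i x + \sum_(i <- r | P i) F i x).
 exact: (testD (tF _ Pi) IH).
by apply/funext => x; rewrite big_cons Pi.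
Qed.

Lemma partial_out (K : set V) phi j x : compact K -> (forall x, ~ K x -> phi x = 0) ->
 ~ K x -> partial j phi x = 0.
move=> cK K0 Kx; rewrite -(partial_cst j 0 x).
apply: (@partial_open _ _ _ _ _ (~` K)) => //.
by apply: closed_openC; exact: compact_closed_rV.
Qed.

Lemma test_partial U phi j : test U phi -> test U (partial j phi).
move=> [sp [K [cK KU K0]]]; split; first exact: sm_partial.
by exists K; split => // x; exact: partial_out.
Qed.

Lemma test_out U phi x : test U phi -> ~ U x -> phi x = 0.
by move=> [_ [K [_ KU K0]]] Ux; apply: K0 => /KU. Qed.

Lemma test_cont U phi : test U phi -> continuous phi.
by move=> /test_smooth/smooth_cont. Qed.

Lemma test_bounded U phi : test U phi ->
 exists2 M : R, 0 <= M & forall x, `|phi x| <= M.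
move=> [sp [K [cK KU K0]]].
have cphi : {within K, continuous phi}.
 by apply: continuous_subspaceT => x; exact: smooth_cont.
have [M [Mr hM]] := compact_bounded (continuous_compact cphi cK).
exists (Num.max 0 (M + 1)); first by rewrite le_max lexx.
move=> x; have [Kx|Kx] := pselect (K x); last by rewrite K0// normr0 le_max lexx.
rewrite le_max; apply/orP; right; apply: (hM (M + 1)); first by rewrite ltrDl.
by exists x.
Qed.

Lemma test_cutoff U c r : 0 < r -> cube c (2 * r) `<=` U -> test U (cutoff c r).
move=> r0 cU; split; first exact: cutoff_smooth.
exists (cube c (2 * r)); split => //; first exact: cube_compact.
move=> x cx; apply: cutoff0 => // /ball_rVP[_ h]; apply: cx => i; exact/ltW.
Qed.

Lemma finite_ball_cover (K : set V) (rho : V -> R) : compact K ->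
 (forall x, K x -> 0 < rho x) ->
 exists s : seq V, (forall x, x \in s -> K x) /\
  forall y, K y -> exists2 x, x \in s & ball x (rho x) y.
rewrite compact_cover => cK r0.
have [x _||D DK Kc] := cK V K (fun x => ball x (rho x)).
- exact: ball_open.
- by move=> x Kx; exists x => //; apply: ballxx; exact: r0.
exists (enum_fset D); split=> [x xD|y /Kc[x /= xD xy]]; last by exists x.
by have := DK x xD; rewrite inE.
Qed.

Lemma cube_sub_ball (c : V) (r r' : R) : 0 < r' -> r < r' -> cube c r `<=` ball c r'.
by move=> r0 rr x h; apply/ball_rVP; split => // i; exact: le_lt_trans (h i) rr.
Qed.

Lemma open_cubeP U x : open U -> U x -> exists2 r, 0 < r & cube x (2 * r) `<=` U.
move=> oU Ux; have /nbhs_ballP[e /= e0 eU] : nbhs x U by exact: open_nbhs_nbhs.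
exists (e / 4); first by rewrite divr_gt0.
by apply: subset_trans eU; apply: cube_sub_ball => //; lra.
Qed.

Lemma sum_telescope (b : nat -> R) N :
 \sum_(j < N) b j * \prod_(l < j) (1 - b l) = 1 - \prod_(l < N) (1 - b l).
elim: N => [|N IH]; first by rewrite !big_ord0 subrr.
by rewrite !big_ord_recr/= IH; ring.
Qed.

(** With cutoffs b_j of a finite cover, the j-th function is the part of b_j left over by the
    earlier ones. By [sum_telescope] the sum is 1 minus the product of the 1 - b_j, hence 1 wherever
    some b_j is 1. The index i0 is a default value outside K. *)
Lemma pou (I : Type) (i0 : I) (K : set V) (U : I -> set V) :
 compact K -> (forall i, open (U i)) -> K `<=` \bigcup_i U i ->
 exists N (idx : nat -> I) (zeta : nat -> V -> R), [/\
  forall j, (j < N)%N -> test (U (idx j)) (zeta j),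
  forall j x, 0 <= zeta j x,
  forall x, \sum_(j < N) zeta j x <= 1 &
  forall x, K x -> \sum_(j < N) zeta j x = 1].
move=> cK oU KU.
have /choice[g gP] : forall x, exists ir : I * R, K x -> 0 < ir.2 /\
  cube x (2 * ir.2) `<=` U ir.1.
 move=> x; have [/KU[i _ Uix]|nKx] := pselect (K x); last by exists (i0, 1).
 by have [r r0 xU] := open_cubeP (oU i) Uix; exists (i, r).
have [|s [sK Ks]] := @finite_ball_cover K (fun x => (g x).2) cK.
 by move=> x /gP[].
pose c j := nth 0 s j; pose b j x := cutoff (c j) (g (c j)).2 x.
have b01 j x : 0 <= b j x <= 1 by rewrite cutoff_ge0 cutoff_le1.
have bC01 j x : 0 <= 1 - b j x <= 1.
 by have /andP[? ?] := b01 j x; apply/andP; split; lra.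
exists (size s), (fun j => (g (c j)).1), (fun j x => b j x * \prod_(l < j) (1 - b l x)).
split.
- move=> j js; apply: testM.
  have /gP[r0 h] : K (c j) by apply: sK; exact: mem_nth.
  exact: test_cutoff.
 apply: smooth_prod => l _; apply: smoothB; [exact: smooth_cst|exact: cutoff_smooth].
- move=> j x; rewrite mulr_ge0//; first by have /andP[] := b01 j x.
 by apply: prodr_ge0 => l _; have /andP[] := bC01 l x.
- move=> x; rewrite (sum_telescope (b ^~ x)) gerBl.
 by apply: prodr_ge0 => l _; have /andP[] := bC01 l x.
- move=> x Kx; rewrite (sum_telescope (b ^~ x)).
 have [y ys xy] := Ks _ Kx.
 have ys' : (index y s < size s)%N by rewrite index_mem.
 rewrite (bigD1 (Ordinal ys'))//= {1}/b /c nth_index// cutoff1//.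
  by rewrite subrr mul0r subr0.
 by have [] := gP y (sK _ ys).
Qed.

Lemma test_plateau (K U : set V) : compact K -> open U -> K `<=` U ->
 exists phi, [/\ test U phi, forall x, 0 <= phi x <= 1 &
  forall x, K x -> phi x = 1].
move=> cK oU KU.
have [|N [_ [z [tz z0 z1 zK]]]] := @pou unit tt K (fun=> U) cK (fun=> oU).
 by move=> x /KU Ux; exists tt.
exists (fun x => \sum_(j < N) z j x); split => //.
 by apply: test_sum => -[j jN] _; exact: tz.
by move=> x; rewrite z1 sumr_ge0.
Qed.

End test_functions.

(** * Lebesgue measure on R^n: invariance and volume bounds *)

Section lebesgue_rV_theory.
Context {R : realType}.
Implicit Types n : nat.

Lemma open_meas n (U : set 'rV[R]_n) : open U -> measurable U.
by move=> oU; apply: sub_sigma_algebra. Qed.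

Lemma closed_meas n (F : set 'rV[R]_n) : closed F -> measurable F.
by move=> cF; rewrite -[F]setCK; apply: measurableC; apply: open_meas; exact: closed_openC.
Qed.

Lemma compact_meas n (K : set 'rV[R]_n) : compact K -> measurable K.
by move=> cK; apply: closed_meas; exact: compact_closed_rV. Qed.

Lemma cont_meas n (f : 'rV[R]_n -> R) (D : set 'rV[R]_n) :
 continuous f -> mfun D f.
move=> cf; apply: (@measurable_funS _ _ _ _ setT) => //.
apply: (@measurability _ _ _ R setT _ _ (@RGenOpens.measurableE R)).
move=> _ [_ [x [y ->]] <-]; rewrite setTI; apply: open_meas.
by apply: open_comp; [move=> M _; exact: cf|exact: interval_open].
Qed.

Lemma leb1_affine (a s : R) (f : R -> \bar R) : s = 1 \/ s = -1 ->
 mfun setT f -> (forall x, 0 <= f x)%E ->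
 (\int[lebesgue_measure]_x f (a + s * x)%R = \int[lebesgue_measure]_x f x)%E.
have ma b : mfun setT (fun x : measurableTypeR R => (b + x : measurableTypeR R)%R).
 apply: measurable_realfun.measurable_funD => //.
have shift b (g : R -> \bar R) : mfun setT g -> (forall x, 0 <= g x)%E ->
  (\int[lebesgue_measure]_x g (b + x)%R = \int[lebesgue_measure]_x g x)%E.
 move=> mg g0.
 have -> : (\int[lebesgue_measure]_x g (b + x)%R =
   \int[pushforward lebesgue_measure (fun x : measurableTypeR R => (b + x : measurableTypeR R)%R)]_x g x)%E.
  by rewrite ge0_integral_pushforward// preimage_setT.
 apply: eq_measure_integral => A mA _; apply/esym; apply: lebesgue_measure_unique => //.
 move=> _ [[x y] _ <-] /=; rewrite /pushforward.
 rewrite (_ : _ @^-1` _ = `]x - b, y - b]%classic); last first.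
  apply/seteqP; split => z /=; rewrite !in_itv/= => /andP[? ?]; apply/andP; split; lra.
 rewrite !lebesgue_measure_itv/= !lte_fin ltrD2r; case: ifP => // _.
 by rewrite -!EFinB; congr EFin; lra.
move=> [->|->] mf f0; first by under eq_integral do rewrite mul1r; exact: shift.
rewrite -(shift a f mf f0).
have mg : mfun setT (fun x : R => f (a + x)%R).
 by apply: (mcomp mf); exact: ma.
rewrite -[RHS](@eq_measure_integral _ _ _ _ _ (pushforward lebesgue_measure (-%R : R -> measurableTypeR R))).
 rewrite ge0_integral_pushforward// ?preimage_setT.
 by apply: eq_integral => x _ /=; rewrite mulN1r.
by move=> A mA _; exact: lebesgue_measureN.
Qed.

Lemma lebS n (f : 'rV[R]_n.+1 -> \bar R) :
 mfun setT f -> (forall x, 0 <= f x)%E ->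
 (\int[lebesgue_rV n.+1]_x f x =
 \int[lebesgue_measure]_x \int[lebesgue_rV n]_v f (cons_rV (x, v)))%E.
move=> mf f0 /=.
rewrite ge0_integral_pushforward//; last exact: measurable_cons_rV.
rewrite preimage_setT fubini_tonelli1// => [|x]; last exact: f0.
by apply: mcomp => //; exact: measurable_cons_rV.
Qed.

Lemma meas_affine n (c : 'rV[R]_n) (s : R) : mfun setT (fun x : 'rV[R]_n => c + s *: x).
apply: measurable_fun_mx => i j; under eq_fun do rewrite !mxE.
apply: measurable_realfun.measurable_funD => //; apply: mfunM => //.
exact: measurable_coord.
Qed.

Lemma leb_affine n (c : 'rV[R]_n) (s : R) (f : 'rV[R]_n -> \bar R) :
 s = 1 \/ s = -1 -> mfun setT f -> (forall x, 0 <= f x)%E ->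
 (\int[lebesgue_rV n]_x f (c + s *: x)%R = \int[lebesgue_rV n]_x f x)%E.
move=> s1; elim: n c f => [|n IH] c f mf f0.
 by apply: eq_integral => x _; congr f; apply/rowP => -[].
rewrite lebS; [|by apply: mcomp => //; exact: meas_affine|by []].
rewrite [RHS]lebS; [|exact: mf|exact: f0].
pose F (x : R) := (\int[lebesgue_rV n]_v f (cons_rV (x, v)))%E.
have mF : mfun setT F.
 apply: (@measurable_fun_fubini_tonelli_F _ _ _ _ _ (lebesgue_rV n) (fun xv => f (cons_rV xv))) => //.
 by apply: mcomp => //; exact: measurable_cons_rV.
rewrite -[RHS](leb1_affine (c ord0 ord0) s1 mF); last first.
 by move=> x; apply: integral_ge0.
apply: eq_integral => x _.
rewrite /F -(IH (rsubmx (c : 'rV_(1 + n))) (fun v => f (cons_rV (c ord0 ord0 + s * x, v)))%R)//.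
 apply: eq_integral => v _; congr f; rewrite -[c in LHS]uncons_rVK /uncons_rV/=.
 apply/rowP => i; rewrite !mxE; have [k _|k _] := @split_ordP 1 n i.
  by rewrite /= !mxE (ord1 k) eqxx !mulr1n.
 by rewrite /= !mxE.
apply: mcomp => //; apply: mcomp; first exact: measurable_cons_rV.
exact: measurable_pair1.
Qed.

Lemma leb_ball n (c : 'rV[R]_n) (r : R) : 0 < r ->
 lebesgue_rV n (ball c r) = ((2 * r) ^+ n)%:E.
move=> r0; elim: n c => [|n IH] c.
 rewrite /= diracE mem_set ?expr0//.
 by apply/ball_rVP; split => // -[].
rewrite /= /lebesgue_cons /pushforward.
rewrite (_ : _ @^-1` _ = ball (c ord0 ord0) r `*` ball (rsubmx (c : 'rV_(1 + n))) r).
 rewrite product_measure1E; last 2 first.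
 - exact: measurable_ball.
 - by apply: open_meas; exact: ball_open.
 rewrite exprS EFinM; congr (_ * _)%E; last exact: IH.
 rewrite mulr_natl.
 by apply: lebesgue_measure_ball; exact: ltW.
apply/seteqP; split => [[x v]|[x v]] /=.
 move=> /ball_rVP[_ h]; split.
  have := h ord0; rewrite /cons_rV (_ : ord0 = lshift n ord0 :> 'I_(1 + n)); last exact/val_inj.
  by rewrite (@row_mxEl _ 1 1 n) mxE.
 apply/ball_rVP; split => // i; have := h (rshift 1 i).
 by rewrite /cons_rV (@row_mxEr _ 1 1 n) !mxE.
move=> [h0 /ball_rVP[_ h]]; apply/ball_rVP; split => // i.
have [k ->|k ->] := @split_ordP 1 n i.
 rewrite /cons_rV (@row_mxEl _ 1 1 n) !mxE (ord1 k) mulr1n.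
 by move: h0; rewrite /ball/= (_ : ord0 = lshift n ord0 :> 'I_(1 + n))//; exact/val_inj.
by have := h k; rewrite /cons_rV (@row_mxEr _ 1 1 n) !mxE.
Qed.

Lemma leb_cube_le n (c : 'rV[R]_n) (r : R) : 0 < r ->
 (lebesgue_rV n (cube c r) <= ((4 * r) ^+ n)%:E)%E.
move=> r0; have r20 : 0 < 2 * r by rewrite mulr_gt0.
rewrite (_ : 4 * r = 2 * (2 * r)); last by ring.
rewrite -(leb_ball c r20); apply: le_measure.
- by rewrite inE; apply: compact_meas; exact: cube_compact.
- by rewrite inE; apply: open_meas; exact: ball_open.
- by apply: cube_sub_ball => //; lra.
Qed.

Lemma bounded_sub_ball n (B : set 'rV[R]_n) : bounded_set B ->
 exists2 r, 0 < r & B `<=` ball 0 r.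
move=> [M [Mr hM]]; exists (`|M| + 2); first by rewrite ltr_wpDl.
move=> x Bx; rewrite -ball_normE /= sub0r normrN.
apply: (@le_lt_trans _ _ (`|M| + 1)); last by rewrite ltrD2l ltr1n.
by apply: (hM _ _ x Bx); rewrite (le_lt_trans (ler_norm _))// ltrDl.
Qed.

Lemma leb_bounded n (B : set 'rV[R]_n) : measurable B -> bounded_set B ->
 (lebesgue_rV n B < +oo)%E.
move=> mB /bounded_sub_ball[r r0 Br].
apply: (@le_lt_trans _ _ (lebesgue_rV n (ball 0 r))).
 by apply: le_measure; rewrite ?inE//; apply: open_meas; exact: ball_open.
by rewrite leb_ball// ltry.
Qed.

Lemma compact_bounded_rV n (K : set 'rV[R]_n) : compact K -> bounded_set K.
exact: compact_bounded. Qed.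

End lebesgue_rV_theory.

(** * Integrals of real-valued functions *)

Section real_integral.
Context d (T : measurableType d) (R : realType).

Definition intR (mu : {measure set T -> \bar R}) (D : set T) (f : T -> R) : Prop :=
 mu.-integrable D (EFin \o f).

Variables (mu : {measure set T -> \bar R}) (D : set T).
Hypothesis mD : measurable D.
Implicit Types f g h : T -> R.
Local Notation intg := (intR mu D).

Lemma intR_meas f : intg f -> mfun D f.
by case/integrableP => /mEFinP. Qed.

Lemma intRD f g : intg f -> intg g -> intg (fun x => f x + g x).
by move=> If Ig; exact: (integrableD mD If Ig). Qed.

Lemma intRB f g : intg f -> intg g -> intg (fun x => f x - g x).
by move=> If Ig; exact: (integrableB mD If Ig). Qed.

Lemma intRZ c f : intg f -> intg (fun x => c * f x).
by move=> If; exact: (integrableZl mD c If). Qed.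

Lemma intRN f : intg f -> intg (fun x => - f x).
by move=> If; exact: (integrableN If). Qed.

Lemma intR0 : intg (fun=> 0).
exact: (integrable0 mu D). Qed.

Lemma intR_norm f : intg f -> intg (fun x => `|f x|).
by move=> If; exact: integrable_norm. Qed.

Lemma intR_sum (I : Type) (s : seq I) (P : pred I) (F : I -> T -> R) :
 (forall i, P i -> intg (F i)) -> intg (fun x => \sum_(i <- s | P i) F i x).
move=> IF; elim: s => [|i s IH].
 rewrite (_ : (fun _ => _) = fun=> 0); first exact: intR0.
 by apply/funext => x; rewrite big_nil.
case Pi: (P i); last first.
 rewrite (_ : (fun _ => _) = fun x => \sum_(i <- s | P i) F i x)//.
 by apply/funext => x; rewrite big_cons Pi.
rewrite (_ : (fun _ => _) = fun x => F i x + \sum_(i <- s | P i) F i x).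
 exact: (intRD (IF _ Pi) IH).
by apply/funext => x; rewrite big_cons Pi.
Qed.

Lemma intR_le f g : mfun D f -> intg g ->
 (forall x, D x -> `|f x| <= g x) -> intg f.
move=> mf Ig fg; apply: (le_integrable mD _ _ Ig); first exact/mEFinP.
by move=> x Dx; rewrite /= lee_fin (le_trans (fg _ Dx))// ler_norm.
Qed.

Lemma intR_bounded f (M : R) : (mu D < +oo)%E ->
 mfun D f -> (forall x, D x -> `|f x| <= M) -> intg f.
move=> Doo mf fM; apply: measurable_bounded_integrable => //.
exists M; split; first exact: num_real.
by move=> x Mx y Dy; apply: le_trans (fM _ Dy) (ltW Mx).
Qed.

Lemma intR_cst c : (mu D < +oo)%E -> intg (fun=> c).
by move=> Doo; apply: (@intR_bounded _ `|c|). Qed.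

Lemma intRM f g (M : R) : mfun D f -> (forall x, D x -> `|f x| <= M) ->
 intg g -> intg (fun x => f x * g x).
move=> mf fM Ig; apply: (@intR_le _ (fun x => M * `|g x|)).
- by apply: mfunM => //; exact: intR_meas.
- by apply: intRZ; exact: intR_norm.
by move=> x Dx; rewrite normrM ler_wpM2r// fM.
Qed.

Lemma intR_eq f g : (forall x, D x -> f x = g x) -> intg f -> intg g.
move=> fg; apply: eq_integrable => // x; rewrite inE => Dx /=; by rewrite fg.
Qed.

Lemma intR_ae f g : mfun D g -> {ae mu, forall x, D x -> f x = g x} ->
 intg f -> intg g.
move=> mg fg /integrableP[mf fi]; apply/integrableP; split; first exact/mEFinP.
rewrite (ae_eq_integral (fun x => `|(EFin \o f) x|)%E)//.
- by apply: mcomp => //; exact/mEFinP.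
- by apply: mcomp.
- by apply: filterS fg => x h Dx /=; rewrite h.
Qed.

Lemma EFin_Rint f : intg f -> (\int[mu]_(x in D) (f x)%:E = (\int[mu]_(x in D) f x)%:E)%E.
by move=> If; rewrite /Rintegral fineK//; exact: integrable_fin_num If. Qed.

Lemma RintD f g : intg f -> intg g ->
 \int[mu]_(x in D) (f x + g x) = \int[mu]_(x in D) f x + \int[mu]_(x in D) g x.
exact: RintegralD. Qed.

Lemma RintB f g : intg f -> intg g ->
 \int[mu]_(x in D) (f x - g x) = \int[mu]_(x in D) f x - \int[mu]_(x in D) g x.
exact: RintegralB. Qed.

Lemma RintZ c f : intg f ->
 \int[mu]_(x in D) (c * f x) = c * \int[mu]_(x in D) f x.
exact: RintegralZl. Qed.

Lemma RintN f : intg f -> \int[mu]_(x in D) (- f x) = - \int[mu]_(x in D) f x.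
move=> If; rewrite -mulN1r -RintZ//; apply: eq_Rintegral => x _; by rewrite mulN1r.
Qed.

Lemma Rint_eq f g : (forall x, D x -> f x = g x) ->
 \int[mu]_(x in D) f x = \int[mu]_(x in D) g x.
by move=> fg; apply: eq_Rintegral => x; rewrite inE => /fg. Qed.

Lemma Rint0 : \int[mu]_(x in D) 0 = 0 :> R.
by rewrite /Rintegral integral0. Qed.

Lemma Rint_cst c : \int[mu]_(x in D) c = c * fine (mu D).
by rewrite Rintegral_cst. Qed.

Lemma Rint_ae f g : mfun D f -> mfun D g ->
 {ae mu, forall x, D x -> f x = g x} ->
 \int[mu]_(x in D) f x = \int[mu]_(x in D) g x.
move=> mf mg fg; rewrite /Rintegral; congr fine; apply: ae_eq_integral => //.
- exact/mEFinP.
- exact/mEFinP.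
- by apply: filterS fg => x h Dx /=; rewrite h.
Qed.

Lemma Rint_sum (I : Type) (s : seq I) (P : pred I) (F : I -> T -> R) :
 (forall i, P i -> intg (F i)) ->
 \int[mu]_(x in D) (\sum_(i <- s | P i) F i x) =
 \sum_(i <- s | P i) \int[mu]_(x in D) F i x.
move=> IF; elim: s => [|i s IH].
 by rewrite [RHS]big_nil -[RHS]Rint0; apply: Rint_eq => x _; rewrite big_nil.
rewrite big_cons; case Pi: (P i).
 rewrite -IH -RintD; [|exact: IF|exact: intR_sum].
 by apply: Rint_eq => x _; rewrite big_cons Pi.
by rewrite -IH; apply: Rint_eq => x _; rewrite big_cons Pi.
Qed.

Lemma Rint_le f g : intg f -> intg g -> (forall x, D x -> f x <= g x) ->
 \int[mu]_(x in D) f x <= \int[mu]_(x in D) g x.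
by move=> If Ig fg; apply: le_Rintegral. Qed.

Lemma Rint_ge0 f : (forall x, D x -> 0 <= f x) -> 0 <= \int[mu]_(x in D) f x.
by move=> f0; apply: Rintegral_ge0. Qed.

Lemma Rint_norm f : intg f -> `|\int[mu]_(x in D) f x| <= \int[mu]_(x in D) `|f x|.
by move=> If; apply: le_normr_Rintegral. Qed.

Lemma Rint_norm_le f g : intg f -> intg g -> (forall x, D x -> `|f x| <= g x) ->
 `|\int[mu]_(x in D) f x| <= \int[mu]_(x in D) g x.
by move=> If Ig fg; apply: le_trans (Rint_norm If) _; apply: Rint_le => //; exact: intR_norm.
Qed.

Lemma Rint_dom_ae (f_ : nat -> T -> R) f g : (forall k, mfun D (f_ k)) ->
 mfun D f -> intg g ->
 {ae mu, forall x, D x -> f_ ^~ x @ \oo --> f x} ->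
 {ae mu, forall x, forall k, D x -> `|f_ k x| <= g x} ->
 intg f /\ \int[mu]_(x in D) f_ k x @[k --> \oo] --> \int[mu]_(x in D) f x.
move=> mf_ mf Ig ff fg.
have [|||||If _ cvf] := @dominated_convergence _ _ _ mu D mD (fun k => EFin \o f_ k) (EFin \o f) (EFin \o g).
- by move=> k; exact/mEFinP.
- exact/mEFinP.
- apply: filterS ff => x h Dx; apply: (cvg_EFin _ (h Dx)).
 by apply: nearW.
- exact: Ig.
- by apply: filterS fg => x h k Dx; rewrite /= lee_fin; exact: h.
split; first exact: If.
apply: fine_cvg; rewrite fineK//; exact: integrable_fin_num If.
Qed.

Lemma Rint_dom (f_ : nat -> T -> R) f g : (forall k, mfun D (f_ k)) ->
 intg g -> (forall x, D x -> f_ ^~ x @ \oo --> f x) ->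
 (forall k x, D x -> `|f_ k x| <= g x) ->
 intg f /\ \int[mu]_(x in D) f_ k x @[k --> \oo] --> \int[mu]_(x in D) f x.
move=> mf_ Ig ff fg; apply: (Rint_dom_ae (g := g)) => //.
- by apply: (measurable_fun_cvg (h := f_)) => //.
- by apply: aeW.
- by apply: aeW => x k Dx; exact: fg.
Qed.

Lemma L1_tri f g h : intg f -> intg g -> intg h ->
 \int[mu]_(x in D) `|f x - h x| <=
 \int[mu]_(x in D) `|f x - g x| + \int[mu]_(x in D) `|g x - h x|.
move=> If Ig Ih; rewrite -RintD; [|exact/intR_norm/intRB|exact/intR_norm/intRB].
apply: Rint_le; first exact/intR_norm/intRB.
 by apply: intRD; exact/intR_norm/intRB.
by move=> x _; apply: le_trans (ler_normD _ _); rewrite addrA subrK.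
Qed.

Lemma intR_indic E : measurable E -> (mu D < +oo)%E -> intg \1_E.
move=> mE Doo; apply: (@intR_bounded _ 1) => // x _.
by rewrite indicE; case: (_ \in _); rewrite ?normr0 ?normr1.
Qed.

Lemma Rint_indic E : measurable E -> \int[mu]_(x in D) \1_E x = fine (mu (E `&` D)).
by move=> mE; rewrite /Rintegral integral_indic. Qed.

End real_integral.

Section restrictions.
Context d (T : measurableType d) (R : realType) (mu : {measure set T -> \bar R}).

Lemma intR_sub (D E : set T) (f : T -> R) : measurable D -> measurable E ->
 E `<=` D -> intR mu D f -> intR mu E f.
by move=> mD mE ED; apply: integrableS. Qed.

Lemma intR_mkcond (D : set T) (f : T -> R) : measurable D ->
 intR mu D f <-> intR mu setT (f \_ D).
move=> mD; have := integrable_mkcond (EFin \o f) mD (mu := mu); rewrite /intR.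
by rewrite (_ : (EFin \o f) \_ D = EFin \o (f \_ D)) ?restrict_EFin.
Qed.

Lemma Rint_mkcond (D : set T) (f : T -> R) :
 \int[mu]_(x in D) f x = \int[mu]_x (f \_ D) x.
exact: Rintegral_mkcond. Qed.

Lemma Rint_le_sub (D E : set T) (f : T -> R) : measurable D -> measurable E ->
 E `<=` D -> intR mu D f -> (forall x, D x -> 0 <= f x) ->
 \int[mu]_(x in E) f x <= \int[mu]_(x in D) f x.
move=> mD mE ED If f0; rewrite Rint_mkcond [leRHS]Rint_mkcond.
apply: Rint_le => //.
- exact: (intR_mkcond f mE).1 (intR_sub mD mE ED If).
- exact: (intR_mkcond f mD).1 If.
move=> x _; rewrite !patchE; case: ifPn => [/set_mem xE|_].
 by rewrite mem_set//; exact: ED.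
by case: ifPn => // /set_mem; exact: f0.
Qed.

End restrictions.

Import HBSimple.

(** * A density criterion in L^1 *)

Section L1_approximation.
Context d (T : measurableType d) (R : realType) (mu : {measure set T -> \bar R}).
Variables (D : set T) (mD : measurable D).
Variable Phi : set (T -> R).
Hypothesis PhiD : forall f g, Phi f -> Phi g -> Phi (fun x => f x + g x).
Hypothesis PhiZ : forall c f, Phi f -> Phi (fun x => c * f x).
Hypothesis Phi0 : Phi (fun=> 0).
Hypothesis PhiI : forall f, Phi f -> intR mu D f.
Hypothesis Phi_indic : forall E, measurable E -> forall e : R, 0 < e ->
 exists2 p, Phi p & \int[mu]_(x in D) `|\1_E x - p x| <= e.
Hypothesis Doo : (mu D < +oo)%E.

Let approx (f : T -> R) := intR mu D f /\ forall e : R, 0 < e ->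
 exists2 p, Phi p & \int[mu]_(x in D) `|f x - p x| <= e.

Let approxD f g : approx f -> approx g -> approx (fun x => f x + g x).
move=> [If hf] [Ig hg]; split; first exact: intRD.
move=> e e0; have [p Pp pe] := hf _ (divr_gt0 e0 (ltr0Sn _ 1)).
have [q Pq qe] := hg _ (divr_gt0 e0 (ltr0Sn _ 1)).
exists (fun x => p x + q x); first exact: PhiD.
rewrite [e]splitr; apply: le_trans (lerD pe qe).
have Ip := PhiI Pp; have Iq := PhiI Pq.
rewrite -RintD//; [|exact/intR_norm/intRB|exact/intR_norm/intRB].
apply: Rint_le => //.
- by apply: intR_norm => //; apply: intRB => //; exact: intRD.
- by apply: intRD => //; exact/intR_norm/intRB.
move=> x _; apply: le_trans (ler_normD _ _).
by rewrite le_eqVlt; apply/orP; left; apply/eqP; congr `|_|; ring.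
Qed.

Let approxZ c f : approx f -> approx (fun x => c * f x).
move=> [If hf]; have Icf : intR mu D (fun x => c * f x) by exact: intRZ.
split => // e e0.
have c0 : 0 < `|c| + 1 by rewrite ltr_wpDl.
have [p Pp pe] := hf _ (divr_gt0 e0 c0); have Ip := PhiI Pp.
exists (fun x => c * p x); first exact: PhiZ.
have H1 : intR mu D (fun x => `|f x - p x|) by exact/intR_norm/intRB.
rewrite (_ : (fun x => _) = fun x => `|c| * `|f x - p x|); last first.
 by apply/funext => x; rewrite -normrM mulrBr.
rewrite RintZ//; apply: (@le_trans _ _ ((`|c| + 1) * (e / (`|c| + 1)))).
 by apply: ler_pM => //; [exact: Rint_ge0|rewrite lerDl].
by rewrite mulrCA divff ?mulr1// gt_eqF.
Qed.

(** Simple functions are dense in L^1 and are finite combinations of indicators, so only indicators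
    have to be approximated. The criterion serves for measures on open sets and for the surface
    measure on the boundary. *)
Lemma L1_dense (f : T -> R) : intR mu D f -> forall e : R, 0 < e ->
 exists2 p, Phi p & \int[mu]_(x in D) `|f x - p x| <= e.
move=> If e e0.
have [g_ [Ig _ gf]] := approximation_sfun_integrable mD If.
have e20 : 0 < e / 2 by rewrite divr_gt0.
have {gf} [N hN] : exists N, \int[mu]_(x in D) `|f x - (g_ N : T -> R) x| <= e / 2.
 have /fine_cvgP[_ /cvgr_lt/(_ _ e20)[N _ /(_ N (leqnn N))/ltW h]] := gf.
 by exists N.
have [_ /(_ _ e20)[p Pp pe]] : approx (g_ N).
 rewrite (_ : (g_ N : T -> R) = fun x =>
  \sum_(y <- fset_set (range (g_ N))) (y * \1_(g_ N @^-1` [set y]) x)); last first.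
  by apply/funext => x; rewrite [LHS]fimfunE fsbig_finite.
 elim: (enum_fset _) => [|y s IH].
  rewrite (_ : (fun _ => _) = fun=> 0); last by apply/funext => x; rewrite big_nil.
  split; first exact: intR0.
  move=> e' e'0; exists (fun=> 0) => //.
  rewrite (_ : (fun x => _) = fun=> 0) ?Rint0 ?ltW//.
  by apply/funext => x; rewrite subrr normr0.
 rewrite (_ : (fun _ => _) = fun x => y * \1_(g_ N @^-1` [set y]) x +
   \sum_(y <- s) (y * \1_(g_ N @^-1` [set y]) x)); last first.
  by apply/funext => x; rewrite big_cons.
 have mE : measurable (g_ N @^-1` [set y]) by [].
 apply: approxD => //; apply: approxZ; split; first exact: intR_indic.
 by move=> e' e'0; exact: Phi_indic.
exists p => //; rewrite [e]splitr; apply: le_trans (lerD hN pe).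
by apply: L1_tri => //; [exact: Ig|exact: PhiI].
Qed.

End L1_approximation.

(** * Regularity of finite Borel measures *)

Section regularity.
Context {R : realType} {n : nat}.
Local Notation V := 'rV[R]_n.
Variable mu : {measure set V -> \bar R}.
Hypothesis mufin : (mu setT < +oo)%E.

Let multy (E : set V) : measurable E -> (mu E < +oo)%E.
by move=> mE; apply: le_lt_trans mufin; apply: le_measure; rewrite ?inE. Qed.

(** Sets squeezed between a closed and an open set up to small measure. They form a sigma-algebra
    that contains the open sets, hence all Borel sets. *)
Let reg : set (set V) := [set E : set V | measurable E /\ forall e : R, 0 < e ->
 exists F U : set V, [/\ closed F, open U, F `<=` E, E `<=` U & (mu (U `\` F) <= e%:E)%E]].

Let regC E : reg E -> reg (setT `\` E).
move=> [mE h]; split; first exact: measurableD.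
move=> e e0; have [F [U [cF oU FE EU UF]]] := h e e0.
exists (~` U), (~` F); rewrite setTD; split.
- exact: open_closedC.
- exact: closed_openC.
- exact: subsetC.
- exact: subsetC.
- by rewrite setDE setCK setIC -setDE.
Qed.

Lemma cvg_mu_lt (A : (set V)^nat) (e : R) : 0 < e ->
 (forall k, measurable (A k)) -> nonincreasing_seq A -> \bigcap_k A k = set0 ->
 exists k, (mu (A k) <= e%:E)%E.
move=> e0 mA ndA A0.
have : mu \o A @ \oo --> mu (\bigcap_k A k).
 by apply: nonincreasing_cvg_mu => //; [exact: multy|exact: bigcap_measurable].
rewrite A0 measure0 => h; have : nbhs (0 : \bar R)%E [set y | (y < e%:E)%E].
 by apply: open_nbhs_nbhs; split; [exact: open_ereal_lt_ereal|rewrite /= lte_fin].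
by move=> /h[N _ hN]; exists N; apply/ltW/hN => /=.
Qed.

Let reg_open U : open U -> reg U.
move=> oU; split; first exact: open_meas.
move=> e e0; pose d k : R := k.+1%:R^-1.
pose F k := ~` \bigcup_(y in ~` U) ball y (d k).
have cF k : closed (F k).
 by apply: open_closedC; apply: bigcup_open => y _; exact: ball_open.
have FU k : F k `<=` U.
 move=> x Fx; apply: contrapT => Ux; apply: Fx; exists x => //; apply: ballxx.
 by rewrite invr_gt0.
have [|||k hk] := @cvg_mu_lt (fun k => U `\` F k) _ e0.
- move=> k; apply: measurableD; [exact: open_meas|exact: closed_meas].
- move=> i j ij; apply/subsetPset => x [Ux Fjx]; split => // Fix; apply: Fjx => -[y Uy xy].
 apply: Fix; exists y => //; apply: le_ball xy.
 by rewrite lef_pV2 ?posrE// ler_nat.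
- rewrite -subset0 => x h.
 have [Ux _] : (U `\` F 0%N) x by exact: h.
 have /nbhs_ballP[r /= r0 rU] : nbhs x U by exact: open_nbhs_nbhs.
 have [k hk] : exists k, d k < r.
  by have [k _ hk] := near_infty_natSinv_lt (PosNum r0); exists k; apply: hk => /=.
 have [_ /contrapT[y Uy /ball_sym xy]] := h k I.
 by apply: Uy; apply: rU; apply: le_ball xy; exact: ltW.
by exists (F k), U; split.
Qed.

Let reg_bigcup (E : (set V)^nat) : (forall k, reg (E k)) -> reg (\bigcup_k E k).
move=> rE; have mE k : measurable (E k) by case: (rE k).
split; first exact: bigcup_measurable.
(* Half of e is spent on the differences of [U k] and [F k]; the other half on truncating the union
   of the [F k], as only a finite union of closed sets is sure to be closed. *)
move=> e e0; pose d k : R := e / 2 / 2 ^+ k.+1.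
have d0 k : 0 < d k by rewrite !divr_gt0// exprn_gt0.
have /choice[FU hFU] : forall k, exists FU : set V * set V, [/\ closed FU.1, open FU.2,
  FU.1 `<=` E k, E k `<=` FU.2 & (mu (FU.2 `\` FU.1) <= (d k)%:E)%E].
 by move=> k; have [_ /(_ _ (d0 k))[F [U h]]] := rE k; exists (F, U).
pose F k := (FU k).1; pose U k := (FU k).2.
have cF k : closed (F k) by have [] := hFU k.
have oU k : open (U k) by have [] := hFU k.
have mF k : measurable (F k) by exact: closed_meas.
have mU k : measurable (U k) by exact: open_meas.
pose G N := \big[setU/set0]_(k < N) F k.
have mG N : measurable (G N) by apply: bigsetU_measurable.
have mUF : measurable (\bigcup_k F k) by exact: bigcup_measurable.
have e20 : 0 < e / 2 by rewrite divr_gt0.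
have [|||N hN] := @cvg_mu_lt (fun N => (\bigcup_k F k) `\` G N) _ e20.
- by move=> N; exact: measurableD.
- move=> i j ij; apply/subsetPset => x [Ux Gjx]; split => // Gix; apply: Gjx.
 by move: Gix; apply: subset_bigsetU.
- rewrite -subset0 => x h; have [[k _ Fk] _] := h 0%N I.
 by have [_] := h k.+1 I; apply; rewrite /G big_ord_recr/=; right.
exists (G N), (\bigcup_k U k); split.
- rewrite /G; elim/big_ind : _ => //; [exact: closed0|exact: closedU].
- exact: bigcup_open.
- move=> x; rewrite /G -bigcup_mkord => -[k _ Fk]; exists k => //.
 by have [_ _ h _ _] := hFU k; exact: h.
- by move=> x [k _ Ek]; exists k => //; have [_ _ _ h _] := hFU k; exact: h.
rewrite [e]splitr EFinD.
have mB : measurable (\bigcup_k (U k `\` F k)).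
 by apply: bigcup_measurable => k _; exact: measurableD.
apply: (@le_trans _ _ (mu ((\bigcup_k (U k `\` F k)) `|` ((\bigcup_k F k) `\` G N)))).
 apply: le_measure; rewrite ?inE.
 - by apply: measurableD => //; exact: bigcup_measurable.
 - by apply: measurableU => //; exact: measurableD.
 move=> x [[k _ Ukx] nG].
 have [Fx|nFx] := pselect ((\bigcup_k F k) x); first by right.
 by left; exists k => //; split => // Fkx; apply: nFx; exists k.
apply: le_trans (measureU2 _ _ _) _ => //; first exact: measurableD.
apply: leeD => //.
apply: (@le_trans _ _ (\sum_(k <oo) mu (U k `\` F k))%E).
 by apply: measure_sigma_subadditive => // k; exact: measurableD.
apply: (@le_trans _ _ (\sum_(k <oo) (e / 2 / (2 ^ k.+1)%:R)%:E)%E); last first.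
 by rewrite epsilon_trick0// ltW.
apply: lee_nneseries => // k _; have [_ _ _ _] := hFU k.
by rewrite /d natrX.
Qed.

Lemma regular_closed_open (E : set V) : measurable E -> forall e : R, 0 < e ->
 exists F U : set V, [/\ closed F, open U, F `<=` E, E `<=` U & (mu (U `\` F) <= e%:E)%E].
move=> mE; suff [] : reg E by [].
have : (<<s @open V >>) `<=` reg; last by apply.
apply: smallest_sub => //; split.
- by apply: reg_open; exact: open0.
- exact: regC.
- exact: reg_bigcup.
Qed.

Lemma regular_compact_open (E : set V) : measurable E -> forall e : R, 0 < e ->
 exists K U : set V, [/\ compact K, open U, K `<=` E, E `<=` U & (mu (U `\` K) <= e%:E)%E].
move=> mE e e0; have e20 : 0 < e / 2 by rewrite divr_gt0.
have [F [U [cF oU FE EU UF]]] := regular_closed_open mE e20.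
have mQ (k : nat) : measurable (cube (0 : V) k%:R).
 by apply: compact_meas; exact: cube_compact.
have [|||N hN] := @cvg_mu_lt (fun k => F `\` cube 0 k%:R) _ e20.
- by move=> k; apply: measurableD => //; exact: closed_meas.
- move=> i j ij; apply/subsetPset => x [Fx nQ]; split => // Qx; apply: nQ => l.
 by apply: le_trans (Qx l) _; rewrite ler_nat.
- rewrite -subset0 => x h; have [k hk] : exists k : nat, \sum_i `|x 0 i| <= k%:R.
  by exists (Num.truncn (\sum_i `|x 0 i|)).+1; exact/ltW/truncnS_gt.
 have [_] := h k I; apply => i; rewrite mxE sub0r normrN; apply: le_trans hk.
 by rewrite (bigD1 i)//= lerDl sumr_ge0.
exists (F `&` cube 0 N%:R), U; split => //.
- by rewrite setIC; apply: compact_closedI => //; exact: cube_compact.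
- by apply: subset_trans FE; exact: subIsetl.
rewrite [e]splitr EFinD.
have mF : measurable F by exact: closed_meas.
have mU : measurable U by exact: open_meas.
apply: (@le_trans _ _ (mu ((U `\` F) `|` (F `\` cube 0 N%:R)))).
 apply: le_measure; rewrite ?inE.
 - by apply: measurableD => //; exact: measurableI.
 - by apply: measurableU; exact: measurableD.
 move=> x [Ux nF]; have [Fx|Fx] := pselect (F x); last by left.
 by right; split => // Qx; apply: nF.
apply: le_trans (measureU2 _ _ _) _; [exact: measurableD|exact: measurableD|].
exact: leeD.
Qed.

Lemma test_meas U phi (D : set V) : test U phi -> mfun D phi.
by move=> tp; apply: cont_meas; exact: test_cont tp. Qed.

Lemma test_intR U phi (D : set V) : measurable D -> test U phi -> intR mu D phi.
move=> mD tp; have [M M0 hM] := test_bounded tp.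
by apply: (@intR_bounded _ _ _ mu D mD phi M) => //; [exact: multy|exact: test_meas tp].
Qed.

End regularity.

Lemma cvge0_lt (R : realType) (f : nat -> \bar R) (e : R) : 0 < e ->
 f @ \oo --> (0 : \bar R)%E -> \forall k \near \oo, (f k < e%:E)%E.
move=> e0 f0; have : nbhs (0 : \bar R)%E [set y | (y < e%:E)%E].
 by apply: open_nbhs_nbhs; split; [exact: open_ereal_lt_ereal|rewrite /= lte_fin].
by move=> /f0.
Qed.

(** * Metric outer measures and Hausdorff measure *)

Section metric_outer_measure.
Context {R : realType} {n : nat}.
Local Notation V := 'rV[R]_n.

Definition separated_sets (E F : set V) :=
 exists2 dl : R, 0 < dl & forall x y, E x -> F y -> ~ ball x dl y.

Variable mu : {outer_measure set V -> \bar R}.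
Hypothesis metric : forall E F, separated_sets E F -> (mu E + mu F <= mu (E `|` F))%E.

(** Caratheodory's criterion. The part of X outside F is exhausted by the sets [A k] of points at
    distance at least 1/(k+1) from F; the point is that the measure left outside [A k] tends to
    0. *)
Lemma metric_closed_carath (F : set V) : closed F ->
 measurable (F : set (caratheodory_type mu)).
move=> cF; apply: le_caratheodory_measurable => X.
have [->|Xoo] := eqVneq (mu X) +oo%E; first by rewrite leey.
pose d k : R := k.+1%:R^-1.
have d0 k : 0 < d k by rewrite invr_gt0.
have d_lt k : d k.+1 < d k by rewrite ltf_pV2 ?posrE// ltr_nat.
pose A k := [set x | (X `&` ~` F) x /\ forall y, F y -> ~ ball x (d k) y].
have AX k : A k `<=` X by move=> x [[]].
have AS k : A k `<=` A k.+1.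
 move=> x [XFx h]; split => // y Fy /(le_ball (ltW (d_lt k))); exact: h.
have sepA k : separated_sets (A k) ((X `&` ~` F) `\` A k.+1).
 exists (d k - d k.+1); first by rewrite subr_gt0.
 move=> x y [_ hx] [XFy nAy] xy; apply: nAy; split => // z Fz yz.
 apply: (hx z Fz); have := ball_triangle xy yz.
 by rewrite subrK.
pose D k := A k.+1 `\` A k.
(* The shell [D k.+1] is at positive distance from [A k], but not from [A k.+1]. Hence a step by
   two, and a telescoping sum that leaves two terms. *)
have step k : (mu (A k) + mu (D k.+1) <= mu (A k.+2))%E.
 apply: (@le_trans _ _ (mu (A k `|` D k.+1))).
  apply: metric; have [e e0 he] := sepA k; exists e => // x y Ax [Ay nAy].
  by apply: he => //; split => //; case: Ay.
 by apply: le_outer_measure => x [/AS/AS//|[]].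
have Xfin : mu X \is a fin_num by rewrite ge0_fin_numE ?outer_measure_ge0// ltey.
have Afin k : mu (A k) \is a fin_num.
 rewrite ge0_fin_numE ?outer_measure_ge0//; apply: (@le_lt_trans _ _ (mu X)).
  exact: le_outer_measure.
 by rewrite ltey.
have sumD N : (\sum_(0 <= k < N) mu (D k.+1) <= mu (A N) + mu (A N.+1))%E.
 elim: N => [|N IH]; first by rewrite big_geq// adde_ge0 ?outer_measure_ge0.
 rewrite big_nat_recr//=; apply: (le_trans (leeD2r _ IH)).
 by rewrite addeAC addeC leeD2l.
have sumDoo : (\sum_(0 <= k <oo) mu (D k) < +oo)%E.
 apply: (@le_lt_trans _ _ (mu (D 0%N) + (mu X + mu X))%E); last first.
  have X_oo : (mu X < +oo)%E by rewrite ltey.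
  apply: lte_add_pinfty; last exact: lte_add_pinfty.
  by apply: le_lt_trans X_oo; apply: le_outer_measure => x [/AX].
 apply: lime_le.
  by apply: is_cvg_nneseries => k _ _; exact: outer_measure_ge0.
 apply: nearW => -[|N]; first by rewrite big_geq// !adde_ge0 ?outer_measure_ge0.
 rewrite big_nat_recl// leeD2l// (le_trans (sumD N))//.
 by apply: leeD; exact: le_outer_measure.
have XF_A k : (mu (X `&` ~` F) <= mu (A k) + \sum_(k <= j <oo) mu (D j))%E.
 have sub : X `&` ~` F `<=` A k `|` \bigcup_(j in [set j | (k <= j)%N]) D j.
  move=> x XFx; have [[N AN]|nA] := pselect (exists N, A N x); last first.
   exfalso; apply: nA; have [_ /= nFx] := XFx.
   have /nbhs_ballP[e /= e0 he] : nbhs x (~` F).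
    by apply: open_nbhs_nbhs; split => //; exact: closed_openC.
   have [N _ hN] := near_infty_natSinv_lt (PosNum e0).
   exists N; split => // y Fy xy; apply: (he y) Fy; apply: le_ball xy.
   by apply: ltW; apply: hN => /=.
  have [Ak|nAk] := pselect (A k x); [by left|right].
  elim: N AN => [A0|N IH AN].
   exfalso; apply: nAk; elim: k {XFx} => // k; exact: AS.
  have [/IH//|nAN] := pselect (A N x).
  exists N => //=; rewrite leqNgt; apply/negP => Nk; apply: nAk.
  rewrite -(subnK Nk); elim: (k - N.+1)%N => // j; rewrite addSn; exact: AS.
 apply: (le_trans (le_outer_measure mu _ _ sub)); apply: (le_trans (outer_measureU2 mu _ _)).
 rewrite leeD2l//; apply: le_trans (outer_measure_sigma_subadditive_tail mu k D).
 by apply: le_outer_measure => x [j /= kj Dj]; exists j => //=; apply/negP; rewrite -leqNgt.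
have tail0 : (\sum_(k <= j <oo) mu (D j))%E @[k --> \oo] --> (0 : \bar R)%E.
 by apply: nneseries_tail_cvg => // k _; exact: outer_measure_ge0.
apply/lee_addgt0Pr => e e0.
have [k _ hk] := cvge0_lt e0 tail0.
apply: (@le_trans _ _ (mu (X `&` F) + (mu (A k) + e%:E))%E).
 by rewrite leeD2l// (le_trans (XF_A k))// leeD2l// ltW//; apply: hk => /=.
rewrite addeA leeD2r//; apply: (@le_trans _ _ (mu ((X `&` F) `|` A k))).
 apply: metric; exists (d k) => // x y [_ Fx] [_ h] /ball_sym; exact: h.
by apply: le_outer_measure => x [[]//|/AX].
Qed.

Lemma metric_borel_carath (B : set V) : measurable B ->
 measurable (B : set (caratheodory_type mu)).
have : <<s @open V >> `<=` (measurable : set (set (caratheodory_type mu))).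
 apply: smallest_sub.
  split; first exact: measurable0.
   by move=> A mA; rewrite setTD; exact: measurableC.
  by move=> F mF; exact: bigcupT_measurable.
 move=> U oU; rewrite -[U]setCK; apply: measurableC; apply: metric_closed_carath.
 exact: open_closedC.
by apply.
Qed.

End metric_outer_measure.

Section hd_metric.
Context {R : realType} {n : nat}.
Variable k : nat.
Local Notation V := 'rV[R]_n.
Implicit Types (E F U W : set V) (dl : R).
Local Open Scope ereal_scope.

Lemma mxdot_ge0 p q (M : 'M[R]_(p, q)) : (0 <= mxdot M M)%R.
by apply: sumr_ge0 => i _; apply: sumr_ge0 => j _; rewrite -expr2 sqr_ge0. Qed.

Lemma coord_enorm p q (M : 'M[R]_(p, q)) i j : (`|M i j| <= enorm M)%R.
rewrite -sqrtr_sqr ler_wsqrtr// /mxdot (bigD1 i)//= (bigD1 j)//= expr2.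
rewrite -addrA lerDl addr_ge0// ?sumr_ge0// => [|i' _]; first by move=> j' _; rewrite -expr2 sqr_ge0.
by apply: sumr_ge0 => j' _; rewrite -expr2 sqr_ge0.
Qed.

Lemma enorm_ge0 p q (M : 'M[R]_(p, q)) : (0 <= enorm M)%R.
exact: sqrtr_ge0. Qed.

Lemma le_ediam U W : U `<=` W -> ediam U <= ediam W.
move=> UW; apply: le_ereal_sup => _ [x Ux [y Uy <-]].
by exists x; [exact: UW|exists y => //; exact: UW].
Qed.

Lemma ediam_ge0 U : U !=set0 -> 0 <= ediam U.
move=> [x Ux]; apply: le_ereal_sup_tmp; exists (enorm (x - x))%:E.
 by exists x => //; exists x.
by rewrite lee_fin enorm_ge0.
Qed.

Lemma enorm_le_ediam U x y : U x -> U y -> (enorm (x - y))%:E <= ediam U.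
by move=> Ux Uy; apply: ereal_sup_ubound; exists x => //; exists y. Qed.

Lemma ball_volume_ge0 : (0 <= ball_volume k :> R)%R.
exact/fine_ge0/measure_ge0. Qed.

Lemma gauge_ge0 dl U : 0 <= @hausdorff_gauge R n k dl U.
rewrite /hausdorff_gauge; case: asboolP => // /eqP/set0P U0; case: ifP => // _.
by rewrite lee_fin mulr_ge0 ?ball_volume_ge0// exprn_ge0// divr_ge0// fine_ge0// ediam_ge0.
Qed.

Lemma gauge0 dl : @hausdorff_gauge R n k dl set0 = 0.
by rewrite /hausdorff_gauge asboolT. Qed.

Lemma le_gauge dl U W : U `<=` W -> @hausdorff_gauge R n k dl U <= @hausdorff_gauge R n k dl W.
move=> UW; have [->|/set0P U0] := eqVneq U set0; first by rewrite gauge0 gauge_ge0.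
have W0 : W !=set0 by case: U0 => x /UW Wx; exists x.
have E X : X !=set0 -> hausdorff_gauge k dl X = if ediam X <= dl%:E
  then (ball_volume k * (fine (ediam X) / 2) ^+ k)%:E else +oo.
 by move=> /set0P/eqP X0; rewrite /hausdorff_gauge asboolF.
rewrite !E//; have [Wd|_] := boolP (ediam W <= dl%:E); last by rewrite leey.
rewrite (le_trans (le_ediam UW) Wd) lee_fin ler_wpM2l ?ball_volume_ge0//.
have fW : ediam W \is a fin_num by rewrite ge0_fin_numE ?ediam_ge0// (le_lt_trans Wd)// ltry.
have fU : ediam U \is a fin_num.
 by rewrite ge0_fin_numE ?ediam_ge0// (le_lt_trans (le_trans (le_ediam UW) Wd))// ltry.
rewrite lerXn2r ?nnegrE ?divr_ge0 ?fine_ge0 ?ediam_ge0//.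
by rewrite ler_pM2r// fine_le// le_ediam.
Qed.

Lemma pre_antitone dl dl' E : (dl <= dl')%R ->
 @hausdorff_pre R n k dl' E <= @hausdorff_pre R n k dl E.
move=> dd; apply: le_ereal_inf_tmp => _ [U EU <-].
apply: (@le_trans _ _ (\sum_(i <oo) hausdorff_gauge k dl' (U i))).
 by apply: ereal_inf_lbound; exists U.
apply: lee_nneseries => [i _ _|i _]; first exact: gauge_ge0.
rewrite /hausdorff_gauge; case: asboolP => // _.
have [h|_] := boolP (ediam (U i) <= dl%:E); last by rewrite leey.
by rewrite (le_trans h)// lee_fin.
Qed.

Lemma pre_ge0 dl E : 0 <= @hausdorff_pre R n k dl E.
apply: le_ereal_inf_tmp => _ [U _ <-]; apply: nneseries_ge0 => i _ _; exact: gauge_ge0.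
Qed.

Lemma pre_le_hd dl E : (0 < dl)%R -> @hausdorff_pre R n k dl E <= hausdorff k E.
by move=> d0; apply: ereal_sup_ubound; exists dl. Qed.

(** A set of diameter less than the distance of E and F cannot meet both, so a fine cover of the
    union splits into a cover of E and a cover of F. *)
Lemma hd_metric (E F : set V) : separated_sets E F ->
 @hausdorff R n k E + @hausdorff R n k F <= @hausdorff R n k (E `|` F).
move=> [d d0 sep]; set c := hausdorff k (E `|` F).
have c0 : 0 <= c by exact: le_trans (pre_ge0 1 _) (pre_le_hd _ ltr01).
have [->|coo] := eqVneq c +oo; first by rewrite leey.
have cfin : c \is a fin_num by rewrite ge0_fin_numE// ltey.
(* The suprema over the two scales are taken one after the other, so the scales are independent
   here; both are refined to a common one below d. *)
have main d1 d2 : (0 < d1)%R -> (0 < d2)%R ->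
  @hausdorff_pre R n k d1 E + @hausdorff_pre R n k d2 F <= c.
 move=> d10 d20; pose dl := Num.min (Num.min d1 d2) (d / 2)%R.
 have dl0 : (0 < dl)%R by rewrite !lt_min d10 d20 divr_gt0.
 have dl1 : (dl <= d1)%R by rewrite !ge_min lexx.
 have dl2 : (dl <= d2)%R by rewrite !ge_min lexx orbT.
 have dld : (dl < d)%R by rewrite gt_min; apply/orP; right; lra.
 apply: (le_trans (leeD (pre_antitone E dl1) (pre_antitone F dl2))).
 apply: le_trans (pre_le_hd (E `|` F) dl0).
 apply: le_ereal_inf_tmp => _ [U EFU <-].
 apply: (@le_trans _ _ (\sum_(i <oo) (hausdorff_gauge k dl (U i `&` E) + hausdorff_gauge k dl (U i `&` F)))).
  rewrite nneseriesD; [|by move=> i _ _; exact: gauge_ge0..].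
  apply: leeD; apply: ereal_inf_lbound.
   exists (fun i => U i `&` E) => //.
   by move=> x Ex; have [i _ Ui] := EFU x (or_introl Ex); exists i.
  exists (fun i => U i `&` F) => //.
  by move=> x Fx; have [i _ Ui] := EFU x (or_intror Fx); exists i.
 apply: lee_nneseries => [i _ _|i _]; first by rewrite adde_ge0 ?gauge_ge0.
 have [Eie|/set0P[x [Uix Ex]]] := eqVneq (U i `&` E) set0.
  by rewrite Eie gauge0 add0e; apply: le_gauge; exact: subIsetl.
 have [Eif|/set0P[y [Uiy Fy]]] := eqVneq (U i `&` F) set0.
  by rewrite Eif gauge0 adde0; apply: le_gauge; exact: subIsetl.
 rewrite [leRHS]/hausdorff_gauge asboolF; last by move=> U0; rewrite U0 in Uix.
 case: ifPn => [Ud|_]; last by rewrite leey.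
 exfalso; apply: (sep x y Ex Fy); apply/ball_rVP; split => // j.
 have := le_trans (enorm_le_ediam Uix Uiy) Ud; rewrite lee_fin => h.
 apply: le_lt_trans dld; apply: le_trans h.
 by have := coord_enorm (x - y) ord0 j; rewrite !mxE.
have pfin d2 : (0 < d2)%R -> @hausdorff_pre R n k d2 F \is a fin_num.
 move=> d20; rewrite ge0_fin_numE ?pre_ge0//; apply: le_lt_trans (_ : c < +oo); last by rewrite ltey.
 by apply: le_trans (main 1%R d2 ltr01 d20); rewrite leeDr ?pre_ge0.
have h1 d2 : (0 < d2)%R -> hausdorff k E + hausdorff_pre k d2 F <= c.
 move=> d20; rewrite -leeBrDr ?pfin//; apply: ge_ereal_sup => _ [d1 /= d10 <-].
 by rewrite leeBrDr ?pfin// main.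
have Efin : hausdorff k E \is a fin_num.
 rewrite ge0_fin_numE; last exact: le_trans (pre_ge0 1 _) (pre_le_hd _ ltr01).
 apply: le_lt_trans (_ : c < +oo); last by rewrite ltey.
 by apply: le_trans (h1 1%R ltr01); rewrite leeDl ?pre_ge0.
rewrite addeC -leeBrDr//; apply: ge_ereal_sup => _ [d2 /= d20 <-].
by rewrite leeBrDr// addeC h1.
Qed.

End hd_metric.

Section surface_borel.
Context {R : realType} {n : nat}.
Local Notation V := 'rV[R]_n.

Lemma borel_surface (B : set V) : measurable B -> measurable (B : set (surface_type R n)).
move=> mB; apply: (@metric_borel_carath R n (@surface_outer R n)) => //.
exact: hd_metric.
Qed.

Lemma meas_surface_id : mfun setT (id : surface_type R n -> V).
by move=> _ B mB; rewrite setTI preimage_id; exact: borel_surface. Qed.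

End surface_borel.

(** * Riesz representation of bounded functionals on test functions *)

Section grouped_partition.
Context {R : realType} {n : nat}.
Local Notation V := 'rV[R]_n.

(** [pou] may use the same [U i] several times. Summing over equal indices gives one function for
    each i, as needed where each [U i] comes with its own estimate. *)
Lemma pou_nat (K : set V) (U : nat -> set V) :
 compact K -> (forall i, open (U i)) -> K `<=` \bigcup_i U i ->
 exists M (eta : nat -> V -> R), [/\
  forall i, test (U i) (eta i),
  forall i x, 0 <= eta i x,
  forall x, \sum_(i < M) eta i x <= 1 &
  forall x, K x -> \sum_(i < M) eta i x = 1].
move=> cK oU KU.
have [N [idx [z [tz z0 z1 zK]]]] := pou 0%N cK oU KU.
pose M := (\max_(j < N) idx j)%N.
pose eta i x := \sum_(j < N | idx j == i) z j x.
have E x : \sum_(i < M.+1) eta i x = \sum_(j < N) z j x.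
 rewrite [RHS](partition_big (fun j : 'I_N => inord (idx j) : 'I_M.+1) xpredT)//=.
 apply: eq_bigr => i _; apply: eq_bigl => j; rewrite -val_eqE/= inordK//.
 by rewrite ltnS; exact: (@leq_bigmax _ (fun j : 'I_N => idx j) j).
exists M.+1, eta; split.
- by move=> i; apply: test_sum => j /eqP <-; exact: tz.
- by move=> i x; apply: sumr_ge0.
- by move=> x; rewrite E.
- by move=> x Kx; rewrite E zK.
Qed.

End grouped_partition.

Lemma sum_half_pow (R : realFieldType) (M : nat) :
 \sum_(i < M) (2 ^+ i.+1)^-1 = 1 - (2 ^+ M)^-1 :> R.
elim: M => [|M IH]; first by rewrite big_ord0 expr0 invr1 subrr.
by rewrite big_ord_recr/= IH exprS invfM; field; rewrite expf_neq0.
Qed.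

Section var_measure.
Context {R : realType} {n : nat}.
Local Notation V := 'rV[R]_n.
Variables (O : set V) (L : (V -> R) -> R) (C : R).
Hypothesis oOmega : open O.
Hypothesis LD : forall p q, test O p -> test O q ->
 L (fun x => p x + q x) = L p + L q.
Hypothesis LZ : forall c p, test O p -> L (fun x => c * p x) = c * L p.
Hypothesis LC : forall p (M : R), test O p -> (forall x, `|p x| <= M) -> `|L p| <= C * M.

Lemma functional0 : L (fun=> 0) = 0.
rewrite -[RHS](mul0r (L (fun=> 0))) -(LZ 0 (test0 O)).
by congr L; apply/funext => x; rewrite mul0r.
Qed.

Lemma functional_sum (N : nat) (p : nat -> V -> R) : (forall i, test O (p i)) ->
 L (fun x => \sum_(i < N) p i x) = \sum_(i < N) L (p i).
move=> tp; elim: N => [|N IH].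
 rewrite [RHS]big_ord0 -[RHS]functional0; congr L; apply/funext => x; by rewrite big_ord0.
rewrite big_ord_recr/= -IH -LD//; last by apply: test_sum.
by congr L; apply/funext => x; rewrite big_ord_recr.
Qed.

Local Open Scope ereal_scope.

(** Total variation of L on an open set. Its extension by infima over open supersets is a metric
    outer measure, hence a Borel measure. *)
Definition open_var (U : set V) : \bar R :=
 ereal_sup [set (L p)%:E | p in [set p | test (U `&` O) p /\ forall x, (`|p x| <= 1)%R]].

Lemma open_var_ub U p : test (U `&` O) p -> (forall x, (`|p x| <= 1)%R) ->
 (L p)%:E <= open_var U.
by move=> tp p1; apply: ereal_sup_ubound; exists p. Qed.

Lemma open_var_ge0 U : 0 <= open_var U.
rewrite (_ : 0 = (L (fun=> 0%R))%:E); last by rewrite functional0.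
by apply: open_var_ub => [|x]; [exact: test0|rewrite normr0].
Qed.

Lemma open_var_le U (c : R) : (forall p, test (U `&` O) p ->
 (forall x, (`|p x| <= 1)%R) -> (L p <= c)%R) -> open_var U <= c%:E.
by move=> h; apply: ge_ereal_sup => _ [p [tp p1] <-]; rewrite lee_fin h. Qed.

Lemma open_var_leC U : open_var U <= C%:E.
apply: open_var_le => p tp p1; apply: le_trans (ler_norm _) _; rewrite -[leRHS]mulr1.
by apply: LC p1; apply: test_subset tp; exact: subIsetr.
Qed.

Lemma open_var_fin U : open_var U \is a fin_num.
by rewrite ge0_fin_numE ?open_var_ge0// (le_lt_trans (open_var_leC U))// ltry. Qed.

Lemma le_open_var U W : U `<=` W -> open_var U <= open_var W.
move=> UW; apply: ge_ereal_sup => _ [p [tp p1] <-]; apply: open_var_ub => //.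
by apply: test_subset tp; exact: setSI.
Qed.

Lemma functional_le U (M : R) p : test (U `&` O) p -> (0 <= M)%R ->
 (forall x, (`|p x| <= M)%R) -> (L p)%:E <= M%:E * open_var U.
move=> tp M0 pM; have tp' : test O p.
 by apply: test_subset tp; exact: subIsetr.
have [M00|Mn0] := eqVneq M 0%R.
 have := LC tp' pM; rewrite M00 mulr0 normr_le0 => /eqP ->.
 by rewrite mul0e.
have Mp : (0 < M)%R by rewrite lt_neqAle eq_sym Mn0.
rewrite -[L p](mulVKf Mn0) -LZ// EFinM lee_pmul2l ?lte_fin//.
apply: open_var_ub; first exact: testZ.
by move=> x; rewrite normrM normfV (gtr0_norm Mp) ler_pdivrMl// mulr1.
Qed.

(** A partition of unity on the compact support of p splits L p into finitely many terms, one for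
    each [U i]. *)
Lemma open_var_bigcup (U : nat -> set V) : (forall i, open (U i)) ->
 open_var (\bigcup_i U i) <= \sum_(i <oo) open_var (U i).
move=> oU; apply: ge_ereal_sup => _ [p [tp p1] <-].
have [sp [K [cK KU K0]]] := tp.
have [|M [eta [teta e0 e1 eK]]] := pou_nat cK oU.
 by apply: subset_trans KU _; exact: subIsetl.
have tpO : test O p by apply: test_subset tp; exact: subIsetr.
have tpe i : test (U i `&` O) (fun x => p x * eta i x)%R.
 have [se [K' [cK' KU' K0']]] := teta i; split; first exact: smoothM.
 exists (K `&` K'); split.
 - by apply: compact_closedI => //; exact: compact_closed_rV.
 - by move=> x [/KU[_ Ox] /KU' Ux].
 - by move=> x /not_andP[/K0 ->|/K0' ->]; rewrite ?mul0r ?mulr0.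
have pE : p = fun x => (\sum_(i < M) (p x * eta i x))%R.
 apply/funext => x; rewrite -mulr_sumr; have [Kx|Kx] := pselect (K x).
  by rewrite eK// mulr1.
 by rewrite K0// mul0r.
rewrite pE (functional_sum M (p := fun i x => p x * eta i x)%R); last first.
 by move=> i; apply: test_subset (tpe i); exact: subIsetr.
rewrite -sumEFin; apply: (@le_trans _ _ (\sum_(i < M) open_var (U i))).
 apply: lee_sum => i _; apply: open_var_ub => // x.
 rewrite normrM -[leRHS]mulr1 ler_pM// ger0_norm//.
 apply: le_trans (e1 x); rewrite (bigD1 i)//= lerDl sumr_ge0//.
rewrite -(big_mkord xpredT (fun i => open_var (U i))).
by apply: nneseries_lim_ge => i _ _; exact: open_var_ge0.
Qed.

Definition outer_var (E : set V) : \bar R :=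
 ereal_inf [set open_var U | U in [set U | open U /\ E `<=` U]].

Lemma outer_var_open U : open U -> outer_var U = open_var U.
move=> oU; apply/eqP; rewrite eq_le; apply/andP; split.
 by apply: ereal_inf_lbound; exists U => //; split.
by apply: le_ereal_inf_tmp => _ [W [oW UW] <-]; exact: le_open_var.
Qed.

Let outer_var0 : outer_var set0 = 0.
rewrite outer_var_open; last exact: open0.
apply/eqP; rewrite eq_le open_var_ge0 andbT.
apply: open_var_le => p; rewrite set0I => tp _.
rewrite (_ : p = fun=> 0%R) ?functional0//.
by apply/funext => x; exact: test_out tp _.
Qed.

Let outer_var_ge0 E : 0 <= outer_var E.
by apply: le_ereal_inf_tmp => _ [W _ <-]; exact: open_var_ge0. Qed.

Let le_outer_var : {homo outer_var : A B / A `<=` B >-> A <= B}.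
move=> A B AB; apply: le_ereal_inf_tmp => _ [W [oW BW] <-].
by apply: ereal_inf_lbound; exists W => //; split => //; exact: subset_trans BW.
Qed.

Lemma outer_var_fin E : outer_var E \is a fin_num.
rewrite ge0_fin_numE//; apply: le_lt_trans (ltry C); apply: le_trans (open_var_leC setT).
by apply: ereal_inf_lbound; exists setT => //; split => //; exact: openT.
Qed.

Lemma outer_var_approx E (e : R) : (0 < e)%R -> exists U, [/\ open U, E `<=` U &
 open_var U <= outer_var E + e%:E].
move=> e0; have := outer_var_fin E.
by move=> /(lb_ereal_inf_adherent e0)[_ [U [oU EU] <-] /ltW h]; exists U.
Qed.

Let outer_var_subadd : sigma_subadditive outer_var.
move=> F; apply/lee_addgt0Pr => e e0.
have /choice[U hU] : forall i, exists U, [/\ open U, F i `<=` U &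
  open_var U <= outer_var (F i) + (e / (2 ^ i.+1)%:R)%:E].
 by move=> i; apply: outer_var_approx; rewrite divr_gt0// ltr0n expn_gt0.
apply: (@le_trans _ _ (open_var (\bigcup_i U i))).
 apply: ereal_inf_lbound; exists (\bigcup_i U i) => //; split.
  by apply: bigcup_open => i _; have [] := hU i.
 by move=> x [i _ Fx]; exists i => //; have [_ h _] := hU i; exact: h.
apply: (le_trans (open_var_bigcup _)); first by move=> i; have [] := hU i.
apply: le_trans (epsilon_trick xpredT _ (ltW e0)) => //.
by apply: lee_nneseries => [i _ _|i _]; [exact: open_var_ge0|have [] := hU i].
Qed.

HB.instance Definition _ := isOuterMeasure.Build R V outer_var
 outer_var0 outer_var_ge0 le_outer_var outer_var_subadd.

(** Test functions supported in the disjoint d/2-neighbourhoods of E and F can be added without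
    exceeding 1 in absolute value. *)
Lemma outer_var_metric (E F : set V) : separated_sets E F ->
 outer_var E + outer_var F <= outer_var (E `|` F).
move=> [d d0 sep]; apply: le_ereal_inf_tmp => _ [U [oU EFU] <-].
pose N X := U `&` \bigcup_(x in X) ball x (d / 2)%R.
have oN X : open (N X) by apply: openI => //; apply: bigcup_open => x _; exact: ball_open.
have d20 : (0 < d / 2)%R by rewrite divr_gt0.
have disj x : N E x -> N F x -> False.
 move=> [_ [y Ey yx]] [_ [z Fz zx]]; apply: (sep y z Ey Fz).
 by have := ball_triangle yx (ball_sym zx); rewrite -splitr.
apply: (@le_trans _ _ (open_var (N E) + open_var (N F))).
 apply: leeD; apply: ereal_inf_lbound.
  exists (N E) => //; split => // x Ex; split; first by apply: EFU; left.
  by exists x => //; exact: ballxx.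
 exists (N F) => //; split => // x Ex; split; first by apply: EFU; right.
 by exists x => //; exact: ballxx.
rewrite -leeBrDr ?open_var_fin//; apply: ge_ereal_sup => _ [p [tp p1] <-].
rewrite leeBrDr ?open_var_fin// addeC -leeBrDr//; apply: ge_ereal_sup => _ [q [tq q1] <-].
rewrite leeBrDr// -EFinD -LD; first last.
- by apply: test_subset tp; exact: subIsetr.
- by apply: test_subset tq; exact: subIsetr.
apply: open_var_ub.
 by apply: testD; [apply: test_subset tq|apply: test_subset tp]; apply: setSI; exact: subIsetl.
move=> x; have [NEx|nNE] := pselect (N E x).
 by rewrite (test_out tq) ?add0r// => -[NFx _]; exact: disj NEx NFx.
by rewrite (test_out tp) ?addr0// => -[].
Qed.

Lemma borel_var (B : set V) : measurable B ->
 measurable (B : set (caratheodory_type outer_var)).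
by move=> mB; apply: metric_borel_carath mB; exact: outer_var_metric. Qed.

Let mOmega : measurable O. Proof. exact: open_meas. Qed.

Definition var_measure (B : set V) : \bar R := outer_var (B `&` O).

Let var_measure0 : var_measure set0 = 0.
by rewrite /var_measure set0I outer_var0. Qed.

Let var_measure_ge0 B : 0 <= var_measure B.
exact: outer_var_ge0. Qed.

Let var_measure_sadd : semi_sigma_additive var_measure.
move=> F mF tF mUF; rewrite /var_measure setI_bigcupl.
pose om : {outer_measure set V -> \bar R} := outer_var.
pose m0 : {measure set (caratheodory_type om) -> \bar R} :=
 (om : set (caratheodory_type om) -> \bar R).
apply: (@measure_semi_sigma_additive _ _ _ m0 (fun k => F k `&` O)).
- by move=> k; apply: borel_var; exact: measurableI.
- exact: trivIset_setIr.
- by apply: borel_var; rewrite -setI_bigcupl; exact: measurableI.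
Qed.

HB.instance Definition _ := isMeasure.Build _ _ _ var_measure
 var_measure0 var_measure_ge0 var_measure_sadd.

Lemma var_measure_leC : var_measure setT <= C%:E.
rewrite /var_measure setTI outer_var_open//; exact: open_var_leC.
Qed.

Lemma var_measure_open_le U (c : R) : open U ->
 (forall p, test (U `&` O) p -> (forall x, (`|p x| <= 1)%R) -> (L p <= c)%R) ->
 var_measure U <= c%:E.
move=> oU h; rewrite /var_measure outer_var_open; last exact: openI.
by apply: open_var_le => p; rewrite -setIA setIid; exact: h.
Qed.

Lemma var_measure_fin E : var_measure E \is a fin_num.
exact: outer_var_fin. Qed.

(** On the layer where |p| lies between ie and (i+1)e, the functional is at most (i+1)e times the
    variation of a slightly larger open set. A partition of unity over the layers assembles these
    bounds. *)
Lemma var_measure_bound p : test O p ->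
 (L p <= \int[var_measure]_x `|p x|)%R.
move=> tp; have muoo : var_measure setT < +oo.
 by rewrite -ge0_fin_numE ?var_measure_fin.
have Ip := @test_intR R n var_measure muoo O p setT measurableT tp.
set c := fine (var_measure setT).
have c0 : (0 <= c)%R by rewrite fine_ge0.
suff main (e : R) : (0 < e)%R -> (L p <= \int[var_measure]_x `|p x| + e * (c + 1))%R.
 apply/ler_addgt0Pr => e e0; have c1 : (0 < c + 1)%R by rewrite ltr_wpDl.
 by have := main _ (divr_gt0 e0 c1); rewrite divfK// gt_eqF.
move=> e0; pose E i := O `&` [set x | (i%:R * e <= `|p x| < i.+1%:R * e)%R].
have cp : continuous p by exact: test_cont tp.
have cnp : continuous (fun x => `|p x|)%R.
 by move=> x; apply: continuous_comp; [exact: cp|exact: norm_continuous].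
have mE i : measurable (E i).
 apply: measurableI => //; rewrite (_ : [set _ | _] = (fun x => `|p x|)%R @^-1` `[(i%:R * e)%R, (i.+1%:R * e)%R[%classic).
  rewrite -[X in measurable X]setTI; apply: (cont_meas (D := setT) cnp) => //.
 by apply/seteqP; split => x /=; rewrite in_itv.
(* The excess of [U i] over its layer gets multiplied by (i+1)e; with this choice the contributions
   sum to at most e. *)
pose dl i : R := ((i.+1%:R)^-1 / 2 ^+ i.+1)%R.
have dl0 i : (0 < dl i)%R by rewrite divr_gt0// ?invr_gt0// exprn_gt0.
have /choice[U hU] : forall i, exists U, [/\ open U, E i `<=` U,
  open_var U <= outer_var (E i) + (dl i)%:E &
  forall x, U x -> (`|p x| <= i.+1%:R * e)%R].
 move=> i; have [U [oU EU hU]] := outer_var_approx (E i) (dl0 i).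
 exists (U `&` [set x | (`|p x| < i.+1%:R * e)%R]); split.
 - apply: openI => //; rewrite (_ : [set _ | _] = (fun x => `|p x|)%R @^-1` [set y | (y < i.+1%:R * e)%R])//.
  by apply: open_comp => [x _|]; [exact: cnp|exact: open_lt].
 - by move=> x Ex; split; [exact: EU|case: Ex => _ /= /andP[]].
 - by apply: le_trans hU; apply: le_open_var; exact: subIsetl.
 - by move=> x [_ /= /ltW].
have [sp [K [cK KO K0]]] := tp.
have [||M [eta [teta eta0 eta1 etaK]]] := @pou_nat R n K U cK.
- by move=> i; have [] := hU i.
- move=> x Kx; exists (Num.truncn (`|p x| / e)) => //.
 have [_ EU _ _] := hU (Num.truncn (`|p x| / e)); apply: EU; split; first exact: KO.
 have : (0 <= `|p x| / e)%R by rewrite divr_ge0// ltW.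
 by move=> /truncn_itv /=; rewrite ler_pdivlMr// ltr_pdivrMr.
have tpe i : test (U i `&` O) (fun x => p x * eta i x)%R.
 have [se [K' [cK' KU' K0']]] := teta i; split; first exact: smoothM.
 exists (K `&` K'); split.
 - by apply: compact_closedI => //; exact: compact_closed_rV.
 - by move=> x [/KO Ox /KU' Ux].
 - by move=> x /not_andP[/K0 ->|/K0' ->]; rewrite ?mul0r ?mulr0.
have pE : p = fun x => (\sum_(i < M) (p x * eta i x))%R.
 apply/funext => x; rewrite -mulr_sumr; have [Kx|Kx] := pselect (K x).
  by rewrite etaK// mulr1.
 by rewrite K0// mul0r.
rewrite {1}pE (functional_sum M (p := fun i x => p x * eta i x)%R); last first.
 by move=> i; apply: test_subset (tpe i); exact: subIsetr.
have bound (i : 'I_M) : (L (fun x => p x * eta i x) <=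
  i.+1%:R * e * \int[var_measure]_x \1_(E i) x + e * (2 ^+ i.+1)^-1)%R.
 have [oU EU UV Up] := hU i.
 have i0 : (0 <= i.+1%:R * e)%R by rewrite mulr_ge0// ltW.
 have := functional_le (tpe i) i0.
 move=> h; rewrite -lee_fin; apply: le_trans (h _) _.
  move=> x; have [Ux|nUx] := pselect (U i x); last first.
   by rewrite (test_out (teta i) nUx) mulr0 normr0.
  rewrite normrM -[leRHS]mulr1 ler_pM ?Up// ger0_norm//.
  by apply: le_trans (eta1 x); rewrite (bigD1 i)//= lerDl sumr_ge0.
 apply: (@le_trans _ _ ((i.+1%:R * e)%:E * (outer_var (E i) + (dl i)%:E))).
  by apply: lee_pmul => //; exact: open_var_ge0.
 rewrite -[outer_var (E i)]fineK ?outer_var_fin// -EFinD -EFinM lee_fin.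
 have -> : (\int[var_measure]_x \1_(E i) x = fine (outer_var (E i)))%R.
  rewrite Rint_indic// setIT /= /var_measure (_ : E i `&` O = E i)//.
  by apply: setIidl => ? [].
 rewrite mulrDr lerD2l /dl (mulrC i.+1%:R e) -!mulrA ler_wpM2l ?(ltW e0)//.
 by rewrite mulrA divff ?mul1r// pnatr_eq0.
apply: (le_trans (ler_sum _ (fun i _ => bound i))).
rewrite big_split/= -mulr_sumr mulrDr mulr1 addrA; apply: lerD.
 apply: (@le_trans _ _ (\int[var_measure]_x (`|p x| + e))%R); last first.
  rewrite RintD//; [|exact: intR_norm|exact: intR_cst].
  by rewrite Rint_cst.
 rewrite (eq_bigr (fun i : 'I_M => \int[var_measure]_x (i.+1%:R * e * \1_(E i) x))%R); last first.
  by move=> i _; rewrite RintZ//; exact: intR_indic.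
 rewrite -Rint_sum//; last by move=> i _; apply: intRZ => //; exact: intR_indic.
 apply: Rint_le => //.
 - by apply: intR_sum => // i _; apply: intRZ => //; exact: intR_indic.
 - by apply: intRD => //; [exact: intR_norm|exact: intR_cst].
 move=> x _; have [[i Ei]|nE] := pselect (exists i : 'I_M, E i x); last first.
  rewrite big1 ?addr_ge0// ?ltW// => i _; rewrite indicE memNset ?mulr0// => Ei.
  by apply: nE; exists i.
 rewrite (bigD1 i)//= indicE mem_set// mulr1 big1 ?addr0.
  case: Ei => _ /= /andP[h1 _]; rewrite -natr1 mulrDl mul1r lerD2r//.
 move=> j ji; rewrite indicE memNset ?mulr0// => Ej.
 case: Ei => _ /= /andP[i1 i2]; case: Ej => _ /= /andP[j1 j2].
 have := le_lt_trans i1 j2; have := le_lt_trans j1 i2.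
 rewrite !ltr_pM2r// !ltr_nat !ltnS => ji1 ij1.
 by move/eqP: ji; apply; apply/val_inj/eqP; rewrite eqn_leq ji1.
by rewrite ger_pMr// sum_half_pow gerBl invr_ge0 exprn_ge0.
Qed.

Lemma var_measure_ex : exists mu : {measure set V -> \bar R}, [/\
 mu setT <= C%:E,
 forall U (c : R), open U -> (forall p, test (U `&` O) p ->
  (forall x, (`|p x| <= 1)%R) -> (L p <= c)%R) -> mu U <= c%:E &
 forall p, test O p -> (L p <= \int[mu]_x `|p x|)%R].
exists var_measure; split.
- exact: var_measure_leC.
- by move=> U c oU; exact: var_measure_open_le.
- exact: var_measure_bound.
Qed.

End var_measure.

(** * Integration against charges, and signed representing measures *)

Section charge_integrals.
Context d (T : measurableType d) (R : realType).
Implicit Types (nu : {charge set T -> \bar R}).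

Lemma measure_lty (mu : {measure set T -> \bar R}) (D : set T) :
 (mu setT < +oo)%E -> measurable D -> (mu D < +oo)%E.
by move=> h mD; apply: le_lt_trans h; apply: le_measure; rewrite ?inE. Qed.

Lemma charge_parts nu : exists P N : {measure set T -> \bar R}, [/\
 (P setT < +oo)%E, (N setT < +oo)%E,
 forall A, measurable A -> nu A = (P A - N A)%E &
 forall D f, charge_integral nu D f = (\int[P]_(x in D) f x - \int[N]_(x in D) f x)%E].
pose hP := cid (Hahn_decomposition nu); pose hN := cid (svalP hP).
exists (jordan_pos (svalP hN)), (jordan_neg (svalP hN)); split => //.
- by rewrite -ge0_fin_numE// fin_num_measure.
- by rewrite -ge0_fin_numE// fin_num_measure.
by move=> A mA; rewrite (jordan_decomp (svalP hN) mA) /cadd/= /cscale/= mulN1e.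
Qed.

(** [charge_integral] uses some chosen Hahn decomposition P - N. Any other decomposition W - V is
    compared with it through the equality of measures P + V = N + W. *)
Lemma charge_integral_diff nu (W V : {measure set T -> \bar R}) (D : set T) (f : T -> R) (M : R) :
 (W setT < +oo)%E -> (V setT < +oo)%E -> measurable D ->
 (forall A, measurable A -> nu A = (W A - V A)%E) ->
 mfun D f -> (forall x, D x -> `|f x| <= M) ->
 charge_integral nu D (EFin \o f) =
 (\int[W]_(x in D) f x - \int[V]_(x in D) f x)%:E.
move=> Woo Voo mD nuE mf fM; have [P [N [Poo Noo nuPN ->]]] := charge_parts nu.
have I (m : {measure set T -> \bar R}) : (m setT < +oo)%E -> intR m D f.
 by move=> moo; apply: (@intR_bounded _ _ _ m D mD f M) => //; exact: measure_lty.
have E : (\int[measure_add P V]_(x in D) (f x)%:E = \int[measure_add N W]_(x in D) (f x)%:E)%E.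
 apply: eq_measure_integral => A mA _.
 have aE (m1 m2 : {measure set T -> \bar R}) : measure_add m1 m2 A = (m1 A + m2 A)%E.
  exact: measure_addE.
 rewrite [LHS]aE [RHS]aE.
 have := nuPN A mA; rewrite nuE// => h.
 have fW : W A \is a fin_num by rewrite ge0_fin_numE// measure_lty.
 have fV : V A \is a fin_num by rewrite ge0_fin_numE// measure_lty.
 have fP : P A \is a fin_num by rewrite ge0_fin_numE// measure_lty.
 have fN : N A \is a fin_num by rewrite ge0_fin_numE// measure_lty.
 move: h; rewrite -(fineK fW) -(fineK fV) -(fineK fP) -(fineK fN) -!EFinB -!EFinD.
 by move=> [] h; congr EFin; lra.
have iP := I P Poo; have iN := I N Noo; have iW := I W Woo; have iV := I V Voo.
move: E; rewrite !integral_measure_add// !EFin_Rint// -!EFinD => -[] E.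
by congr EFin; lra.
Qed.

End charge_integrals.

Section riesz.
Context {R : realType} {n : nat}.
Local Notation V := 'rV[R]_n.

Lemma le_measure_open (W mu : {measure set V -> \bar R}) (c : R) :
 (mu setT < +oo)%E -> 0 <= c ->
 (forall U, open U -> (W U <= c%:E * mu U)%E) ->
 forall B, measurable B -> (W B <= c%:E * mu B)%E.
move=> muoo c0 h B mB; apply/lee_addgt0Pr => e e0.
have c1 : 0 < c + 1 by rewrite ltr_wpDl.
have [F [U [cF oU FB BU UF]]] := regular_closed_open muoo mB (divr_gt0 e0 c1).
have mU := open_meas oU; have mF := closed_meas cF.
apply: (@le_trans _ _ (W U)); first by apply: le_measure; rewrite ?inE.
apply: (le_trans (h _ oU)).
have -> : mu U = (mu B + mu (U `\` B))%E.
 rewrite -measureU//; first by rewrite setDUK.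
 - exact: measurableD.
 - by rewrite setDIK.
rewrite ge0_muleDr// leeD2l//.
apply: (@le_trans _ _ (c%:E * (e / (c + 1))%:E)%E).
 rewrite lee_wpmul2l ?lee_fin//; apply: le_trans UF; apply: le_measure; rewrite ?inE.
 - exact: measurableD.
 - exact: measurableD.
 - exact: setDS.
rewrite -EFinM lee_fin mulrCA -[leRHS]mulr1 ler_wpM2l ?(ltW e0)//.
by rewrite ler_pdivrMr// mul1r lerDl.
Qed.

Variables (O : set V) (L : (V -> R) -> R) (C : R).
Hypothesis oOmega : open O.
Hypothesis LD : forall p q, test O p -> test O q ->
 L (fun x => p x + q x) = L p + L q.
Hypothesis LZ : forall c p, test O p -> L (fun x => c * p x) = c * L p.
Hypothesis LC : forall p (M : R), test O p -> (forall x, `|p x| <= M) -> `|L p| <= C * M.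

(** With mu the variation measure of L, the functional p -> L p + (integral of p against mu) is
    positive. Its own variation measure W represents it, so L is the difference of W and mu. On open
    sets this functional is at most twice the integral of |p|, whence the factor 2. *)
Lemma riesz_measures : exists mu W : {measure set V -> \bar R}, [/\
 (mu setT <= C%:E)%E,
 forall U (c : R), open U -> (forall p, test (U `&` O) p ->
  (forall x, `|p x| <= 1) -> L p <= c) -> (mu U <= c%:E)%E,
 forall B, measurable B -> (W B <= 2%:E * mu B)%E &
 forall p, test O p -> L p = \int[W]_x p x - \int[mu]_x p x].
have [mu [muC muU muL]] := var_measure_ex oOmega LD LZ LC.
have muoo : (mu setT < +oo)%E by rewrite (le_lt_trans muC)// ltry.
have Imu p : test O p -> intR mu setT p by move=> tp; exact: test_intR tp.
pose La p := \int[mu]_x p x + L p.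
have LaD p q : test O p -> test O q ->
  La (fun x => p x + q x) = La p + La q.
 by move=> tp tq; rewrite /La RintD ?LD//; [ring|exact: Imu..].
have LaZ c p : test O p -> La (fun x => c * p x) = c * La p.
 by move=> tp; rewrite /La RintZ ?LZ ?mulrDr//; exact: Imu.
have LaB p q : test O p -> test O q ->
  La (fun x => p x - q x) = La p - La q.
 move=> tp tq; rewrite -mulN1r -LaZ// -LaD//; last exact: testZ.
 by congr La; apply/funext => x; rewrite mulN1r.
have LaC p (M : R) : test O p -> (forall x, `|p x| <= M) ->
  `|La p| <= (fine (mu setT) + C) * M.
 move=> tp pM; apply: (le_trans (ler_normD _ _)); rewrite mulrDl lerD//; last exact: LC.
 rewrite mulrC -Rint_cst//; apply: Rint_norm_le => //; [exact: Imu|exact: intR_cst].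
have La_ge0 p : test O p -> (forall x, 0 <= p x) -> 0 <= La p.
 move=> tp p0; have := muL _ (testZ (-1) tp); rewrite LZ// mulN1r.
 rewrite (@Rint_eq _ _ _ _ _ _ p); first by rewrite /La => ?; lra.
 by move=> x _; rewrite mulN1r normrN ger0_norm.
have [W [WC WU WL]] := var_measure_ex oOmega LaD LaZ LaC.
have Woo : (W setT < +oo)%E by rewrite (le_lt_trans WC)// ltry.
have IW p : test O p -> intR W setT p by move=> tp; exact: test_intR tp.
(* The known inequality, applied to M chi - p instead of p, turns into the reverse inequality for p,
   provided that [La] of the plateau chi nearly reaches the mass of W. *)
have W_ge p : test O p -> (forall x, 0 <= p x) -> \int[W]_x p x <= La p.
 move=> tp p0; have [M M0 pM] := test_bounded tp.
 apply/ler_addgt0Pr => e e0; have M1 : 0 < M + 1 by rewrite ltr_wpDl.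
 have d0 := divr_gt0 e0 M1; set dl := e / (M + 1).
 have [q [tq q1 Lq]] : exists q, [/\ test O q, forall x, `|q x| <= 1 &
   fine (W setT) - dl <= La q].
  apply: contrapT => nq.
  have fW : W setT \is a fin_num by rewrite ge0_fin_numE.
  suff : (W setT <= (fine (W setT) - dl)%:E)%E.
   by rewrite -[X in (X <= _)%E]fineK// lee_fin /dl; lra.
  apply: WU; first exact: openT.
  move=> q; rewrite setTI => tq q1; apply: contrapT => /negP; rewrite -ltNge => /ltW hq.
  by apply: nq; exists q.
 have [sp [K [cK KO K0]]] := tp; have [sq [K' [cK' KO' K0']]] := tq.
 have KKO : K `|` K' `<=` O by rewrite subUset.
 have [x0 [tchi chi01 chi1]] := test_plateau (compactU cK cK') oOmega KKO.
 have chi_ge0 x : 0 <= x0 x by have /andP[] := chi01 x.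
 have La_chi : fine (W setT) - dl <= La x0.
  apply: (le_trans Lq); rewrite -subr_ge0 -LaB//; apply: La_ge0; first exact: testB.
  move=> x; rewrite subr_ge0; have [Kx|nKx] := pselect (K' x).
   by rewrite chi1; [exact: le_trans (ler_norm _) (q1 x)|right].
  by rewrite K0'.
 have Lr : La (fun x => M * x0 x - p x) <= \int[W]_x (M * x0 x - p x).
  have tr : test O (fun x => M * x0 x - p x) by exact: (testB (testZ M tchi) tp).
  apply: le_trans (WL _ tr) _; rewrite le_eqVlt; apply/orP; left; apply/eqP.
  apply: Rint_eq => x _; rewrite ger0_norm// subr_ge0.
  have [Kx|nKx] := pselect (K x); last by rewrite K0// mulr_ge0.
  by rewrite chi1 ?mulr1; [exact: le_trans (ler_norm _) (pM x)|left].
 move: Lr; rewrite (LaB _ _ (testZ M tchi) tp) (LaZ _ _ tchi).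
 rewrite RintB//; [|by apply: intRZ => //; exact: IW|exact: IW].
 rewrite RintZ//; last exact: IW.
 have chiW : \int[W]_x x0 x <= fine (W setT).
  rewrite -[leRHS]mul1r -Rint_cst//; apply: Rint_le => //; [exact: IW|exact: intR_cst|].
  by move=> x _; have /andP[] := chi01 x.
 have h1 : M * \int[W]_x x0 x <= M * fine (W setT) by exact: ler_wpM2l.
 have h2 : M * (fine (W setT) - dl) <= M * La x0 by exact: ler_wpM2l.
 have h3 : M * dl <= e.
  by rewrite /dl mulrCA -[leRHS]mulr1 ler_wpM2l ?(ltW e0)// ler_pdivrMr// mul1r lerDl.
 move: h2; rewrite mulrBr => h2 h4; lra.
have W_eq0 p : test O p -> (forall x, 0 <= p x) -> \int[W]_x p x = La p.
 move=> tp p0; apply/eqP; rewrite eq_le W_ge//=; apply: (le_trans (WL _ tp)).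
 by rewrite le_eqVlt; apply/orP; left; apply/eqP/Rint_eq => x _; rewrite ger0_norm.
have W_eq p : test O p -> \int[W]_x p x = La p.
 move=> tp; have [M M0 pM] := test_bounded tp; have [sp [K [cK KO K0]]] := tp.
 have [chi [tchi chi01 chi1]] := test_plateau cK oOmega KO.
 have chi_ge0 x : 0 <= chi x by have /andP[] := chi01 x.
 have tM : test O (fun x => M * chi x) by exact: testZ.
 have := W_eq0 _ (testD tp tM); rewrite LaD// RintD//; [|exact: IW|exact: IW].
 rewrite (W_eq0 _ tM) => [h|x]; last by rewrite mulr_ge0.
 apply: (addIr (La (fun x => M * chi x))); apply: h => x.
 have [Kx|nKx] := pselect (K x); last by rewrite K0// add0r mulr_ge0.
 by rewrite chi1// mulr1; have := pM x; rewrite ler_norml => /andP[? _]; lra.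
have W2 B : measurable B -> (W B <= 2%:E * mu B)%E.
 move=> mB; apply: le_measure_open => // U oU; have mU := open_meas oU.
 have fU : mu U \is a fin_num by rewrite ge0_fin_numE// measure_lty.
 rewrite -(fineK fU) -EFinM; apply: WU => // p tp p1.
 have tpO : test O p by apply: test_subset tp; exact: subIsetr.
 have hp : \int[mu]_x `|p x| <= fine (mu U).
  rewrite -[U]setIT -Rint_indic//; apply: Rint_le => //.
  - by apply: intR_norm => //; exact: Imu.
  - exact: intR_indic.
  move=> x _; rewrite indicE; have [Ux|nUx] := pselect (U x); first by rewrite mem_set.
  by rewrite (test_out tp) ?normr0// => -[].
 have h1 := muL _ tpO.
 have h2 : \int[mu]_x p x <= \int[mu]_x `|p x|.
  by apply: Rint_le => //; [exact: Imu|apply: intR_norm => //; exact: Imu|move=> x _; exact: ler_norm].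
 rewrite /La; lra.
exists mu, W; split => // p tp.
by rewrite W_eq// /La; ring.
Qed.

Lemma riesz : exists (mu : {measure set V -> \bar R}) (nu : {charge set V -> \bar R}), [/\
 (mu setT <= C%:E)%E,
 forall U (c : R), open U -> (forall p, test (U `&` O) p ->
  (forall x, `|p x| <= 1) -> L p <= c) -> (mu U <= c%:E)%E,
 forall B, measurable B -> (`|nu B| <= 3%:E * mu B)%E &
 forall p D, test O p -> measurable D -> O `<=` D ->
  charge_integral nu D (EFin \o p) = (L p)%:E].
have [mu [W [muC muU W2 LE]]] := riesz_measures.
have muoo : (mu setT < +oo)%E by rewrite (le_lt_trans muC)// ltry.
have Woo : (W setT < +oo)%E.
 by apply: le_lt_trans (W2 _ measurableT) _; rewrite lte_mul_pinfty// lee_fin.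
pose W' := charge_of_finite_measure (mfrestr measurableT Woo).
pose mu' := charge_of_finite_measure (mfrestr measurableT muoo).
pose nu : {charge set V -> \bar R} := cadd W' (copp mu').
have nuE A : measurable A -> nu A = (W A - mu A)%E.
 move=> mA; have -> : nu A = (W (A `&` setT) - mu (A `&` setT))%E by [].
 by rewrite setIT.
exists mu, nu; split => //.
- move=> B mB; rewrite nuE//.
 have fW : W B \is a fin_num by rewrite ge0_fin_numE// measure_lty.
 have fmu : mu B \is a fin_num by rewrite ge0_fin_numE// measure_lty.
 have := W2 B mB; have : (0 <= W B)%E by []. have : (0 <= mu B)%E by [].
 rewrite -(fineK fW) -(fineK fmu) -EFinB -!EFinM !lee_fin => h1 h2 h3.
 by rewrite ler_norml; apply/andP; split; lra.
- move=> p D tp mD OD; have [M M0 pM] := test_bounded tp.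
 rewrite (@charge_integral_diff _ _ _ nu W mu D p M)//; last exact: test_meas tp.
 have DE (m : {measure set V -> \bar R}) : \int[m]_(x in D) p x = \int[m]_x p x.
  rewrite Rint_mkcond; apply: Rint_eq => x _; rewrite patchE; case: ifPn => //.
  by move=> /negP nD; rewrite (test_out tp)// => /OD Dx; apply: nD; rewrite inE.
 by rewrite !DE LE.
Qed.

End riesz.

(** * Indicators as limits of test functions *)

Section test_limits.
Context {R : realType} {n : nat}.
Local Notation V := 'rV[R]_n.
Implicit Types (O K : set V).

Lemma cvg_near_eq (u : nat -> R) (l : R) (N : nat) :
 (forall k, (N <= k)%N -> u k = l) -> u @ \oo --> l.
move=> h; apply/cvgrPdist_lt => e e0; exists N => // k /= Nk.
by rewrite h// subrr normr0.
Qed.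

Lemma lim_unique (u v : nat -> R) (a b : R) : u @ \oo --> a -> v @ \oo --> b ->
 (forall k, u k = v k) -> a = b.
move=> ua vb /funext uv; rewrite uv in ua.
exact: (@cvg_unique _ (@Rhausdorff R) _ _ _ _ ua vb).
Qed.

Lemma test_to_compact O K : open O -> compact K -> K `<=` O ->
 exists phi : nat -> V -> R, [/\ forall k, test O (phi k),
  forall k x, 0 <= phi k x <= 1 & forall x, phi ^~ x @ \oo --> (\1_K x : R)].
move=> oO cK KO; pose U k := O `&` \bigcup_(x in K) ball x (k.+1%:R^-1 : R).
have oU k : open (U k) by apply: openI => //; apply: bigcup_open => x _; exact: ball_open.
have KU k : K `<=` U k.
 move=> x Kx; split; first exact: KO.
 by exists x => //; apply: ballxx; rewrite invr_gt0.
have /choice[phi hphi] : forall k, exists phi, [/\ test (U k) phi,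
  forall x, 0 <= phi x <= 1 & forall x, K x -> phi x = 1].
 by move=> k; exact: (test_plateau cK (oU k) (KU k)).
exists phi; split.
- by move=> k; have [t _ _] := hphi k; apply: test_subset t; exact: subIsetl.
- by move=> k; have [] := hphi k.
move=> x; rewrite indicE; have [Kx|nKx] := pselect (K x).
 rewrite mem_set//; apply: (@cvg_near_eq _ _ 0%N) => k _.
 by have [_ _ ->] := hphi k.
rewrite memNset//; have /nbhs_ballP[e /= e0 he] : nbhs x (~` K).
 by apply: open_nbhs_nbhs; split => //; apply: closed_openC; exact: compact_closed_rV.
have [N _ hN] := near_infty_natSinv_lt (PosNum e0).
apply: (@cvg_near_eq _ _ N) => k Nk; have [t _ _] := hphi k; apply: (test_out t).
move=> [_ [y Ky yx]]; apply: (he y) => //; apply: ball_sym; apply: le_ball yx.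
by apply: ltW; apply: hN.
Qed.

Lemma test_to_open O : open O ->
 exists theta : nat -> V -> R, [/\ forall k, test O (theta k),
  forall k x, 0 <= theta k x <= 1 & forall x, O x -> theta ^~ x @ \oo --> (1 : R)].
move=> oO; pose F k := ~` (\bigcup_(y in ~` O) ball y (k.+1%:R^-1 : R)).
have cF k : closed (F k).
 by apply: open_closedC; apply: bigcup_open => y _; exact: ball_open.
have cK k : compact (F k `&` cube 0 k%:R).
 by rewrite setIC; apply: compact_closedI => //; exact: cube_compact.
have KO k : F k `&` cube 0 k%:R `<=` O.
 move=> x [Fx _]; apply: contrapT => nO; apply: Fx; exists x => //; apply: ballxx.
 by rewrite invr_gt0.
have /choice[phi hphi] : forall k, exists phi, [/\ test O phi,
  forall x, 0 <= phi x <= 1 & forall x, (F k `&` cube 0 k%:R) x -> phi x = 1].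
 by move=> k; exact: (test_plateau (cK k) oO (KO k)).
exists phi; split.
- by move=> k; have [] := hphi k.
- by move=> k; have [] := hphi k.
move=> x Ox; have /nbhs_ballP[e /= e0 he] : nbhs x O by exact: open_nbhs_nbhs.
have [N _ hN] := near_infty_natSinv_lt (PosNum e0).
pose M := (Num.truncn (\sum_i `|x 0 i|)).+1.
apply: (@cvg_near_eq _ _ (maxn N M)) => k; rewrite geq_max => /andP[Nk Mk].
have [_ _ ->//] := hphi k; split.
 move=> [y nOy yx]; apply: nOy; apply: he; apply: ball_sym; apply: le_ball yx.
 by apply: ltW; apply: hN.
move=> i; rewrite mxE sub0r normrN; apply: (@le_trans _ _ (\sum_i `|x 0 i|)).
 by rewrite (bigD1 i)//= lerDl sumr_ge0.
by apply: (le_trans (ltW (truncnS_gt _))); rewrite ler_nat.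
Qed.

Lemma regular_compact_in (mu : {measure set V -> \bar R}) (D E : set V) (e : R) :
 measurable D -> (mu D < +oo)%E -> measurable E -> E `<=` D -> 0 < e ->
 exists K, [/\ compact K, K `<=` E & (mu (E `\` K) <= e%:E)%E].
move=> mD Doo mE ED e0.
have oo : (mrestr mu mD setT < +oo)%E by rewrite /mrestr setTI.
have [K [U [cK oU KE EU UK]]] := regular_compact_open (mu := mrestr mu mD) oo mE e0.
have mK := compact_meas cK; have mU := open_meas oU.
exists K; split => //; apply: le_trans UK; rewrite /= /mrestr.
apply: le_measure; rewrite ?inE.
- exact: measurableD.
- by apply: measurableI => //; exact: measurableD.
- by move=> x [Ex nK]; split; [split => //; exact: EU|exact: ED].
Qed.

End test_limits.

(** * Taylor and Lipschitz estimates *)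

Section taylor.
Context {R : realType} {n : nat}.
Local Notation V := 'rV[R]_n.
Local Notation e_ := (fun j : 'I_n => delta_mx 0 j : V).
Implicit Types (k : V -> R) (v : V -> R).

Lemma coord_le_norm (x : V) i : `|x 0 i| <= `|x|.
rewrite [leRHS]/Num.norm/= mx_normrE.
exact: (le_bigmax _ (fun ij : 'I_1 * 'I_n => `|x ij.1 ij.2|) (0, i)).
Qed.

Lemma delta_norm_le1 (j : 'I_n) : `|e_ j| <= 1.
rewrite [leLHS]/Num.norm/= mx_normrE; apply/bigmax_leP; split => // -[i l] _ /=.
by rewrite mxE; case: (_ && _); rewrite ?normr0 ?normr1.
Qed.

(** The quadratic remainder of [test_taylor] survives integration, so this criterion differentiates
    convolutions without a limit theorem for difference quotients. *)
Lemma isder_quadratic (f : V -> R) (x v : V) (d C : R) : 0 <= C ->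
 (forall h : R, `|f (h *: v + x) - f x - h * d| <= C * h ^+ 2) -> is_derive x v f d.
move=> C0 hf.
have l : h^-1 *: ((f \o shift x) (h *: v) - f x) @[h --> 0^'] --> d.
 apply/cvgrPdist_le => e e0.
 have e1 : 0 < e / (C + 1) by rewrite divr_gt0// ltr_wpDl.
 near=> h; have h0 : h != 0 by near: h; exact: nbhs_dnbhs_neq.
 rewrite distrC /GRing.scale/= -[X in _ - X](mulKf h0) -mulrBr normrM normfV.
 rewrite ler_pdivrMl ?normr_gt0//; apply: (le_trans (hf h)).
 rewrite -(real_normK (num_real h)) expr2 mulrCA ler_wpM2l//.
 apply: (@le_trans _ _ ((C + 1) * `|h|)); first by rewrite ler_wpM2r// lerDl.
 rewrite -ler_pdivlMl ?ltr_wpDl// mulrC ltW//; near: h.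
 by apply: dnbhs0_lt.
by apply: DeriveDef; [apply/cvg_ex; exists d|exact: (cvg_lim (@Rhausdorff R) l)].
Unshelve. all: by end_near. Qed.

Lemma lipschitz_cont (f : V -> R) (C : R) : 0 <= C ->
 (forall x y : V, `|f y - f x| <= C * `|y - x|) -> continuous f.
move=> C0 hC x; apply: (iffRL (@cvgrPdist_lt _ _ _ (nbhs x) _ f (f x))) => e e0.
have C1 : 0 < C + 1 by rewrite ltr_wpDl.
have e1 : 0 < e / (C + 1) by rewrite divr_gt0.
apply/nbhs_ballP; exists (e / (C + 1)) => //= y; rewrite -ball_normE /= => xy.
rewrite distrC; apply: (le_lt_trans (hC _ _)).
apply: (@le_lt_trans _ _ ((C + 1) * `|y - x|)); first by rewrite ler_wpM2r// lerDl.
by rewrite -ltr_pdivlMl// mulrC distrC.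
Qed.

Lemma smooth_line_mvt k j (x : V) (h : R) : smooth k ->
 exists s : R, [/\ 0 <= s, s <= 1 & k (h *: e_ j + x) - k x = h * partial j k ((s * h) *: e_ j + x)].
move=> sk; pose f t := k ((t * h) *: e_ j + x).
have df (t : R) : is_derive t 1 f (h * partial j k ((t * h) *: e_ j + x)).
 have /isder_line dk := smooth_isder j ((t * h) *: e_ j + x) sk.
 have di : is_derive t (1 : R) (fun s : R => h *: (s - t)) h.
  by apply: is_derive_eq; rewrite subr0 /GRing.scale/= mulr1.
 rewrite (_ : f = (fun s : R => k (s *: e_ j + ((t * h) *: e_ j + x))) \o (fun s => h *: (s - t))).
  rewrite [X in is_derive _ _ _ X]mulrC; apply: is_derive1_comp.
  by rewrite subrr scaler0.
 apply/funext => s; rewrite /f /= addrA -scalerDl; congr (k (_ *: _ + _)).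
 by rewrite /GRing.scale/=; ring.
have [|s] := @MVT_segment R f (fun t => h * partial j k ((t * h) *: e_ j + x)) 0 1 ler01.
 apply: continuous_subspaceT => t; apply: differentiable_continuous.
 by apply/derivable1_diffP; have [] := df t.
rewrite in_itv/= => /andP[s0 s1]; rewrite /f mul1r mul0r scale0r add0r subr0 mulr1 => e.
by exists s.
Qed.

Lemma test_partial_lip U k : test U k ->
 exists2 C, 0 <= C & forall j x (h : R), `|k (h *: e_ j + x) - k x| <= C * `|h|.
move=> tk.
have /choice[C hC] : forall j, exists C, 0 <= C /\ forall x, `|partial j k x| <= C.
 by move=> j; have [C C0 hC] := test_bounded (test_partial j tk); exists C.
exists (\sum_j C j) => [|j x h]; first by apply: sumr_ge0 => j _; have [] := hC j.
have [s [_ _ ->]] := smooth_line_mvt j x h (test_smooth tk).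
rewrite normrM mulrC ler_wpM2r//; have [_ h1] := hC j; apply: (le_trans (h1 _)).
by rewrite (bigD1 j)//= lerDl sumr_ge0// => i _; have [] := hC i.
Qed.

Lemma test_taylor U k : test U k ->
 exists2 C, 0 <= C & forall j x (h : R),
  `|k (h *: e_ j + x) - k x - h * partial j k x| <= C * h ^+ 2.
move=> tk.
have /choice[C hC] : forall j, exists C, 0 <= C /\
  forall x (h : R), `|partial j k (h *: e_ j + x) - partial j k x| <= C * `|h|.
 by move=> j; have [C C0 hC] := test_partial_lip (test_partial j tk); exists C.
exists (\sum_j C j) => [|j x h]; first by apply: sumr_ge0 => j _; have [] := hC j.
have [s [s0 s1 ->]] := smooth_line_mvt j x h (test_smooth tk).
rewrite -mulrBr normrM -(real_normK (num_real h)) expr2 mulrCA ler_wpM2l//.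
have [c0 h1] := hC j; apply: (le_trans (h1 _ _)).
rewrite normrM (ger0_norm s0); apply: ler_pM => //; first exact: mulr_ge0.
 by rewrite (bigD1 j)//= lerDl sumr_ge0// => i _; have [] := hC i.
by rewrite ler_piMl.
Qed.

(** Only increments along coordinate directions are controlled so far; y is reached from x by
    changing one coordinate at a time, which costs the factor n. *)
Lemma test_lip U k : test U k ->
 exists2 C, 0 <= C & forall x y : V, `|k y - k x| <= C * `|y - x|.
move=> tk; have [C C0 hC] := test_partial_lip tk.
exists (n%:R * C) => [|x y]; first by rewrite mulr_ge0.
pose p (l : nat) : V := \row_i (if (i < l)%N then y 0 i else x 0 i).
have step (l : nat) : (l <= n)%N -> `|k (p l) - k x| <= l%:R * C * `|y - x|.
 elim: l => [_|l IH ln].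
  rewrite (_ : p 0%N = x); first by rewrite subrr normr0 !mul0r.
  by apply/rowP => i; rewrite mxE ltn0.
 have -> : p l.+1 = (y 0 (Ordinal ln) - x 0 (Ordinal ln)) *: e_ (Ordinal ln) + p l.
  apply/rowP => i; rewrite !mxE eqxx/= ltnS leq_eqVlt.
  have [il|il] := eqVneq (i : nat) l.
   have -> : i = Ordinal ln by exact: val_inj.
   by rewrite /= eqxx ltnn mulr1 subrK.
  rewrite (_ : i == Ordinal ln = false) ?mulr0 ?add0r//.
  by apply/negbTE; apply: contra il => /eqP ->.
 rewrite -natr1 !mulrDl mul1r [leRHS]addrC.
 apply: (le_trans (ler_distD (k (p l)) _ _)); apply: lerD; last exact: (IH (ltnW ln)).
 apply: (le_trans (hC _ _ _)); rewrite ler_wpM2l//.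
 by have := coord_le_norm (y - x) (Ordinal ln); rewrite !mxE.
have := step n (leqnn _); rewrite (_ : p n = y)//.
by apply/rowP => i; rewrite mxE ltn_ord.
Qed.

End taylor.

(** * Mollification with a shift *)

Section convolution.
Context {R : realType} {n : nat}.
Local Notation V := 'rV[R]_n.
Local Notation leb := (lebesgue_rV n).
Local Notation e_ := (fun j : 'I_n => delta_mx 0 j : V).
Implicit Types (k v : V -> R).

Lemma test_leb_intR U k D : measurable D -> test U k -> intR leb D k.
move=> mD [sk [K [cK KU kK]]].
have mK := compact_meas cK.
have Koo : (leb K < +oo)%E by apply: leb_bounded => //; exact: compact_bounded_rV.
have [M M0 hM] : exists2 M : R, 0 <= M & forall x, `|k x| <= M.
 by apply: (@test_bounded _ _ U); split => //; exists K.
have mk (E : set V) : mfun E k := cont_meas (smooth_cont sk).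
apply: (intR_sub measurableT) => //.
have -> : k = k \_ K.
 by apply/funext => x; rewrite patchE; case: ifPn => // /negP xK; apply: kK; rewrite inE in xK.
apply/(intR_mkcond _ _ mK); exact: intR_bounded Koo _ _.
Qed.

Lemma leb_int_shift k (a : V) : intR leb setT k ->
 intR leb setT (fun x => k (a + x)) /\ \int[leb]_x k (a + x) = \int[leb]_x k x.
move=> ik; have mk := intR_meas ik.
have pos (g : V -> R) : mfun setT g -> (forall x, 0 <= g x) ->
  (\int[leb]_x (g (a + x))%:E = \int[leb]_x (g x)%:E)%E.
 move=> mg g0; rewrite -(@leb_affine R n a 1 (EFin \o g)) => [|||x]; first last.
 - by rewrite lee_fin.
 - exact/mEFinP.
 - by left.
 by apply: eq_integral => x _; rewrite scale1r.
have mka : mfun setT (fun x => k (a + x)).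
 apply: mcomp => //.
 have := meas_affine a (1 : R); congr mfun.
 by apply/funext => x; rewrite scale1r.
have ika : intR leb setT (fun x => k (a + x)).
 apply/integrableP; split; first exact/mEFinP.
 have /integrableP[_] := ik; apply: le_lt_trans.
 rewrite -(pos (fun x => `|k x|))//; first exact: mcomp.
have pz (u : R) : 0 <= Num.max u 0 by rewrite le_max lexx orbT.
split => //.
have E (g : V -> R) : intR leb setT g -> \int[leb]_x g x =
  \int[leb]_x Num.max (g x) 0 - \int[leb]_x Num.max (- g x) 0.
 move=> ig; have mg := intR_meas ig.
 have im (s : R -> R) : mfun setT s -> (forall u, `|Num.max (s u) 0| <= `|u|) ->
   intR leb setT (fun x => Num.max (s (g x)) 0).
  move=> ms hs; apply: (@intR_le _ _ _ _ _ measurableT _ (fun x => `|g x|)) => //.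
   by apply: measurable_maxr => //; exact: mcomp.
  exact: intR_norm.
 rewrite -RintB//.
 - by apply: Rint_eq => x _; rewrite /Num.max; case: ltP => ?; case: ltP => ?; lra.
 - by apply: (im id) => // u; rewrite ger0_norm// ge_max normr_ge0 ler_norm.
 - apply: (im (fun u => - u)); first exact: oppr_measurable.
  by move=> u; rewrite ger0_norm// ge_max normr_ge0 -normrN ler_norm.
rewrite E// [RHS]E//; congr (_ - _); congr fine; apply: (pos (fun x => Num.max _ 0)) => //.
 by apply: measurable_maxr.
by apply: measurable_maxr => //; exact: mcomp.
Qed.

(** By translation invariance k(x + h e_j) - k(x) has integral 0. The Taylor remainder, divided by
    h, then bounds the integral of the derivative by a constant times h. *)
Lemma test_int_partial U k j D : measurable D -> U `<=` D -> test U k ->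
 \int[leb]_(x in D) partial j k x = 0.
move=> mD UD tk; have tpk := test_partial j tk.
rewrite Rint_mkcond (_ : _ \_ D = partial j k); last first.
 apply/funext => x; rewrite patchE; case: ifPn => // /negP xD; apply/esym.
 by apply: (test_out tpk) => /UD; rewrite -inE.
have [K [cK KU kK]] : exists K, [/\ compact K, K `<=` U & forall x, ~ K x -> k x = 0] by case: tk.
have [r r0 Kr] : exists2 r, 0 < r & K `<=` ball 0 r by apply: bounded_sub_ball; exact: compact_bounded_rV.
have [C C0 hC] := test_taylor tk.
have ik := test_leb_intR measurableT tk.
have ipk := test_leb_intR measurableT tpk.
pose B : set V := ball 0 (r + 2).
have mB : measurable B by apply: open_meas; exact: ball_open.
have Boo : (leb B < +oo)%E by rewrite /B leb_ball ?ltry//; lra.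
have key (h : R) : 0 < h -> h <= 1 ->
  `|\int[leb]_x partial j k x| <= h * (C * fine (leb B)).
 move=> h0 h1; have [ikh ikE] := leb_int_shift (h *: e_ j) ik.
 have -> : \int[leb]_x partial j k x =
   - (h^-1 * \int[leb]_x (k (h *: e_ j + x) - k x - h * partial j k x)).
  rewrite !RintB//; [|exact: intRB|exact: intRZ].
  by rewrite ikE RintZ// subrr sub0r mulrN opprK mulKf// gt_eqF.
 have iq : intR leb setT (fun x => k (h *: e_ j + x) - k x - h * partial j k x).
  by apply: intRB => //; [exact: intRB|exact: intRZ].
 rewrite normrN normrM gtr0_norm ?invr_gt0// ler_pdivrMl//.
 have iB : intR leb setT \1_B.
  have := (intR_mkcond leb (fun=> 1) mB).1 (intR_cst mB 1 Boo).
  by congr (intR _ _ _); apply/funext => x; rewrite patchE indicE; case: (_ \in _).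
 have -> : h * (h * (C * fine (leb B))) = \int[leb]_x (C * h ^+ 2 * \1_B x).
  rewrite RintZ// Rint_indic// setIT expr2; ring.
 apply: Rint_norm_le => //; first exact: intRZ.
 move=> x _; rewrite indicE; have [Bx|nBx] := pselect (B x).
  by rewrite mem_set// mulr1; exact: hC.
 have nK : ~ K x by move=> /Kr xr; apply: nBx; apply: le_ball xr; rewrite lerDl.
 have nKh : ~ K (h *: e_ j + x).
  move=> /Kr xr; apply: nBx; apply: ball_triangle xr _.
  rewrite -ball_normE /= addrK normrZ ger0_norm ?ltW//.
  by apply: (le_lt_trans (ler_wpM2l (ltW h0) (delta_norm_le1 j))); rewrite mulr1 (le_lt_trans h1)// ltr1n.
 by rewrite memNset// mulr0 kK// kK// (@partial_out _ _ K)// mulr0 !subr0 normr0.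
apply/eqP; rewrite -normr_le0 leNgt; apply/negP => I0.
set I := `|_| in key I0; set M := C * _ in key.
have M0 : 0 <= M by rewrite mulr_ge0// fine_ge0.
have d0 : 0 < I + M + 1 by lra.
(* For this step size the bound I <= h M reads I (I + M + 1) <= I M, impossible for I > 0. *)
have := key (I / (I + M + 1)) (divr_gt0 I0 d0).
rewrite ler_pdivrMr// mul1r => /(_ ltac:(lra)); rewrite mulrAC ler_pdivlMr//.
by nra.
Qed.

End convolution.

Section convolution.
Context {R : realType} {n : nat}.
Local Notation V := 'rV[R]_n.
Local Notation leb := (lebesgue_rV n).
Local Notation e_ := (fun j : 'I_n => delta_mx 0 j : V).
Implicit Types (k v : V -> R) (x a : V).
Variable O : set V.
Hypothesis mO : measurable O.

(** The kernel is centred at x + a: near the boundary a points inwards, so that the kernel only sees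
    points of [O]. *)
Definition conv k a v x : R := \int[leb]_(y in O) (k (x + a - y) * v y).

Lemma conv_intR U k a v x : test U k -> intR leb O v ->
 intR leb O (fun y => k (x + a - y) * v y).
move=> tk iv; have [M M0 hM] := test_bounded tk; apply: (@intRM _ _ _ _ _ mO _ _ M) => //.
rewrite (_ : (fun _ => _) = (fun y => k (-1 *: y + (x + a)))).
 apply: cont_meas; apply: smooth_cont; apply: smooth_affine.
 exact: test_smooth tk.
by apply/funext => y; rewrite scaleN1r addrC.
Qed.

Lemma conv_lip U k a v : test U k -> intR leb O v ->
 exists2 C, 0 <= C & forall x x', `|conv k a v x' - conv k a v x| <= C * `|x' - x|.
move=> tk iv; have [C C0 hC] := test_lip tk.
exists (C * \int[leb]_(y in O) `|v y|) => [|x x'].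
 by rewrite mulr_ge0// Rint_ge0.
have i1 := conv_intR a x tk iv; have i2 := conv_intR a x' tk iv.
rewrite /conv -RintB// mulrAC -RintZ//; last exact: intR_norm.
apply: Rint_norm_le => //; [exact: intRB|by apply: intRZ => //; exact: intR_norm|].
move=> y _; rewrite -mulrBl normrM ler_wpM2r//; apply: (le_trans (hC _ _)).
by rewrite (_ : x' + a - y - (x + a - y) = x' - x)//; apply/rowP => i; rewrite !mxE; ring.
Qed.

Lemma conv_cont U k a v : test U k -> intR leb O v -> continuous (conv k a v).
by move=> tk iv; have [C C0 hC] := conv_lip a tk iv; exact: lipschitz_cont hC.
Qed.

Lemma conv_isder U k a v j x : test U k -> intR leb O v ->
 is_derive x (e_ j) (conv k a v) (conv (partial j k) a v x).
move=> tk iv; have [C C0 hC] := test_taylor tk.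
apply: (@isder_quadratic _ _ _ _ _ _ (C * \int[leb]_(y in O) `|v y|)).
 by rewrite mulr_ge0// Rint_ge0.
move=> h; have i1 := conv_intR a x tk iv; have i2 := conv_intR a (h *: e_ j + x) tk iv.
have i3 := conv_intR a x (test_partial j tk) iv; have i12 := intRB mO i2 i1.
rewrite /conv -RintB// -RintZ// -RintB//; last exact: intRZ.
rewrite mulrAC -RintZ//; last exact: intR_norm.
apply: Rint_norm_le => //.
- by apply: intRB => //; exact: intRZ.
- by apply: intRZ => //; exact: intR_norm.
move=> y _; rewrite mulrA -!mulrBl normrM ler_wpM2r//.
have -> : h *: e_ j + x + a - (y : V) = h *: e_ j + (x + a - (y : V)) by rewrite !addrA.
exact: hC.
Qed.

Lemma conv_partial U k a v j : test U k -> intR leb O v ->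
 partial j (conv k a v) = conv (partial j k) a v.
by move=> tk iv; apply/funext => x; exact: partial_isder (conv_isder _ _ _ tk iv). Qed.

Lemma conv_smooth U k a v : test U k -> intR leb O v -> smooth (conv k a v).
move=> tk iv; apply: (@gen_alg_smooth _ _ [set f | exists2 k, test U k & f = conv k a v]).
 move=> _ [k' tk' ->]; split; first exact: conv_cont tk' iv.
 move=> j; split; first by move=> x; have [] := conv_isder a j x tk' iv.
 apply: gen_alg_gen; exists (partial j k'); first exact: test_partial.
 exact: conv_partial tk' iv.
by apply: gen_alg_gen; exists k.
Qed.

Lemma meas_sub_rV a : mfun setT (fun xy : V * V => xy.1 + a - xy.2).
apply: measurable_fun_mx => i j.
rewrite (_ : (fun _ => _) = (fun xy : V * V => xy.1 i j + a i j - xy.2 i j)); last first.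
 by apply/funext => xy; rewrite !mxE.
have m1 : mfun setT (fun xy : V * V => xy.1 i j) :=
 mcomp (measurable_coord i j) measurable_fst.
have m2 : mfun setT (fun xy : V * V => xy.2 i j) :=
 mcomp (measurable_coord i j) measurable_snd.
by apply: mfunB => //; exact: measurable_funD.
Qed.

Lemma conv_meas_prod U k a v : test U k -> mfun setT v ->
 mfun setT (fun xy : V * V => k (xy.1 + a - xy.2) * v xy.2).
move=> tk mv; apply: mfunM; last exact: mcomp.
by apply: mcomp; [exact: test_meas tk|exact: meas_sub_rV].
Qed.

Definition mollifier (d : R) k :=
 [/\ test (ball (0 : V) d) k, forall x, 0 <= k x & \int[leb]_x k x = 1].

Lemma mollifier_ex (d : R) : 0 < d -> exists k, mollifier d k.
move=> d0; pose c : V -> R := cutoff 0 (d / 4).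
have d4 : 0 < d / 4 by rewrite divr_gt0.
have tc : test (ball (0 : V) d) c.
 by apply: test_cutoff => //; apply: cube_sub_ball => //; lra.
have ic := test_leb_intR measurableT tc.
have c0 : 0 < \int[leb]_x c x.
 have mB : measurable (ball (0 : V) (d / 4)) by apply: open_meas; exact: ball_open.
 apply: (@lt_le_trans _ _ (\int[leb]_x \1_(ball (0 : V) (d / 4)) x)).
  rewrite Rint_indic// setIT (_ : fine _ = fine ((2 * (d / 4)) ^+ n)%:E).
   by rewrite /= exprn_gt0// mulr_gt0.
  by congr fine; exact: leb_ball.
 apply: Rint_le => //.
  have Boo : (leb (ball (0%R : V) (d / 4)) < +oo)%E by rewrite leb_ball ?ltry.
  have := (intR_mkcond leb (fun=> 1) mB).1 (intR_cst mB 1 Boo).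
  by congr (intR _ _ _); apply/funext => x; rewrite patchE indicE; case: (_ \in _).
 move=> x _; rewrite indicE; case: (boolP (_ \in _)) => [/set_mem xB|_].
  by rewrite /c cutoff1.
 exact: cutoff_ge0.
exists (fun x => (\int[leb]_x c x)^-1 * c x); split.
- exact: testZ.
- by move=> x; rewrite mulr_ge0 ?invr_ge0 ?cutoff_ge0// ltW.
- by rewrite RintZ// mulVf// gt_eqF.
Qed.

Lemma mollifier_shift d k a x : mollifier d k -> intR leb setT (fun y => k (x + a - y)) /\
 \int[leb]_y k (x + a - y) = 1.
move=> [tk k0 k1]; have ik := test_leb_intR measurableT tk.
have mk : mfun setT (EFin \o k) by apply/mEFinP; exact: test_meas tk.
have E := @leb_affine R n (x + a) (-1) (EFin \o k) (or_intror erefl) mk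
 (fun y => ltac:(by rewrite /= lee_fin k0)).
have eqf : (fun y => k (x + a - y)) = (fun y => k (x + a + -1 *: y)).
 by apply/funext => y; rewrite scaleN1r.
split; last by rewrite eqf -[RHS]k1; congr fine; exact: E.
rewrite eqf; apply/integrableP; split.
 by apply/mEFinP; apply: mcomp; [exact: test_meas tk|exact: meas_affine].
have /integrableP[_] := ik; apply: le_lt_trans.
rewrite (eq_integral (fun y : V => (EFin \o k) (x + a + -1 *: y)%R)); last first.
 by move=> y _; rewrite /= ger0_norm.
by rewrite E le_eqVlt; apply/orP; left; apply/eqP; apply: eq_integral => y _; rewrite /= ger0_norm.
Qed.

Lemma mollifier_shiftx d k a y : mollifier d k ->
 (\int[leb]_x (k (x + a - y))%:E = 1)%E.
move=> [tk k0 k1].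
have mk : mfun setT (EFin \o k) by apply/mEFinP; exact: test_meas tk.
have := @leb_affine R n (a - y) 1 (EFin \o k) (or_introl erefl) mk
 (fun y => ltac:(by rewrite /= lee_fin k0)).
rewrite [RHS]EFin_Rint ?k1//; last exact: test_leb_intR tk.
by move=> E; rewrite -[RHS]E; apply: eq_integral => x _ /=; rewrite scale1r (addrC (a - y)) addrA.
Qed.

(** Tonelli: for fixed y the kernel has mass 1 in x. *)
Lemma conv_L1 d k a v D : measurable D -> mollifier d k -> intR leb O v ->
 intR leb D (conv k a v) /\
 \int[leb]_(x in D) `|conv k a v x| <= \int[leb]_(y in O) `|v y|.
move=> mD mk iv; have [tk k0 k1] := mk.
pose w y := `|(v \_ O) y|.
have iw : intR leb setT w.
 by apply: intR_norm => //; exact: (intR_mkcond leb v mO).1.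
have wE : \int[leb]_(y in O) `|v y| = \int[leb]_y w y.
 rewrite Rint_mkcond; apply: Rint_eq => y _; rewrite /w !patchE.
 by case: ifPn; rewrite ?normr0.
have mF : mfun setT (fun xy : V * V => (k (xy.1 + a - xy.2) * w xy.2)%:E).
 by apply/mEFinP; apply: conv_meas_prod tk _; exact: intR_meas iw.
have F0 (xy : V * V) : (0 <= (k (xy.1 + a - xy.2) * w xy.2)%:E)%E.
 by rewrite lee_fin /w mulr_ge0.
have := fubini_tonelli (m1 := leb) (m2 := leb) _ mF F0.
have -> : (\int[leb]_y \int[leb]_x (k (x + a - y) * w y)%:E = (\int[leb]_y w y)%:E)%E.
 rewrite -EFin_Rint//; apply: eq_integral => y _.
 under eq_integral do rewrite mulrC EFinM.
 rewrite ge0_integralZl//; first by rewrite (mollifier_shiftx _ _ mk) mule1.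
 - apply/mEFinP; apply: mcomp; first exact: test_meas tk.
  have := meas_affine (a - y) (1 : R); congr mfun.
  by apply/funext => x; rewrite scale1r addrC addrA.
 - by move=> x _; rewrite lee_fin.
 - by rewrite lee_fin /w.
move=> E.
have ik x := conv_intR a x tk iv.
have mc : mfun D (conv k a v).
 by apply: cont_meas; exact: conv_cont tk iv.
have le x : (`|(conv k a v x)%:E| <= \int[leb]_y (k (x + a - y) * w y)%:E)%E.
 rewrite /conv -EFin_Rint//; apply: (le_trans (le_abse_integral _ _ _)) => //.
  by have /integrableP[] := ik x.
 rewrite integral_mkcond le_eqVlt; apply/orP; left; apply/eqP.
 apply: eq_integral => y _; rewrite !patchE /w patchE; case: ifPn => _.
  by rewrite /= normrM (ger0_norm (k0 _)).
 by rewrite normr0 mulr0.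
have mG : mfun setT (fun x => \int[leb]_y (k (x + a - y) * w y)%:E)%E.
 exact: measurable_fun_fubini_tonelli_F _ mF F0.
have main : (\int[leb]_(x in D) `|(conv k a v x)%:E| <= (\int[leb]_y w y)%:E)%E.
 rewrite -E; apply: (@le_trans _ _ (\int[leb]_(x in D) \int[leb]_y (k (x + a - y) * w y)%:E)%E).
  apply: ge0_le_integral => //.
  - by apply/mEFinP; apply: mcomp.
  - exact: mfunTS.
 apply: ge0_subset_integral => // x _; apply: integral_ge0 => y _; exact: (F0 (x, y)).
have ic : intR leb D (conv k a v).
 apply/integrableP; split; first exact/mEFinP.
 by apply: le_lt_trans main _; rewrite ltry.
split => //; rewrite wE -lee_fin -EFin_Rint//; last exact: intR_norm.

Qed.

(** Jensen's inequality: expand the nonnegative integral of k (v - c)^2, where c is the convolution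
    at x, and use that the kernel has mass at most 1 on [O]. *)
Lemma conv_sq d k a v x : mollifier d k -> intR leb O v -> intR leb O (fun y => v y ^+ 2) ->
 conv k a v x ^+ 2 <= conv k a (fun y => v y ^+ 2) x.
move=> mk iv iv2; have [tk k0 k1] := mk; have [ik ik1] := mollifier_shift a x mk.
set c := conv k a v x.
have i1 := conv_intR a x tk iv; have i2 := conv_intR a x tk iv2.
have i0 : intR leb O (fun y => k (x + a - y)) by apply: intR_sub ik.
have le1 : \int[leb]_(y in O) k (x + a - y) <= 1.
 by rewrite -ik1; apply: Rint_le_sub => //.
have : 0 <= \int[leb]_(y in O) (k (x + a - y) * (v y - c) ^+ 2).
 by apply: Rint_ge0 => y _; rewrite mulr_ge0// sqr_ge0.
have -> : \int[leb]_(y in O) (k (x + a - y) * (v y - c) ^+ 2) =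
  \int[leb]_(y in O) (k (x + a - y) * v y ^+ 2 - 2 * c * (k (x + a - y) * v y)
   + c ^+ 2 * k (x + a - y)).
 by apply: Rint_eq => y _; ring.
have i3 := intRZ mO (2 * c) i1; have i4 := intRZ mO (c ^+ 2) i0.
rewrite RintD//; last exact: intRB.
rewrite RintB// !RintZ//.
rewrite -/(conv k a v x) -/c -/(conv k a (fun y => v y ^+ 2) x).
set q := conv _ _ _ _; have := sqr_ge0 c; nra.
Qed.

End convolution.

(** * Convergence of mollifications and the lemma of du Bois-Reymond *)

Section convolution_limits.
Context {R : realType} {n : nat}.
Local Notation V := 'rV[R]_n.
Local Notation leb := (lebesgue_rV n).
Implicit Types (k v g : V -> R) (x a : V).
Variable O : set V.
Hypothesis oO : open O.

Lemma test_dense_L1 (mu : {measure set V -> \bar R}) v (e : R) :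
 (mu O < +oo)%E -> intR mu O v -> 0 < e ->
 exists2 p, test O p & \int[mu]_(x in O) `|v x - p x| <= e.
move=> Ooo iv; have mO := open_meas oO; move: e.
have It p : test O p -> intR mu O p.
 move=> tp; have [M M0 hM] := test_bounded tp.
 by apply: (@intR_bounded _ _ _ _ _ mO _ M) => //; exact: test_meas tp.
apply: (@L1_dense _ _ R mu O mO (test O)) => //.
- exact: testD.
- exact: testZ.
- exact: test0.
move=> E mE e e0; have mEO : measurable (E `&` O) by exact: measurableI.
have oo : (mrestr mu mO setT < +oo)%E by rewrite /mrestr setTI.
have [K [U [cK oU KE EU UK]]] := regular_compact_open (mu := mrestr mu mO) oo mEO e0.
have [|phi [tphi phi01 phi1]] := test_plateau cK (openI oU oO).
 by move=> x /KE[Ex Ox]; split => //; exact: EU.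
have tO := test_subset (@subIsetr _ _ _) tphi; exists phi => //.
have mK := compact_meas cK; have mU := open_meas oU.
have mUK : measurable (U `\` K) by exact: measurableD.
have -> : e = fine e%:E by [].
apply: (@le_trans _ _ (fine (mu ((U `\` K) `&` O)))); last first.
 have fin : mu ((U `\` K) `&` O) \is a fin_num.
  rewrite ge0_fin_numE//; apply: le_lt_trans Ooo.
  by apply: le_measure; rewrite ?inE//; exact: (measurableI _ _ mUK mO).
 exact: fine_le.
rewrite -Rint_indic//; apply: Rint_le => //.
- by apply: intR_norm => //; apply: intRB => //; [exact: intR_indic|exact: It].
- exact: intR_indic.
move=> x Ox; have [Kx|nKx] := pselect (K x).
 by have [Ex _] := KE _ Kx; rewrite phi1// indicE mem_set// subrr normr0 indicE.
have [Ux|nUx] := pselect (U x); last first.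
 have nE : ~ E x by move=> Ex; apply: nUx; exact: EU (conj Ex Ox).
 have nUO : ~ (U `&` O) x by case.
 by rewrite (test_out tphi nUO) indicE memNset// subrr normr0 indicE.
rewrite [leRHS]indicE mem_set//= ler_norml.
have /andP[? ?] := phi01 x; rewrite indicE; case: (_ \in _) => /=; apply/andP; split; lra.
Qed.

Hypothesis Ooo : (leb O < +oo)%E.
Let mO : measurable O := open_meas oO.

Lemma convB U k a v v' x : test U k -> intR leb O v -> intR leb O v' ->
 conv O k a (fun y => v y - v' y) x = conv O k a v x - conv O k a v' x.
move=> tk iv iv'; rewrite /conv -RintB//; [|exact: conv_intR tk iv|exact: conv_intR tk iv'].
by apply: Rint_eq => y _; rewrite mulrBr.
Qed.

Lemma conv_test_close d k a p (C : R) x : mollifier d k -> test O p ->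
 (forall x y : V, `|p y - p x| <= C * `|y - x|) -> 0 <= C ->
 `|conv O k a p x - p x| <= C * (d + `|a|).
move=> mk tp hC C0; have [tk k0 k1] := mk; have [ik ik1] := mollifier_shift a x mk.
have ip := test_leb_intR measurableT tp; have [M M0 hM] := test_bounded tp.
have ikp := conv_intR measurableT a x tk ip.
have ikc c : intR leb setT (fun y => k (x + a - y) * c).
 by rewrite (_ : (fun _ => _) = (fun y => c * k (x + a - y))); [exact: intRZ|apply/funext => y; rewrite mulrC].
have -> : conv O k a p x = \int[leb]_y (k (x + a - y) * p y).
 rewrite /conv Rint_mkcond; apply: Rint_eq => y _; rewrite patchE.
 case: ifPn => // /negP yO; apply/esym; rewrite (_ : p y = 0) ?mulr0//.
 by apply: (test_out tp) => Oy; apply: yO; rewrite inE.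
have ->: p x = \int[leb]_y (k (x + a - y) * p x).
 by under [RHS]eq_Rintegral do rewrite mulrC; rewrite RintZ// ik1 mulr1.
rewrite -RintB//.
have -> : C * (d + `|a|) = \int[leb]_y (k (x + a - y) * (C * (d + `|a|))).
 by under [RHS]eq_Rintegral do rewrite mulrC; rewrite RintZ// ik1 mulr1.
apply: Rint_norm_le => //; first exact: intRB.
move=> y _; rewrite -mulrBr normrM (ger0_norm (k0 _)).
have [b|nb] := pselect (ball (0 : V) d (x + a - y)); last by rewrite (test_out tk nb) !mul0r.
rewrite ler_wpM2l//; apply: (le_trans (hC _ _)); rewrite ler_wpM2l//.
move: b; rewrite -ball_normE /= sub0r normrN => /ltW b.
rewrite (_ : y - x = a - (x + a - y)); last by apply/rowP => i; rewrite !mxE; ring.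
by apply: (le_trans (ler_normB _ _)); rewrite addrC lerD.
Qed.

(** Convolution contracts L^1 and test functions are dense, so a Lipschitz function is enough. The
    bound depends on kernel and shift only through d0, because different pieces of the boundary will
    use different shifts. *)
Lemma conv_L1_cvg v (e : R) : intR leb O v -> 0 < e -> exists2 d0 : R, 0 < d0 &
 forall d k a, mollifier d k -> d <= d0 -> `|a| <= d0 ->
 \int[leb]_(x in O) `|conv O k a v x - v x| <= e.
move=> iv e0; have e3 : 0 < e / 3 by rewrite divr_gt0.
have [p tp hp] := test_dense_L1 Ooo iv e3; have [C C0 hC] := test_lip tp.
have ip := test_leb_intR mO tp.
set m := fine (leb O); have m0 : 0 <= m by exact: fine_ge0.
pose q := 2 * C * m + 1; have q0 : 0 < q by rewrite ltr_wpDl// !mulr_ge0.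
exists (e / 3 / q) => [|d k a mk dd ad]; first by rewrite divr_gt0.
have [tk _ _] := mk.
have [icv _] := conv_L1 mO a mO mk iv; have [icp _] := conv_L1 mO a mO mk ip.
apply: (le_trans (L1_tri mO icv icp iv)).
rewrite (_ : e = e / 3 + (e / 3 + e / 3)); last by field.
apply: lerD.
 have [_] := conv_L1 mO a mO mk (intRB mO iv ip); move=> h.
 apply: le_trans hp; apply: le_trans h; rewrite le_eqVlt; apply/orP; left; apply/eqP.
 by apply: Rint_eq => x _; rewrite (convB _ _ tk).
apply: (le_trans (L1_tri mO icp ip iv)); apply: lerD; last first.
 by under eq_Rintegral do rewrite distrC.
apply: (@le_trans _ _ (\int[leb]_(x in O) (C * (d + `|a|)))).
 apply: Rint_le => //; [by apply: intR_norm => //; exact: intRB|exact: intR_cst|].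
 by move=> x _; exact: conv_test_close mk tp hC C0.
rewrite Rint_cst//; apply: (@le_trans _ _ (C * (2 * (e / 3 / q)) * m)).
 by rewrite ler_wpM2r// ler_wpM2l// mulr_natl mulr2n lerD.
rewrite (_ : _ * m = e / 3 * ((2 * C * m) / q)); last by ring.
rewrite ler_piMr//; first exact: ltW.
by rewrite ler_pdivrMr ?mul1r ?lerDl.
Qed.

Lemma intR_prod (D : set V) v g : measurable D -> mfun D v -> mfun D g ->
 intR leb D (fun x => v x ^+ 2) -> intR leb D (fun x => g x ^+ 2) -> intR leb D (fun x => v x * g x).
move=> mD mv mg v2 g2; apply: (@intR_le _ _ _ _ _ mD _ (fun x => v x ^+ 2 + g x ^+ 2)).
- exact: mfunM.
- exact: intRD.
move=> x _; rewrite normrM -[v x ^+ 2](real_normK (num_real _)) -[g x ^+ 2](real_normK (num_real _)).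
have := sqr_ge0 (`|v x| - `|g x|); have : 0 <= `|v x| * `|g x| by rewrite mulr_ge0.
nra.
Qed.

Lemma conv_L2 d k a v : mollifier d k -> intR leb O v -> intR leb O (fun x => v x ^+ 2) ->
 intR leb O (fun x => conv O k a v x ^+ 2) /\
 \int[leb]_(x in O) conv O k a v x ^+ 2 <= \int[leb]_(x in O) v x ^+ 2.
move=> mk iv iv2; have [ic _] := conv_L1 mO a mO mk iv.
have [ic2 hc2] := conv_L1 mO a mO mk iv2.
have i2 : intR leb O (fun x => conv O k a v x ^+ 2).
 apply: intR_le ic2 _ => //; first by apply: measurable_funX; exact: intR_meas ic.
 by move=> x _; rewrite ger0_norm ?sqr_ge0//; exact: conv_sq mk iv iv2.
split => //; rewrite (_ : \int[leb]_(x in O) v x ^+ 2 = \int[leb]_(x in O) `|v x ^+ 2|); last first.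
 by apply: Rint_eq => x _; rewrite ger0_norm ?sqr_ge0.
apply: le_trans hc2; apply: Rint_le => //; first exact: intR_norm.
move=> x _; apply: le_trans (ler_norm _); exact: conv_sq mk iv iv2.
Qed.

(** g is truncated at height M: the bounded part is paired with the L^1 convergence, the remainder,
    small in L^2, with the uniform L^2 bound of the convolutions. *)
Lemma conv_L2_weak v g (e : R) : intR leb O v -> intR leb O (fun x => v x ^+ 2) ->
 mfun O g -> intR leb O (fun x => g x ^+ 2) -> 0 < e ->
 exists2 d0 : R, 0 < d0 & forall d k a, mollifier d k -> d <= d0 -> `|a| <= d0 ->
 `|\int[leb]_(x in O) (g x * (conv O k a v x - v x))| <= e.
move=> iv iv2 mg ig2 e0; set W := \int[leb]_(x in O) v x ^+ 2.
have W0 : 0 <= W by apply: Rint_ge0 => x _; exact: sqr_ge0.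
(* Weight in Young's inequality below. It leaves e/4 for the truncation error of g and at most e/4
   for the L^2 term, which is 2 W / s. *)
pose s := (8 * W + 2) / e; have s0 : 0 < s by rewrite divr_gt0// ltr_wpDl// mulr_ge0.
pose T (M : nat) x := Num.max (- M%:R) (Num.min (g x) M%:R).
have mT M : mfun O (T M).
 by apply: measurable_maxr => //; exact: measurable_minr.
have M_ge0 (M : nat) : 0 <= M%:R :> R by [].
have Tle M x : `|T M x| <= M%:R.
 rewrite ler_norml /T le_max lexx/= ge_max ge_min lexx orbT andbT.
 by have := M_ge0 M; lra.
have TE M x : `|g x| <= M%:R -> T M x = g x.
 by rewrite ler_norml => /andP[? ?]; rewrite /T min_l// max_r.
have Tg M x : (g x - T M x) ^+ 2 <= g x ^+ 2.
 have := M_ge0 M; rewrite /T /Num.max /Num.min; case: (ltP (g x)) => ?; case: ltP => ?; nra.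
have [||||_ l] := @Rint_dom _ _ _ leb O mO (fun M x => (g x - T M x) ^+ 2) (fun=> 0) (fun x => g x ^+ 2).
- by move=> M; apply: measurable_funX; apply: mfunB.
- by [].
- move=> x _; apply: (@cvg_near_eq _ _ _ (Num.truncn `|g x|).+1) => M hM.
 rewrite TE ?subrr ?expr0n//; apply: (le_trans (ltW (truncnS_gt _))).
 by rewrite ler_nat.
- by move=> M x _; rewrite ger0_norm ?sqr_ge0.
rewrite Rint0 in l; have es : 0 < e / 2 / s by rewrite (divr_gt0 _ s0)// divr_gt0.
have /cvgrPdist_le/(_ _ es) [M _ hM] := l.
have {hM} := hM M (leqnn _); rewrite /= sub0r normrN ger0_norm; last first.
 by apply: Rint_ge0 => x _; exact: sqr_ge0.
move=> hM; pose M1 : R := M.+1%:R; have M0 : 0 < M1 by [].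
have e2M : 0 < e / 2 / M1 by rewrite !divr_gt0.
have [d0 d00 hd0] := conv_L1_cvg iv e2M; exists d0 => // d k a mk dd ad.
have h1 := hd0 d k a mk dd ad; have [ic _] := conv_L1 mO a mO mk iv.
have [ic2 hc2] := conv_L2 a mk iv iv2; rewrite -/W in hc2.
set c := conv O k a v in h1 ic ic2 hc2 *.
have mv := intR_meas iv; have mc := intR_meas ic; have mTM := mT M.
have igT : intR leb O (fun x => (g x - T M x) ^+ 2).
 apply: (@intR_le _ _ _ _ _ mO _ (fun x => g x ^+ 2)) => //.
  by apply: measurable_funX; exact: mfunB.
 by move=> x _; rewrite ger0_norm ?sqr_ge0.
have icv := intRB mO ic iv.
have i1 : intR leb O (fun x => T M x * (c x - v x)).
 by apply: (@intRM _ _ _ _ _ mO _ _ M%:R).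
have iq : intR leb O (fun x => s / 2 * (g x - T M x) ^+ 2 + s^-1 * (c x ^+ 2 + v x ^+ 2)).
 by apply: intRD => //; apply: intRZ => //; exact: intRD.
have qle x : `|(g x - T M x) * (c x - v x)| <= s / 2 * (g x - T M x) ^+ 2 + s^-1 * (c x ^+ 2 + v x ^+ 2).
 rewrite [leRHS](_ : _ = s^-1 * ((s ^+ 2 * (g x - T M x) ^+ 2) / 2 + c x ^+ 2 + v x ^+ 2)); last by field; rewrite gt_eqF.
 rewrite ler_pdivlMl// normrM; have := sqr_ge0 (s * `|g x - T M x| - `|c x - v x|).
 by have := sqr_ge0 (c x + v x); rewrite sqrrB exprMn !real_normK ?num_real//; lra.
have i2 : intR leb O (fun x => (g x - T M x) * (c x - v x)).
 apply: (@intR_le _ _ _ _ _ mO _ _ _ iq) => [|x _]; last exact: qle.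
 by apply: mfunM; exact: mfunB.
have -> : \int[leb]_(x in O) (g x * (c x - v x)) =
  \int[leb]_(x in O) (T M x * (c x - v x)) + \int[leb]_(x in O) ((g x - T M x) * (c x - v x)).
 by rewrite -RintD//; apply: Rint_eq => x _; ring.
apply: (le_trans (ler_normD _ _)); rewrite (splitr e); apply: lerD.
 apply: (@le_trans _ _ (\int[leb]_(x in O) (M1 * `|c x - v x|))).
  apply: Rint_norm_le => //; first by apply: intRZ => //; exact: intR_norm.
  by move=> x _; rewrite normrM ler_wpM2r// (le_trans (Tle _ _))// ler_nat.
 by rewrite RintZ//; [rewrite mulrC -ler_pdivlMr|exact: intR_norm].
apply: (le_trans (Rint_norm_le mO i2 iq (fun x _ => qle x))).
rewrite RintD//; [|exact: intRZ|by apply: intRZ => //; exact: intRD].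
rewrite !RintZ//; last exact: intRD.
rewrite RintD// -/W.
apply: (@le_trans _ _ (s / 2 * (e / 2 / s) + s^-1 * (W + W))).
 apply: lerD; [by rewrite ler_wpM2l// ltW// divr_gt0|by rewrite ler_wpM2l ?invr_ge0 ?lerD// ltW].
rewrite (_ : s / 2 * (e / 2 / s) = e / 4); last by field; rewrite gt_eqF.
rewrite /s invf_div (_ : e / (8 * W + 2) * (W + W) = (e / 4) * (8 * W / (8 * W + 2))); last by field; lra.
have : 8 * W / (8 * W + 2) <= 1 by rewrite ler_pdivrMr; lra.
move=> h; have e4 : 0 < e / 4 by rewrite divr_gt0.
by have := ler_wpM2l (ltW e4) h; rewrite mulr1; lra.
Qed.

Lemma intR_testl U p v : test U p -> intR leb O v -> intR leb O (fun y => p y * v y).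
move=> tp iv; have [M M0 hM] := test_bounded tp.
by apply: (@intRM _ _ _ _ _ mO _ _ M) => //; exact: test_meas tp.
Qed.

(** A test function th times a mollification of g is a test function; in the limit the hypothesis
    says that g^2 th has integral 0, and th is then taken to 1 on [O]. *)
Lemma du_bois_reymond g : intR leb O g -> intR leb O (fun x => g x ^+ 2) ->
 (forall p, test O p -> \int[leb]_(x in O) (g x * p x) = 0) ->
 {ae leb, forall x, O x -> g x = 0}.
move=> ig ig2 h; have mg := intR_meas ig.
have key th : test O th -> \int[leb]_(x in O) (g x ^+ 2 * th x) = 0.
 move=> tt; have [M _ hM] := test_bounded tt; have mt := test_meas tt (D := O).
 have mgt : mfun O (fun x => g x * th x) by exact: mfunM.
 have igt : intR leb O (fun x => (g x * th x) ^+ 2).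
  apply: (@intR_le _ _ _ _ _ mO _ (fun x => M ^+ 2 * g x ^+ 2)); last 1 first.
  - move=> x _; rewrite ger0_norm ?sqr_ge0// exprMn mulrC ler_wpM2r ?sqr_ge0//.
   by rewrite -[th x ^+ 2]real_normK ?num_real// lerXn2r ?nnegrE// (le_trans _ (hM x)).
  - by apply: measurable_funX; exact: mfunM.
  - exact: intRZ.
 apply/eqP; rewrite -normr_eq0 eq_le normr_ge0 andbT; apply/ler_addgt0Pr => e e0.
 have [d d0 hd] := conv_L2_weak ig ig2 mgt igt e0.
 have [k mk] := @mollifier_ex _ n _ d0; have [tk _ _] := mk.
 have := hd d k 0 mk (lexx d); rewrite normr0 add0r => /(_ (ltW d0)).
 have tc := testM tt (conv_smooth mO 0 tk ig).
 have i1 : intR leb O (fun x => g x * (th x * conv O k 0 g x)).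
  by apply: intR_eq (intR_testl tc ig) => // x _; rewrite mulrC.
 have i2 : intR leb O (fun x => g x ^+ 2 * th x).
  by apply: intR_eq (intR_testl tt ig2) => // x _; rewrite mulrC.
 have -> : \int[leb]_(x in O) (g x * th x * (conv O k 0 g x - g x)) =
   - \int[leb]_(x in O) (g x ^+ 2 * th x).
  rewrite -[RHS]add0r -(h _ tc) -RintB//; apply: Rint_eq => x _; ring.
 by rewrite normrN.
have [th [tth th01 cth]] := test_to_open oO.
have [||||_ l] := @Rint_dom _ _ _ leb O mO (fun (k : nat) x => g x ^+ 2 * th k x) (fun x => g x ^+ 2) (fun x => g x ^+ 2).
- by move=> k; apply: mfunM; [exact: measurable_funX|exact: test_meas (tth k)].
- by [].
- by move=> x Ox; rewrite -[X in _ --> X]mulr1; apply: cvgMr; exact: cth.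
- move=> k x _; have /andP[? ?] := th01 k x.
 by rewrite normrM (ger0_norm (sqr_ge0 _)) ger0_norm// ler_piMr ?sqr_ge0.
have g0 := lim_unique l (cvg_cst 0) (fun k : nat => key _ (tth k)).
have := (ae_eq_integral_abs leb mO (measurable_int _ ig2)).1.
under eq_integral => x _ do rewrite /= ger0_norm ?sqr_ge0//.
rewrite (EFin_Rint mO ig2) g0 => /(_ erefl).
by apply: filterS => x h0 Ox; have /eqP := h0 Ox; rewrite eqe sqrf_eq0 => /eqP.
Qed.

End convolution_limits.

(** * Lipschitz charts and smoothing data up to the boundary *)

Section smoothing_data.
Context {R : realType} {n : nat}.
Local Notation V := 'rV[R]_n.

Lemma enorm_le_norm (v : V) : enorm v <= n%:R * `|v|.
apply: (@le_trans _ _ (\sum_i `|v 0 i|)); last first.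
 rewrite -[n in n%:R]card_ord mulr_natl -sumr_const; apply: ler_sum => i _.
 exact: coord_le_norm.
have S0 : 0 <= \sum_i `|v 0 i| by exact: sumr_ge0.
rewrite -[leRHS](ger0_norm S0) -sqrtr_sqr /enorm ler_wsqrtr// /mxdot big_ord1.
suff [] : 0 <= \sum_i `|v 0 i| /\ \sum_i v 0 i * v 0 i <= (\sum_i `|v 0 i|) ^+ 2 by [].
elim/big_rec2 : _ => [|i S Q _ [Q0 QS]]; first by rewrite expr0n.
split; first exact: addr_ge0.
rewrite -expr2 -(real_normK (num_real (v 0 i))).
by have := normr_ge0 (v 0 i); nra.
Qed.

(** What is kept of the Lipschitz graph: a uniform inner cone with axis e. A kernel centred at x + t
    e with radius kappa t stays in [O] as far as it meets [U]. *)
Definition shift_chart (O U : set V) (e : V) (kappa t0 : R) : Prop :=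
 [/\ open U, `|e| <= 1, 0 < kappa, 0 < t0 &
  forall t x y, 0 < t -> t <= t0 -> O x -> U y -> `|x + t *: e - y| < kappa * t -> O y].

(** Interior points use [O] itself as chart and points off the closure an empty chart, so that one
    function yields charts for all x; only boundary points use the graph. *)
Lemma lipschitz_chart (O : set V) x : open O -> lipschitz_boundary O ->
 exists c : set V * V * R * R, shift_chart O c.1.1.1 c.1.1.2 c.1.2 c.2 /\
  (closure O x -> c.1.1.1 x).
move=> oO lO; have [cx|ncx] := pselect (closure O x); last first.
 by exists (set0, 0, 1, 1) => /=; split => //; split => //; rewrite normr0.
have [Ox|nOx] := pselect (O x).
 by exists (O, 0, 1, 1) => /=; split => //; split => //; rewrite normr0.
have bx : bd O x by split => //; rewrite ((interior_id O).1 oO).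
have [e [g [L [rho [e1 rho0 gL ge gO]]]]] := lO x bx.
have n0 : 0 < n%:R :> R.
 case: (posnP n) => [n0|]; last by rewrite ltr0n.
 have : enorm e = 0.
  by rewrite /enorm /mxdot big_ord1 big1 ?sqrtr0// => i; case: i => i hi; exfalso; rewrite n0 in hi.
 by rewrite e1 => /eqP; rewrite oner_eq0.
have n1 : 1 <= n%:R :> R by rewrite ler1n; rewrite ltr0n in n0.
have en (i : 'I_n) : `|e 0 i| <= 1 by rewrite -e1; exact: coord_enorm.
have ee : `|e| <= 1.
 rewrite [leLHS]/Num.norm/= mx_normrE; apply/bigmax_leP; split => // -[i l] _ /=.
 by rewrite (ord1 i).
(* The factor n passes from the max norm to the Euclidean norm. A displacement below kappa t then
   changes gamma and the height along e by at most t together, the height gained by the shift. *)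
pose kappa : R := ((`|L| + 1) * n%:R)^-1.
have Ln0 : 0 < (`|L| + 1) * n%:R by rewrite mulr_gt0// ltr_wpDl.
have k0 : 0 < kappa by rewrite invr_gt0.
have k1 : kappa <= 1.
 by rewrite invf_le1//; have := normr_ge0 L; nra.
(* The points that occur are within 4r of x in the max norm, hence within rho/2 in the Euclidean
   norm, where the graph describes [O]. *)
pose r := rho / (8 * n%:R); have r0 : 0 < r by rewrite divr_gt0// mulr_gt0.
have rE : n%:R * r = rho / 8 by rewrite /r; field; rewrite gt_eqF.
exists (ball x r, e, kappa, r) => /=; split; last by move=> _; exact: ballxx.
split => //; first exact: ball_open.
move=> t x' y t0 tr Ox' xy hy.
have yx : `|y - x| < r by move: xy; rewrite -ball_normE /= distrC.
have near (z : V) : `|z| <= 4 * r -> enorm z < rho.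
 move=> hz; apply: (le_lt_trans (enorm_le_norm _)).
 apply: (@le_lt_trans _ _ (n%:R * (4 * r))); first by rewrite ler_wpM2l// ltW.
 by rewrite mulrCA rE; lra.
have hy1 : `|x' + t *: e - y| < t by apply: (lt_le_trans hy); rewrite ger_pMl.
have ht : `|t *: e| <= t by rewrite normrZ (gtr0_norm t0) ler_piMr// ltW.
have nx' : enorm (x' - x) < rho.
 apply: near; rewrite (_ : x' - x = (x' + t *: e - y) - t *: e + (y - x)); last first.
  by apply/rowP => i; rewrite !mxE; ring.
 apply: (le_trans (ler_normD _ _)); have := ler_normB (x' + t *: e - y) (t *: e).
 by move: yx hy1 ht tr; lra.
have ny : enorm (y - x) < rho by apply: near; lra.
apply/(gO y ny); have := (gO x' nx').1 Ox' => gx.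
pose h := x' + t *: e - y.
have hE : y = x' + t *: e - h by rewrite /h opprB addrCA subrr addr0.
have eh : enorm h <= n%:R * (kappa * t).
 by apply: (le_trans (enorm_le_norm _)); rewrite ler_wpM2l// ltW.
have dh : `|mxdot h e| <= n%:R * (kappa * t).
 rewrite /mxdot big_ord1; apply: (le_trans (ler_norm_sum _ _ _)).
 rewrite -[n in n%:R]card_ord mulr_natl -sumr_const; apply: ler_sum => i _.
 rewrite normrM -[leRHS]mulr1; apply: ler_pM => //.
 by apply: (le_trans (coord_le_norm _ _)); exact: ltW.
have gy : g y <= g x' + `|L| * (n%:R * (kappa * t)).
 rewrite -(ge x' t) -lerBlDl; apply: (le_trans (ler_norm _)); apply: (le_trans (gL _ _)).
 rewrite {1}hE addrAC subrr add0r.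
 have -> : enorm (- h) = enorm h.
  by rewrite /enorm /mxdot; congr Num.sqrt; apply: eq_bigr => i _; apply: eq_bigr => l _; rewrite !mxE mulrNN.
 apply: (@le_trans _ _ (`|L| * enorm h)); first by rewrite ler_wpM2r ?ler_norm ?enorm_ge0.
 by rewrite ler_wpM2l.
have ye : mxdot y e = mxdot x' e + t - mxdot h e.
 have -> : t = t * mxdot e e by rewrite -[mxdot e e]sqr_sqrtr ?mxdot_ge0// -/(enorm e) e1 expr1n mulr1.
 rewrite {1}hE /mxdot !big_ord1 mulr_sumr -big_split -sumrB; apply: eq_bigr => i _ /=.
 by rewrite !mxE; ring.
rewrite ye; have kE : (`|L| + 1) * (n%:R * (kappa * t)) = t.
 by rewrite /kappa; field; rewrite !gt_eqF// ltr_wpDl.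
by have := ler_norm (mxdot h e); lra.
Qed.

Lemma compact_closure (O : set V) : bounded_set O -> compact (closure O).
move=> /bounded_sub_ball[r r0 Or].
apply: (@subclosed_compact _ _ (cube 0 r)); [exact: closed_closure|exact: cube_compact|].
have Oc : O `<=` cube 0 r.
 by move=> x /Or/ball_rVP[_ h] i; exact/ltW/h.
have cc : closed (cube (0 : V) r) by apply: compact_closed_rV; exact: cube_compact.
by rewrite [X in _ `<=` X](closure_id _).1//; exact: closure_subset.
Qed.

(** A partition of unity on the closure of [O], and for each piece j and each scale k a mollifier
    with its inner shift. By the last field the kernel seen from a point of [O] is a test function
    of [O], so weak derivatives can be tested with it. *)
Record smoothing (O : set V) := Smoothing {
 sm_N : nat;
 sm_zeta : nat -> V -> R;
 sm_rho : nat -> nat -> V -> R;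
 sm_shift : nat -> nat -> V;
 sm_scale : nat -> R;
 sm_scale0 : sm_scale @ \oo --> 0;
 sm_zeta_test : forall j, test setT (sm_zeta j);
 sm_zeta_ge0 : forall j x, 0 <= sm_zeta j x;
 sm_zeta_le1 : forall x, \sum_(j < sm_N) sm_zeta j x <= 1;
 sm_zeta1 : forall x, closure O x -> \sum_(j < sm_N) sm_zeta j x = 1;
 sm_rho_mollifier : forall j k, exists2 d, d <= sm_scale k & mollifier d (sm_rho j k);
 sm_shift_le : forall j k, `|sm_shift j k| <= sm_scale k;
 sm_test : forall j k x, (j < sm_N)%N -> O x ->
  test O (fun y => sm_rho j k (x + sm_shift j k - y) * sm_zeta j y) }.

Lemma finite_pos_min (N : nat) (t : nat -> R) : (forall j, 0 < t j) ->
 exists2 t0, 0 < t0 & forall j, (j < N)%N -> t0 <= t j.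
move=> t_gt0; elim: N => [|N [t0 t00 IH]]; first by exists 1.
exists (Num.min t0 (t N)) => [|j]; first by rewrite lt_min t00 t_gt0.
rewrite ltnS leq_eqVlt => /predU1P[->|/IH h]; first by rewrite ge_min lexx orbT.
by rewrite ge_min h.
Qed.

Lemma smoothing_ex (O : set V) : open O -> bounded_set O ->
 lipschitz_boundary O -> inhabited (smoothing O).
move=> oO bO lO; have /choice[c hc] := fun x => lipschitz_chart x oO lO.
pose U x := (c x).1.1.1; pose e x := (c x).1.1.2; pose kap x := (c x).1.2; pose tt x := (c x).2.
have hU x : shift_chart O (U x) (e x) (kap x) (tt x) by have [] := hc x.
have oU x : open (U x) by have [] := hU x.
have cU : closure O `<=` \bigcup_i U i by move=> x cx; exists x => //; have [_] := hc x; exact.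
have [N [idx [zeta [tz z0 z1 z_1]]]] := pou 0 (compact_closure bO) oU cU.
(* [pou] controls the supports for j < N only, while the record quantifies over all j. *)
pose z j := if (j < N)%N then zeta j else fun=> 0.
have [t0 t00 ht0] := @finite_pos_min N (tt \o idx) (fun j => let: And5 _ _ _ h _ := hU (idx j) in h).
pose t k : R := t0 / k.+1%:R.
have tk0 k : 0 < t k by rewrite divr_gt0.
have k0 j : 0 < kap (idx j) by have [] := hU (idx j).
(* The factor [kap] keeps the kernel inside the cone; the cap by 1 keeps its radius below the common
   scale. *)
have /choice[rho hrho] : forall jk : nat * nat, exists rho : V -> R, mollifier (Num.min (kap (idx jk.1)) 1 * t jk.2) rho.
 by move=> [j k]; apply: mollifier_ex; rewrite mulr_gt0// lt_min k0 ltr01.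
have sz x : \sum_(j < N) z j x = \sum_(j < N) zeta j x.
 by apply: eq_bigr => j _; rewrite /z ltn_ord.
constructor; apply: (@Smoothing O N z (fun j k => rho (j, k)) (fun j k => t k *: e (idx j)) t).
- rewrite -(mulr0 t0); apply: cvgM; first exact: cvg_cst.
 exact: (@cvg_harmonic R).
- move=> j; rewrite /z; case: ifPn => [/tz h|_]; last exact: test0.
 exact: test_subset h.
- by move=> j x; rewrite /z; case: ifPn.
- by move=> x; rewrite sz.
- by move=> x cx; rewrite sz z_1.
- move=> j k; exists (Num.min (kap (idx j)) 1 * t k); last exact: (hrho (j, k)).
 by rewrite ler_piMl ?ge_min ?lexx ?orbT// ltW.
- move=> j k; rewrite normrZ (gtr0_norm (tk0 k)) ler_piMr//; first exact: ltW.
 by have [] := hU (idx j).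
move=> j k x jN Ox; have [tr _ _] := hrho (j, k); rewrite /z jN.
have srho : smooth (fun y : V => rho (j, k) (x + t k *: e (idx j) - y)).
 rewrite (_ : (fun _ => _) = (fun y : V => rho (j, k) (-1 *: y + (x + t k *: e (idx j))))).
  by apply: smooth_affine; exact: test_smooth tr.
 by apply/funext => y; rewrite scaleN1r addrC.
split; first by apply: smoothM => //; exact: test_smooth (tz j jN).
have [_ [K [cK KU Kz]]] := tz j jN; have [_ [B [cB Bb Br]]] := tr.
exists (K `&` [set y | B (x + t k *: e (idx j) - y)]); split.
- apply: compact_closedI => //.
 apply: (@preimage_closed V V (fun y => x + t k *: e (idx j) - y)).
  rewrite (_ : (fun _ => _) = (fun y : V => -1 *: y + (x + t k *: e (idx j)))).
   by move=> y _; apply: continuousD; [exact: scaler_continuous|exact: cst_continuous].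
  by apply/funext => y; rewrite scaleN1r addrC.
 exact: compact_closed_rV.
- move=> y [Ky /= By].
 have [_ _ _ _ h] := hU (idx j); apply: (h (t k) x y) => //.
 + apply: le_trans (ht0 j jN); rewrite /t ler_pdivrMr// ler_peMr ?ler1n//; exact: ltW.
 + exact: KU.
 have := Bb _ By; rewrite -ball_normE /= sub0r normrN => h1; apply: (lt_le_trans h1).
 by rewrite ler_wpM2r ?ge_min ?lexx// ltW.
move=> y /not_andP[/Kz ->|nB]; first by rewrite mulr0.
by rewrite Br ?mul0r.
Qed.

End smoothing_data.

Lemma cvg_bigsum {R : realType} (I : Type) (s : seq I) (u : I -> nat -> R) (a : I -> R) :
 (forall i, u i @ \oo --> a i) -> (fun l => \sum_(i <- s) u i l) @ \oo --> \sum_(i <- s) a i.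
move=> ua; elim: s => [|i s IH].
 by rewrite big_nil (_ : (fun _ => _) = fun=> 0); [exact: cvg_cst|apply/funext => l; rewrite big_nil].
rewrite big_cons (_ : (fun _ => _) = (fun l => u i l + \sum_(i <- s) u i l)).
 exact: cvgD.
by apply/funext => l; rewrite big_cons.
Qed.

(** * Convergence of the smoothing of scalar functions *)

Section smoothing_limits.
Context {R : realType} {n : nat}.
Local Notation V := 'rV[R]_n.
Local Notation leb := (lebesgue_rV n).
Implicit Types (v g : V -> R) (x : V) (l : 'I_n).

Lemma cvg0_squeeze (u v : nat -> R) : (forall k, `|u k| <= v k) ->
 v @ \oo --> 0 -> u @ \oo --> 0.
move=> uv v0; apply: norm_cvg0; apply: (squeeze_cvgr _ (cvg_cst 0) v0).
by apply: nearW => k; rewrite normr_ge0 uv.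
Qed.

Lemma cvg0_sum (I : Type) (s : seq I) (u : I -> nat -> R) :
 (forall i, u i @ \oo --> 0) -> (fun k => \sum_(i <- s) u i k) @ \oo --> 0.
by move=> u0; rewrite -[X in _ --> X](@big1_eq _ _ +%R I s xpredT); exact: cvg_bigsum. Qed.

Lemma cvg_ext (u v : nat -> R) (a : R) : (forall k, u k = v k) -> u @ \oo --> a -> v @ \oo --> a.
by move=> /funext ->. Qed.

Variable O : set V.
Hypothesis oO : open O.
Hypothesis Ooo : (leb O < +oo)%E.
Let mO : measurable O := open_meas oO.
Variable S : smoothing O.
Local Notation N := (sm_N S).
Local Notation zeta := (sm_zeta S).
Local Notation cv := (fun j k => conv O (sm_rho S j k) (sm_shift S j k)).

Lemma sm_rho_test j k : exists2 d, mollifier d (sm_rho S j k) & test (ball 0 d) (sm_rho S j k).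
by have [d _ md] := sm_rho_mollifier S j k; exists d => //; case: md. Qed.

Lemma sm_conv_cvg j v : intR leb O v ->
 (fun k => \int[leb]_(x in O) `|cv j k v x - v x|) @ \oo --> 0.
move=> iv; apply/cvgrPdist_le => e e0.
have [d0 d00 hd] := conv_L1_cvg oO Ooo iv e0.
have /cvgrPdist_le/(_ _ d00) [M _ hM] := @sm_scale0 _ _ _ S.
exists M => // k /= Mk; have := hM k Mk; rewrite /= !sub0r !normrN => hk.
have sk : sm_scale S k <= d0 by apply: le_trans hk; exact: ler_norm.
rewrite ger0_norm ?Rint_ge0//.
have [d dk md] := sm_rho_mollifier S j k.
by apply: hd md _ _; [exact: le_trans sk|apply: le_trans sk; exact: sm_shift_le].
Qed.

Lemma sm_conv_intR j k v : intR leb O v -> intR leb O (cv j k v).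
by move=> iv; have [d _ md] := sm_rho_mollifier S j k; have [] := conv_L1 mO (sm_shift S j k) mO md iv. Qed.

Lemma sm_sum_cvg (h : nat -> V -> R) : (forall j, intR leb O (h j)) ->
 (fun k => \int[leb]_(x in O) `|\sum_(j < N) cv j k (h j) x - \sum_(j < N) h j x|) @ \oo --> 0.
move=> ih; have ic j k := sm_conv_intR j k (ih j).
apply: cvg0_squeeze; last first.
 by apply: (@cvg0_sum 'I_N (index_enum _) (fun j k => \int[leb]_(x in O) `|cv j k (h j) x - h j x|)) => j; exact: sm_conv_cvg.
move=> k; rewrite ger0_norm ?Rint_ge0// -Rint_sum//; last first.
 by move=> j _; apply: intR_norm => //; exact: intRB.
apply: Rint_le => //.
- by apply: intR_norm => //; apply: intRB => //; apply: intR_sum.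
- by apply: intR_sum => // j _; apply: intR_norm => //; exact: intRB.
by move=> x _; rewrite -sumrB; exact: ler_norm_sum.
Qed.

Definition sm_approx k v x : R := \sum_(j < N) cv j k (fun y => zeta j y * v y) x.

Definition sm_kernel k x y : R :=
 \sum_(j < N) sm_rho S j k (x + sm_shift S j k - y) * zeta j y.

(** The error made when a derivative is moved onto the kernel: the terms in which the partition of
    unity is differentiated. It tends to 0 in L^1 because these derivatives sum to 0 on [O]. *)
Definition sm_rem l k v x : R := \sum_(j < N) cv j k (fun y => partial l (zeta j) y * v y) x.

Lemma sm_approx_smooth k v : intR leb O v -> smooth (sm_approx k v).
move=> iv; apply: smooth_sum => j _; have [d _ tr] := sm_rho_test j k.
exact: conv_smooth tr (intR_testl oO (sm_zeta_test S j) iv).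
Qed.

Lemma sm_approx_intR k v : intR leb O v -> intR leb O (sm_approx k v).
move=> iv; apply: intR_sum => // j _; apply: sm_conv_intR.
exact: (intR_testl oO (sm_zeta_test S j) iv).
Qed.

Lemma sm_approx_cvg v : intR leb O v ->
 (fun k => \int[leb]_(x in O) `|sm_approx k v x - v x|) @ \oo --> 0.
move=> iv; apply: cvg_ext (sm_sum_cvg (fun j => intR_testl oO (sm_zeta_test S j) iv)).
move=> k; apply: Rint_eq => x Ox.
rewrite /sm_approx; congr `|_ - _|; rewrite -mulr_suml sm_zeta1 ?mul1r//.
exact: subset_closure.
Qed.

Lemma sm_zeta_partial0 l x : O x -> \sum_(j < N) partial l (zeta j) x = 0.
move=> Ox; rewrite -[RHS](partial_cst l 1 x) -partial_sum; last first.
 by move=> j _; exact: test_smooth (sm_zeta_test S j).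
apply: (@partial_open _ _ _ _ _ O) => // y Oy; apply: sm_zeta1.
exact: subset_closure.
Qed.

Lemma sm_rem_intR l k v : intR leb O v -> intR leb O (sm_rem l k v).
move=> iv; apply: intR_sum => // j _; apply: sm_conv_intR.
exact: (intR_testl oO (test_partial l (sm_zeta_test S j)) iv).
Qed.

Lemma sm_rem_cvg l v : intR leb O v ->
 (fun k => \int[leb]_(x in O) `|sm_rem l k v x|) @ \oo --> 0.
move=> iv; apply: cvg_ext (sm_sum_cvg (fun j => intR_testl oO (test_partial l (sm_zeta_test S j)) iv)).
move=> k; apply: Rint_eq => x Ox.
by rewrite /sm_rem -mulr_suml sm_zeta_partial0// mul0r subr0.
Qed.

Lemma sm_kernel_test k x : O x -> test O (sm_kernel k x).
by move=> Ox; apply: test_sum => j _; exact: sm_test. Qed.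

Lemma sm_kernel_ge0 k x y : 0 <= sm_kernel k x y.
apply: sumr_ge0 => j _; rewrite mulr_ge0 ?sm_zeta_ge0//.
by have [d [_ r0 _] _] := sm_rho_test j k; exact: r0.
Qed.

(** The mollifiers depend on x - y only, so a derivative in x is minus a derivative in y, up to the
    terms in which zeta is differentiated. *)
Lemma sm_approx_partial l k v x : intR leb O v -> O x ->
 partial l (sm_approx k v) x =
 - (\int[leb]_(y in O) (v y * partial l (sm_kernel k x) y)) + sm_rem l k v x.
move=> iv Ox.
have tr j : exists U, test U (sm_rho S j k) by have [d _ h] := sm_rho_test j k; exists (ball 0 d).
have sz j := test_smooth (sm_zeta_test S j).
have iz j := intR_testl oO (sm_zeta_test S j) iv.
have iz' j := intR_testl oO (test_partial l (sm_zeta_test S j)) iv.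
rewrite /sm_approx partial_sum; last by move=> j _; have [U h] := tr j; exact: conv_smooth h (iz j).
pose B j y := - partial l (sm_rho S j k) (x + sm_shift S j k - y) * zeta j y +
 sm_rho S j k (x + sm_shift S j k - y) * partial l (zeta j) y.
have KE y : partial l (sm_kernel k x) y = \sum_(j < N) B j y.
 have E j : (fun y => sm_rho S j k (x + sm_shift S j k - y)) =
   (fun y => sm_rho S j k (-1 *: y + (x + sm_shift S j k))).
  by apply/funext => z; rewrite scaleN1r addrC.
 have sr j : smooth (fun y => sm_rho S j k (x + sm_shift S j k - y)).
  by rewrite E; apply: smooth_affine; have [U h] := tr j; exact: test_smooth h.
 rewrite partial_sum => [|j _]; last exact: smoothM (sr j) (sz j).
 apply: eq_bigr => j _; rewrite (partialM l y (sr j) (sz j)) /B addrC; congr (_ + _).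
 rewrite E partial_affine; last by have [U h] := tr j; exact: test_smooth h.
 by rewrite mulrC mulN1r scaleN1r addrC.
have iB j : intR leb O (fun y => v y * B j y).
 have [U h] := tr j.
 rewrite (_ : (fun _ => _) = (fun y => - (partial l (sm_rho S j k) (x + sm_shift S j k - y) * (zeta j y * v y)) +
   sm_rho S j k (x + sm_shift S j k - y) * (partial l (zeta j) y * v y))).
  apply: intRD => //; last exact: conv_intR h (iz' j).
  by apply: intRN => //; exact: conv_intR (test_partial l h) (iz j).
 by apply/funext => y; rewrite /B; ring.
have -> : \int[leb]_(y in O) (v y * partial l (sm_kernel k x) y) =
  \sum_(j < N) \int[leb]_(y in O) (v y * B j y).
 rewrite -Rint_sum//; apply: Rint_eq => y _; rewrite KE mulr_sumr; reflexivity.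
rewrite /sm_rem -sumrN -big_split; apply: eq_bigr => j _ /=; have [U h] := tr j.
rewrite (conv_partial mO _ _ h (iz j)) /conv -RintN// -RintD//.
- by apply: Rint_eq => y _; rewrite /B; ring.
- exact: intRN.
- exact: conv_intR h (iz' j).
Qed.

Lemma sm_approx_L2_weak v g : intR leb O v -> intR leb O (fun x => v x ^+ 2) ->
 mfun O g -> intR leb O (fun x => g x ^+ 2) ->
 (fun k => \int[leb]_(x in O) (g x * sm_approx k v x)) @ \oo --> \int[leb]_(x in O) (g x * v x).
move=> iv iv2 mg ig2.
have iz j := intR_testl oO (sm_zeta_test S j) iv.
have iz2 j : intR leb O (fun x => (zeta j x * v x) ^+ 2).
 rewrite (_ : (fun _ => _) = (fun x => zeta j x * (zeta j x * v x ^+ 2))).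
  by apply: (intR_testl oO (sm_zeta_test S j)); exact: (intR_testl oO (sm_zeta_test S j)).
 by apply/funext => x; ring.
have icz j k : intR leb O (fun x => g x * cv j k (fun y => zeta j y * v y) x).
 have [d _ md] := sm_rho_mollifier S j k.
 have [h _] := conv_L2 oO (sm_shift S j k) md (iz j) (iz2 j).
 by apply: intR_prod => //; exact: intR_meas (sm_conv_intR j k (iz j)).
have igz j : intR leb O (fun x => g x * (zeta j x * v x)).
 by apply: intR_prod => //; exact: intR_meas (iz j).
have igc j k : intR leb O (fun x => g x * (cv j k (fun y => zeta j y * v y) x - zeta j x * v x)).
 rewrite (_ : (fun _ => _) = (fun x => g x * cv j k (fun y => zeta j y * v y) x - g x * (zeta j x * v x))).
  exact: intRB.
 by apply/funext => x; rewrite mulrBr.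
have cj j : (fun k => \int[leb]_(x in O) (g x * (cv j k (fun y => zeta j y * v y) x - zeta j x * v x))) @ \oo --> 0.
 apply/cvgrPdist_le => e e0.
 have [d0 d00 hd] := conv_L2_weak oO Ooo (iz j) (iz2 j) mg ig2 e0.
 have /cvgrPdist_le/(_ _ d00) [M _ hM] := @sm_scale0 _ _ _ S.
 exists M => // k /= Mk; have := hM k Mk; rewrite /= !sub0r !normrN => hk.
 have sk : sm_scale S k <= d0 by apply: le_trans hk; exact: ler_norm.
 have [d dk md] := sm_rho_mollifier S j k.
 by apply: hd md _ _; [exact: le_trans sk|apply: le_trans sk; exact: sm_shift_le].
have c0 := @cvg0_sum 'I_N (index_enum _) (fun j k => \int[leb]_(x in O)
 (g x * (cv j k (fun y => zeta j y * v y) x - zeta j x * v x))) (fun j => cj j).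
rewrite -[X in _ --> X]add0r.
apply: cvg_ext (cvgD c0 (cvg_cst (\int[leb]_(x in O) (g x * v x)))) => k /=.
have -> : \int[leb]_(x in O) (g x * v x) = \int[leb]_(x in O) (\sum_(j < N) g x * (zeta j x * v x)).
 apply: Rint_eq => x Ox; rewrite -mulr_sumr -mulr_suml sm_zeta1 ?mul1r//.
 exact: subset_closure.
rewrite fctE -Rint_sum// -RintD//; [|exact: intR_sum|exact: intR_sum].
apply: Rint_eq => x _; rewrite -big_split /= /sm_approx mulr_sumr; apply: eq_bigr => j _.
by rewrite mulrBr subrK.
Qed.

End smoothing_limits.

(** * The Frobenius norm *)

Section euclidean_norm.
Context {R : realType} {p q : nat}.
Implicit Types M N : 'M[R]_(p, q).

Lemma mxdotC M N : mxdot M N = mxdot N M.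
by apply: eq_bigr => i _; apply: eq_bigr => j _; rewrite mulrC. Qed.

Lemma mxdotDl M M' N : mxdot (M + M') N = mxdot M N + mxdot M' N.
rewrite -big_split; apply: eq_bigr => i _; rewrite -big_split; apply: eq_bigr => j _.
by rewrite !mxE mulrDl.
Qed.

Lemma mxdotZl c M N : mxdot (c *: M) N = c * mxdot M N.
by rewrite /mxdot mulr_sumr; apply: eq_bigr => i _; rewrite mulr_sumr; apply: eq_bigr => j _; rewrite !mxE mulrA.
Qed.

Lemma mxdotDr M N N' : mxdot M (N + N') = mxdot M N + mxdot M N'.
by rewrite mxdotC mxdotDl !(mxdotC M). Qed.

Lemma mxdotZr c M N : mxdot M (c *: N) = c * mxdot M N.
by rewrite mxdotC mxdotZl (mxdotC M). Qed.

Lemma mxdotNl M N : mxdot (- M) N = - mxdot M N.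
by rewrite -scaleN1r mxdotZl mulN1r. Qed.

Lemma mxdotBl M M' N : mxdot (M - M') N = mxdot M N - mxdot M' N.
by rewrite mxdotDl mxdotNl. Qed.

Lemma mxdotBr M N N' : mxdot M (N - N') = mxdot M N - mxdot M N'.
by rewrite mxdotC mxdotBl !(mxdotC M). Qed.

Lemma mxdot0r M : mxdot M 0 = 0.
by rewrite -(scale0r 0) mxdotZr mul0r. Qed.

Lemma enorm_sqr M : enorm M ^+ 2 = mxdot M M.
by rewrite sqr_sqrtr ?mxdot_ge0. Qed.

Lemma enorm0 : enorm (0 : 'M[R]_(p, q)) = 0.
by rewrite /enorm mxdot0r sqrtr0. Qed.

Lemma enorm_eq0 M : enorm M = 0 -> M = 0.
move=> h; apply/matrixP => i j; apply/eqP; rewrite mxE -normr_le0 -h.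
exact: coord_enorm.
Qed.

Lemma CS M N : mxdot M N <= enorm M * enorm N.
have := enorm_ge0 M; rewrite le_eqVlt => /predU1P[/esym h|M0].
 by rewrite (enorm_eq0 h) mxdotC mxdot0r enorm0 mul0r.
have := enorm_ge0 N; rewrite le_eqVlt => /predU1P[/esym h|N0].
 by rewrite (enorm_eq0 h) mxdot0r enorm0 mulr0.
have := mxdot_ge0 ((enorm N / enorm M) *: M - N).
rewrite mxdotBl !mxdotBr !mxdotZl !mxdotZr -!enorm_sqr (mxdotC N M).
set d := mxdot M N; set a := enorm M in M0 *; set b := enorm N in N0 *.
have -> : b / a * (b / a * a ^+ 2) - b / a * d - (b / a * d - b ^+ 2) = 2 * (b / a) * (a * b - d).
 by field; rewrite gt_eqF.
rewrite pmulr_rge0 ?subr_ge0//; by rewrite mulr_gt0// divr_gt0.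
Qed.

Lemma CS_norm M N : `|mxdot M N| <= enorm M * enorm N.
rewrite ler_norml CS andbT lerNl -mxdotNl.
have -> : enorm M = enorm (- M) by rewrite /enorm mxdotNl (mxdotC M) mxdotNl opprK.
exact: CS.
Qed.

Lemma enorm_tri M N : enorm (M + N) <= enorm M + enorm N.
rewrite -ler_sqr ?nnegrE ?addr_ge0 ?enorm_ge0// enorm_sqr mxdotDl !mxdotDr (mxdotC N M).
rewrite -!enorm_sqr; have := CS M N; lra.
Qed.

Lemma enormZ c M : enorm (c *: M) = `|c| * enorm M.
by rewrite /enorm mxdotZl mxdotZr mulrA -expr2 sqrtrM ?sqr_ge0// sqrtr_sqr. Qed.

Lemma enormN M : enorm (- M) = enorm M.
by rewrite -scaleN1r enormZ normrN1 mul1r. Qed.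

Lemma enorm_le_entries M (e : R) : (forall i j, `|M i j| <= e) -> enorm M <= (p * q)%:R * e.
move=> h; case: (leP 0 e) => e0; last first.
 case: p q M h => [|p'] [|q'] M h; rewrite ?mul0n ?muln0 ?mul0r; last first.
 - by have := le_lt_trans (h ord0 ord0) e0; rewrite normr_lt0.
 - by rewrite /enorm /mxdot big1 ?sqrtr0// => i _; rewrite big_ord0.
 - by rewrite /enorm /mxdot big_ord0 sqrtr0.
 - by rewrite /enorm /mxdot big_ord0 sqrtr0.
have le0 : 0 <= (p * q)%:R * e by rewrite mulr_ge0.
rewrite -(ger0_norm le0) -sqrtr_sqr; apply: ler_wsqrtr.
apply: (@le_trans _ _ ((p * q)%:R * e ^+ 2)).
 apply: (@le_trans _ _ (\sum_(i < p) \sum_(j < q) e ^+ 2)).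
  apply: ler_sum => i _; apply: ler_sum => j _.
  by rewrite -expr2 -(real_normK (num_real (M i j))) ler_sqr ?nnegrE.
 by rewrite sumr_const card_ord sumr_const card_ord mulr_natl -mulrnA mulnC.
rewrite exprMn ler_wpM2r ?sqr_ge0// -natrX ler_nat.
by case: (p * q)%N => // k; rewrite expnS expn1 leq_pmulr.
Qed.

Lemma mxdot_delta M i j : mxdot (delta_mx i j) M = M i j.
rewrite /mxdot (bigD1 i)//= (bigD1 j)//= mxE !eqxx mul1r big1 => [|l lj]; last first.
 by rewrite mxE eqxx (negbTE lj) mul0r.
rewrite addr0 big1 ?addr0// => k ki; apply: big1 => l _.
by rewrite mxE (negbTE ki) mul0r.
Qed.

End euclidean_norm.

(** * Duality for the variation of matrix-valued charges *)

Section charge_integral_theory.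
Context {R : realType} {d : measure_display} {T : measurableType d}.
Implicit Types (nu : {charge set T -> \bar R}) (D : set T) (f g : T -> R).

Definition chint nu D f : R := fine (charge_integral nu D (EFin \o f)).

Definition bmeas D f (M : R) := mfun D f /\ forall x, D x -> `|f x| <= M.

Lemma chint_parts nu : exists P N : {measure set T -> \bar R}, [/\
 (P setT < +oo)%E, (N setT < +oo)%E, forall A, measurable A -> fine (nu A) = fine (P A) - fine (N A) &
 forall D f M, measurable D -> bmeas D f M ->
  charge_integral nu D (EFin \o f) = (\int[P]_(x in D) f x - \int[N]_(x in D) f x)%:E].
have [P [N [Poo Noo E _]]] := charge_parts nu; exists P, N; split => //.
 by move=> A mA; rewrite E// fineB// ge0_fin_numE// measure_lty.
by move=> D f M mD [mf fM]; rewrite (charge_integral_diff Poo Noo mD E mf fM).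
Qed.

Lemma chintE nu D f M : measurable D -> bmeas D f M ->
 charge_integral nu D (EFin \o f) = (chint nu D f)%:E.
move=> mD bf; have [P [N [_ _ _ E]]] := chint_parts nu.
by rewrite /chint (E _ _ _ mD bf).
Qed.

Lemma bmeas_intR (P : {measure set T -> \bar R}) D f M : (P setT < +oo)%E -> measurable D ->
 bmeas D f M -> intR P D f.
by move=> Poo mD [mf fM]; apply: (@intR_bounded _ _ _ _ _ mD _ M) => //; exact: measure_lty. Qed.

Lemma chint_sum nu D (I : Type) (s : seq I) (c : I -> R) (f : I -> T -> R) (M : I -> R) :
 measurable D -> (forall i, bmeas D (f i) (M i)) ->
 chint nu D (fun x => \sum_(i <- s) c i * f i x) = \sum_(i <- s) c i * chint nu D (f i).
move=> mD bf; have [P [N [Poo Noo _ E]]] := chint_parts nu.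
have bs : bmeas D (fun x => \sum_(i <- s) c i * f i x) (\sum_(i <- s) `|c i| * M i).
 split; first by apply: measurable_sum => i; apply: mfunM => //; have [] := bf i.
 move=> x Dx; apply: (le_trans (ler_norm_sum _ _ _)); apply: ler_sum => i _.
 by rewrite normrM ler_wpM2l//; have [_] := bf i; exact.
have ii (Q : {measure set T -> \bar R}) i : (Q setT < +oo)%E -> intR Q D (f i) by move=> Qoo; exact: bmeas_intR Qoo mD (bf i).
rewrite {1}/chint (E _ _ _ mD bs) /= !Rint_sum//.
- rewrite -sumrB; apply: eq_bigr => i _.
 by rewrite /chint (E _ _ _ mD (bf i)) /= !RintZ ?mulrBr//; exact: ii.
- by move=> i _; apply: intRZ => //; exact: ii.
- by move=> i _; apply: intRZ => //; exact: ii.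
Qed.

Lemma chint_indic nu D A : measurable D -> measurable A -> A `<=` D ->
 chint nu D \1_A = fine (nu A).
move=> mD mA AD; have [P [N [_ _ F E]]] := chint_parts nu.
have bA : bmeas D (\1_A : T -> R) 1.
 by split => // x _; rewrite indicE; case: (_ \in _); rewrite ?normr0 ?normr1.
by rewrite /chint (E _ _ _ mD bA) /= !Rint_indic// (setIidl AD) F.
Qed.

Lemma chint_dom nu D (f_ : nat -> T -> R) f M : measurable D ->
 (forall k, bmeas D (f_ k) M) -> (forall x, D x -> f_ ^~ x @ \oo --> f x) ->
 (fun k => chint nu D (f_ k)) @ \oo --> chint nu D f.
move=> mD bf cf; have [P [N [Poo Noo _ E]]] := chint_parts nu.
have L (Q : {measure set T -> \bar R}) : (Q setT < +oo)%E ->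
  intR Q D f /\ \int[Q]_(x in D) f_ k x @[k --> \oo] --> \int[Q]_(x in D) f x.
 move=> Qoo; apply: (@Rint_dom _ _ _ Q D mD f_ f (fun=> M)) => //.
 - by move=> k; have [] := bf k.
 - by apply: intR_cst => //; exact: measure_lty.
 - by move=> k x Dx; have [_] := bf k; exact.
have [iP lP] := L _ Poo; have [iN lN] := L _ Noo.
have bff : bmeas D f M.
 split; first exact: intR_meas iP.
 move=> x Dx; have c : `|f_ k x| @[k --> \oo] --> `|f x| by apply: cvg_norm; exact: cf.
 rewrite -(cvg_lim _ c)//; apply: limr_le.
  by apply/cvg_ex; eexists; exact: c.
 by apply: nearW => k; have [_] := bf k; exact.
rewrite {2}/chint (E _ _ _ mD bff) /=; apply: cvg_trans (cvgB lP lN).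
rewrite (_ : (fun k => chint nu D (f_ k)) = (fun k => \int[P]_(x in D) f_ k x) \- (fun k => \int[N]_(x in D) f_ k x))//.
by apply/funext => k; rewrite /chint (E _ _ _ mD (bf k)).
Qed.

Lemma chintB nu D f g M M' : measurable D -> bmeas D f M -> bmeas D g M' ->
 chint nu D (fun x => f x - g x) = chint nu D f - chint nu D g.
move=> mD bf bg; pose F (b : bool) := if b then f else g.
have -> : (fun x => f x - g x) = (fun x => \sum_(b <- [:: true; false]) (if b then 1 else -1) * F b x).
 by apply/funext => x; rewrite !big_cons big_nil /=; ring.
rewrite (@chint_sum _ _ _ _ _ _ (fun b => if b then M else M'))//; last by case.
by rewrite !big_cons big_nil /=; ring.
Qed.

Lemma chint_bound nu D : measurable D -> exists2 C, 0 <= C &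
 forall f M, bmeas D f M -> `|chint nu D f| <= M * C.
move=> mD; have [P [N [Poo Noo _ E]]] := chint_parts nu.
exists (fine (P D) + fine (N D)) => [|f M bf]; first by rewrite addr_ge0// fine_ge0.
rewrite /chint (E _ _ _ mD bf) /= mulrDr.
apply: (le_trans (ler_normB _ _)); have [mf fM] := bf.
have i := bmeas_intR _ mD bf.
have L (Q : {measure set T -> \bar R}) : (Q setT < +oo)%E ->
  `|\int[Q]_(x in D) f x| <= M * fine (Q D).
 move=> Qoo; rewrite -(Rint_cst Q mD M); apply: Rint_norm_le => //; first exact: i.
 by apply: intR_cst => //; exact: measure_lty.
by apply: lerD; exact: L.
Qed.

Section variation_bound.
Context {p q : nat}.
Variables (mu : 'I_p -> 'I_q -> {charge set T -> \bar R}) (D : set T).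
Hypothesis mD : measurable D.
Implicit Types Phi : 'I_p -> 'I_q -> T -> R.

Definition mx_charge (E : set T) : 'M[R]_(p, q) := \matrix_(i, j) fine (mu i j E).

Lemma mx_var_fin (C : finType) (E : C -> set T) : (forall c, measurable (E c)) ->
 trivIset setT E -> \bigcup_c E c = D ->
 ((\sum_c enorm (mx_charge (E c)))%:E <= mx_variation mu D)%E.
move=> mE tE UE; pose F (k : nat) : set T :=
 if insub k is Some i then E (enum_val (i : 'I_#|C|)) else set0.
have FE (i : 'I_#|C|) : F i = E (enum_val i) by rewrite /F valK.
apply: (@le_trans _ _ (\sum_(k <oo) (enorm (mx_charge (F k)))%:E)%E); last first.
 apply: ereal_sup_ubound; exists F => //; split.
 - by move=> k; rewrite /F; case: insub.
 - apply/trivIsetP => k l _ _ kl; rewrite /F.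
  case: insubP => [i _ ik|_]; last by rewrite set0I.
  case: insubP => [j _ jl|_]; last by rewrite setI0.
  have /trivIsetP := tE; apply => //; apply: contra kl => /eqP/enum_val_inj ij.
  by rewrite -ik -jl ij.
 - rewrite -UE; apply/seteqP; split => [x [k _]|x [c _ Ec]].
   by rewrite /F; case: insubP => // i _ _ h; exists (enum_val i).
  by exists (enum_rank c) => //; rewrite FE enum_rankK.
apply: (@le_trans _ _ (\sum_(0 <= k < #|C|) (enorm (mx_charge (F k)))%:E)%E); last first.
 by apply: nneseries_lim_ge => k _ _; rewrite lee_fin enorm_ge0.
rewrite sumEFin lee_fin big_mkord.
rewrite [leLHS](_ : _ = \sum_(c in predT) enorm (mx_charge (E c)))//.
by rewrite big_enum_val /=; apply: ler_sum => i _; rewrite FE.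
Qed.

(** Phi is rounded to a grid of mesh e. Its finitely many level sets partition D, and on each of
    them Cauchy-Schwarz compares the integral with a term of the variation. *)
Lemma mx_var_ge Phi : (forall i j, mfun D (Phi i j)) ->
 (forall x, D x -> enorm (\matrix_(i, j) Phi i j x) <= 1) ->
 ((\sum_i \sum_j chint (mu i j) D (Phi i j))%:E <= mx_variation mu D)%E.
move=> mPhi Phi1.
have Phi_le i j x : D x -> `|Phi i j x| <= 1.
 by move=> Dx; apply: le_trans (Phi1 x Dx); have := coord_enorm (\matrix_(i, j) Phi i j x) i j; rewrite mxE.
have bPhi i j : bmeas D (Phi i j) 1 by split => // x; exact: Phi_le.
have /choice[B hB] : forall ij : 'I_p * 'I_q, exists B, 0 <= B /\
  forall f M, bmeas D f M -> `|chint (mu ij.1 ij.2) D f| <= M * B.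
 by move=> ij; have [B B0 hB] := chint_bound (mu ij.1 ij.2) mD; exists B.
have [->|Voo] := eqVneq (mx_variation mu D) +oo%E; first by rewrite leey.
(* Rounding causes two errors of order e: the norm of Phi may rise above 1, which gives the factor
   on the right, and the integrals change by at most e times [B]. *)
have key (e : R) : 0 < e -> ((\sum_i \sum_j chint (mu i j) D (Phi i j) -
  e * \sum_i \sum_j B (i, j))%:E <= (1 + (p * q)%:R * e)%:E * mx_variation mu D)%E.
 (* The entries of Phi lie in [-1, 1], an interval of length 2, hence this number of cells. *)
 move=> e0; pose K := Num.truncn (2 / e).
 pose C := {ffun 'I_p * 'I_q -> 'I_K.+1}.
 pose kap (c : C) i j : R := e * (c (i, j))%:R - 1.
 pose E (c : C) : set T := D `&` \bigcap_(ij in [set: 'I_p * 'I_q])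
  (D `&` (Phi ij.1 ij.2) @^-1` `[kap c ij.1 ij.2, kap c ij.1 ij.2 + e[).
 have EP c x i j : E c x -> kap c i j <= Phi i j x < kap c i j + e.
  by move=> [_ /(_ (i, j) I) [_ /=]]; rewrite in_itv.
 have mE c : measurable (E c).
  apply: measurableI => //; apply: fin_bigcap_measurable => // -[i j] _ /=.
  by apply: mPhi.
 have tE : trivIset setT E.
  apply/trivIsetP => c c' _ _ cc'; apply/seteqP; split => // x [/= Ec Ec'].
  move/eqP: cc'; apply; apply/ffunP => -[i j]; apply: val_inj => /=.
  have /andP[a1 a2] := EP c x i j Ec; have /andP[a3 a4] := EP c' x i j Ec'.
  have lt (y z : R) (a b : nat) : e * a%:R - 1 <= y -> y < e * b%:R - 1 + e -> (a <= b)%N.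
   move=> h1 h2; have : e * a%:R < e * b.+1%:R by rewrite -natr1; nra.
   by rewrite ltr_pM2l// ltr_nat ltnS.
  by apply/eqP; rewrite eqn_leq (lt _ 0 _ _ a1 a4) (lt _ 0 _ _ a3 a2).
 pose cx x : C := [ffun ij => inord (Num.truncn ((Phi ij.1 ij.2 x + 1) / e))].
 have Ecx x : D x -> E (cx x) x.
  move=> Dx; split => // -[i j] _ /=; split => //; rewrite /= in_itv/=.
  have := Phi_le i j x Dx; rewrite ler_norml => /andP[l1 l2].
  have p0 : 0 <= (Phi i j x + 1) / e by apply: divr_ge0; [lra|exact: ltW].
  have := truncn_itv p0; rewrite /kap ffunE /= inordK => [|]; last first.
   rewrite ltnS; apply: le_truncn; rewrite ler_pM2r ?invr_gt0//; lra.
  by rewrite -natr1 ler_pdivlMr// ltr_pdivrMr// => /andP[? ?]; apply/andP; split; lra.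
 have UE : \bigcup_c E c = D.
  by apply/seteqP; split => [x [c _ []]//|x Dx]; exists (cx x) => //; exact: Ecx.
 have indE c x : E c x -> forall c', \1_(E c') x = (c' == c)%:R :> R.
  move=> Ec c'; rewrite indicE; have [->|cc'] := eqVneq; first by rewrite mem_set.
  rewrite memNset// => Ec'; have /trivIsetP/(_ c' c I I cc') h := tE.
  by have : set0 x by rewrite -h.
 pose kf i j x := \sum_c kap c i j * \1_(E c) x.
 have kfE i j c x : E c x -> kf i j x = kap c i j.
  move=> Ec; rewrite /kf (bigD1 c)//= (indE _ _ Ec) eqxx mulr1 big1 ?addr0// => c' cc'.
  by rewrite (indE _ _ Ec) (negbTE cc') mulr0.
 have b1 c : bmeas D (\1_(E c) : T -> R) 1.
  by split => // x _; rewrite indicE; case: (_ \in _); rewrite ?normr0 ?normr1.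
 have mkf i j : mfun D (kf i j).
  by apply: measurable_sum => c; apply: mfunM.
 have bd i j : bmeas D (fun x => Phi i j x - kf i j x) e.
  split; first exact: mfunB.
  move=> x Dx; have Ec := Ecx x Dx; rewrite (kfE _ _ _ _ Ec).
  by have /andP[? ?] := EP _ _ i j Ec; rewrite ler_norml; apply/andP; split; lra.
 have bkf i j : bmeas D (kf i j) (1 + e).
  split=> // x Dx; rewrite (_ : kf i j x = Phi i j x - (Phi i j x - kf i j x)); last by ring.
  apply: (le_trans (ler_normB _ _)); apply: lerD; first exact: Phi_le.
  by have [_] := bd i j; exact.
 have kfI i j : chint (mu i j) D (kf i j) = \sum_c kap c i j * fine (mu i j (E c)).
  rewrite (@chint_sum _ _ _ _ _ _ (fun=> 1))//.
  by apply: eq_bigr => c _; rewrite chint_indic// => x [].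
 apply: (@le_trans _ _ ((1 + (p * q)%:R * e) * \sum_c enorm (mx_charge (E c)))%:E); last first.
  rewrite EFinM lee_wpmul2l ?lee_fin ?addr_ge0 ?mulr_ge0//; first exact: ltW.
  exact: mx_var_fin.
 rewrite lee_fin; apply: (@le_trans _ _ (\sum_i \sum_j chint (mu i j) D (kf i j))).
  rewrite lerBlDr mulr_sumr -big_split; apply: ler_sum => i _ /=.
  rewrite mulr_sumr -big_split; apply: ler_sum => j _ /=.
  rewrite -lerBlDl -(chintB _ mD (bPhi i j) (bkf i j)).
  by apply: (le_trans (ler_norm _)); have [_ h] := hB (i, j); exact: h.
 apply: (@le_trans _ _ (\sum_c mxdot (\matrix_(i, j) kap c i j) (mx_charge (E c)))).
  rewrite exchange_big /= le_eqVlt; apply/orP; left; apply/eqP.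
  rewrite exchange_big /=; under eq_bigr => i _ do under eq_bigr => j _ do rewrite kfI.
  under eq_bigr => i _ do rewrite exchange_big /=.
  rewrite exchange_big /=; apply: eq_bigr => c _; apply: eq_bigr => i _.
  by apply: eq_bigr => j _; rewrite !mxE.
 rewrite mulr_sumr; apply: ler_sum => c _.
 have [/eqP|] := boolP (E c == set0); last first.
  move=> /set0P[x Ec]; apply: (le_trans (CS _ _)).
  rewrite ler_wpM2r ?enorm_ge0//.
  have Dx : D x by case: Ec.
  have -> : (\matrix_(i, j) kap c i j) = (\matrix_(i, j) Phi i j x) + (\matrix_(i, j) (kap c i j - Phi i j x)).
   by apply/matrixP => i j; rewrite !mxE; ring.
  apply: (le_trans (enorm_tri _ _)); apply: lerD; first exact: Phi1.
  apply: enorm_le_entries => i j; rewrite mxE.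
  by have /andP[? ?] := EP _ _ i j Ec; rewrite ler_norml; apply/andP; split; lra.
 move=> Ec0; rewrite (_ : mx_charge (E c) = 0) ?mxdot0r ?enorm0 ?mulr0//.
 by apply/matrixP => i j; rewrite !mxE Ec0 charge0.
have V0 : (mx_variation mu D \is a fin_num).
 rewrite fin_numE Voo andbT; apply/eqP => h; have := key 1 ltr01.
 rewrite h gt0_muleNy ?leeNy_eq// lte_fin ltr_wpDr// mulr_ge0.
move: key; rewrite -(fineK V0) => key; rewrite lee_fin; apply/ler_addgt0Pr => dl dl0.
set SB := \sum_i \sum_j B (i, j) in key.
have SB0 : 0 <= SB by apply: sumr_ge0 => i _; apply: sumr_ge0 => j _; have [] := hB (i, j).
set V := fine _ in key *; pose W : R := `|(p * q)%:R * V| + SB + 1.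
have W0 : 0 < W by rewrite ltr_wpDl// addr_ge0.
have := key (dl / W) (divr_gt0 dl0 W0); rewrite -EFinM lee_fin.
have h : (dl / W) * ((p * q)%:R * V + SB) <= dl.
 rewrite mulrAC ler_pdivrMr// ler_wpM2l ?(ltW dl0)// /W.
 by have := ler_norm ((p * q)%:R * V); lra.
by move: h; set a := dl / W; set S := \sum_i _; rewrite mulrDr; lra.
Qed.

End variation_bound.
End charge_integral_theory.

Section variation_test.
Context {R : realType} {n p q : nat}.
Local Notation V := 'rV[R]_n.
Variables (mu : 'I_p -> 'I_q -> {charge set V -> \bar R}) (O : set V).
Hypothesis oO : open O.
Let mO : measurable O := open_meas oO.

Lemma test_bmeas U phi : test U phi -> exists M, bmeas O phi M.
by move=> tp; have [M _ hM] := test_bounded tp; exists M; split => //; exact: test_meas tp.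
Qed.

Lemma charge_regular (E : set V) (e : R) : measurable E -> 0 < e ->
 exists K, [/\ compact K, K `<=` E & forall i j, `|fine (mu i j E) - fine (mu i j K)| <= e].
move=> mE e0.
have /choice[K hK] : forall ij : 'I_p * 'I_q, exists K, [/\ compact K, K `<=` E &
  forall K', compact K' -> K `<=` K' -> K' `<=` E ->
   `|fine (mu ij.1 ij.2 E) - fine (mu ij.1 ij.2 K')| <= e].
 move=> [i j] /=; have [P [N [Poo Noo F _]]] := chint_parts (mu i j).
 have e2 : 0 < e / 2 by rewrite divr_gt0.
 have [KP [cP KPE hP]] := regular_compact_in measurableT Poo mE (@subsetT _ _) e2.
 have [KN [cN KNE hN]] := regular_compact_in measurableT Noo mE (@subsetT _ _) e2.
 exists (KP `|` KN); split; [exact: compactU|by rewrite subUset|].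
 move=> K' cK' KK' KE; have mK' := compact_meas cK'.
 have L (Q : {measure set V -> \bar R}) K0 : (Q setT < +oo)%E -> compact K0 -> K0 `<=` K' ->
   (Q (E `\` K0) <= (e / 2)%:E)%E -> `|fine (Q E) - fine (Q K')| <= e / 2.
  move=> Qoo cK0 K0K hQ; have fQ A : measurable A -> Q A \is a fin_num.
   by move=> mA; rewrite ge0_fin_numE// measure_lty.
  have QE : (Q E = Q K' + Q (E `\` K'))%E.
   rewrite -{1}(setDUK KE) measureU//; [exact: measurableD|by rewrite setDIK].
  have -> : fine (Q E) - fine (Q K') = fine (Q (E `\` K')).
   rewrite QE fineD ?fQ//; last exact: measurableD.
   by rewrite addrAC subrr add0r.
  rewrite ger0_norm ?fine_ge0// -[e / 2]/(fine (e / 2)%:E); apply: fine_le => //.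
   by apply: fQ; exact: measurableD.
  apply: le_trans hQ; apply: le_measure; rewrite ?inE//.
  - exact: measurableD.
  - by apply: measurableD => //; exact: compact_meas.
  - exact: setDS.
 rewrite !F// (_ : _ - _ = (fine (P E) - fine (P K')) - (fine (N E) - fine (N K'))); last by ring.
 apply: (le_trans (ler_normB _ _)); rewrite (splitr e); apply: lerD.
  by apply: (L _ KP) => //; apply: subset_trans KK'; exact: subsetUl.
 by apply: (L _ KN) => //; apply: subset_trans KK'; exact: subsetUr.
pose K' := \big[setU/set0]_(ij : 'I_p * 'I_q) K ij.
have cK' : compact K'.
 by rewrite /K'; elim/big_ind : _ => //; [exact: compact0|exact: compactU|move=> ij _; have [] := hK ij].
have KE : K' `<=` E.
 by rewrite /K'; elim/big_ind : _ => [//|A B AE BE|ij _]; [rewrite subUset|have [] := hK ij].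
exists K'; split => // i j; have [_ _ h] := hK (i, j); apply: h => //.
by rewrite /K' (bigD1 (i, j))//=; exact: subsetUl.
Qed.

(** The best dual field is, on each [E k], the constant direction of the charge of [E k]. Inner
    regularity replaces the sets by disjoint compact ones, whose indicators are limits of test
    functions. *)
Lemma mx_var_le (c : R) :
 (forall Psi : 'I_p -> 'I_q -> V -> R, (forall i j, test O (Psi i j)) ->
  (forall x, enorm (\matrix_(i, j) Psi i j x) <= 1) ->
  \sum_i \sum_j chint (mu i j) O (Psi i j) <= c) ->
 (mx_variation mu O <= c%:E)%E.
move=> h; apply: ge_ereal_sup => _ [E [mE tE UE] <-].
apply: lime_le; first by apply: is_cvg_nneseries => k _ _; rewrite lee_fin enorm_ge0.
apply: nearW => N; rewrite sumEFin lee_fin big_mkord.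
have EO k : E k `<=` O by rewrite -UE; exact: bigcup_sup.
apply/ler_addgt0Pr => e e0.
pose nn : R := N%:R * (p * q)%:R + 1; have nn0 : 0 < nn by rewrite ltr_wpDl// mulr_ge0.
have /choice[K hK] : forall k, exists K, [/\ compact K, K `<=` E k &
  forall i j, `|fine (mu i j (E k)) - fine (mu i j K)| <= e / nn].
 by move=> k; apply: charge_regular => //; rewrite divr_gt0.
have KO k : K k `<=` O by have [_ KE _] := hK k; exact: subset_trans (EO k).
have cK k : compact (K k) by have [] := hK k.
have mK k := compact_meas (cK k).
have /choice[phi hphi] : forall k, exists phi : nat -> V -> R, [/\ forall l, test O (phi l),
  forall l x, 0 <= phi l x <= 1 & forall x, phi ^~ x @ \oo --> (\1_(K k) x : R)].
 by move=> k; exact: test_to_compact.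
(* As the inverse of 0 is 0, the direction is 0 where the charge vanishes. *)
pose dir k : 'M[R]_(p, q) := (enorm (mx_charge mu (E k)))^-1 *: mx_charge mu (E k).
have dir1 k : enorm (dir k) <= 1.
 rewrite enormZ normfV ger0_norm ?enorm_ge0//.
 by have [->|n0] := eqVneq (enorm (mx_charge mu (E k))) 0; rewrite ?mulr0// mulVf.
have dirE k : mxdot (dir k) (mx_charge mu (E k)) = enorm (mx_charge mu (E k)).
 rewrite mxdotZl -enorm_sqr expr2.
 by have [->|n0] := eqVneq (enorm (mx_charge mu (E k))) 0; rewrite ?mulr0// mulKf.
(* The product keeps the sum over k at most 1, so that the dual field has norm at most 1; it
   disappears in the limit because the compact sets are disjoint. *)
pose psi l k x := phi k l x * \prod_(k' < k) (1 - phi k' l x).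
have phi01 k l x : 0 <= phi k l x <= 1 by have [_ h1 _] := hphi k; exact: h1.
have psi0 l k x : 0 <= psi l k x.
 rewrite mulr_ge0 ?prodr_ge0//; first by have /andP[] := phi01 k l x.
 by move=> k' _; rewrite subr_ge0; have /andP[] := phi01 k' l x.
have psi1 l x : \sum_(k < N) psi l k x <= 1.
 rewrite (sum_telescope (fun k => phi k l x)) gerBl prodr_ge0// => k' _.
 by rewrite subr_ge0; have /andP[] := phi01 k' l x.
have tphi k l : test O (phi k l) by have [h1 _ _] := hphi k; exact: h1.
have tpsi l k : test O (psi l k).
 apply: testM => //; apply: smooth_prod => k' _; apply: smoothB; first exact: smooth_cst.
 exact: test_smooth (tphi k' l).
have cpsi k x : (fun l => psi l k x) @ \oo --> (\1_(K k) x : R).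
 have -> : \1_(K k) x = \1_(K k) x * \prod_(k' < k) (1 - \1_(K k') x) :> R.
  rewrite indicE; case: (boolP (x \in K k)) => [xK|_]; last by rewrite mul0r.
  rewrite big1 ?mulr1// => k' _; rewrite indicE memNset ?subr0// => xk'.
  have /trivIsetP/(_ k k' I I) := tE; rewrite neq_ltn ltn_ord orbT => /(_ isT) ek.
  have [_ h1 _] := hK k; have [_ h2 _] := hK k'.
  by have : set0 x by rewrite -ek; split; [apply: h1; exact: set_mem|exact: h2].
 apply: cvgM; first by have [_ _] := hphi k; exact.
 elim: (k : nat) => [|j IH].
  by rewrite big_ord0 (_ : (fun _ => _) = fun=> 1); [exact: cvg_cst|apply/funext => l; rewrite big_ord0].
 rewrite big_ord_recr /= (_ : (fun _ => _) = (fun l => \prod_(k' < j) (1 - phi k' l x) * (1 - phi j l x))).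
  apply: cvgM => //; apply: cvgB; first exact: cvg_cst.
  by have [_ _] := hphi j; exact.
 by apply/funext => l; rewrite big_ord_recr.
pose Psi l i j x := \sum_(k < N) dir k i j * psi l k x.
have tPsi l i j : test O (Psi l i j).
 by apply: test_sum => k _; apply: testZ.
have Psi1 l x : enorm (\matrix_(i, j) Psi l i j x) <= 1.
 apply: le_trans (psi1 l x).
 have -> : \matrix_(i, j) Psi l i j x = \sum_(k < N) psi l k x *: dir k.
  apply/matrixP => i j; rewrite summxE mxE; apply: eq_bigr => k _.
  by rewrite [RHS]mxE mulrC.
 elim/big_ind2 : _ => [|x1 x2 y1 y2 h1 h2|k _]; first by rewrite enorm0.
  by apply: (le_trans (enorm_tri _ _)); exact: lerD.
 by rewrite enormZ ger0_norm// ler_piMr.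
have bpsi l k : bmeas O (psi l k) 1.
 split; first exact: test_meas (tpsi l k).
 move=> x _; rewrite ger0_norm// /psi.
 have /andP[a0 a1] := phi01 k l x; apply: le_trans a1; rewrite ler_piMr//.
 by apply: prodr_ile1 => k' _; have /andP[? ?] := phi01 k' l x; apply/andP; split; lra.
have lim : (fun l => \sum_i \sum_j chint (mu i j) O (Psi l i j)) @ \oo -->
  \sum_i \sum_j \sum_(k < N) dir k i j * fine (mu i j (K k)).
 apply: cvg_bigsum => i.
 apply: cvg_bigsum => j.
 rewrite (_ : (fun _ => _) = (fun l => \sum_(k < N) dir k i j * chint (mu i j) O (psi l k))).
  apply: cvg_bigsum => k; apply: cvgM; first exact: cvg_cst.
  rewrite -(chint_indic _ mO (mK k) (KO k)); apply: (@chint_dom _ _ _ _ _ (fun l => psi l k) _ 1 mO) => [l|x _]; [exact: bpsi|exact: cpsi].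
 by apply/funext => l; rewrite (@chint_sum _ _ _ _ _ _ _ _ _ (fun=> 1)).
have le_c : \sum_i \sum_j \sum_(k < N) dir k i j * fine (mu i j (K k)) <= c.
 rewrite -(cvg_lim _ lim)//; apply: limr_le; first by apply/cvg_ex; eexists; exact: lim.
 by apply: nearW => l; apply: h.
apply: (@le_trans _ _ (\sum_i \sum_j \sum_(k < N) dir k i j * fine (mu i j (K k)) + e)); last by rewrite lerD2r.
under eq_bigr => k _ do rewrite -dirE.
rewrite -lerBlDl [X in _ - X](_ : _ = \sum_(k < N) mxdot (dir k) (mx_charge mu (K k))); last first.
 rewrite exchange_big; under eq_bigr => j _ do rewrite exchange_big.
 rewrite exchange_big; apply: eq_bigr => k _; rewrite exchange_big; apply: eq_bigr => i _.
 by apply: eq_bigr => j _; rewrite /mx_charge !mxE.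
rewrite -sumrB; apply: (@le_trans _ _ (\sum_(k < N) (p * q)%:R * (e / nn))).
 apply: ler_sum => k _; rewrite -mxdotBr; apply: (le_trans (CS _ _)).
 rewrite -[leRHS]mul1r; apply: ler_pM => //; rewrite ?enorm_ge0//.
 by apply: enorm_le_entries => i j; rewrite /mx_charge !mxE; have [_ _ h3] := hK k; exact: h3.
rewrite sumr_const card_ord (_ : _ *+ N = N%:R * (p * q)%:R * e / nn); last first.
 by rewrite -mulr_natl !mulrA.
by rewrite ler_pdivrMr// mulrC ler_wpM2l ?(ltW e0)// /nn lerDl.
Qed.

End variation_test.

Lemma meas_indic2 {R : realType} d (T : measurableType d) (D : set T) :
 measurable D -> mfun setT (\1_D : T -> R).
by move=> mD; exact: measurable_indic. Qed.

(** * Fubini's theorem for bounded functions *)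

Section fubini_bounded.
Context {R : realType} d1 d2 (T1 : measurableType d1) (T2 : measurableType d2).
Variables (m1 : {sigma_finite_measure set T1 -> \bar R}) (m2 : {sigma_finite_measure set T2 -> \bar R}).
Variables (D1 : set T1) (D2 : set T2) (F : T1 * T2 -> R) (M : R).
Hypotheses (mD1 : measurable D1) (mD2 : measurable D2).
Hypotheses (D1oo : (m1 D1 < +oo)%E) (D2oo : (m2 D2 < +oo)%E).
Hypotheses (mF : mfun setT F) (FM : forall z, `|F z| <= M).

(** Adding M makes the integrand nonnegative, so that Tonelli's theorem applies; the constant is
    subtracted afterwards. *)
Let G (z : T1 * T2) := ((F z + M) * \1_D1 z.1 * \1_D2 z.2)%:E.

Let mG : mfun setT G.
apply/mEFinP; apply: mfunM; last first.
 exact: mcomp (meas_indic2 mD2) measurable_snd.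
apply: mfunM; last exact: mcomp (meas_indic2 mD1) measurable_fst.
exact: measurable_funD.
Qed.

Let G0 z : (0 <= G z)%E.
have := FM z; rewrite ler_norml lee_fin => /andP[h _].
by rewrite !mulr_ge0 ?indicE//; lra.
Qed.

Lemma fubini_inner1 : mfun setT (fun x => \int[m2]_(y in D2) F (x, y)) /\
 forall x, `|\int[m2]_(y in D2) F (x, y)| <= M * fine (m2 D2).
have mFx x : mfun D2 (fun y => F (x, y)).
 by apply: mfunTS; exact: mcomp mF (measurable_pair1 x).
have iF x : intR m2 D2 (fun y => F (x, y)) by apply: (@intR_bounded _ _ _ _ _ mD2 _ M).
split; last first.
 move=> x; rewrite -(Rint_cst m2 mD2 M); apply: Rint_norm_le => //; exact: intR_cst.
have mh : mfun setT (fun x => \int[m2]_y ((F (x, y) + M) * \1_D2 y)%:E)%E.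
 have m1' : mfun setT (fun z : T1 * T2 => ((F z + M) * \1_D2 z.2)%:E).
  apply/mEFinP; apply: mfunM; first exact: measurable_funD.
  exact: mcomp (meas_indic2 mD2) measurable_snd.
 apply: (measurable_fun_fubini_tonelli_F _ m1') => z.
 by have := FM z; rewrite ler_norml lee_fin => /andP[h _]; rewrite mulr_ge0 ?indicE//; lra.
have E x : (\int[m2]_y ((F (x, y) + M) * \1_D2 y)%:E = (\int[m2]_(y in D2) F (x, y) + M * fine (m2 D2))%:E)%E.
 rewrite -(Rint_cst m2 mD2 M) -RintD//; last exact: intR_cst.
 rewrite -EFin_Rint//; last by apply: intRD => //; exact: intR_cst.
 rewrite [RHS]integral_mkcond; apply: eq_integral => y _.
 by rewrite patchE indicE; case: (_ \in _); rewrite ?mulr1 ?mulr0.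
rewrite (_ : (fun _ => _) = (fun x => fine (\int[m2]_y ((F (x, y) + M) * \1_D2 y)%:E)%E - M * fine (m2 D2))).
 apply: mfunB => //; exact: mcomp mh.
by apply/funext => x; rewrite E /= addrK.
Qed.

Lemma fubini_iter1 : (\int[m1]_x \int[m2]_y G (x, y) =
 (\int[m1]_(x in D1) \int[m2]_(y in D2) F (x, y) + M * fine (m2 D2) * fine (m1 D1))%:E)%E.
have [mh hM] := fubini_inner1.
have ih : intR m1 D1 (fun x => \int[m2]_(y in D2) F (x, y)).
 by apply: (@intR_bounded _ _ _ _ _ mD1 _ _ _ _ (fun x _ => hM x)) => //; exact: mfunTS.
have iF x : intR m2 D2 (fun y => F (x, y)).
 apply: (@intR_bounded _ _ _ _ _ mD2 _ M) => //.
 by apply: mfunTS; exact: mcomp mF (measurable_pair1 x).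
rewrite -(Rint_cst m1 mD1) -RintD//; last exact: intR_cst.
rewrite -EFin_Rint//; last by apply: intRD => //; exact: intR_cst.
rewrite [RHS]integral_mkcond; apply: eq_integral => x _; rewrite patchE /G /=.
case: ifPn => xD; last first.
 by rewrite (_ : (fun _ => _) = cst 0%E) ?integral0//; apply/funext => y; rewrite indicE (negbTE xD) mulr0 mul0r.
rewrite -(Rint_cst m2 mD2 M) -RintD//; last exact: intR_cst.
rewrite -EFin_Rint//; last by apply: intRD => //; exact: intR_cst.
rewrite [RHS]integral_mkcond; apply: eq_integral => y _.
by rewrite patchE !indicE xD mulr1; case: (_ \in _); rewrite ?mulr1 ?mulr0.
Qed.

End fubini_bounded.

Lemma Rint_fubini {R : realType} d1 d2 (T1 : measurableType d1) (T2 : measurableType d2)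
 (m1 : {sigma_finite_measure set T1 -> \bar R}) (m2 : {sigma_finite_measure set T2 -> \bar R})
 (D1 : set T1) (D2 : set T2) (F : T1 * T2 -> R) (M : R) :
 measurable D1 -> measurable D2 -> (m1 D1 < +oo)%E -> (m2 D2 < +oo)%E ->
 mfun setT F -> (forall z, `|F z| <= M) ->
 \int[m1]_(x in D1) \int[m2]_(y in D2) F (x, y) = \int[m2]_(y in D2) \int[m1]_(x in D1) F (x, y).
move=> mD1 mD2 D1oo D2oo mF FM.
have mF' : mfun setT (fun z : T2 * T1 => F (z.2, z.1)).
 exact: mcomp mF (measurable_fun_pair measurable_snd measurable_fst).
have e1 := fubini_iter1 mD1 mD2 D1oo D2oo mF FM.
have e2 := fubini_iter1 mD2 mD1 D2oo D1oo mF' (fun z => FM (z.2, z.1)).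
have mG : mfun setT (fun z : T1 * T2 => ((F z + M) * \1_D1 z.1 * \1_D2 z.2)%:E).
 apply/mEFinP; apply: mfunM; last first.
  exact: mcomp (meas_indic2 mD2) measurable_snd.
 apply: mfunM; last exact: mcomp (meas_indic2 mD1) measurable_fst.
 exact: measurable_funD.
have G0 z : (0 <= ((F z + M) * \1_D1 z.1 * \1_D2 z.2)%:E)%E.
 have := FM z; rewrite ler_norml lee_fin => /andP[h _].
 by rewrite !mulr_ge0 ?indicE//; lra.
have := fubini_tonelli (m1 := m1) (m2 := m2) _ mG G0; rewrite e1.
have -> : (\int[m2]_y \int[m1]_x ((F (x, y) + M) * \1_D1 x * \1_D2 y)%:E =
 \int[m2]_y \int[m1]_x ((F (x, y) + M) * \1_D2 y * \1_D1 x)%:E)%E.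
 by apply: eq_integral => y _; apply: eq_integral => x _; rewrite mulrAC.
by rewrite e2 => -[]; lra.
Qed.

Lemma enorm_le_sum {R : realType} p q (M : 'M[R]_(p, q)) : enorm M <= \sum_i \sum_j `|M i j|.
have S0 : 0 <= \sum_i \sum_j `|M i j| by apply: sumr_ge0 => i _; exact: sumr_ge0.
rewrite -[leRHS](ger0_norm S0) -sqrtr_sqr /enorm ler_wsqrtr// /mxdot !pair_big /=.
suff [] : 0 <= \sum_ij `|M ij.1 ij.2| /\
 \sum_ij M ij.1 ij.2 * M ij.1 ij.2 <= (\sum_ij `|M ij.1 ij.2|) ^+ 2 by [].
elim/big_rec2 : _ => [|i S Q _ [Q0 QS]]; first by rewrite expr0n.
split; first exact: addr_ge0.
rewrite -expr2 -(real_normK (num_real (M i.1 i.2))).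
by have := normr_ge0 (M i.1 i.2); nra.
Qed.

(** * Integrable matrix fields *)

Section fields.
Context {R : realType} {d : measure_display} {T : measurableType d}.
Variables (mu : {measure set T -> \bar R}) (D : set T).
Hypothesis mD : measurable D.
Context {p q : nat}.
Implicit Types u : T -> 'M[R]_(p, q).

Lemma meas_mxP u : mfun D u <-> forall i j, mfun D (fun x => u x i j).
split=> [mu' i j|mu']; first exact: mcomp (measurable_coord i j) mu'.
pose v x := if x \in D then u x else 0.
have uv : {in D, v =1 u} by move=> x xD; rewrite /v xD.
apply: (eq_measurable_fun v) => //; apply: mfunTS; apply: measurable_fun_mx => i j.
have h := (measurable_restrictT (fun x => u x i j) mD).1 (mu' i j).
rewrite (_ : (fun _ => _) = (fun x => u x i j) \_ D)//.
by apply/funext => x; rewrite patchE /v; case: ifP => // _; rewrite mxE.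
Qed.

Lemma enorm_meas u : mfun D u -> mfun D (fun x => enorm (u x)).
move=> mu'; have ms : mfun setT (@Num.sqrt R).
 by apply: continuous_measurable_fun; exact: sqrt_continuous.
apply: (mcomp ms).
apply: measurable_sum => i; apply: measurable_sum => j.
by apply: mfunM; exact: (meas_mxP _).1.
Qed.

Lemma in_L1P u : in_L mu D 1 u <-> forall i j, intR mu D (fun x => u x i j).
split=> [[mu' uoo] i j|iu].
 apply: (@intR_le _ _ _ _ _ mD _ (fun x => enorm (u x))).
 - exact: (meas_mxP _).1.
 - apply/integrableP; split; first by apply/mEFinP; exact: enorm_meas.
  rewrite (eq_integral (fun x => (enorm (u x) ^+ 1)%:E))// => x _.
  by rewrite expr1 /= ger0_norm ?enorm_ge0.
 - by move=> x _; exact: coord_enorm.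
have mu' : mfun D u by apply/meas_mxP => i j; exact: intR_meas (iu i j).
split => //; have ie : intR mu D (fun x => enorm (u x)).
 apply: (@intR_le _ _ _ _ _ mD _ (fun x => \sum_i \sum_j `|u x i j|)).
 - exact: enorm_meas.
 - by apply: intR_sum => // i _; apply: intR_sum => // j _; exact: intR_norm.
 move=> x _; rewrite ger0_norm ?enorm_ge0//.
 exact: enorm_le_sum.
have /integrableP[_] := ie; congr (_ < _)%E; apply: eq_integral => x _.
by rewrite expr1 /= ger0_norm ?enorm_ge0.
Qed.

Lemma in_L2P u : in_L mu D 2 u <-> forall i j, mfun D (fun x => u x i j) /\
 intR mu D (fun x => u x i j ^+ 2).
split=> [[mu' uoo] i j|iu].
 have mij : mfun D (fun x => u x i j) by exact: (meas_mxP _).1.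
 split => //; apply: (@intR_le _ _ _ _ _ mD _ (fun x => enorm (u x) ^+ 2)).
 - exact: measurable_funX.
 - apply/integrableP; split.
   by apply/mEFinP; apply: measurable_funX; exact: enorm_meas.
  rewrite (eq_integral (fun x => (enorm (u x) ^+ 2)%:E))// => x _.
  by rewrite /= ger0_norm ?sqr_ge0.
 - move=> x _; rewrite ger0_norm ?sqr_ge0// -(real_normK (num_real _)).
  by rewrite ler_sqr ?nnegrE ?enorm_ge0//; exact: coord_enorm.
have mu' : mfun D u by apply/meas_mxP => i j; exact: (iu i j).1.
split => //; have ie : intR mu D (fun x => enorm (u x) ^+ 2).
 rewrite (_ : (fun _ => _) = (fun x => \sum_i \sum_j u x i j ^+ 2)).
  by apply: intR_sum => // i _; apply: intR_sum => // j _; exact: (iu i j).2.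
 by apply/funext => x; rewrite enorm_sqr.
have /integrableP[_] := ie; congr (_ < _)%E; apply: eq_integral => x _.
by rewrite /= ger0_norm ?sqr_ge0.
Qed.

Lemma in_L2_L1 u : (mu D < +oo)%E -> in_L mu D 2 u -> in_L mu D 1 u.
move=> Doo /in_L2P h; apply/in_L1P => i j; have [m1 i2] := h i j.
apply: (@intR_le _ _ _ _ _ mD _ (fun x => 1 + u x i j ^+ 2)) => //.
 by apply: intRD => //; exact: intR_cst.
move=> x _; rewrite -(real_normK (num_real (u x i j))).
by have := sqr_ge0 (`|u x i j| - 1); nra.
Qed.

Lemma intR_mxdot (u v : T -> 'M[R]_(p, q)) : (forall i j, intR mu D (fun x => u x i j * v x i j)) ->
 intR mu D (fun x => mxdot (u x) (v x)).
by move=> h; apply: intR_sum => // i _; exact: intR_sum. Qed.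

End fields.

Lemma meas_invr {R : realType} : mfun setT (fun x : R => x^-1).
have -> : [set: R] = [set x | x != 0] `|` [set 0].
 by apply/seteqP; split => // x _; have [->|x0] := eqVneq x 0; [right|left].
have o0 : open [set x : R | x != 0] by exact: open_neq.
apply/measurable_funU => //; first exact: open_measurable.
split; last exact: measurable_fun_set1.
apply: open_continuous_measurable_fun => // x; rewrite inE => x0.
exact: inv_continuous.
Qed.

(** The same set function, tied to the proof of its finiteness, so that it can carry the structure
    of a finite measure. *)
Definition finite_copy {R : realType} d (T : measurableType d) (P : {measure set T -> \bar R})
 (_ : (P setT < +oo)%E) : set T -> \bar R := P.

Section finite_copy.
Context {R : realType} d (T : measurableType d) (P : {measure set T -> \bar R}).
Hypothesis Poo : (P setT < +oo)%E.
HB.instance Definition _ := isMeasure.Build _ _ _ (finite_copy Poo)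
 (measure0 P) (measure_ge0 P) (@measure_semi_sigma_additive _ _ _ P).
Let finite_copy_fin : fin_num_fun (finite_copy Poo).
by move=> U mU; rewrite ge0_fin_numE ?measure_ge0//; exact: measure_lty. Qed.
HB.instance Definition _ := Measure_isFinite.Build _ _ _ (finite_copy Poo) finite_copy_fin.
End finite_copy.

Lemma chint_fubini {R : realType} d1 d2 (T1 : measurableType d1) (T2 : measurableType d2)
 (m1 : {sigma_finite_measure set T1 -> \bar R}) (nu : {charge set T2 -> \bar R})
 (D1 : set T1) (D2 : set T2) (F : T1 * T2 -> R) (M : R) :
 measurable D1 -> measurable D2 -> (m1 D1 < +oo)%E ->
 mfun setT F -> (forall z, `|F z| <= M) ->
 \int[m1]_(x in D1) chint nu D2 (fun y => F (x, y)) =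
 chint nu D2 (fun y => \int[m1]_(x in D1) F (x, y)).
move=> mD1 mD2 D1oo mF FM; have [P [N [Poo Noo _ E]]] := chint_parts nu.
have mF' : mfun setT (fun z : T2 * T1 => F (z.2, z.1)).
 exact: mcomp mF (measurable_fun_pair measurable_snd measurable_fst).
have [mh hM] := fubini_inner1 mD1 D1oo mF' (fun z => FM (z.2, z.1)).
have bx x : bmeas D2 (fun y => F (x, y)) M.
 by split => //; apply: mfunTS; exact: mcomp mF (measurable_pair1 x).
have by' : bmeas D2 (fun y => \int[m1]_(x in D1) F (x, y)) (M * fine (m1 D1)).
 by split; [exact: mfunTS mh|move=> y _; exact: hM].
rewrite [RHS]/chint (E _ _ _ mD2 by') /=.
have L (Q : {measure set T2 -> \bar R}) (Qoo : (Q setT < +oo)%E) :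
  intR m1 D1 (fun x => \int[Q]_(y in D2) F (x, y)) /\
  \int[m1]_(x in D1) \int[Q]_(y in D2) F (x, y) = \int[Q]_(y in D2) \int[m1]_(x in D1) F (x, y).
 have D2oo : (Q D2 < +oo)%E := measure_lty Qoo mD2.
 split; last exact: (@Rint_fubini _ _ _ _ _ m1 (finite_copy Qoo) _ _ _ _ mD1 mD2 D1oo D2oo mF FM).
 have [mk kM] := @fubini_inner1 _ _ _ _ _ (finite_copy Qoo) D2 F M mD2 D2oo mF FM.
 by apply: (@intR_bounded _ _ _ _ _ mD1 _ _ D1oo _ (fun x _ => kM x)); exact: mfunTS.
have [iP <-] := L P Poo; have [iN <-] := L N Noo.
by rewrite -RintB//; apply: Rint_eq => x _; rewrite /chint (E _ _ _ mD2 (bx x)).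
Qed.

Lemma cont_mx {R : realType} (T : topologicalType) p q (u : T -> 'M[R]_(p, q)) :
 (forall i j, continuous (fun x => u x i j)) -> continuous u.
move=> cu x; apply/cvg_ballP => e e0.
have h : \forall y \near x, forall ij : 'I_p * 'I_q, ball (u x ij.1 ij.2) e (u y ij.1 ij.2).
 apply: filter_forall => -[i j] /=.
 by have /cvg_ballP := cu i j x; exact.
by apply: filterS h => y hy; split => // i j; exact: (hy (i, j)).
Qed.

Lemma cvg_EFin_eq {R : realType} (U : nat -> \bar R) (a : nat -> R) (b : R) :
 (forall k, U k = (a k)%:E) -> a @ \oo --> b -> U @ \oo --> b%:E.
by move=> /funext -> ab; apply: cvg_EFin => //; exact: nearW. Qed.

(** * Coverings by balls, Borel hulls and bounded densities *)

Section hausdorff_covering.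
Context {R : realType} {n : nat}.
Variable k : nat.
Local Notation V := 'rV[R]_n.

Lemma ball_volume_gt0 : 0 < ball_volume k :> R.
pose D := [set x : 'rV[R]_k | enorm x <= 1].
have r0 : 0 < k.+1%:R^-1 :> R by rewrite invr_gt0.
have BD : ball (0 : 'rV[R]_k) k.+1%:R^-1 `<=` D.
 move=> x; rewrite -ball_normE /= sub0r normrN => /ltW xr.
 apply: (le_trans (enorm_le_norm _)); apply: (@le_trans _ _ (k%:R * k.+1%:R^-1)).
  by rewrite ler_wpM2l.
 by rewrite ler_pdivrMr// mul1r ler_nat.
have mB : measurable (ball (0 : 'rV[R]_k) (k.+1%:R^-1 : R)).
 by apply: open_meas; exact: ball_open.
have mD : measurable D.
 rewrite -[D]setTI; have me : mfun setT (fun x : 'rV[R]_k => enorm x).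
  by apply: enorm_meas => //; exact: measurable_id.
 rewrite (_ : D = (fun x : 'rV[R]_k => enorm x) @^-1` `]-oo, 1]); first exact: me.
 by apply/seteqP; split => x /=; rewrite in_itv.
have bD : bounded_set D.
 exists 1; split => // M M1 x /= xD; apply: le_trans (ltW M1).
 rewrite [leLHS]/Num.norm/= mx_normrE; apply/bigmax_leP; split => // -[i j] _ /=.
 by apply: le_trans xD; exact: coord_enorm.
have lt : (0 < lebesgue_rV k D)%E.
 apply: (@lt_le_trans _ _ (lebesgue_rV k (ball (0 : 'rV[R]_k) k.+1%:R^-1))).
  have -> : lebesgue_rV k (ball (0 : 'rV[R]_k) k.+1%:R^-1) = ((2 * k.+1%:R^-1) ^+ k)%:E by exact: leb_ball.
  by rewrite lte_fin exprn_gt0// mulr_gt0.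
 by apply: le_measure; rewrite ?inE.
by rewrite /ball_volume fine_gt0// lt leb_bounded.
Qed.

(** Even a set of diameter 0 needs a ball of positive radius, so the radius must exceed the diameter
    by a controlled amount. *)
Lemma exists_radius (d e : R) : 0 <= d -> 0 < e -> exists2 r, d < r <= d + e & r ^+ k <= d ^+ k + e.
move=> d0 e0.
have c : (fun x : R => x ^+ k) @ d --> d ^+ k by exact: exprn_continuous.
have /cvgrPdist_le/(_ _ e0)/nbhs_ballP[h /= h0 hh] := c.
pose r := d + Num.min (h / 2) e.
have m0 : 0 < Num.min (h / 2) e by rewrite lt_min e0 divr_gt0.
exists r; first by rewrite /r ltrDl m0 lerD2l ge_min lexx orbT.
have : ball d h r.
 rewrite -ball_normE /= /r opprD addrA subrr add0r normrN gtr0_norm//.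
 by rewrite gt_min; apply/orP; left; lra.
by move=> /hh /=; rewrite ler_norml => /andP[? _]; lra.
Qed.

(** A set of diameter d lies in a ball about one of its points with radius just above d. Using d in
    place of d/2 costs 2^k; the summand 1 in the constant pays for the enlargements, which add up to
    at most c. *)
Lemma hd_ball_cover : exists2 C : R, 0 <= C &
 forall (K : set V) (c dl : R), compact K -> (hausdorff k K < c%:E)%E -> 0 < dl ->
 exists (s : seq nat) (x : nat -> V) (r : nat -> R), [/\ forall i, i \in s -> 0 < r i <= dl,
  K `<=` \bigcup_(i in [set` s]) ball (x i) (r i) & \sum_(i <- s) r i ^+ k <= C * c].
have bv0 := ball_volume_gt0.
exists (2 ^+ k / ball_volume k + 1) => [|K c dl cK Kc dl0]; first by rewrite addr_ge0// divr_ge0// ltW.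
have c0 : 0 < c.
 have : (0 <= hausdorff k K)%E by exact: outer_measure_ge0.
 by move=> h; have := le_lt_trans h Kc; rewrite lte_fin.
have dl2 : 0 < dl / 2 by rewrite divr_gt0.
have : (hausdorff_pre k (dl / 2) K < c%:E)%E by apply: le_lt_trans Kc; exact: pre_le_hd.
move=> /ereal_inf_lt[_ [U KU <-] Uc].
have gfin i : (hausdorff_gauge k (dl / 2) (U i) < c%:E)%E.
 apply: le_lt_trans Uc; apply: (le_trans _ (nneseries_lim_ge i.+1 _)) => [|j _ _]; last exact: gauge_ge0.
 by rewrite big_nat_recr//= leeDr// sume_ge0// => j _; exact: gauge_ge0.
pose ne i := ~~ `[< U i = set0 >].
pose d i : R := fine (ediam (U i)).
have dP i : ne i -> [/\ 0 <= d i, ediam (U i) = (d i)%:E, d i <= dl / 2 &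
  hausdorff_gauge k (dl / 2) (U i) = (ball_volume k * (d i / 2) ^+ k)%:E].
 move=> Ui; have /asboolP/eqP/set0P U0 := Ui; have e0 := ediam_ge0 U0.
 have := gfin i; rewrite /hausdorff_gauge (negbTE Ui); case: ifP => // hd _.
 have fd : ediam (U i) \is a fin_num by rewrite ge0_fin_numE// (le_lt_trans hd) ?ltry.
 have dE : ediam (U i) = (d i)%:E by rewrite /d fineK.
 by split => //; [rewrite fine_ge0|rewrite -lee_fin -dE].
have /choice[xr hxr] : forall i, exists xr : V * R, ne i ->
  [/\ U i `<=` ball xr.1 xr.2, 0 < xr.2 <= dl & xr.2 ^+ k <= d i ^+ k + c / 2 ^+ i.+1].
 move=> i; have [Ui|] := boolP (ne i); last by exists (0, 0).
 have /asboolP/eqP/set0P[x Ux] := Ui; have [d0 dE ddl _] := dP i Ui.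
 have e0 : 0 < Num.min (dl / 2) (c / 2 ^+ i.+1) by rewrite lt_min dl2 divr_gt0// exprn_gt0.
 have [r /andP[dr rd] rk] := exists_radius d0 e0.
 exists (x, r) => _ /=; split.
 - move=> y Uy; apply/ball_rVP; split=> [|j]; first exact: le_lt_trans dr.
  apply: le_lt_trans dr; rewrite -lee_fin -dE; apply: le_trans (enorm_le_ediam Ux Uy).
  by rewrite lee_fin; have := coord_enorm (x - y) 0 j; rewrite !mxE.
 - rewrite (le_lt_trans d0 dr)/=; apply: (le_trans rd); rewrite [leRHS](splitr dl) lerD//.
  by rewrite ge_min lexx.
 - by apply: (le_trans rk); rewrite lerD2l ge_min lexx orbT.
pose B i := if ne i then ball (xr i).1 (xr i).2 else set0.
have oB i : open (B i) by rewrite /B; case: ifP => _; [exact: ball_open|exact: open0].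
have KB : K `<=` \bigcup_i B i.
 move=> x /KU[i _ Ux]; exists i => //; rewrite /B; have ni : ne i.
  by apply/asboolP => U0; rewrite U0 in Ux.
 by rewrite ni; have [h _ _] := hxr i ni; exact: h.
(* The partition of unity only extracts a finite subcover: at each point of K some eta i is
   nonzero. *)
have [M [eta [teta _ _ eta1]]] := pou_nat cK oB KB.
exists [seq i <- index_iota 0 M | ne i], (fun i => (xr i).1), (fun i => (xr i).2); split.
- by move=> i; rewrite mem_filter => /andP[ni _]; have [] := hxr i ni.
- move=> x Kx; have [i Bi] : exists i : 'I_M, B i x.
  apply: contrapT => nB; have := eta1 x Kx; rewrite big1 => [/esym/eqP|i _]; first by rewrite oner_eq0.
  by apply: (test_out (teta i)) => Bi; apply: nB; exists i.
 move: Bi; rewrite /B; case: ifPn => // ni Bi; exists (val i) => //=.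
 by rewrite mem_filter ni mem_index_iota /=.
rewrite big_filter; apply: (@le_trans _ _ (\sum_(i <- index_iota 0 M | ne i) (d i ^+ k + c / 2 ^+ i.+1))).
 by apply: ler_sum => i ni; have [] := hxr i ni.
rewrite big_split /= mulrDl mul1r; apply: lerD; last first.
 apply: (@le_trans _ _ (\sum_(i < M) c / 2 ^+ i.+1)).
  rewrite big_mkord big_mkcond /=; apply: ler_sum => i _.
  by case: ifP => // _; rewrite divr_ge0 ?exprn_ge0// ltW.
 by rewrite -mulr_sumr sum_half_pow ger_pMr// gerBl invr_ge0 exprn_ge0.
rewrite mulrAC ler_pdivlMr// -ler_pdivrMl ?exprn_gt0//.
apply: (@le_trans _ _ (\sum_(i <- index_iota 0 M | ne i) (ball_volume k * (d i / 2) ^+ k))).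
 rewrite mulrC mulr_suml mulr_suml; apply: ler_sum => i _; rewrite expr_div_n mulrA.
 by rewrite (mulrC (ball_volume k)).
rewrite -lee_fin -sumEFin; apply: le_trans (ltW Uc).
apply: (le_trans _ (nneseries_lim_ge M _)) => [|j _ _]; last exact: gauge_ge0.
rewrite !big_mkord [leLHS]big_mkcond; apply: lee_sum => i _ /=.
by case: ifP => ni; [have [_ _ _ ->] := dP i ni|exact: gauge_ge0].
Qed.

Lemma ediam_closure (U : set V) : ediam (closure U) = ediam U.
apply/eqP; rewrite eq_le; apply/andP; split; last by apply: le_ediam; exact: subset_closure.
apply: ge_ereal_sup => _ [x cx [y cy <-]].
apply/lee_addgt0Pr => e e0; pose h := e / (4 * (n%:R + 1)).
have n1 : 0 < n%:R + 1 :> R by rewrite ltr_wpDl.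
have h0 : 0 < h by rewrite divr_gt0// mulr_gt0.
have [x' [Ux' xx']] := cx (ball x h) (nbhsx_ballx _ _ h0).
have [y' [Uy' yy']] := cy (ball y h) (nbhsx_ballx _ _ h0).
apply: (@le_trans _ _ ((enorm (x' - y'))%:E + e%:E)%E); last first.
 by rewrite leeD2r// enorm_le_ediam.
rewrite lee_fin (_ : x - y = (x' - y') + ((x - x') + (y' - y))); last by apply/rowP => i; rewrite !mxE; ring.
apply: (le_trans (enorm_tri _ _)); rewrite lerD2l; apply: (le_trans (enorm_tri _ _)).
have b (z z' : V) : ball z h z' -> enorm (z - z') <= e / 2.
 rewrite -ball_normE /= => /ltW hz; apply: (le_trans (enorm_le_norm _)).
 apply: (@le_trans _ _ ((n%:R + 1) * h)); first by apply: ler_pM => //; rewrite lerDl.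
 by rewrite /h (_ : _ * _ = e / 4); [lra|field; rewrite gt_eqF].
rewrite (splitr e); apply: lerD; first exact: b.
by rewrite -(opprB y y') enormN; exact: b.
Qed.

(** Closures have the same diameter. Intersecting over all scales the unions of the closures of
    nearly optimal covers gives a Borel set of no larger measure; it replaces sets that are only
    Caratheodory measurable. *)
Lemma hd_borel_hull (E : set V) : (hausdorff k E < +oo)%E ->
 exists B, [/\ measurable B, E `<=` B & (hausdorff k B <= hausdorff k E)%E].
move=> Eoo; have E0 : (0 <= hausdorff k E)%E by exact: outer_measure_ge0.
have fE : hausdorff k E \is a fin_num by rewrite ge0_fin_numE.
have /choice[U hU] : forall j : nat, exists U : (set V)^nat, E `<=` \bigcup_i U i /\
  (\sum_(i <oo) hausdorff_gauge k j.+1%:R^-1 (U i) < hausdorff k E + (j.+1%:R^-1)%:E)%E.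
 move=> j; have j0 : 0 < j.+1%:R^-1 :> R by rewrite invr_gt0.
 have : (hausdorff_pre k j.+1%:R^-1 E < hausdorff k E + (j.+1%:R^-1)%:E)%E.
  by apply: (le_lt_trans (pre_le_hd _ _ j0)); rewrite lteDl// lte_fin.
 by move=> /ereal_inf_lt[_ [U EU <-] h]; exists U.
exists (\bigcap_j \bigcup_i closure (U j i)); split.
- apply: bigcap_measurable; first by exists 0%N.
 move=> j _; apply: bigcup_measurable => i _; apply: closed_meas; exact: closed_closure.
- move=> x Ex j _; have [EU _] := hU j; have [i _ Ui] := EU x Ex.
 by exists i => //; exact: subset_closure.
apply: ge_ereal_sup => _ [dl dl0 <-]; apply/lee_addgt0Pr => e e0.
have m0 : 0 < Num.min dl e by rewrite lt_min dl0 e0.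
have [j _ hj] := near_infty_natSinv_lt (PosNum m0).
have := hj j (leqnn _); rewrite /= lt_min => /andP[jd je].
have [_ Uj] := hU j.
apply: (@le_trans _ _ (hausdorff_pre k j.+1%:R^-1 (\bigcap_j \bigcup_i closure (U j i)))).
 by apply: pre_antitone; exact: ltW.
apply: (@le_trans _ _ (\sum_(i <oo) hausdorff_gauge k j.+1%:R^-1 (closure (U j i)))%E).
 by apply: ereal_inf_lbound; exists (fun i => closure (U j i)) => // x; exact.
apply: (@le_trans _ _ (\sum_(i <oo) hausdorff_gauge k j.+1%:R^-1 (U j i))%E).
 apply: lee_nneseries => [i _ _|i _]; first exact: gauge_ge0.
 rewrite /hausdorff_gauge ediam_closure.
 have [->|/set0P[x Ux]] := eqVneq (U j i) set0; first by rewrite closure0.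
 have U0 : U j i <> set0 by move=> h; rewrite h in Ux.
 have cU0 : closure (U j i) <> set0.
  by move=> h; have : closure (U j i) x := subset_closure Ux; rewrite h.
 by rewrite !asboolF.
by apply: (le_trans (ltW Uj)); rewrite leeD2l// lee_fin ltW.
Qed.

End hausdorff_covering.

Lemma integral_mrestr {R : realType} d (T : measurableType d)
  (mu : {measure set T -> \bar R}) (D : set T) (mD : measurable D) (f : T -> \bar R) :
 mfun setT f -> (forall x, 0 <= f x)%E ->
 (\int[mrestr mu mD]_x f x = \int[mu]_(x in D) f x)%E.
move=> mf f0; transitivity (\int[mrestr mu mD]_(x in D) f x)%E.
 rewrite -(setUv D) ge0_integral_setU//; last 3 first.
 - exact: measurableC.
 - by rewrite setUv.
 - exact/disj_setPCl.
 rewrite [X in (_ + X)%E](_ : _ = 0%E) ?adde0//.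
 apply: null_set_integral => //; first exact: measurableC.
 - exact: mfunTS.
 - by change (mu (~` D `&` D) = 0%E); rewrite setICl measure0.
apply: eq_measure_integral => B mB BD.
by change (mu (B `&` D) = mu B); rewrite (setIidl BD).
Qed.

(** The Radon-Nikodym density exceeds k on a null set only, so cutting it at k makes the bound hold
    everywhere. A signed p is reduced to the nonnegative p + B. *)
Lemma bounded_density {R : realType} d (T : measurableType d)
  (m W : {measure set T -> \bar R}) (k : R) :
 (m setT < +oo)%E -> 0 <= k -> (forall B, measurable B -> (W B <= k%:E * m B)%E) ->
 exists g : T -> R, [/\ mfun setT g, forall x, 0 <= g x <= k &
  forall (p : T -> R) (B : R), mfun setT p -> (forall x, `|p x| <= B) ->
   \int[W]_x p x = \int[m]_x (p x * g x)].
move=> moo k0 Wm.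
have Woo : (W setT < +oo)%E.
 by apply: le_lt_trans (Wm _ measurableT) _; rewrite lte_mul_pinfty// ge0_fin_numE.
pose m' : {finite_measure set T -> \bar R} := finite_copy moo.
pose W' : {finite_measure set T -> \bar R} := finite_copy Woo.
have dom : W' `<< m'.
 apply/null_content_dominatesP => B mB mB0; apply/eqP; rewrite eq_le measure_ge0 andbT.
 apply: le_trans (Wm _ mB) _.
 by rewrite (_ : m B = 0%E) ?mule0.
pose F := Radon_Nikodym_SigmaFinite.f W' m'.
have Ffin x : F x \is a fin_num := Radon_Nikodym_SigmaFinite.f_fin_num dom x.
pose f x := fine (F x).
have fF x : (f x)%:E = F x by rewrite fineK.
have f0 x : 0 <= f x by apply: fine_ge0; exact: Radon_Nikodym_SigmaFinite.f_ge0.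
have If : intR m setT f.
 have eF : EFin \o f = F by exact/funext.
 have /integrableP[F1 F2] := Radon_Nikodym_SigmaFinite.f_integrable dom.
 apply/integrableP; rewrite eF; split; first exact: F1.
 exact: F2.
have mf := intR_meas If.
have cov (p : T -> R) (B : R) : mfun setT p -> (forall x, `|p x| <= B) -> (forall x, 0 <= p x) ->
  \int[W]_x p x = \int[m]_x (p x * f x).
 move=> mp pB p0; rewrite /Rintegral; congr fine.
 rewrite -(@Radon_Nikodym_SigmaFinite.change_of_variables _ _ _ W' m' dom (EFin \o p) setT)//.
  by apply: eq_integral => x _; rewrite EFinM fF.
 exact/mEFinP.
pose E := [set x | k < f x].
have mE : measurable E.
 have -> : E = setT `&` f @^-1` `]k, +oo[ by rewrite setTI; apply/seteqP; split => x /=; rewrite in_itv/= andbT.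
 exact: mf.
have E0 : m E = 0%E.
 have IE : intR m E f by apply: intR_sub If.
 have Eoo : (m E < +oo)%E by exact: measure_lty.
 have WE : (W E = \int[m]_(x in E) (f x)%:E)%E.
  rewrite [LHS](Radon_Nikodym_SigmaFinite.f_integral dom mE).
  by apply: eq_integral => x _; rewrite fF.
 have le : \int[m]_(x in E) (f x - k) <= 0.
  rewrite (RintB mE IE (intR_cst mE k Eoo)) Rint_cst// subr_le0.
  rewrite -lee_fin -EFin_Rint// -WE EFinM fineK ?Wm//.
  by rewrite ge0_fin_numE.
 have If' : intR m E (fun x => f x - k) := intRB mE IE (intR_cst mE k Eoo).
 have : ae_eq m E (EFin \o (fun x => f x - k)) (cst 0%E).
  apply/(ae_eq_integral_abs _ mE); first exact: measurable_int If'.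
  apply/eqP; rewrite eq_le integral_ge0 ?andbT; last by move=> x _; exact: abse_ge0.
  rewrite (eq_integral (fun x => (f x - k)%:E)); last first.
   by move=> x; rewrite inE => /ltW Ex /=; rewrite ger0_norm// subr_ge0.
  by rewrite EFin_Rint.
 move=> [N [mN N0 sub]].
 apply/eqP; rewrite eq_le measure_ge0 andbT -N0; apply: le_measure; rewrite ?inE//.
 move=> x Ex; apply: sub => /= /(_ Ex) [] /eqP; rewrite subr_eq0 => /eqP fk.
 by move: Ex; rewrite /E/= fk ltxx.
exists (fun x => Num.min (f x) k); split.
- by apply: measurable_minr => //; exact: mcst.
- by move=> x; rewrite le_min f0 k0/= ge_min lexx orbT.
move=> p B mp pB.
have B0 (x : T) : 0 <= B by exact: le_trans (normr_ge0 _) (pB x).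
have gf (q : T -> R) : mfun setT q ->
  \int[m]_x (q x * f x) = \int[m]_x (q x * Num.min (f x) k).
 move=> mq; apply: Rint_ae => //.
 - exact: mfunM.
 - by apply: mfunM => //; apply: measurable_minr => //; exact: mcst.
 exists E; split => // x /=; apply: contra_notP => /negP; rewrite -leNgt => fk _.
 by rewrite min_l.
have mg : mfun setT (fun x => p x * f x) by exact: mfunM.
have pm : mfun setT (fun x => p x + B) by apply: measurable_funD => //; exact: mcst.
have p2 x : `|p x + B| <= B + B.
 by apply: le_trans (ler_normD _ _) _; rewrite lerD// ger0_norm// (B0 x).
have p0 x : 0 <= p x + B by rewrite -lerBlDr sub0r; have := pB x; rewrite ler_norml => /andP[].
have IpW : intR W setT p := intR_bounded measurableT Woo mp (fun x _ => pB x).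
have e1 := cov _ _ pm p2 p0.
have e2 : \int[W]_x B = \int[m]_x (B * f x).
 apply: (cov (fun=> B) B); first exact: mcst.
 - by move=> x; rewrite ger0_norm// (B0 x).
 - by move=> x; exact: B0.
have Ipf : intR m setT (fun x => p x * f x) by exact: (intRM measurableT mp (fun x _ => pB x) If).
rewrite -gf//; move: e1.
rewrite RintD//; last exact: intR_cst.
under [X in _ = X -> _]Rint_eq => x _ do rewrite mulrDl.
by rewrite RintD//; [rewrite e2 => /addIr|exact: intRZ].
Qed.

Lemma smooth_bounded {R : realType} {n : nat} (phi : 'rV[R]_n -> R) (D : set 'rV[R]_n) :
 bounded_set D -> smooth phi -> exists2 B : R, 0 <= B & forall x, D x -> `|phi x| <= B.
move=> bD sp; have [r r0 Dr] := bounded_sub_ball bD.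
have tc : test setT (fun x => cutoff (0 : 'rV[R]_n) r x * phi x).
 by apply: (testM _ sp); exact: test_cutoff.
have [B B0 hB] := test_bounded tc; exists B => // x Dx.
by have := hB x; rewrite cutoff1 ?mul1r//; exact: Dr.
Qed.

Lemma ae_mono {R : realType} d (T : measurableType d) (mu : {measure set T -> \bar R})
  (P Q : T -> Prop) : (forall x, P x -> Q x) -> {ae mu, forall x, P x} -> {ae mu, forall x, Q x}.
move=> PQ [N [mN N0 sub]]; exists N; split => // x nQ; apply: sub => /= Px.
by apply: nQ; exact: PQ.
Qed.

Lemma ae_mono2 {R : realType} d (T : measurableType d) (mu : {measure set T -> \bar R})
  (P P' Q : T -> Prop) : (forall x, P x -> P' x -> Q x) ->
 {ae mu, forall x, P x} -> {ae mu, forall x, P' x} -> {ae mu, forall x, Q x}.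
by move=> PQ; apply: filterS2 => x; exact: PQ. Qed.

Section bounded_pairing.
Context {R : realType} d (T : measurableType d) (mu : {measure set T -> \bar R}).
Variable D : set T.
Hypothesis mD : measurable D.
Context {p q : nat}.
Implicit Types h g : T -> 'M[R]_(p, q).

Lemma in_L1_enorm h : in_L mu D 1 h -> intR mu D (fun x => enorm (h x)).
move=> [mh hoo]; apply/integrableP; split.
 by apply/mEFinP; exact: enorm_meas.
apply: le_lt_trans hoo; rewrite le_eqVlt; apply/orP; left; apply/eqP.
by apply: eq_integral => x _; rewrite /= expr1 ger0_norm// enorm_ge0.
Qed.

Lemma mxdot_meas h g : mfun D h -> mfun D g ->
 mfun D (fun x => mxdot (h x) (g x)).
move=> /(meas_mxP mD) mh /(meas_mxP mD) mg.
apply: measurable_sum => i; apply: measurable_sum => j.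
exact: mfunM.
Qed.

Lemma mxdot_Linf h g (B : R) : 0 <= B -> in_L mu D 1 h -> mfun D g ->
 {ae mu, forall x, D x -> enorm (g x) <= B} ->
 intR mu D (fun x => mxdot (h x) (g x)) /\
 `|\int[mu]_(x in D) mxdot (h x) (g x)| <= B * \int[mu]_(x in D) enorm (h x).
move=> B0 h1 mg gB; have Ih := in_L1_enorm h1; have [mh _] := h1.
have mhg := mxdot_meas mh mg.
have IBh := intRZ mD B Ih.
have le : (\int[mu]_(x in D) `|(mxdot (h x) (g x))%:E| <= \int[mu]_(x in D) `|(B * enorm (h x))%:E|)%E.
 apply: ae_ge0_le_integral => //.
 - by apply: mcomp => //; exact/mEFinP.
 - by apply: mcomp => //; exact: measurable_int IBh.
 - apply: filterS gB => x gx Dx; rewrite lee_fin.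
  apply: le_trans (CS_norm _ _) _; apply: le_trans (ler_norm _).
  by rewrite mulrC ler_wpM2r// ?enorm_ge0// gx.
have Ihg : intR mu D (fun x => mxdot (h x) (g x)).
 apply/integrableP; split; first exact/mEFinP.
 by apply: le_lt_trans le _; have /integrableP[] := IBh.
split => //; apply: le_trans (Rint_norm mD Ihg) _.
rewrite -(RintZ mD B Ih) -lee_fin -!EFin_Rint//; last exact: intR_norm.
apply: le_trans le _; rewrite le_eqVlt; apply/orP; left; apply/eqP.
by apply: eq_integral => x _; rewrite /= ger0_norm// mulr_ge0// enorm_ge0.
Qed.

End bounded_pairing.

Lemma ae_forall {R : realType} d (T : measurableType d) (mu : {measure set T -> \bar R})
  (I : finType) (P : I -> T -> Prop) : (forall i, {ae mu, forall x, P i x}) ->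
 {ae mu, forall x, forall i, P i x}.
by move=> h; exact: filter_forall. Qed.

Lemma cvg_norm_le {R : realType} (u : nat -> R) (l c : R) (N : nat) : u @ \oo --> l ->
 (forall k, (N <= k)%N -> `|u k| <= c) -> `|l| <= c.
move=> ul uc; apply/ler_addgt0Pr => e e0.
have /cvgrPdist_le/(_ e e0)[N' _ hN'] := ul.
have h1 := hN' (maxn N N') (leq_maxr _ _); have h2 := uc (maxn N N') (leq_maxl _ _).
rewrite -(subrK (u (maxn N N')) l) addrC; apply: le_trans (ler_normD _ _) _.
exact: lerD.
Qed.

(** * Fatou's lemma and completeness of L^2 *)

Section fatou_le.
Context {R : realType}.
Local Open Scope ereal_scope.

Lemma lee_real_approx (l L : \bar R) : (forall a : R, a%:E < l -> a%:E <= L) -> l <= L.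
case: l => [r||] h; last by rewrite leNye.
- apply/lee_subgt0Pr => e e0; apply: h.
 by rewrite lte_fin ltrBlDr ltrDl.
- case: L h => [s||] h; first 1 last.
 + by rewrite leey.
 + by have := h 0%R (ltry _).
 + have := h (s + 1)%R (ltry _); rewrite lee_fin.
  by rewrite gerDl ler10.
Qed.

Lemma limn_einf_ge (u : nat -> \bar R) (l : \bar R) :
 (forall a : R, a%:E < l -> exists N, forall k, (N <= k)%N -> a%:E <= u k) ->
 l <= limn_einf u.
move=> h; rewrite limn_einf_lim; apply: lee_real_approx => a /h[N hN].
apply: lime_ge; first exact: is_cvg_einfs.
exists N => // k /= Nk; apply: le_ereal_inf_tmp => _ [j /= kj <-].
by apply: hN; exact: leq_trans kj.
Qed.

Lemma limn_einf_le (u : nat -> \bar R) (c : R) :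
 (forall e : R, (0 < e)%R -> exists N, forall k, (N <= k)%N -> u k <= (c + e)%:E) ->
 limn_einf u <= c%:E.
move=> h; rewrite limn_einf_lim; apply/lee_addgt0Pr => e e0.
have [N hN] := h e e0.
apply: lime_le; first exact: is_cvg_einfs.
exists 0%N => // k /= _; apply: ereal_inf_le; exists (u (maxn k N)).
 by exists (maxn k N) => //=; exact: leq_maxl.
by rewrite -EFinD; apply: hN; exact: leq_maxr.
Qed.

Context d (T : measurableType d) (mu : {measure set T -> \bar R}) (D : set T).
Hypothesis mD : measurable D.

(** A form of Fatou's lemma fit for the conjugate: g may be infinite, so lower semicontinuity is
    expressed through the real levels below it. *)
Lemma fatou_le (g_ : nat -> T -> \bar R) (g : T -> \bar R) (c_ : nat -> R) (c : R) :
 (forall k, mfun D (g_ k)) -> mfun D g ->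
 (forall k x, D x -> 0 <= g_ k x) -> (forall x, D x -> 0 <= g x) ->
 {ae mu, forall x, D x -> forall a : R, a%:E < g x ->
  exists N, forall k, (N <= k)%N -> a%:E <= g_ k x} ->
 (forall k, \int[mu]_(x in D) g_ k x <= (c_ k)%:E) -> c_ @ \oo --> c ->
 \int[mu]_(x in D) g x <= c%:E.
move=> mg_ mg g_0 g0 ae ic cc.
have lim0 x : D x -> 0 <= limn_einf (g_ ^~ x).
 move=> Dx; apply: limn_einf_ge => a a0; exists 0%N => k _.
 exact: le_trans (ltW a0) (g_0 k x Dx).
apply: (@le_trans _ _ (\int[mu]_(x in D) limn_einf (g_ ^~ x))).
 apply: ae_ge0_le_integral => //.
  rewrite /limn_einf; apply: mcomp => //.
  by apply: measurable_fun_limn_esup => k; apply: mcomp.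
 by apply: ae_mono ae => x h Dx; apply: limn_einf_ge; exact: h.
apply: le_trans (fatou mu mD mg_ g_0) _.
apply: limn_einf_le => e e0.
have /cvgrPdist_le/(_ e e0)[N _ hN] := cc.
exists N => k Nk; apply: le_trans (ic k) _; rewrite lee_fin.
by have := hN k Nk; rewrite ler_norml => /andP[+ _]; rewrite lerNl opprB lerBlDl.
Qed.

End fatou_le.

Section riesz_fischer.
Context {R : realType} d (T : measurableType d) (mu : {measure set T -> \bar R}) (D : set T).
Hypotheses (mD : measurable D) (Doo : (mu D < +oo)%E).

(** From |g| <= 2^k g^2 + 2^-k the increments have L^1 norms of order 2^-k, so their series
    converges absolutely almost everywhere. *)
Lemma fast_L2_cvg (v : nat -> T -> R) :
 (forall k, mfun D (v k)) ->
 (forall k, intR mu D (fun x => (v k.+1 x - v k x) ^+ 2)) ->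
 (forall k, \int[mu]_(x in D) (v k.+1 x - v k x) ^+ 2 <= 4 ^- k) ->
 {ae mu, forall x, D x -> cvgn (v ^~ x)}.
move=> mv Iv vk.
pose g k x : R := `|v k.+1 x - v k x|.
have mg k : mfun D (g k) by apply: mcomp => //; exact: mfunB.
have I1 k : intR mu D (fun x => 2 ^+ k * (v k.+1 x - v k x) ^+ 2 + 2 ^- k).
 by apply: (intRD mD); [exact: (intRZ mD)|exact: intR_cst].
have gk k : (\int[mu]_(x in D) (g k x)%:E <= ((1 + fine (mu D)) * 2 ^- k)%:E)%E.
 have le x : D x -> `|g k x| <= 2 ^+ k * (v k.+1 x - v k x) ^+ 2 + 2 ^- k.
  move=> _; rewrite /g normr_id.
  have p0 : 0 < 2 ^+ k :> R by rewrite exprn_gt0.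
  rewrite -(ler_pM2l p0) mulrDr divff ?gt_eqF// -[X in _ <= _ * (_ * X) + _]real_normK ?num_real//.
  set a := `|_|; have := sqr_ge0 (2 ^+ k * a - 1); have := mulr_ge0 (ltW p0) (normr_ge0 (v k.+1 x - v k x)).
  rewrite -/a; nra.
 have Ig := intR_le mD (mg k) (I1 k) le.
 rewrite (EFin_Rint mD Ig) lee_fin.
 apply: (@le_trans _ _ (\int[mu]_(x in D) (2 ^+ k * (v k.+1 x - v k x) ^+ 2 + 2 ^- k))).
  by apply: (Rint_le mD Ig (I1 k)) => x Dx; apply: le_trans (le x Dx); exact: ler_norm.
 rewrite (RintD mD (intRZ mD _ (Iv k)) (intR_cst mD _ Doo)) (RintZ mD _ (Iv k)) (Rint_cst _ mD).
 rewrite mulrDl mul1r [fine _ * _]mulrC lerD//.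
 apply: (@le_trans _ _ (2 ^+ k * 4 ^- k)); first by rewrite ler_wpM2l// exprn_ge0.
 by rewrite (_ : 4 = 2 * 2 :> R) ?exprMn ?invfM; [rewrite mulrA divff ?mul1r// expf_neq0|rewrite -natrM].
have g0 k x : D x -> (0 <= (g k x)%:E)%E by rewrite lee_fin /g.
have mEg k : mfun D (EFin \o g k) by exact/mEFinP.
have fin : (\int[mu]_(x in D) (\sum_(k <oo) (g k x)%:E) < +oo)%E.
 have h0 (k : nat) : xpredT k -> (0 <= \int[mu]_(x in D) (g k x)%:E)%E.
  by move=> _; apply: integral_ge0 => x Dx; exact: g0.
 have -> : (\int[mu]_(x in D) (\sum_(k <oo) (g k x)%:E) = \sum_(k <oo) \int[mu]_(x in D) (g k x)%:E)%E.
  exact: integral_nneseries.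
 have c0 : 0 < 2 * (1 + fine (mu D)) by rewrite mulr_gt0// ltr_pwDl// fine_ge0.
 apply: le_lt_trans (ltry (2 * (1 + fine (mu D)))); apply: le_trans (epsilon_trick0 xpredT (ltW c0)).
 apply: lee_nneseries => k _; first by move=> _; exact: h0.
 apply: le_trans (gk k) _; rewrite lee_fin.
 by rewrite le_eqVlt; apply/orP; left; apply/eqP; rewrite natrX exprS invfM; field; rewrite expf_neq0.
have Isum : mu.-integrable D (fun x => \sum_(k <oo) (g k x)%:E)%E.
 apply/integrableP; split; first by apply: ge0_emeasurable_sum; [move=> k x Dx _; exact: g0|move=> k _; exact: mEg].
 apply: le_lt_trans fin; rewrite le_eqVlt; apply/orP; left; apply/eqP.
 apply: eq_integral => x; rewrite inE => Dx; rewrite gee0_abs//.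
 by apply: nneseries_ge0 => k _ _; exact: g0.
apply: ae_mono (integrable_ae mD Isum) => x /[apply] fs.
have cv : cvgn (series (fun k => v k.+1 x - v k x)).
 apply: normed_cvg; apply: nondecreasing_is_cvgn.
  by apply: nondecreasing_series => k _ _; exact: normr_ge0.
 exists (fine (\sum_(k <oo) (g k x)%:E)) => _ [N _ <-].
 rewrite -lee_fin fineK// /series/= -sumEFin.
 by apply: (@nneseries_lim_ge _ (fun k => (g k x)%:E) xpredT 0 N) => k _ _; rewrite lee_fin /g.
have e : v ^~ x = (fun k => v 0%N x + series (fun k => v k.+1 x - v k x) k).
 by apply/funext => k; rewrite -(eq_sum_telescope (v ^~ x)).
by rewrite e; apply: is_cvgD => //; exact: is_cvg_cst.
Qed.

End riesz_fischer.

Section L2_fields.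
Context {R : realType} d (T : measurableType d) (mu : {measure set T -> \bar R}) (D : set T).
Hypotheses (mD : measurable D) (Doo : (mu D < +oo)%E).

Lemma L2_sqdiff (f g : T -> R) : mfun D f -> mfun D g ->
 intR mu D (fun x => f x ^+ 2) -> intR mu D (fun x => g x ^+ 2) ->
 intR mu D (fun x => (f x - g x) ^+ 2).
move=> mf mg If Ig.
apply: (intR_le mD (g := fun x => 2 * f x ^+ 2 + 2 * g x ^+ 2)).
- by apply: measurable_funX; exact: mfunB.
- by apply: (intRD mD); exact: (intRZ mD).
- move=> x _; rewrite ger0_norm ?sqr_ge0//.
 by have := sqr_ge0 (f x + g x); nra.
Qed.

Context {p q : nat}.
Implicit Types v w : T -> 'M[R]_(p, q).

Lemma in_L2_diff v w : in_L mu D 2 v -> in_L mu D 2 w -> in_L mu D 2 (fun x => v x - w x).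
move=> /(in_L2P mu mD) v2 /(in_L2P mu mD) w2; apply/(in_L2P mu mD) => i j.
have [a1 a2] := v2 i j; have [b1 b2] := w2 i j.
have E : (fun x => (v x - w x) i j) = fun x => v x i j - w x i j.
 by apply/funext => x; rewrite !mxE.
split; first by rewrite E; exact: mfunB.
by apply: (intR_eq mD _ (L2_sqdiff a1 b1 a2 b2)) => x _; rewrite !mxE.
Qed.

Lemma in_L2_sq v : in_L mu D 2 v -> intR mu D (fun x => mxdot (v x) (v x)).
move=> /(in_L2P mu mD) v2; apply: intR_mxdot => // i j.
by have [_] := v2 i j; apply: (intR_eq mD) => x _; rewrite expr2.
Qed.

Lemma sq_le_mxdot (M : 'M[R]_(p, q)) i j : M i j ^+ 2 <= mxdot M M.
rewrite -enorm_sqr -(real_normK (num_real (M i j))).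
by rewrite lerXn2r ?nnegrE ?enorm_ge0// coord_enorm.
Qed.

Lemma mxdot_cvg (u_ : nat -> 'M[R]_(p, q)) (u : 'M[R]_(p, q)) :
 (forall i j, (fun k => u_ k i j) @ \oo --> u i j) ->
 (fun k => mxdot (u_ k) (u_ k)) @ \oo --> mxdot u u.
move=> h; apply: cvg_bigsum => i.
apply: cvg_bigsum => j.
by apply: cvgM; exact: h.
Qed.

(** Riesz-Fischer. The subsequence is part of the conclusion because the conjugate needs convergence
    almost everywhere, while the L^2 convergence is that of the whole sequence. *)
Lemma L2_complete (v : nat -> T -> 'M[R]_(p, q)) :
 (forall k, in_L mu D 2 (v k)) ->
 (forall e : R, 0 < e -> exists N, forall k l, (N <= k)%N -> (N <= l)%N ->
  \int[mu]_(x in D) mxdot (v k x - v l x) (v k x - v l x) <= e) ->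
 exists w (s : nat -> nat), [/\ in_L mu D 2 w, forall k, (k <= s k)%N,
  {ae mu, forall x, D x -> forall i j, (fun k => v (s k) x i j) @ \oo --> w x i j} &
  forall e : R, 0 < e -> exists N, forall k, (N <= k)%N ->
   \int[mu]_(x in D) mxdot (v k x - w x) (v k x - w x) <= e].
move=> v2 cau.
have vc k i j := (in_L2P mu mD (v k)).1 (v2 k) i j.
have p4 k : 0 < 4 ^- k :> R by rewrite invr_gt0 exprn_gt0.
have /choice[t ht] := fun k : nat => cau _ (p4 k).
(* This makes s monotone and at least both t k and k. *)
pose s k := (\sum_(j < k.+1) t j + k)%N.
have st k : (t k <= s k)%N by rewrite /s big_ord_recr/= -addnA addnCA leq_addr.
have ss k : (s k <= s k.+1)%N.
 have -> : s k.+1 = (\sum_(j < k.+1) t j + t k.+1 + k.+1)%N by rewrite /s big_ord_recr.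
 by rewrite /s -addnA leq_add2l addnS leqW// leq_addl.
have fast i j : {ae mu, forall x, D x -> cvgn (fun k => v (s k) x i j)}.
 apply: (fast_L2_cvg mD Doo) => k.
 - by have [] := vc (s k) i j.
 - by have [a1 a2] := vc (s k.+1) i j; have [b1 b2] := vc (s k) i j; exact: L2_sqdiff.
 - apply: le_trans (ht k (s k.+1) (s k) (leq_trans (st k) (ss k)) (st k)).
  have [a1 a2] := vc (s k.+1) i j; have [b1 b2] := vc (s k) i j.
  apply: (Rint_le mD (L2_sqdiff a1 b1 a2 b2)).
   by apply: in_L2_sq; exact: in_L2_diff.
  by move=> x _; apply: le_trans (sq_le_mxdot _ i j); rewrite !mxE.
have [N [mN N0 subN]] := ae_forall (fun i => ae_forall (fast i)).
have cN x : D x -> ~ N x -> forall i j, cvgn (fun k => v (s k) x i j).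
 by move=> Dx nN i j; apply: contrapT => nc; apply: nN; apply: subN => /= /(_ i j Dx).
(* Setting the sequence to 0 on the null set N makes it converge everywhere on D, which yields
   measurability of the limit. *)
pose w x : 'M[R]_(p, q) := \matrix_(i, j) (limn (fun k => v (s k) x i j * \1_(~` N) x)).
have wc x : D x -> forall i j, (fun k => v (s k) x i j * \1_(~` N) x) @ \oo --> w x i j.
 move=> Dx i j; rewrite mxE; have [Nx|nN] := pselect (N x).
  have e0 : (fun k => v (s k) x i j * \1_(~` N) x) = fun=> 0.
   by apply/funext => k; rewrite indicE in_setC mem_set//= mulr0.
  by rewrite e0; apply: is_cvg_cst.
 have e1 : (fun k => v (s k) x i j * \1_(~` N) x) = fun k => v (s k) x i j.
  by apply/funext => k; rewrite indicE mem_set// mulr1.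
 by rewrite e1; exact: cN.
have wae x : D x -> ~ N x -> forall i j, (fun k => v (s k) x i j) @ \oo --> w x i j.
 move=> Dx nN i j; apply: cvg_ext (wc x Dx i j) => k.
 by rewrite indicE mem_set// mulr1.
have mw : mfun D w.
 apply/(meas_mxP mD) => i j.
 apply: (@measurable_fun_cvg _ _ _ D (fun k x => v (s k) x i j * \1_(~` N) x)).
  move=> k; apply: mfunM; first by have [] := vc (s k) i j.
  by apply: mfunTS; apply: meas_indic2; exact: measurableC.
 by move=> x Dx; exact: wc.
have aeN : {ae mu, forall x, D x -> ~ N x}.
 by exists N; split => // x /= /not_implyP[_ /contrapT].
have close (e : R) k M : (forall l, (M <= l)%N -> \int[mu]_(x in D) mxdot (v k x - v l x) (v k x - v l x) <= e) ->
  (\int[mu]_(x in D) (mxdot (v k x - w x) (v k x - w x))%:E <= e%:E)%E.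
 move=> h; apply: (@fatou_le _ _ _ mu D mD (fun l x => (mxdot (v k x - v (s (l + M)%N) x) (v k x - v (s (l + M)%N) x))%:E) _ (fun=> e)).
 - by move=> l; exact: measurable_int (in_L2_sq (in_L2_diff (v2 k) (v2 _))).
 - have [mvk _] := v2 k.
  have md : mfun D (fun x => v k x - w x).
   apply/(meas_mxP mD) => i j.
   rewrite (_ : (fun x => _) = fun x => v k x i j - w x i j); last by apply/funext => x; rewrite !mxE.
   by apply: mfunB; [have [] := vc k i j|exact: ((meas_mxP mD w).1 mw)].
  by apply/mEFinP; exact: mxdot_meas.
 - by move=> l x _; rewrite lee_fin mxdot_ge0.
 - by move=> x _; rewrite lee_fin mxdot_ge0.
 - apply: ae_mono aeN => x nN Dx a; rewrite lte_fin => ag.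
  have cc : (fun l => mxdot (v k x - v (s (l + M)%N) x) (v k x - v (s (l + M)%N) x)) @ \oo --> mxdot (v k x - w x) (v k x - w x).
   apply: mxdot_cvg => i j.
   rewrite [X in _ --> X](_ : _ = v k x i j - w x i j); last by rewrite !mxE.
   apply: (cvg_ext (u := fun l => v k x i j - v (s (l + M)%N) x i j)); first by move=> l; rewrite !mxE.
   apply: cvgB; first exact: cvg_cst.
   have := wae x Dx (nN Dx) i j; rewrite -(cvg_shiftn M (fun l => v (s l) x i j)); exact.
  have [L _ hL] := cvgr_gt _ cc _ ag.
  by exists L => l Ll; rewrite lee_fin; apply: ltW; exact: hL.
 - move=> l; have I1 := in_L2_sq (in_L2_diff (v2 k) (v2 (s (l + M)%N))).
  rewrite (EFin_Rint mD I1) lee_fin; apply: h.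
  by rewrite (leq_trans (leq_addl l M))// /s leq_addl.
 - exact: cvg_cst.
have w2 : in_L mu D 2 w.
 have [M hM] := cau 1 ltr01.
 have c1 := close 1 M M (fun l Ml => hM M l (leqnn _) Ml).
 have d2 : in_L mu D 2 (fun x => v M x - w x).
  have [mvk _] := v2 M.
  split.
   apply/(meas_mxP mD) => i j.
   rewrite (_ : (fun x => _) = fun x => v M x i j - w x i j); last by apply/funext => x; rewrite !mxE.
   by apply: mfunB; [have [] := vc M i j|exact: ((meas_mxP mD w).1 mw)].
  apply: le_lt_trans (ltry 1); apply: le_trans c1.
  by under eq_integral => x _ do rewrite enorm_sqr.
 have := in_L2_diff (v2 M) d2; rewrite (_ : (fun x => _) = w)//.
 by apply/funext => x; rewrite opprB addrCA subrr addr0.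
exists w, s; split => //.
- by move=> k; rewrite /s leq_addl.
- by apply: ae_mono aeN => x nN Dx; apply: wae => //; exact: nN.
- move=> e e0; have [M hM] := cau e e0; exists M => k Mk.
 have := close e k M (fun l Ml => hM k l Mk Ml).
 by rewrite (EFin_Rint mD (in_L2_sq (in_L2_diff (v2 k) w2))).
Qed.

End L2_fields.

(** * The L^2 inner product and the arithmetic of near-minimisers *)

Section L2_inner_product.
Context {R : realType} d (T : measurableType d) (mu : {measure set T -> \bar R}) (D : set T).
Hypotheses (mD : measurable D).
Context {p q : nat}.
Implicit Types u v w g : T -> 'M[R]_(p, q).

Definition ip u v : R := \int[mu]_(x in D) mxdot (u x) (v x).

Lemma ip_intR u v : in_L mu D 2 u -> in_L mu D 2 v ->
 intR mu D (fun x => mxdot (u x) (v x)).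
move=> u2 v2; apply: (intR_mxdot mD) => i j.
have [m1 i1] := (in_L2P mu mD _).1 u2 i j; have [m2 i2] := (in_L2P mu mD _).1 v2 i j.
apply: (intR_le mD (g := fun x => u x i j ^+ 2 + v x i j ^+ 2)).
- exact: mfunM.
- exact: (intRD mD).
move=> x _; have := sqr_ge0 (u x i j - v x i j); have := sqr_ge0 (u x i j + v x i j).
by rewrite ler_norml => h1 h2; apply/andP; split; nra.
Qed.

Lemma in_L2_lin (a b : R) u v : in_L mu D 2 u -> in_L mu D 2 v ->
 in_L mu D 2 (fun x => a *: u x + b *: v x).
move=> v2 w2; apply/(in_L2P mu mD) => i j.
have [v1 v3] := (in_L2P mu mD _).1 v2 i j; have [w1 w3] := (in_L2P mu mD _).1 w2 i j.
have e x : (a *: u x + b *: v x) i j = a * u x i j + b * v x i j by rewrite !mxE.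
have mm : mfun D (fun x => (a *: u x + b *: v x) i j).
 rewrite (eq_fun e).
 by apply: measurable_funD; apply: mfunM => //; exact: mcst.
split => //.
apply: (intR_le mD (g := fun x => 2 * a ^+ 2 * u x i j ^+ 2 + 2 * b ^+ 2 * v x i j ^+ 2)).
- exact: measurable_funX.
- by apply: (intRD mD); exact: (intRZ mD).
- move=> x _; rewrite !mxE ger0_norm ?sqr_ge0//.
 have := sqr_ge0 (a * u x i j - b * v x i j); nra.
Qed.

Lemma ipC u v : ip u v = ip v u.
by apply: Rint_eq => x _; rewrite mxdotC. Qed.

Lemma ip_ge0 u : 0 <= ip u u.
by apply: Rint_ge0 => x _; rewrite -enorm_sqr sqr_ge0. Qed.

Lemma ip_linl (a b : R) u v g : in_L mu D 2 u -> in_L mu D 2 v -> in_L mu D 2 g ->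
 ip (fun x => a *: u x + b *: v x) g = a * ip u g + b * ip v g.
move=> u2 v2 g2; have Iu := ip_intR u2 g2; have Iv := ip_intR v2 g2.
rewrite /ip -(RintZ mD a Iu) -(RintZ mD b Iv) -(RintD mD (intRZ mD a Iu) (intRZ mD b Iv)).
by apply: Rint_eq => x _; rewrite mxdotDl !mxdotZl.
Qed.

Lemma ip_linr (a b : R) u v g : in_L mu D 2 u -> in_L mu D 2 v -> in_L mu D 2 g ->
 ip g (fun x => a *: u x + b *: v x) = a * ip g u + b * ip g v.
by move=> u2 v2 g2; rewrite ipC ip_linl// (ipC u) (ipC v). Qed.

Lemma ip_ae u u' v v' : in_L mu D 2 u -> in_L mu D 2 u' -> in_L mu D 2 v -> in_L mu D 2 v' ->
 {ae mu, forall x, D x -> u x = u' x} -> {ae mu, forall x, D x -> v x = v' x} ->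
 ip u v = ip u' v'.
move=> u2 u2' v2 v2' h h'; apply: (Rint_ae mD).
- exact: intR_meas (ip_intR u2 v2).
- exact: intR_meas (ip_intR u2' v2').
- by apply: ae_mono2 h h' => x e e' Dx; rewrite e// e'.
Qed.

Lemma ip_subr u v g : in_L mu D 2 u -> in_L mu D 2 v -> in_L mu D 2 g ->
 ip (fun x => u x - v x) g = ip u g - ip v g.
move=> u2 v2 g2; rewrite -[ip u g]mul1r -[- ip v g]mulN1r -ip_linl//.
by apply: Rint_eq => x _; rewrite scale1r scaleN1r.
Qed.

Lemma ip_sqr_sub u v : in_L mu D 2 u -> in_L mu D 2 v ->
 ip (fun x => u x - v x) (fun x => u x - v x) = ip u u - 2 * ip u v + ip v v.
move=> u2 v2; have w2 := in_L2_diff mD u2 v2.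
rewrite ip_subr// (ipC u) (ipC v) !ip_subr// (ipC v u); ring.
Qed.

Lemma ip_sqr_lin (a b : R) u v : in_L mu D 2 u -> in_L mu D 2 v ->
 ip (fun x => a *: u x + b *: v x) (fun x => a *: u x + b *: v x) =
 a ^+ 2 * ip u u + 2 * a * b * ip u v + b ^+ 2 * ip v v.
move=> u2 v2; have w2 := in_L2_lin a b u2 v2.
rewrite ip_linl// !ip_linr// (ipC v u); ring.
Qed.

Lemma ip_young u v (s : R) : 0 < s -> in_L mu D 2 u -> in_L mu D 2 v ->
 2 * `|ip u v| <= s * ip u u + s^-1 * ip v v.
move=> s0 u2 v2.
have h1 := ip_ge0 (fun x => s *: u x + 1 *: v x).
have h2 := ip_ge0 (fun x => s *: u x + (-1) *: v x).
rewrite ip_sqr_lin// in h1; rewrite ip_sqr_lin// in h2.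
have si : 0 < s^-1 by rewrite invr_gt0.
have e : s^-1 * (s ^+ 2 * ip u u) = s * ip u u by field; rewrite gt_eqF.
have e' : s^-1 * (s * ip u v) = ip u v by field; rewrite gt_eqF.
have := ler_wpM2l (ltW si) h1; have := ler_wpM2l (ltW si) h2.
move: e e'; move: (ip u u) (ip u v) (ip v v) => a b c e e'.
rewrite !mulr0 !mulrDr !e => g1 g2.
have -> : 2 * `|b| = `|2 * b| by rewrite normrM ger0_norm.
rewrite ler_norml; apply/andP; split; nra.
Qed.

Lemma ip_eq0 u : in_L mu D 2 u -> ip u u = 0 -> {ae mu, forall x, D x -> u x = 0}.
move=> u2 u0; have I := ip_intR u2 u2.
have := (ae_eq_integral_abs mu mD (measurable_int _ I)).1.
under eq_integral => x _ do rewrite /= ger0_norm -?enorm_sqr ?sqr_ge0// enorm_sqr.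
rewrite (EFin_Rint mD I) -/(ip u u) u0 => /(_ erefl).
by apply: ae_mono => x h Dx; apply: enorm_eq0; have /eqP := h Dx; rewrite /= eqe -enorm_sqr sqrf_eq0 => /eqP.
Qed.

Lemma ip_cvg (u_ : nat -> T -> 'M[R]_(p, q)) u g : (forall k, in_L mu D 2 (u_ k)) ->
 in_L mu D 2 u -> in_L mu D 2 g ->
 (fun k => ip (fun x => u_ k x - u x) (fun x => u_ k x - u x)) @ \oo --> (0 : R) ->
 (fun k => ip (u_ k) g) @ \oo --> ip u g.
move=> u2 v2 g2 c0; apply/cvgrPdist_le => e e0.
pose s := e^-1 * ip g g + e^-1.
have s0 : 0 < s by rewrite ltr_wpDl ?invr_gt0// mulr_ge0 ?ip_ge0// invr_ge0 ltW.
have h : s^-1 * ip g g <= e.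
 rewrite mulrC ler_pdivrMr// /s mulrDr mulrA divff ?gt_eqF// mul1r lerDl.
 by rewrite ltW.
have [N _ hN] := cvgr_le 0 c0 _ (divr_gt0 e0 s0).
exists N => // k Nk; rewrite distrC -ip_subr//.
have w2 := in_L2_diff mD (u2 k) v2.
have := ip_young s0 w2 g2; have := hN k Nk; rewrite /= => h1 h2.
have h3 : s * ip (fun x => u_ k x - u x) (fun x => u_ k x - u x) <= e.
 by rewrite mulrC -ler_pdivlMr.
move: h2 h3; lra.
Qed.

Lemma ip_sqr_cvg (u_ : nat -> T -> 'M[R]_(p, q)) u : (forall k, in_L mu D 2 (u_ k)) ->
 in_L mu D 2 u ->
 (fun k => ip (fun x => u_ k x - u x) (fun x => u_ k x - u x)) @ \oo --> (0 : R) ->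
 (fun k => ip (u_ k) (u_ k)) @ \oo --> ip u u.
move=> u2 v2 c0.
have e k : ip (u_ k) (u_ k) = ip (fun x => u_ k x - u x) (fun x => u_ k x - u x)
  + 2 * ip (u_ k) u - ip u u by rewrite ip_sqr_sub//; ring.
rewrite (eq_fun e) (_ : nbhs (ip u u) = nbhs (0 + 2 * ip u u - ip u u)); last by congr nbhs; ring.
apply: cvgB; last exact: cvg_cst.
by apply: cvgD => //; apply: cvgM; [exact: cvg_cst|exact: ip_cvg].
Qed.

End L2_inner_product.

(* In a uniformly convex situation a minimising sequence for a decreasing family of
 constraints is Cauchy. *)
Lemma minimizing_cauchy {R : realType} (I : Type) (P : nat -> I -> Prop) (Phi : I -> R)
  (dist : I -> I -> R) (B : R) :
 (forall k l z, (k <= l)%N -> P l z -> P k z) ->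
 (forall k z, P k z -> 0 <= Phi z) ->
 (forall k, exists2 z, P k z & Phi z <= B) ->
 (forall k z z', P k z -> P k z' ->
  exists2 w, P k w & 8 * Phi w + dist z z' <= 4 * (Phi z + Phi z')) ->
 exists z_ : nat -> I, [/\ forall k, P k (z_ k),
  forall k w, P k w -> Phi (z_ k) <= Phi w + k.+1%:R^-1 &
  forall e : R, 0 < e -> exists N, forall k l, (N <= k)%N -> (N <= l)%N ->
   dist (z_ k) (z_ l) <= e].
move=> mono ge0 bnd mid.
pose mset k := [set Phi z | z in P k]; pose inf_ k := inf (mset k).
have hi k : has_inf (mset k).
 split; first by have [z Pz _] := bnd k; exists (Phi z), z.
 by exists 0 => _ [z Pz <-]; exact: ge0 Pz.
have inf_le k z : P k z -> inf_ k <= Phi z.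
 by move=> Pz; apply: ge_inf; [exact: (hi k).2|exists z].
have /choice[z_ zP] : forall k, exists z, P k z /\ Phi z < inf_ k + k.+1%:R^-1.
 move=> k; have k0 : 0 < k.+1%:R^-1 :> R by rewrite invr_gt0.
 by have [_ [z Pz <-] h] := inf_adherent k0 (hi k); exists z.
have infB k : inf_ k <= B by have [z Pz h] := bnd k; exact: le_trans (inf_le _ _ Pz) h.
have inf_mono k l : (k <= l)%N -> inf_ k <= inf_ l.
 move=> kl; apply: lb_le_inf; first exact: (hi l).1.
 by move=> _ [z Pz <-]; apply: inf_le; exact: mono kl Pz.
exists z_; split.
- by move=> k; have [] := zP k.
- move=> k w Pw; have [_ h] := zP k; apply: ltW; apply: lt_le_trans h _.
 by rewrite lerD2r inf_le.
move=> e e0; have e16 : 0 < e / 16 by rewrite divr_gt0.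
have hs : has_sup (range inf_).
 by split; [exists (inf_ 0%N), 0%N|exists B => _ [k _ <-]].
have [_ [N1 _ <-] hN1] := sup_adherent e16 hs.
have [N2 hN2] : exists N2 : nat, forall k, (N2 <= k)%N -> k.+1%:R^-1 <= e / 16.
 have [N2 _ h] := cvgr_le 0 (@cvg_harmonic R) _ e16.
 by exists N2 => k Nk; exact: h.
pose N := maxn N1 N2; exists N => k l Nk Nl.
have [Pk hk] := zP k; have [Pl hl] := zP l.
have [w Pw hw] := mid N _ _ (mono _ _ _ Nk Pk) (mono _ _ _ Nl Pl).
have h1 := inf_le _ _ Pw.
have h2 : inf_ N1 <= inf_ N by exact: inf_mono (leq_maxl N1 N2).
have hsup j : inf_ j <= sup (range inf_) by apply: ub_le_sup; [exact: hs.2|exists j].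
have h3 := hN2 k (leq_trans (leq_maxr N1 N2) Nk).
have h4 := hN2 l (leq_trans (leq_maxr N1 N2) Nl).
have := lt_le_trans hk (lerD (hsup k) h3); have := lt_le_trans hl (lerD (hsup l) h4).
have := le_trans h2 h1; move: hw hN1; clear.
move: (sup _) (Phi _) (Phi _) (Phi _) (inf_ _) (dist _ _) => a b b' b'' c d'; lra.
Qed.

Lemma half01 {R : realType} : 0 <= (2^-1 : R) <= 1.
by apply/andP; split; lra. Qed.

(** d and d' are the defects of two near-minimisers, a, b, c the inner products of their residuals,
    e the energy of the midpoint, m the infimum and k the tolerance. *)
Lemma energy_midpoint {R : realType} (e d d' a b c k m : R) :
 e <= (1 - 2^-1) * d + 2^-1 * d' +
  2^-1 * ((1 - 2^-1) ^+ 2 * a + 2 * (1 - 2^-1) * 2^-1 * b + 2^-1 ^+ 2 * c) ->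
 m <= e -> d + 2^-1 * a <= m + k -> d' + 2^-1 * c <= m + k -> 0 <= a - 2 * b + c ->
 e <= m + k /\ a - 2 * b + c <= 8 * k.
by move=> *; split; lra. Qed.

(** After division by t the hypothesis reads a + t b >= 0; the t chosen below is too small for t |b|
    to compensate a negative a. *)
Lemma first_order_ge0 {R : realType} (a b : R) :
 (forall t, 0 <= t <= 1 -> 0 <= t * a + t ^+ 2 * b) -> 0 <= a.
move=> h; rewrite leNgt; apply/negP => a0.
pose t := - a / (`|b| - a + 1).
have p : 0 < `|b| - a + 1 by have := normr_ge0 b; lra.
have t0 : 0 < t by rewrite divr_gt0// oppr_gt0.
have t1 : t <= 1 by rewrite ler_pdivrMr// mul1r; have := normr_ge0 b; lra.
have tb : t * `|b| < - a.
 by rewrite /t mulrAC ltr_pdivrMr// ltr_pM2l ?oppr_gt0//; lra.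
have := h t; rewrite (ltW t0) t1 => /(_ isT); rewrite expr2 -mulrA -mulrDr pmulr_rge0//.
by have := ler_wpM2l (ltW t0) (ler_norm b); lra.
Qed.

Lemma parallelogram_le {R : realType} (a b c : R) : 0 <= a - 2 * b + c ->
 8 * ((1 - 2^-1) ^+ 2 * a + 2 * (1 - 2^-1) * 2^-1 * b + 2^-1 ^+ 2 * c) + (a - 2 * b + c) <=
 4 * (a + c).
lra. Qed.

(** * The space BV^A and smooth fields *)

Section boundary_value_problem.
Context {R : realType} {m n : nat}.
Local Notation V := 'rV[R]_n.
Local Notation leb := (lebesgue_rV n).
Local Notation field := (V -> 'rV[R]_m).
Local Notation mxfield := (V -> 'M[R]_(m, n)).
Local Notation bdfield := (surface_type R n -> 'rV[R]_m).
Variables (A : {linear 'M[R]_(m, n) -> 'M[R]_(m, n)}).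
Hypothesis A_sym : forall y y', mxdot (A y) y' = mxdot y (A y').
Hypothesis A_idem : forall y, A (A y) = A y.
Variable O : set V.
Hypotheses (oO : open O) (bO : bounded_set O) (n_gt0 : (0 < n)%N).
Hypothesis lO : lipschitz_boundary O.
Variable tr : field -> bdfield.
Hypothesis tr_trace : trace_operator A O tr.
Local Notation intO := (intR leb O).
Local Notation inL2 := (in_L leb O 2).
Local Notation X2 := (in_X2 O A).
Local Notation div := (wdiv O).
Local Notation BVA := (in_BVA O A).
Local Notation Avar := (Avariation O A).
Local Notation sn := (surface n).
Local Notation dO := (bd O).
Local Notation inLb := (in_L sn dO 1).
Local Notation "'∫' x , F" := (Rintegral leb O (fun x => F)%R)
 (at level 36, x name, F at level 36) : ring_scope.
Local Notation "'∫' x , F" := (integral leb O (fun x => F)%E)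
 (at level 36, x name, F at level 36) : ereal_scope.
Local Notation ipO := (ip leb O).
Let mO : measurable O := open_meas oO.
Let Ooo : (leb O < +oo)%E := leb_bounded mO bO.

Implicit Types (u w : field) (phi : V -> R).

Definition jac u (x : V) : 'M[R]_(m, n) := \matrix_(i, l) partial l (fun y => u y 0 i) x.

Definition Adist i j u phi : R := - ∫ x, (A (tensor (u x) (grad phi x)) i j).

Definition comps_L1 u := forall i, intO (fun x => u x 0 i).

Lemma comps_L1P u : in_L leb O 1 u <-> comps_L1 u.
split=> [/(in_L1P _ mO) h i|h]; first exact: h.
by apply/(in_L1P _ mO) => i j; rewrite (ord1 i); exact: h.
Qed.

Lemma A_entry (M : 'M[R]_(m, n)) i j : A M i j = mxdot (A (delta_mx i j)) M.
by rewrite A_sym mxdot_delta. Qed.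

Lemma A_intR i j (M : V -> 'M[R]_(m, n)) D : measurable D ->
 (forall k l, intR leb D (fun x => M x k l)) -> intR leb D (fun x => A (M x) i j).
move=> mD iM; rewrite (_ : (fun _ => _) = (fun x => \sum_k \sum_l A (delta_mx i j) k l * M x k l)).
 by apply: intR_sum => // k _; apply: intR_sum => // l _; exact: intRZ.
by apply/funext => x; rewrite A_entry.
Qed.

Lemma tensor_grad_intR u phi i j : comps_L1 u -> test O phi ->
 intO (fun x => tensor (u x) (grad phi x) i j).
move=> iu tp; rewrite (_ : (fun _ => _) = (fun x => partial j phi x * u x 0 i)).
 exact: (intR_testl oO (test_partial j tp) (iu i)).
by apply/funext => x; rewrite !mxE mulrC.
Qed.

Lemma Adist_intR u phi i j : comps_L1 u -> test O phi ->
 intO (fun x => A (tensor (u x) (grad phi x)) i j).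
by move=> iu tp; apply: A_intR => // k l; exact: tensor_grad_intR. Qed.

Lemma represents_AdiffP u mu : comps_L1 u ->
 represents_Adiff O A u mu <->
 (forall phi, test O phi -> forall i j, chint (mu i j) O phi = Adist i j u phi).
move=> iu; have E phi i j : test O phi ->
  (- ∫ x, (A (tensor (u x) (grad phi x)) i j)%:E)%E = (Adist i j u phi)%:E.
 by move=> tp; rewrite EFin_Rint//; exact: Adist_intR.
have F phi i j : test O phi -> charge_integral (mu i j) O (EFin \o phi) = (chint (mu i j) O phi)%:E.
 by move=> tp; have [M bp] := test_bmeas O tp; exact: chintE mO bp.
split=> h phi tp i j.
 by apply: EFin_inj; rewrite -F// -E//; exact: h.
by rewrite F// E// h.
Qed.

Lemma the_spec (T : Type) (x0 : T) (P : T -> Prop) : (exists x, P x) -> P (the x0 P).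
by rewrite /the; case: pselect => // h _; exact: (svalP (cid h)). Qed.

Lemma BVA_comps u : BVA u -> comps_L1 u.
by case=> /comps_L1P. Qed.

Lemma AdiffP u phi i j : BVA u -> test O phi ->
 chint (Adiff O A u i j) O phi = Adist i j u phi.
move=> bu tp; have [_ h] := bu.
have := the_spec (fun _ _ => czero : {charge set _ -> \bar R}) h.
by move/(represents_AdiffP _ (BVA_comps bu)); apply.
Qed.

Lemma tensor_gradD (v : 'rV[R]_m) (p q : V -> R) (x : V) : smooth p -> smooth q ->
 tensor v (grad (fun y => p y + q y) x) = tensor v (grad p x) + tensor v (grad q x).
by move=> sp sq; apply/matrixP => i j; rewrite !mxE partialD// mulrDr. Qed.

Lemma tensor_gradZ (v : 'rV[R]_m) c (p : V -> R) (x : V) : smooth p ->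
 tensor v (grad (fun y => c * p y) x) = c *: tensor v (grad p x).
by move=> sp; apply/matrixP => i j; rewrite !mxE partialZ// mulrCA. Qed.

(** The Riesz representation yields one charge for each entry of A Du. *)
Lemma BVA_bounded u (C : R) : comps_L1 u ->
 (forall i j p (M : R), test O p -> (forall x, `|p x| <= M) -> `|Adist i j u p| <= C * M) ->
 BVA u.
move=> iu hC; split; first exact/comps_L1P.
have /choice[nu hnu] : forall ij : 'I_m * 'I_n, exists nu : {charge set V -> \bar R},
  forall p, test O p -> chint nu O p = Adist ij.1 ij.2 u p.
 move=> [i j]; have [||_ [nu [_ _ _ h]]] := @riesz _ _ O (Adist i j u) C oO _ _ (hC i j).
 - move=> p q tp tq; rewrite /Adist -opprD -RintD//; [|exact: Adist_intR|exact: Adist_intR].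
  congr (- _); apply: Rint_eq => x _.
  by rewrite tensor_gradD; [rewrite linearD mxE|exact: test_smooth tp|exact: test_smooth tq].
 - move=> c p tp; rewrite /Adist mulrN -RintZ//; last exact: Adist_intR.
  congr (- _); apply: Rint_eq => x _.
  by rewrite tensor_gradZ; [rewrite linearZ mxE|exact: test_smooth tp].
 by exists nu => p tp; rewrite /chint (h p O tp mO).
exists (fun i j => nu (i, j)); apply/represents_AdiffP => // phi tp i j.
by rewrite (hnu (i, j)).
Qed.

Lemma Avar_fin u : BVA u -> Avar u \is a fin_num.
move=> bu; have /choice[B hB] : forall ij : 'I_m * 'I_n, exists B, 0 <= B /\
  forall f M, bmeas O f M -> `|chint (Adiff O A u ij.1 ij.2) O f| <= M * B.
 by move=> ij; have [B B0 h] := chint_bound (Adiff O A u ij.1 ij.2) mO; exists B.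
have ge0 : (0 <= Avar u)%E.
 have := @mx_var_ge _ _ _ _ _ (Adiff O A u) O mO (fun _ _ _ => 0) _ _.
 have -> : \sum_i \sum_j chint (Adiff O A u i j) O (fun=> 0) = 0.
  apply: big1 => i _; apply: big1 => j _; apply/eqP; rewrite -normr_le0.
  have [_ h] := hB (i, j); apply: le_trans (h _ 0 _) _; last by rewrite mul0r.
  by split => // x _; rewrite normr0.
 by apply => // x _; rewrite (_ : \matrix_(_, _) _ = 0) ?enorm0//; apply/matrixP => i j; rewrite !mxE.
rewrite ge0_fin_numE//; apply: le_lt_trans (ltry (\sum_i \sum_j B (i, j))).
apply: mx_var_le => // Psi tPsi Psi1; apply: ler_sum => i _; apply: ler_sum => j _.
apply: (le_trans (ler_norm _)); have [_ h] := hB (i, j); rewrite -[leRHS]mul1r; apply: h.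
split; first exact: test_meas (tPsi i j).
by move=> x _; apply: le_trans (Psi1 x); have := coord_enorm (\matrix_(i, j) Psi i j x) i j; rewrite mxE.
Qed.

Definition smooth_field u := forall i, smooth (fun x => u x 0 i).

Lemma smooth_intR phi (D : set V) : smooth phi -> measurable D -> bounded_set D -> intR leb D phi.
move=> sp mD bD; have [r r0 Dr] := bounded_sub_ball bD.
have tc : test setT (fun x => cutoff (0 : V) r x * phi x).
 by apply: (testM _ sp); exact: test_cutoff.
have := test_leb_intR mD tc; apply: (intR_eq mD) => x Dx.
by rewrite cutoff1 ?mul1r//; exact: Dr.
Qed.

Lemma Adist_smooth u phi i j : smooth_field u -> test O phi ->
 Adist i j u phi = ∫ x, (phi x * A (jac u x) i j).
move=> su tp; have iu k : intO (fun x => u x 0 k) by exact: smooth_intR.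
have iJ k l : intO (fun x => jac u x k l).
 rewrite (_ : (fun _ => _) = partial l (fun y => u y 0 k)); first by apply: smooth_intR => //; exact: sm_partial.
 by apply/funext => x; rewrite mxE.
have i1 := Adist_intR i j iu tp.
have i2 : intO (fun x => phi x * A (jac u x) i j).
 by apply: (intR_testl oO tp); exact: A_intR.
apply/eqP; rewrite /Adist -subr_eq0 -opprD oppr_eq0 -RintD//; apply/eqP.
pose a := A (delta_mx i j).
rewrite (@Rint_eq _ _ _ leb O _ (fun x => \sum_k \sum_l a k l * partial l (fun y => phi y * u y 0 k) x)); last first.
 move=> x _; rewrite !A_entry -/a mxdotC /mxdot mulr_sumr -big_split; apply: eq_bigr => k _ /=.
 rewrite mulr_sumr -big_split; apply: eq_bigr => l _ /=.
 rewrite partialM//; last exact: test_smooth tp.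
 by rewrite !mxE; ring.
have tpu k : test O (fun y => phi y * u y 0 k) by exact: testM tp (su k).
have ip k l := test_leb_intR mO (test_partial l (tpu k)).
rewrite Rint_sum//; last by move=> k _; apply: intR_sum => // l _; exact: intRZ.
apply: big1 => k _; rewrite Rint_sum//; last by move=> l _; exact: intRZ.
by apply: big1 => l _; rewrite RintZ// (test_int_partial l mO (@subset_refl _ _) (tpu k)) mulr0.
Qed.

Lemma smooth_field_C1 u : smooth_field u -> C1_closure O u.
move=> su; split.
 apply: continuous_subspaceT; apply: cont_mx => i j; rewrite (ord1 i).
 exact: smooth_cont.
exists (jac u); split.
 apply: continuous_subspaceT; apply: cont_mx => i j.
 rewrite (_ : (fun _ => _) = partial j (fun y => u y 0 i)); last by apply/funext => x; rewrite mxE.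
 by apply: smooth_cont; exact: sm_partial.
by move=> x _ i j; rewrite mxE; exact: smooth_isder.
Qed.

Lemma enorm_intR p q (M : V -> 'M[R]_(p, q)) : (forall i j, intO (fun x => M x i j)) ->
 intO (fun x => enorm (M x)).
move=> iM; apply: (@intR_le _ _ _ _ _ mO _ (fun x => \sum_i \sum_j `|M x i j|)).
- by apply: enorm_meas => //; apply/(meas_mxP mO) => i j; exact: intR_meas (iM i j).
- by apply: intR_sum => // i _; apply: intR_sum => // j _; exact: intR_norm.
- by move=> x _; rewrite ger0_norm ?enorm_ge0//; exact: enorm_le_sum.
Qed.

Lemma smooth_jac_intR u i j : smooth_field u -> intO (fun x => jac u x i j).
move=> su; rewrite (_ : (fun _ => _) = partial j (fun y => u y 0 i)); last by apply/funext => x; rewrite mxE.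
by apply: smooth_intR => //; exact: sm_partial.
Qed.

Lemma smooth_Ajac_intR u i j : smooth_field u -> intO (fun x => A (jac u x) i j).
by move=> su; apply: A_intR => // k l; exact: smooth_jac_intR. Qed.

Lemma smooth_field_L1 u : smooth_field u -> comps_L1 u.
by move=> su i; exact: smooth_intR. Qed.

Lemma smooth_BVA u : smooth_field u -> BVA u.
move=> su; have iJ i j := smooth_Ajac_intR i j su.
apply: (BVA_bounded (C := (\sum_i \sum_j ∫ x, `|A (jac u x) i j|))).
 exact: smooth_field_L1.
move=> i j p M tp pM; rewrite (Adist_smooth i j su tp).
have M0 : 0 <= M by apply: le_trans (pM 0).
apply: (@le_trans _ _ ((∫ x, `|A (jac u x) i j|) * M)); last first.
 rewrite ler_wpM2r// (bigD1 i)//= (bigD1 j)//= -addrA lerDl addr_ge0 ?sumr_ge0//.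
  by move=> *; exact: Rint_ge0.
 by move=> *; apply: sumr_ge0 => *; exact: Rint_ge0.
rewrite mulrC -RintZ//; last exact: intR_norm.
apply: Rint_norm_le => //; first exact: (intR_testl oO tp).
 by apply: intRZ => //; exact: intR_norm.
by move=> x _; rewrite normrM ler_wpM2r.
Qed.

Lemma sum_mxdot_int (Psi H : V -> 'M[R]_(m, n)) :
 (forall i j, intO (fun x => Psi x i j * H x i j)) ->
 \sum_i \sum_j ∫ x, (Psi x i j * H x i j) = ∫ x, mxdot (Psi x) (H x).
move=> h; rewrite /mxdot Rint_sum//; last by move=> i _; exact: intR_sum.
by apply: eq_bigr => i _; rewrite Rint_sum.
Qed.

Lemma smooth_chint_le u Psi : smooth_field u ->
 (forall i j, test O (Psi i j)) -> (forall x, enorm (\matrix_(i, j) Psi i j x) <= 1) ->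
 \sum_i \sum_j chint (Adiff O A u i j) O (Psi i j) =
  ∫ x, mxdot (\matrix_(i, j) Psi i j x) (A (jac u x)).
move=> su tPsi _; have bu := smooth_BVA su.
rewrite -sum_mxdot_int => [|i j].
 apply: eq_bigr => i _; apply: eq_bigr => j _.
 rewrite (AdiffP)// (Adist_smooth)//.
 by apply: Rint_eq => x _; rewrite mxE.
have := intR_testl oO (tPsi i j) (smooth_Ajac_intR i j su).
by congr intR; apply/funext => x; rewrite mxE.
Qed.

Lemma smooth_Avar u : smooth_field u ->
 (Avar u <= (∫ x, enorm (A (jac u x)))%:E)%E.
move=> su; apply: mx_var_le => // Psi tPsi Psi1; rewrite smooth_chint_le//.
have iJ i j := smooth_Ajac_intR i j su.
apply: Rint_le => //; [|exact: enorm_intR|].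
 apply: intR_mxdot => // i j; have := intR_testl oO (tPsi i j) (iJ i j).
 by congr intR; apply/funext => x; rewrite mxE.
move=> x _; apply: (le_trans (CS _ _)); rewrite -[leRHS]mul1r.
by rewrite ler_wpM2r ?enorm_ge0.
Qed.

(** * Variation of the smoothed fields *)

Section smooth_approximations.
Variable S : smoothing O.

Definition fapprox k w : field := fun x => \row_i sm_approx S k (fun y => w y 0 i) x.

Definition frem k w x : 'M[R]_(m, n) := \matrix_(i, l) sm_rem S l k (fun y => w y 0 i) x.

Lemma fapprox_comp k w i : (fun x => fapprox k w x 0 i) = sm_approx S k (fun y => w y 0 i).
by apply/funext => x; rewrite mxE. Qed.

Lemma fapprox_smooth k w : comps_L1 w -> smooth_field (fapprox k w).
by move=> iw i; rewrite fapprox_comp; exact: sm_approx_smooth. Qed.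

Lemma frem_intR k w i j : comps_L1 w -> intO (fun x => A (frem k w x) i j).
move=> iw; apply: A_intR => // p q; have := sm_rem_intR oO S q k (iw p).
by congr intR; apply/funext => x; rewrite mxE.
Qed.

Lemma fapprox_jac k w i j x : comps_L1 w -> O x ->
 A (jac (fapprox k w) x) i j = Adist i j w (sm_kernel S k x) + A (frem k w x) i j.
move=> iw Ox; have tK := sm_kernel_test S k Ox.
rewrite /Adist; have -> : ∫ y, A (tensor (w y) (grad (sm_kernel S k x) y)) i j =
  \sum_p \sum_q A (delta_mx i j) p q * ∫ y, (w y 0 p * partial q (sm_kernel S k x) y).
 have iK p q : intO (fun y => w y 0 p * partial q (sm_kernel S k x) y).
  have := intR_testl oO (test_partial q tK) (iw p).
  by congr intR; apply/funext => y; rewrite mulrC.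
 rewrite (@Rint_eq _ _ _ leb O _ (fun y => \sum_p \sum_q A (delta_mx i j) p q * (w y 0 p * partial q (sm_kernel S k x) y))).
  rewrite Rint_sum//; last by move=> p _; apply: intR_sum => // q _; exact: intRZ.
  apply: eq_bigr => p _; rewrite Rint_sum//; last by move=> q _; exact: intRZ.
  by apply: eq_bigr => q _; rewrite RintZ.
 move=> y _; rewrite (A_entry) /mxdot; apply: eq_bigr => p _; apply: eq_bigr => q _.
 by rewrite !mxE.
rewrite !(A_entry) /mxdot -sumrN -big_split; apply: eq_bigr => p _ /=.
rewrite -sumrN -big_split; apply: eq_bigr => q _ /=.
rewrite !mxE fapprox_comp (sm_approx_partial oO)//.
by ring.
Qed.

Lemma sm_kernel_meas k : mfun setT (fun z : V * V => sm_kernel S k z.1 z.2).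
apply: measurable_sum => j; have [d _ trh] := sm_rho_test S j k.
apply: (conv_meas_prod _ trh); exact: test_meas (sm_zeta_test S j).
Qed.

Lemma sm_kernel_bounded k : exists2 M, 0 <= M & forall x y, `|sm_kernel S k x y| <= M.
have /choice[B hB] : forall j : nat, exists B, 0 <= B /\ forall x y, `|sm_rho S j k (x + sm_shift S j k - y) * sm_zeta S j y| <= B.
 move=> j; have [d _ trh] := sm_rho_test S j k.
 have [M1 M10 h1] := test_bounded trh; have [M2 M20 h2] := test_bounded (sm_zeta_test S j).
 by exists (M1 * M2); split; [exact: mulr_ge0|move=> x y; rewrite normrM ler_pM].
exists (\sum_(j < sm_N S) B j) => [|x y]; first by apply: sumr_ge0 => j _; have [] := hB j.
by apply: (le_trans (ler_norm_sum _ _ _)); apply: ler_sum => j _; have [_] := hB j; exact.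
Qed.

Lemma sm_kernel_intx k y : intO (fun x => sm_kernel S k x y) /\
 ∫ x, sm_kernel S k x y <= 1.
have ir j : intR leb setT (fun x => sm_rho S j k (x + sm_shift S j k - y)) /\
  \int[leb]_x sm_rho S j k (x + sm_shift S j k - y) = 1.
 have [d _ [trh r0 r1]] := sm_rho_mollifier S j k.
 have [] := leb_int_shift (sm_shift S j k - y) (test_leb_intR measurableT trh).
 by rewrite r1 (_ : (fun x => _) = (fun x => sm_rho S j k (x + sm_shift S j k - y)))//;
  apply/funext => x; rewrite addrC addrA.
have ik j : intO (fun x => sm_rho S j k (x + sm_shift S j k - y) * sm_zeta S j y).
 have := intRZ mO (sm_zeta S j y) (intR_sub measurableT mO (@subsetT _ _) (ir j).1).
 by congr intR; apply/funext => x; rewrite mulrC.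
split; first by apply: intR_sum => // j _.
rewrite Rint_sum//; apply: le_trans (sm_zeta_le1 S y); apply: ler_sum => j _.
under eq_Rintegral do rewrite mulrC.
rewrite RintZ//; last exact: intR_sub (ir j).1.
rewrite -[leRHS]mulr1 ler_wpM2l ?sm_zeta_ge0// -(ir j).2; apply: Rint_le_sub => //.
 exact: (ir j).1.
by move=> x _; have [d _ [_ r0 _]] := sm_rho_mollifier S j k.
Qed.

(** Up to the remainder, A applied to the Jacobian at x is the charge A Dw integrated against the
    kernel of x; call it H. Its L^1 norm is its pairing with the unit field in direction H. Fubini
    moves that field onto the charge, averaged by the kernel into a field of norm at most 1. *)
Lemma fapprox_Avar_le k w : BVA w ->
 ∫ x, enorm (A (jac (fapprox k w) x)) <=
 fine (Avar w) + ∫ x, enorm (A (frem k w x)).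
move=> bw; have iw := BVA_comps bw; have sw := fapprox_smooth k iw.
have iJ i j := smooth_Ajac_intR i j sw; have iF i j := frem_intR k i j iw.
pose H x : 'M[R]_(m, n) := A (jac (fapprox k w) x) - A (frem k w x).
have iH i j : intO (fun x => H x i j).
 by have := intRB mO (iJ i j) (iF i j); congr intR; apply/funext => x; rewrite !mxE.
have HE i j x : O x -> H x i j = chint (Adiff O A w i j) O (sm_kernel S k x).
 move=> Ox; rewrite (AdiffP)//; last exact: sm_kernel_test.
 by rewrite !mxE fapprox_jac// addrK.
suff le : ∫ x, enorm (H x) <= fine (Avar w).
 apply: (@le_trans _ _ (∫ x, (enorm (H x) + enorm (A (frem k w x))))).
  apply: Rint_le => //; [exact: enorm_intR|by apply: intRD => //; exact: enorm_intR|].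
  move=> x _; rewrite -[in leLHS](subrK (A (frem k w x)) (A (jac _ _))).
  exact: enorm_tri.
 by rewrite RintD ?lerD2r//; exact: enorm_intR.
have mH : mfun O H by apply/(meas_mxP mO) => i j; exact: intR_meas (iH i j).
have meH : mfun O (fun x => enorm (H x)) := enorm_meas mO mH.
(* Zero where H vanishes, by the convention for the inverse of 0, and zero off [O]. *)
pose Psi i j := (fun x => (enorm (H x))^-1 * H x i j) \_ O.
have Psi1 i j x : `|Psi i j x| <= 1.
 rewrite /Psi patchE; case: ifP => _; last by rewrite normr0.
 rewrite normrM normfV (ger0_norm (enorm_ge0 _)).
 have [e0|e0] := eqVneq (enorm (H x)) 0; first by rewrite e0 invr0 mul0r.
 have e1 : 0 < enorm (H x) by rewrite lt_neqAle eq_sym e0 enorm_ge0.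
 by rewrite ler_pdivrMl// mulr1 coord_enorm.
have mPsi i j : mfun setT (Psi i j).
 apply/(measurable_restrictT _ mO); apply: mfunM; last exact: intR_meas (iH i j).
 exact: mcomp meas_invr meH.
have PsiH x : O x -> \sum_i \sum_j Psi i j x * H x i j = enorm (H x).
 move=> Ox; have [e0|e0] := eqVneq (enorm (H x)) 0.
  by rewrite e0 (enorm_eq0 e0); apply: big1 => i _; apply: big1 => j _; rewrite mxE mulr0.
 apply: (mulfI e0); rewrite -expr2 enorm_sqr /mxdot mulr_sumr; apply: eq_bigr => i _.
 rewrite mulr_sumr; apply: eq_bigr => j _.
 by rewrite /Psi patchE mem_set// mulrA mulVKf.
have [M M0 hM] := sm_kernel_bounded k.
pose F i j (z : V * V) := Psi i j z.1 * sm_kernel S k z.1 z.2.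
have mF i j : mfun setT (F i j).
 apply: mfunM; last exact: sm_kernel_meas.
 exact: mcomp (mPsi i j) measurable_fst.
have FM i j z : `|F i j z| <= M by rewrite normrM -[leRHS]mul1r ler_pM.
pose Phi i j y := ∫ x, F i j (x, y).
have iPH i j : intO (fun x => Psi i j x * H x i j).
 by apply: (@intRM _ _ _ _ _ mO _ _ 1) => //; exact: mfunTS.
have -> : ∫ x, enorm (H x) = \sum_i \sum_j chint (Adiff O A w i j) O (Phi i j).
 rewrite (@Rint_eq _ _ _ leb O _ (fun x => \sum_i \sum_j Psi i j x * H x i j)); last first.
  by move=> x Ox; rewrite PsiH.
 rewrite Rint_sum//; last by move=> i _; exact: intR_sum.
 apply: eq_bigr => i _; rewrite Rint_sum//; apply: eq_bigr => j _.
 rewrite /Phi -(chint_fubini _ mO mO Ooo (mF i j) (FM i j)); apply: Rint_eq => x Ox.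
 rewrite HE//; have [M' bK] := test_bmeas O (sm_kernel_test S k Ox).
 have := @chint_sum _ _ _ (Adiff O A w i j) O _ [:: tt] (fun=> Psi i j x) (fun=> sm_kernel S k x) (fun=> M') mO (fun=> bK).
 by rewrite big_seq1 => <-; congr chint; apply/funext => y; rewrite big_seq1.
rewrite -lee_fin fineK; last exact: Avar_fin bw.
apply: mx_var_ge => // [i j|y Oy].
 have mF' : mfun setT (fun z : V * V => F i j (z.2, z.1)).
  exact: mcomp (mF i j) (measurable_fun_pair measurable_snd measurable_fst).
 have [mh _] := fubini_inner1 mO Ooo mF' (fun z => FM i j (z.2, z.1)).
 exact: mfunTS mh.
set P := \matrix_(i, j) Phi i j y.
have [iK K1] := sm_kernel_intx k y.
(* |P|^2 is the integral over x of the pairing of P with the kernel times a field of norm at most 1;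
   the kernel has mass at most 1 in x. *)
suff : enorm P ^+ 2 <= enorm P.
 have := enorm_ge0 P; rewrite le_eqVlt => /predU1P[<-|p0]; first by rewrite ler01.
 by rewrite expr2 ger_pMr.
have iFy i j : intO (fun x => F i j (x, y)).
 apply: (@intR_bounded _ _ _ _ _ mO _ M) => //; apply: mfunTS.
 exact: mcomp (mF i j) (measurable_pair2 y).
rewrite enorm_sqr /mxdot.
have -> : \sum_i \sum_j P i j * P i j = ∫ x, (\sum_i \sum_j P i j * F i j (x, y)).
 rewrite Rint_sum//; last by move=> i _; apply: intR_sum => // j _; exact: intRZ.
 apply: eq_bigr => i _; rewrite Rint_sum//; last by move=> j _; exact: intRZ.
 by apply: eq_bigr => j _; rewrite RintZ// /P !mxE.
apply: (@le_trans _ _ (∫ x, (enorm P * sm_kernel S k x y))); last first.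
 by rewrite RintZ// -[leRHS]mulr1 ler_wpM2l ?enorm_ge0.
apply: Rint_le => //; [by apply: intR_sum => // i _; apply: intR_sum => // j _; exact: intRZ|exact: intRZ|].
move=> x Ox.
have -> : \sum_i \sum_j P i j * F i j (x, y) = (\sum_i \sum_j P i j * Psi i j x) * sm_kernel S k x y.
 rewrite mulr_suml; apply: eq_bigr => i _; rewrite mulr_suml; apply: eq_bigr => j _.
 by rewrite /F mulrA.
rewrite ler_wpM2r ?sm_kernel_ge0//.
have -> : \sum_i \sum_j P i j * Psi i j x = mxdot P ((enorm (H x))^-1 *: H x).
 apply: eq_bigr => i _; apply: eq_bigr => j _; congr (_ * _).
 by rewrite /Psi patchE mem_set// [RHS]mxE.
apply: (le_trans (CS _ _)); rewrite -[leRHS]mulr1 ler_wpM2l ?enorm_ge0//.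
rewrite enormZ normfV ger0_norm ?enorm_ge0//.
by have [->|e0] := eqVneq (enorm (H x)) 0; rewrite ?mulr0// mulVf.
Qed.

End smooth_approximations.

(** * Strict convergence of the smoothed fields *)

Section strict_limits.
Variable S : smoothing O.

Lemma L1_cvg_weak (v_ : nat -> V -> R) (v g : V -> R) (M : R) : (forall k, intO (v_ k)) ->
 intO v -> mfun O g -> (forall x, O x -> `|g x| <= M) -> 0 <= M ->
 (fun k => ∫ x, `|v_ k x - v x|) @ \oo --> 0 ->
 (fun k => ∫ x, (g x * v_ k x)) @ \oo --> ∫ x, (g x * v x).
move=> iv_ iv mg gM M0 c0; rewrite -[X in _ --> X]add0r.
have i1 k := intRM mO mg gM (iv_ k); have i2 := intRM mO mg gM iv.
have c1 : (fun k => ∫ x, (g x * v_ k x) - ∫ x, (g x * v x)) @ \oo --> 0.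
 apply: cvg0_squeeze; last by rewrite -(mulr0 M); exact: cvgM (cvg_cst M) c0.
 move=> k; rewrite -RintB// [leRHS](_ : _ = M * ∫ x, `|v_ k x - v x|)//.
 rewrite -RintZ//; last by apply: intR_norm => //; exact: intRB.
 apply: Rint_norm_le => //; first exact: intRB.
  by apply: intRZ => //; apply: intR_norm => //; exact: intRB.
 by move=> x Ox; rewrite -mulrBr normrM ler_wpM2r// gM.
by apply: cvg_ext (cvgD c1 (cvg_cst (∫ x, (g x * v x)))) => k; rewrite fctE subrK.
Qed.

Lemma enorm_int_cvg0 p q (M_ : nat -> V -> 'M[R]_(p, q)) :
 (forall k i j, intO (fun x => M_ k x i j)) ->
 (forall i j, (fun k => ∫ x, `|M_ k x i j|) @ \oo --> 0) ->
 (fun k => ∫ x, enorm (M_ k x)) @ \oo --> 0.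
move=> iM cM; apply: cvg0_squeeze; last first.
 apply: (@cvg0_sum _ _ (index_enum 'I_p) (fun i k => \sum_(j < q) ∫ x, `|M_ k x i j|)) => i.
 by apply: cvg0_sum => j.
move=> k; rewrite ger0_norm; last by apply: Rint_ge0 => x _; exact: enorm_ge0.
have ia i j : intO (fun x => `|M_ k x i j|) by exact: intR_norm.
under eq_bigr => i _ do rewrite -Rint_sum//.
rewrite -Rint_sum//; last by move=> i _; exact: intR_sum.
apply: Rint_le => //; first exact: enorm_intR.
 by apply: intR_sum => // i _; exact: intR_sum.
by move=> x _; exact: enorm_le_sum.
Qed.

Lemma fapprox_comp_cvg w i : comps_L1 w ->
 (fun k => ∫ x, `|fapprox S k w x 0 i - w x 0 i|) @ \oo --> 0.
move=> iw; apply: cvg_ext (sm_approx_cvg oO Ooo S (iw i)) => k.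
by apply: Rint_eq => x _; rewrite mxE.
Qed.

Lemma fapprox_L1 k w : comps_L1 w -> comps_L1 (fapprox S k w).
by move=> iw; apply: smooth_field_L1 => //; exact: fapprox_smooth. Qed.

Lemma fapprox_cvg w : comps_L1 w ->
 (fun k => ∫ x, (enorm (fapprox S k w x - w x))%:E)%E @ \oo --> 0%E.
move=> iw; have iw_ k := fapprox_L1 k iw.
have id k i j : intO (fun x => (fapprox S k w x - w x) i j).
 have := intRB mO (iw_ k j) (iw j); congr intR; apply/funext => x.
 by rewrite !mxE (ord1 i).
have c : (fun k => ∫ x, enorm (fapprox S k w x - w x)) @ \oo --> 0.
 apply: enorm_int_cvg0 => // i j; apply: cvg_ext (fapprox_comp_cvg j iw) => k.
 by apply: Rint_eq => x _; rewrite !mxE (ord1 i).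
rewrite (_ : (fun _ => _) = (fun k => (∫ x, enorm (fapprox S k w x - w x))%:E)).
 by apply: cvg_EFin => //; exact: nearW.
by apply/funext => k; rewrite EFin_Rint//; exact: enorm_intR.
Qed.

Lemma frem_cvg w : comps_L1 w ->
 (fun k => ∫ x, enorm (A (frem S k w x))) @ \oo --> 0.
move=> iw; apply: enorm_int_cvg0 => [k i j|i j]; first exact: frem_intR.
have ir k p q : intO (fun x => frem S k w x p q).
 by have := sm_rem_intR oO S q k (iw p); congr intR; apply/funext => x; rewrite mxE.
apply: cvg0_squeeze; last first.
 apply: (@cvg0_sum _ _ (index_enum 'I_m) (fun p k => \sum_(q < n) `|A (delta_mx i j) p q| * ∫ x, `|frem S k w x p q|)) => p.
 apply: cvg0_sum => q.
 rewrite -(mulr0 `|A (delta_mx i j) p q|); apply: cvgM; first exact: cvg_cst.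
 apply: cvg_ext (sm_rem_cvg oO Ooo S q (iw p)) => k.
 by apply: Rint_eq => x _; rewrite mxE.
move=> k; rewrite ger0_norm ?Rint_ge0//.
have iz p q : intO (fun x => `|A (delta_mx i j) p q| * `|frem S k w x p q|).
 by apply: intRZ => //; exact: intR_norm.
under eq_bigr => p _ do under eq_bigr => q _ do (rewrite -RintZ; [|by []|exact: intR_norm]).
under eq_bigr => p _ do rewrite -Rint_sum//.
rewrite -Rint_sum//; last by move=> p _; exact: intR_sum.
apply: Rint_le => //.
- by apply: intR_norm => //; exact: frem_intR.
- by apply: intR_sum => // p _; exact: intR_sum.
move=> x _; rewrite (A_entry) /mxdot; apply: (le_trans (ler_norm_sum _ _ _)).
apply: ler_sum => p _; apply: (le_trans (ler_norm_sum _ _ _)); apply: ler_sum => q _.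
by rewrite normrM.
Qed.

Lemma fapprox_Adist w phi i j : comps_L1 w -> test O phi ->
 (fun k => Adist i j (fapprox S k w) phi) @ \oo --> Adist i j w phi.
move=> iw tp.
have E u : comps_L1 u -> Adist i j u phi =
  - \sum_p \sum_q A (delta_mx i j) p q * ∫ x, (partial q phi x * u x 0 p).
 move=> iu; have ip p q : intO (fun x => partial q phi x * u x 0 p).
  exact: (intR_testl oO (test_partial q tp) (iu p)).
 rewrite /Adist; congr (- _).
 rewrite (@Rint_eq _ _ _ leb O _ (fun y => \sum_p \sum_q A (delta_mx i j) p q * (partial q phi y * u y 0 p))).
  rewrite Rint_sum//; last by move=> p _; apply: intR_sum => // q _; exact: intRZ.
  apply: eq_bigr => p _; rewrite Rint_sum//; last by move=> q _; exact: intRZ.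
  by apply: eq_bigr => q _; rewrite RintZ.
 move=> y _; rewrite (A_entry) /mxdot; apply: eq_bigr => p _; apply: eq_bigr => q _.
 by rewrite !mxE [u y _ _ * _]mulrC.
rewrite E//; apply: cvg_ext (fun k => esym (E _ (fapprox_L1 k iw))) _; apply: cvgN.
apply: cvg_bigsum => p.
apply: cvg_bigsum => q.
apply: cvgM; first exact: cvg_cst.
have [M M0 hM] := test_bounded (test_partial q tp).
apply: (@L1_cvg_weak (fun k x => fapprox S k w x 0 p) _ _ M) => //.
- by move=> k; exact: fapprox_L1.
- exact: test_meas (test_partial q tp).
- exact: fapprox_comp_cvg.
Qed.

Lemma fapprox_test_pairing w Psi : BVA w ->
 (forall i j, test O (Psi i j)) ->
 (fun k => ∫ x, mxdot (\matrix_(i, j) Psi i j x) (A (jac (fapprox S k w) x))) @ \oo -->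
 \sum_i \sum_j chint (Adiff O A w i j) O (Psi i j).
move=> bw tPsi; have iw := BVA_comps bw.
have E k : \sum_i \sum_j Adist i j (fapprox S k w) (Psi i j) =
  ∫ x, mxdot (\matrix_(i, j) Psi i j x) (A (jac (fapprox S k w) x)).
 have sw := fapprox_smooth S k iw.
 rewrite -sum_mxdot_int// => [|i j].
  apply: eq_bigr => i _; apply: eq_bigr => j _.
  rewrite (Adist_smooth)//.
  by apply: Rint_eq => x _; rewrite mxE.
 have := intR_testl oO (tPsi i j) (smooth_Ajac_intR i j sw).
 by congr intR; apply/funext => x; rewrite mxE.
apply: cvg_ext E _.
apply: cvg_bigsum => i.
apply: cvg_bigsum => j.
by rewrite (AdiffP)//; exact: fapprox_Adist.
Qed.

Lemma Avar_approx_test w (e : R) : BVA w -> 0 < e -> exists Psi : 'I_m -> 'I_n -> V -> R,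
 [/\ forall i j, test O (Psi i j), forall x, enorm (\matrix_(i, j) Psi i j x) <= 1 &
   fine (Avar w) - e < \sum_i \sum_j chint (Adiff O A w i j) O (Psi i j)].
move=> bw e0; apply: contrapT => h.
have fA := Avar_fin bw.
have : (Avar w <= (fine (Avar w) - e)%:E)%E.
 apply: mx_var_le => // Psi tPsi Psi1; rewrite leNgt; apply/negP => lt.
 by apply: h; exists Psi.
by rewrite -{1}(fineK fA) lee_fin; lra.
Qed.

(** A dual field supported in K captures the variation of w up to e/3. The approximations pair with
    it almost as well, while their total mass exceeds the variation of w by at most the remainder;
    so little mass is left outside K, uniformly in k. *)
Lemma fapprox_no_boundary_mass w (e : R) : BVA w -> 0 < e ->
 exists K, [/\ compact K, K `<=` O & exists N : nat, forall theta k, (N <= k)%N ->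
  test O theta -> (forall x, 0 <= theta x <= 1) -> (forall x, K x -> theta x = 1) ->
  ∫ x, ((1 - theta x) * enorm (A (jac (fapprox S k w) x))) <= e].
move=> bw e0; have e3 : 0 < e / 3 by rewrite divr_gt0.
have iw := BVA_comps bw.
have [Psi [tPsi Psi1 hPsi]] := Avar_approx_test bw e3.
have /choice[K hK] : forall ij : 'I_m * 'I_n, exists K, [/\ compact K, K `<=` O & forall x, ~ K x -> Psi ij.1 ij.2 x = 0].
 by move=> ij; have [_] := tPsi ij.1 ij.2.
exists (\big[setU/set0]_ij K ij); split.
- by elim/big_ind : _ => //; [exact: compact0|exact: compactU|move=> ij _; have [] := hK ij].
- by elim/big_ind : _ => [//|B C BO CO|ij _]; [rewrite subUset|have [] := hK ij].
have /cvgrPdist_lt/(_ _ e3) [N1 _ h1] := fapprox_test_pairing bw tPsi.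
have /cvgrPdist_lt/(_ _ e3) [N2 _ h2] := frem_cvg iw.
exists (maxn N1 N2) => theta k; rewrite geq_max => /andP[k1 k2] tth th01 thK.
have sw := fapprox_smooth S k iw; have iJ i j := smooth_Ajac_intR i j sw.
have := h1 k k1; have := h2 k k2; rewrite /= sub0r normrN ger0_norm; last first.
 by apply: Rint_ge0 => x _; exact: enorm_ge0.
set P := ∫ x, mxdot _ _; set Rm := ∫ x, enorm (A (frem _ _ _ _)).
move=> hR; rewrite ltr_norml => /andP[_ hP]; have hT := fapprox_Avar_le S k bw.
rewrite -/Rm in hT; set T := ∫ x, enorm (A (jac _ _)) in hT.
have iE := enorm_intR iJ.
have iPsi : intO (fun x => mxdot (\matrix_(i, j) Psi i j x) (A (jac (fapprox S k w) x))).
 apply: intR_mxdot => // i j; have := intR_testl oO (tPsi i j) (iJ i j).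
 by congr intR; apply/funext => x; rewrite mxE.
apply: (@le_trans _ _ (T - P)); last by move: hP hPsi hT hR; lra.
rewrite /T /P -RintB//.
have ith : intO (fun x => (1 - theta x) * enorm (A (jac (fapprox S k w) x))).
 apply: (@intRM _ _ _ _ _ mO _ _ 1) => //.
  by apply: mfunB => //; exact: test_meas tth.
 by move=> x _; have /andP[? ?] := th01 x; rewrite ger0_norm; lra.
apply: Rint_le => //; first exact: intRB.
move=> x Ox; set E := enorm (A _); have E0 : 0 <= E := enorm_ge0 _.
have [Kx|nK] := pselect ((\big[setU/set0]_ij K ij) x).
 rewrite thK// subrr mul0r subr_ge0; apply: (le_trans (CS _ _)).
 by rewrite -[leRHS]mul1r; exact: ler_wpM2r E0 _ _ (Psi1 x).
have -> : \matrix_(i, j) Psi i j x = 0.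
 apply/matrixP => i j; rewrite !mxE; have [_ _ h] := hK (i, j); apply: h => Kx; apply: nK.
 by rewrite (bigD1 (i, j))//=; left.
rewrite mxdotC mxdot0r subr0; have /andP[? ?] := th01 x.
by rewrite -[leRHS]mul1r ler_wpM2r// lerBlDr lerDl.
Qed.

Lemma fapprox_BVA k w : comps_L1 w -> BVA (fapprox S k w).
by move=> iw; apply: smooth_BVA => //; exact: fapprox_smooth. Qed.

(** [fapprox_Avar_le] is the upper bound; the lower bound comes from pairing with a nearly optimal
    dual field of w. *)
Lemma fapprox_Avar_cvg w : BVA w ->
 (fun k => Avar (fapprox S k w)) @ \oo --> Avar w.
move=> bw; have iw := BVA_comps bw; have bk k := fapprox_BVA k iw.
have fk k := Avar_fin (bk k); have fw := Avar_fin bw.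
rewrite -(fineK fw); apply: cvg_EFin_eq (fun k => esym (fineK (fk k))) _.
have arith (a b c d e : R) : a - e / 2 < c -> c - d <= e / 2 -> b <= a + e / 2 -> d <= b -> `|a - b| <= e.
 by move=> *; rewrite ler_norml; apply/andP; split; lra.
apply/cvgrPdist_le => e e0; have e2 : 0 < e / 2 by rewrite divr_gt0.
have [Psi [tPsi Psi1 hPsi]] := Avar_approx_test bw e2.
have /cvgrPdist_le/(_ _ e2) [N1 _ h1] := fapprox_test_pairing bw tPsi.
have /cvgrPdist_le/(_ _ e2) [N2 _ h2] := frem_cvg iw.
exists (maxn N1 N2) => // k /=; rewrite geq_max => /andP[k1 k2].
have := h1 k k1; have := h2 k k2; rewrite /= sub0r normrN ger0_norm; last first.
 by apply: Rint_ge0 => x _; exact: enorm_ge0.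
have sw := fapprox_smooth S k iw.
rewrite -(smooth_chint_le sw tPsi Psi1) => hR; rewrite ler_norml => /andP[_ hP].
have up : fine (Avar (fapprox S k w)) <= fine (Avar w) + e / 2.
 have := smooth_Avar sw; rewrite -(fineK (fk k)) lee_fin => h.
 apply: (le_trans h); apply: (le_trans (fapprox_Avar_le S k bw)).
 by rewrite lerD2l.
have low : \sum_i \sum_j chint (Adiff O A (fapprox S k w) i j) O (Psi i j) <=
  fine (Avar (fapprox S k w)).
 rewrite -lee_fin (fineK (fk k)); apply: mx_var_ge; [exact: mO| |].
  by move=> i j; exact: test_meas (tPsi i j).
 by move=> x _; exact: Psi1.
exact: arith hPsi hP up low.
Qed.

Lemma fapprox_partial_cvg w (G : V -> 'M[R]_(m, n)) i l : comps_L1 w ->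
 (forall p q, intO (fun x => G x p q)) -> is_weak_gradient O w G ->
 (fun k => ∫ x, `|jac (fapprox S k w) x i l - G x i l|) @ \oo --> 0.
move=> iw iG wG.
have E k x : O x -> jac (fapprox S k w) x i l - G x i l =
  (sm_approx S k (fun y => G y i l) x - G x i l) + sm_rem S l k (fun y => w y 0 i) x.
 move=> Ox; rewrite !mxE fapprox_comp (sm_approx_partial oO)//.
 have tK := sm_kernel_test S k Ox; have := wG _ tK i l.
 rewrite EFin_Rint//; last first.
  have := intR_testl oO (test_partial l tK) (iw i).
  by congr intR; apply/funext => y; rewrite mulrC.
 have iGK : intO (fun y => G y i l * sm_kernel S k x y).
  have := intR_testl oO tK (iG i l).
  by congr intR; apply/funext => y; rewrite mulrC.
 rewrite EFin_Rint// => -[->]; rewrite opprK addrAC; congr (_ - _ + _).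
 rewrite /sm_approx /conv -Rint_sum//.
  by apply: Rint_eq => y _; rewrite /sm_kernel mulr_sumr; apply: eq_bigr => j _; ring.
 move=> j _; have [d _ trh] := sm_rho_test S j k.
 exact: conv_intR trh (intR_testl oO (sm_zeta_test S j) (iG i l)).
have ia k := sm_approx_intR oO S k (iG i l); have ir k := sm_rem_intR oO S l k (iw i).
apply: cvg0_squeeze; last first.
 by rewrite -(addr0 0); exact: cvgD (sm_approx_cvg oO Ooo S (iG i l)) (sm_rem_cvg oO Ooo S l (iw i)).
move=> k; rewrite ger0_norm ?Rint_ge0// fctE -RintD//; [|by apply: intR_norm => //; exact: intRB|exact: intR_norm].
rewrite (@Rint_eq _ _ _ leb O _ (fun x => `|(sm_approx S k (fun y => G y i l) x - G x i l) + sm_rem S l k (fun y => w y 0 i) x|)); last first.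
 by move=> x Ox; rewrite E.
apply: Rint_le => //.
- by apply: intR_norm => //; apply: intRD => //; exact: intRB.
- by apply: intRD => //; [apply: intR_norm => //; exact: intRB|exact: intR_norm].
by move=> x _; exact: ler_normD.
Qed.

End strict_limits.

(** * The surface measure on the boundary *)

Lemma bdE : dO = closure O `\` O.
by rewrite /bd (interior_id O).1. Qed.

Lemma closed_bd : closed dO.
by rewrite bdE setDE; apply: closedI; [exact: closed_closure|exact: open_closedC].
Qed.

Lemma meas_bd : measurable dO.
by apply: closed_meas; exact: closed_bd. Qed.

Lemma surface_meas_bd : measurable (dO : set (surface_type R n)).
exact: borel_surface meas_bd. Qed.

Lemma surface_meas d (T : measurableType d) (f : V -> T) (D : set V) : measurable D ->
 mfun D f ->
 mfun (D : set (surface_type R n)) (f : surface_type R n -> T).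
by move=> mD mf _ B mB; exact: (@borel_surface R n _ (mf mD B mB)). Qed.

(** The surface measure restricted to the Borel sets, as its image under the identity, so that the
    results on Borel measures of R^n apply. *)
Definition borel_hd : {measure set V -> \bar R} :=
 measure_function_pushforward__canonical__measure_function_Measure
  sn (@meas_surface_id R n).

Definition bd_measure : {measure set V -> \bar R} := mrestr borel_hd meas_bd.

Lemma bd_measureE (B : set V) : bd_measure B = hausdorff n.-1 (B `&` dO).
by []. Qed.

Lemma integral_bd_ge0 (f : V -> \bar R) : mfun setT f ->
 (forall x, 0 <= f x)%E ->
 (\int[sn]_(x in dO) f x = \int[bd_measure]_x f x)%E.
move=> mf f0; rewrite integral_mrestr//.
have mf' : mfun dO f by exact: mfunTS.
have f0' : {in dO, forall x, (0 <= f x)%E} by move=> x _; exact: f0.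
exact/esym/(ge0_integral_pushforward (@meas_surface_id R n) sn meas_bd mf' f0').
Qed.

Lemma integral_bd (f : V -> \bar R) : mfun setT f ->
 (\int[sn]_(x in dO) f x = \int[bd_measure]_x f x)%E.
move=> mf; rewrite [LHS]integralE [RHS]integralE.
congr (_ - _)%E; apply: integral_bd_ge0 => //.
- exact: measurable_funepos.
- exact: measurable_funeneg.
Qed.

Lemma intR_bd (f : V -> R) : intR bd_measure setT f -> intR sn dO f.
move=> If; apply/integrableP.
have mf : mfun setT f by exact: intR_meas If.
split.
 apply/mEFinP; apply: surface_meas; first exact: meas_bd.
 exact: mfunTS.
move/integrableP : If => [_]; apply: le_lt_trans.
by rewrite (@integral_bd (fun x => `|(EFin \o f) x|)%E)//; apply: mcomp => //; exact/mEFinP.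
Qed.

Lemma Rint_bd (f : V -> R) : mfun setT f ->
 \int[sn]_(x in dO) f x = \int[bd_measure]_x f x.
by move=> mf; rewrite /Rintegral integral_bd//; exact/mEFinP. Qed.

Section finite_bd_measure.
Hypothesis bdoo : (sn dO < +oo)%E.

Lemma bd_measure_fin : (bd_measure setT < +oo)%E.
by rewrite bd_measureE setTI. Qed.

Lemma test_intR_bd U p : test U p -> intR sn dO p.
by move=> tp; apply: intR_bd; apply: (test_intR bd_measure_fin _ tp). Qed.

(** A set measurable for the surface measure need not be Borel; a Borel hull of equal measure takes
    its place, and [test_dense_L1] handles the hull. *)
Lemma test_dense_bd (h : surface_type R n -> R) (e : R) :
 intR sn dO h -> 0 < e ->
 exists2 p : V -> R, test setT p &
  \int[sn]_(x in dO) `|h x - p x| <= e.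
have mbd := surface_meas_bd.
move=> Ih e0; apply: (@L1_dense _ (surface_type R n) R sn _ mbd
 (test setT : set (V -> R))) => //.
- by move=> f g; exact: testD.
- by move=> c f; exact: testZ.
- exact: test0.
- by move=> f tf; exact: test_intR_bd tf.
move=> {h Ih e e0} E mE e e0.
have mEb : measurable (E `&` dO) by exact: measurableI.
have Eoo : (hausdorff n.-1 (E `&` dO) < +oo)%E.
 by apply: le_lt_trans bdoo; apply: le_outer_measure; exact: subIsetr.
have [B [mB EB HB]] := hd_borel_hull Eoo.
have I1B : intR bd_measure setT \1_B by apply: intR_indic => //; exact: bd_measure_fin.
have [p tp pe] := test_dense_L1 openT bd_measure_fin I1B e0.
exists p => //; apply: le_trans pe.
have Ip := test_intR_bd tp.
have m1 (X : set (surface_type R n)) : measurable X -> intR sn dO \1_X.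
 by move=> mX; apply: intR_indic.
have mBs : measurable (B : set (surface_type R n)) by exact: borel_surface.
apply: le_trans (L1_tri mbd (m1 _ mE) (m1 _ mBs) Ip) _.
rewrite [X in X + _](_ : _ = 0); last first.
 rewrite (_ : \int[_]_(x in _) _ = \int[sn]_(x in dO) \1_((B `\` E) : set (surface_type R n)) x).
  rewrite Rint_indic//; last exact: measurableD.
  rewrite (_ : _ `&` _ = (B `&` dO) `\` (E `&` dO)); last first.
   apply/seteqP; split => [x [[Bx nE] bx]|x [[Bx bx] nE]]; split => //.
    by move=> [].
   by split => // Ex; apply: nE.
  have mBb : measurable (B `&` dO : set (surface_type R n)) by exact: measurableI.
  rewrite (measureD mBb mEb).
   rewrite (setIidr (_ : E `&` dO `<=` B `&` dO)); last by move=> x [Ex bx]; split => //; apply: EB.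
   rewrite [X in fine X](_ : _ = 0%E)//.
   apply/eqP; rewrite eq_le; apply/andP; split.
    rewrite leeBlDr ?add0e.
     by apply: le_trans HB; apply: le_outer_measure; exact: subIsetl.
    by rewrite ge0_fin_numE//; exact: measure_ge0.
   rewrite leeBrDr ?add0e.
    by apply: le_outer_measure => y [Ey by_]; split => //; apply: EB.
   by rewrite ge0_fin_numE//; exact: measure_ge0.
  by apply: le_lt_trans Eoo; apply: le_trans HB; apply: le_outer_measure; exact: subIsetl.
 apply: Rint_eq => x bx; rewrite !indicE.
 have := EB x; rewrite in_setD.
 case: (boolP (x \in E)); rewrite ?inE => Ex; case: (boolP (x \in B)); rewrite ?inE => Bx //= h.
 - by rewrite subrr normr0.
 - by case: (negP Bx); rewrite inE; apply: h; split.
 - by rewrite sub0r normrN1.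
 - by rewrite subrr normr0.
rewrite add0r Rint_bd//; apply: mcomp => //; apply: mfunB.
 exact: meas_indic2.
exact: test_meas tp.
Qed.

End finite_bd_measure.

Let mB : measurable (dO : set (surface_type R n)) := surface_meas_bd.

Lemma int_cube_le (c : V) (r a : R) (g : V -> R) : 0 < r -> 0 <= a ->
 intO g -> (forall x, `|g x| <= a) -> (forall x, ~ cube c r x -> g x = 0) ->
 ∫ x, `|g x| <= a * (4 * r) ^+ n.
move=> r0 a0 Ig ga g0.
have mc : measurable (cube c r) by apply: compact_meas; exact: cube_compact.
have Ic : intO (\1_(cube c r) : V -> R) by exact: intR_indic.
have h : forall x, O x -> `|g x| <= a * \1_(cube c r) x.
 move=> x _; rewrite indicE; case: (boolP (x \in cube c r)); rewrite ?inE => cx.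
  by rewrite mulr1.
 by rewrite mulr0 g0 ?normr0// => /mem_set; rewrite (negbTE cx).
have := Rint_le mO (intR_norm Ig) (intRZ mO a Ic) h => /le_trans; apply.
rewrite RintZ// ler_wpM2l// Rint_indic//.
have : (leb (cube c r `&` O) <= ((4 * r) ^+ n)%:E)%E.
 apply: le_trans (leb_cube_le c r0).
 by apply: le_measure; rewrite ?inE//; exact: measurableI.
move=> le'; have fin : leb (cube c r `&` O) \is a fin_num.
 by rewrite ge0_fin_numE//; exact: le_lt_trans le' (ltry _).
by rewrite -lee_fin fineK.
Qed.

(** The function is 1 minus the product of the 1 - b_i, with b_i the cutoff of the i-th ball. The
    support of b_i has volume at most 8^n r^n and its derivatives are of order 1/r, whence the
    powers n and n - 1. *)
Lemma cover_cutoff : exists2 C : R, 0 <= C &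
 forall (s : seq nat) (x : nat -> V) (r : nat -> R), (forall i, i \in s -> 0 < r i) ->
 exists psi : V -> R, [/\ smooth psi, forall y, 0 <= psi y <= 1,
  forall i y, i \in s -> ball (x i) (r i) y -> psi y = 1,
  ∫ y, psi y <= C * \sum_(i <- s) r i ^+ n &
  forall j, ∫ y, `|partial j psi y| <= C * \sum_(i <- s) r i ^+ n.-1].
have [Cc Cc0 Cc1] := partial_cutoff_bound R n.
exists (8 ^+ n * (Cc + 1)); first by rewrite mulr_ge0// addr_ge0.
elim => [x r _|i s IH x r r0].
 exists (fun=> 0); split.
 - exact: smooth_cst.
 - by move=> y; rewrite lexx ler01.
 - by [].
 - by rewrite Rint0 big_nil mulr0.
 - move=> j; rewrite big_nil mulr0.
  by under Rint_eq => y _ do rewrite partial_cst normr0; rewrite Rint0.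
have ri : 0 < r i by apply: r0; rewrite mem_head.
have [psi [sp p01 p1 Ip Idp]] := IH x r (fun j js => r0 j (mem_behead (js : j \in behead (i :: s)))).
have sb := cutoff_smooth (x i) (r i).
set b := cutoff (x i) (r i) in sb *.
have b0 y : 0 <= b y by exact: cutoff_ge0.
have b1 y : b y <= 1 by exact: cutoff_le1.
have bcube y : ~ cube (x i) (2 * r i) y -> b y = 0.
 by move=> nc; apply: cutoff0 => // /ball_rVP[_ hb]; apply: nc => l; exact: ltW.
have r20 : 0 < 2 * r i by rewrite mulr_gt0.
have Ib : intO b by exact: smooth_intR.
have Idb j : intO (partial j b) by apply: smooth_intR bO; [exact: sm_partial|exact: mO].
have Ips : intO psi by exact: smooth_intR.
have Idps j : intO (partial j psi) by apply: smooth_intR bO; [exact: sm_partial|exact: mO].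
have Hb : ∫ y, `|b y| <= 1 * (4 * (2 * r i)) ^+ n.
 apply: (int_cube_le (c := x i)) => // y; first by rewrite ger0_norm.
have Hdb j : ∫ y, `|partial j b y| <= (Cc / r i) * (4 * (2 * r i)) ^+ n.
 apply: (int_cube_le (c := x i)) => //; first by rewrite divr_ge0// ltW.
  by move=> y; exact: Cc1.
 by move=> y; apply: partial_out => //; exact: cube_compact.
have e8 : (4 * (2 * r i)) ^+ n = 8 ^+ n * r i ^+ n.
 by rewrite mulrA exprMn; congr (_ ^+ _ * _); rewrite -natrM.
have sm1 : smooth (fun y => 1 - (1 - b y) * (1 - psi y)).
 apply: smoothB; first exact: smooth_cst.
 apply: smoothM; (apply: smoothB; first exact: smooth_cst); [exact: sb|exact: sp].
exists (fun y => 1 - (1 - b y) * (1 - psi y)); split.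
- exact: sm1.
- move=> y; have /andP[h1 h2] := p01 y.
 have : 0 <= (1 - b y) * (1 - psi y) by rewrite mulr_ge0// subr_ge0.
 have : (1 - b y) * (1 - psi y) <= 1 by rewrite mulr_ile1// ?subr_ge0// lerBlDr lerDl.
 by lra.
- move=> l y; rewrite inE => /orP[/eqP->|ls] hy.
  by rewrite /b cutoff1// subrr mul0r subr0.
 by rewrite (p1 l)// subrr mulr0 subr0.
- have h : forall y, O y -> 1 - (1 - b y) * (1 - psi y) <= `|b y| + psi y.
  move=> y _; have /andP[h1 h2] := p01 y; rewrite ger0_norm//.
  by have := mulr_ge0 (b0 y) h1; lra.
 have Il : intO (fun y => 1 - (1 - b y) * (1 - psi y)).
  by apply: smooth_intR bO; [exact: sm1|exact: mO].
 apply: le_trans (Rint_le mO Il (intRD mO (intR_norm Ib) Ips) h) _.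
 rewrite RintD//; last exact: intR_norm.
 rewrite big_cons mulrDr lerD//; apply: le_trans Hb _.
 rewrite mul1r e8 ler_wpM2r ?exprn_ge0 ?(ltW ri)//.
 by rewrite ler_peMr ?exprn_ge0// lerDr.
- move=> j.
 have pE y : partial j (fun y => 1 - (1 - b y) * (1 - psi y)) y =
   (1 - b y) * partial j psi y + (1 - psi y) * partial j b y.
  have s1 : smooth (fun y => 1 - b y) by exact: (smoothB (smooth_cst 1) sb).
  have s2 : smooth (fun y => 1 - psi y) by exact: (smoothB (smooth_cst 1) sp).
  rewrite (partialB _ _ (smooth_cst 1) (smoothM s1 s2)) (partialM _ _ s1 s2).
  rewrite (partialB _ _ (smooth_cst 1) sb) (partialB _ _ (smooth_cst 1) sp).
  by rewrite !partial_cst; ring.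
 have h : forall y, O y -> `|partial j (fun y => 1 - (1 - b y) * (1 - psi y)) y| <=
   `|partial j b y| + `|partial j psi y|.
  move=> y _; rewrite pE addrC; have /andP[h1 h2] := p01 y.
  apply: le_trans (ler_normD _ _) _; rewrite !normrM; apply: lerD.
   by rewrite ler_piMl// ger0_norm ?subr_ge0// lerBlDr lerDl.
  by rewrite ler_piMl// ger0_norm ?subr_ge0// lerBlDr lerDl.
 have Il : intO (fun y => `|partial j (fun y => 1 - (1 - b y) * (1 - psi y)) y|).
  by apply: intR_norm; apply: smooth_intR bO; [apply: sm_partial; exact: sm1|exact: mO].
 apply: le_trans (Rint_le mO Il (intRD mO (intR_norm (Idb j)) (intR_norm (Idps j))) h) _.
 rewrite RintD//; try exact: intR_norm.
 rewrite big_cons mulrDr lerD//; apply: le_trans (Hdb j) _.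
 rewrite e8 (_ : r i ^+ n = r i * r i ^+ n.-1); last by rewrite -exprS prednK.
 rewrite (_ : _ * _ = Cc * (8 ^+ n * r i ^+ n.-1)); last by field; exact: lt0r_neq0.
 rewrite mulrA ler_wpM2r ?exprn_ge0 ?(ltW ri)// mulrC ler_wpM2l ?exprn_ge0//.
 by rewrite lerDl.
Qed.

(** * The boundary flux and its density *)

Section boundary_flux.
Hypothesis bdoo : (sn dO < +oo)%E.

(** The weak normal trace of a vector field z, with d in the role of its divergence. *)
Definition flux (d : V -> R) (z : 'I_n -> V -> R) (phi : V -> R) : R :=
 ∫ x, (d x * phi x + \sum_j z j x * partial j phi x).

Definition flux_data (d : V -> R) (z : 'I_n -> V -> R) (M : R) : Prop :=
 [/\ intO d, intO (fun x => d x ^+ 2),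
   forall j, mfun O (z j) &
   forall j x, O x -> `|z j x| <= M].

Lemma intR_testr U d phi : intO d -> test U phi ->
 intO (fun x => d x * phi x).
move=> Id tp; apply: (intR_eq mO _ (intR_testl oO tp Id)) => x _; exact: mulrC.
Qed.

Lemma flux_intR d z M U phi : flux_data d z M -> test U phi ->
 intO (fun x => d x * phi x + \sum_j z j x * partial j phi x).
move=> [Id _ mz zM] tp; apply: (intRD mO); first exact: intR_testr tp.
apply: intR_sum => // j _; apply: (intRM mO (mz j) (zM j)).
exact: test_leb_intR mO (test_partial j tp).
Qed.

Lemma fluxD d z M U phi psi : flux_data d z M ->
 test U phi -> test U psi ->
 flux d z (fun x => phi x + psi x) = flux d z phi + flux d z psi.
move=> hd tp ts; rewrite /flux -(RintD mO (flux_intR hd tp) (flux_intR hd ts)).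
apply: Rint_eq => x _; rewrite mulrDr addrACA -big_split/=; congr (_ + _).
by apply: eq_bigr => j _; rewrite partialD ?mulrDr//; [exact: test_smooth tp|exact: test_smooth ts].
Qed.

Lemma fluxZ d z M U c phi : flux_data d z M -> test U phi ->
 flux d z (fun x => c * phi x) = c * flux d z phi.
move=> hd tp; rewrite /flux -(RintZ mO c (flux_intR hd tp)).
apply: Rint_eq => x _; rewrite mulrDr mulr_sumr; congr (_ + _); first by rewrite mulrCA.
by apply: eq_bigr => j _; rewrite partialZ ?(mulrCA c)//; exact: test_smooth tp.
Qed.

Lemma flux_ext d z phi psi : (forall x, O x -> phi x = psi x) ->
 flux d z phi = flux d z psi.
move=> e; apply: Rint_eq => x Ox; rewrite e//; congr (_ + _).
by apply: eq_bigr => j _; rewrite (partial_open j oO Ox e).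
Qed.

(** A flux that vanishes on test functions of [O] depends only on what happens near the boundary:
    phi may be multiplied by a cutoff psi of small balls covering its support in the boundary, and
    the gradient of psi has mass comparable to the Hausdorff measure of that part. *)
Lemma flux_le : exists2 C, 0 <= C & forall d z M, 0 <= M -> flux_data d z M ->
 (forall phi, test O phi -> flux d z phi = 0) ->
 forall U phi, test U phi -> (forall x, `|phi x| <= 1) ->
 flux d z phi <= C * M * fine (hausdorff n.-1 (U `&` dO)).
have [C1 C10 cover] := @hd_ball_cover R n n.-1.
have [C2 C20 cutoffs] := cover_cutoff.
exists (n%:R * (C2 * C1)); first by rewrite !mulr_ge0.
move=> d z M M0 hd fl0 U phi tp phi1.
have [Id Id2 mz zM] := hd.
have sp := test_smooth tp.
have [_ [K [cK KU K0]]] := tp.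
have Hfin : hausdorff n.-1 (U `&` dO) \is a fin_num.
 rewrite ge0_fin_numE ?outer_measure_ge0//; apply: le_lt_trans bdoo.
 by apply: le_outer_measure; exact: subIsetr.
set h := fine _.
have h0 : 0 <= h by apply: fine_ge0; exact: outer_measure_ge0.
have /choice[mm mP] : forall j, exists mm : R, forall x, `|partial j phi x| <= mm.
 by move=> j; have [mm _ hm] := test_bounded (test_partial j tp); exists mm.
have m0 j : 0 <= mm j by apply: le_trans (mP j 0).
pose S := \sum_j mm j.
have S0 : 0 <= S by apply: sumr_ge0.
pose D2 := ∫ x, d x ^+ 2.
have D20 : 0 <= D2 by apply: Rint_ge0 => x _; exact: sqr_ge0.
set C := n%:R * (C2 * C1).
have C0 : 0 <= C by rewrite /C !mulr_ge0.
suff key : forall eta, 0 < eta -> flux d z phi <= C * M * h + eta * (D2 + 1 + C * M).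
 apply/ler_addgt0Pr => e e0.
 have p0 : 0 < D2 + 1 + C * M by rewrite -addrA addrCA ltr_pwDl// addr_ge0// mulr_ge0.
 have /le_trans := key (e / (D2 + 1 + C * M)) (divr_gt0 e0 p0).
 by apply; rewrite divfK ?gt_eqF.
move=> eta eta0.
pose c := h + eta.
have c0 : 0 < c by rewrite /c ltr_wpDl.
pose a := C2 * C1 * c * (eta^-1 + M * S).
have a0 : 0 <= a by rewrite /a !mulr_ge0 ?addr_ge0 ?mulr_ge0 ?invr_ge0// ltW.
(* Balls this small have so little total volume that the terms containing psi itself, not its
   gradient, stay below eta. *)
pose dl := eta / (a + 1).
have dl0 : 0 < dl by rewrite divr_gt0// ltr_wpDl.
have cbd : closed dO by exact: closed_bd.
have cK' : compact (K `&` dO) by exact: compact_closedI.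
have HK : (hausdorff n.-1 (K `&` dO) < c%:E)%E.
 apply: (@le_lt_trans _ _ h%:E); last by rewrite lte_fin ltrDl.
 by rewrite fineK//; apply: le_outer_measure; exact: setSI.
have [s [x_ [r [r_ Kc sr]]]] := cover _ _ _ cK' HK dl0.
have r0 i : i \in s -> 0 < r i by move=> /r_/andP[].
have [psi [ss p01 p1 Ip Idp]] := cutoffs s x_ r r0.
have P_ : \sum_(i <- s) r i ^+ n <= dl * (C1 * c).
 apply: (@le_trans _ _ (dl * \sum_(i <- s) r i ^+ n.-1)); last by rewrite ler_wpM2l// ltW.
 rewrite mulr_sumr big_seq [leRHS]big_seq; apply: ler_sum => i /r_/andP[ri rd].
 by rewrite -{1}(prednK n_gt0) exprS ler_wpM2r// exprn_ge0// ltW.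
have s1 : smooth (fun x => 1 - psi x) := smoothB (smooth_cst 1) ss.
have t1 : test U (fun x => phi x * (1 - psi x)) := testM tp s1.
have t2 : test U (fun x => phi x * psi x) := testM tp ss.
(* On [O] this function agrees with one of compact support in [O], as psi is 1 on a neighbourhood of
   the support of phi in the boundary. *)
have fl1 : flux d z (fun x => phi x * (1 - psi x)) = 0.
 pose W := \bigcup_(i in [set` s]) ball (x_ i) (r i).
 have oW : open W by apply: bigcup_open => i /r0 ri; exact: ball_open.
 pose K2 := (K `&` closure O) `\` W.
 have cK2 : compact K2.
  apply: compact_closedI; last exact: open_closedC.
  by apply: compact_closedI => //; exact: closed_closure.
 have K2O : K2 `<=` O.
  move=> y [[Ky Oy] nW]; apply: contrapT => nO; apply: nW; apply: Kc; split=> //.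
  by rewrite bdE.
 have [th [tt _ th1]] := test_plateau cK2 oO K2O.
 have sphi1 := test_smooth t1.
 rewrite -(fl0 _ (testM tt sphi1)); apply: flux_ext => y Oy.
 have [K2y|nK2] := pselect (K2 y); first by rewrite th1// mul1r.
 rewrite [phi y * _](_ : _ = 0) ?mulr0//.
 have [Ky|nK] := pselect (K y); last by rewrite K0// mul0r.
 have [Wy|nW] := pselect (W y); last by case: nK2; split => //; split => //; exact: subset_closure.
 by have [i /= si bi] := Wy; rewrite (p1 i)// subrr mulr0.
have -> : flux d z phi = flux d z (fun x => phi x * psi x).
 rewrite -[RHS]addr0 -fl1 -(fluxD hd t2 t1); apply: flux_ext => y _; ring.
have Ipsi : intO psi by apply: smooth_intR bO; [exact: ss|exact: mO].
have Idpsi j : intO (fun y => `|partial j psi y|).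
 by apply: intR_norm; apply: smooth_intR bO; [exact: sm_partial|exact: mO].
(* d is only in L^2, so d phi psi is split into eta d^2 and psi / eta by Young's inequality. *)
pose G y := eta * d y ^+ 2 + ((eta^-1 + M * S) * psi y + M * \sum_j `|partial j psi y|).
have IG1 := intRZ mO eta Id2.
have IG2 := intRZ mO (eta^-1 + M * S) Ipsi.
have IG3 : intO (fun y => \sum_j `|partial j psi y|) by apply: intR_sum => // j _.
have IG4 := intRZ mO M IG3.
have IG : intO G := intRD mO IG1 (intRD mO IG2 IG4).
have le1 y : O y -> d y * (phi y * psi y) + \sum_j z j y * partial j (fun x => phi x * psi x) y <= G y.
 move=> Oy; have /andP[q0 q1] := p01 y.
 have hA : d y * (phi y * psi y) <= eta * d y ^+ 2 + eta^-1 * psi y.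
  have u1 : d y * (phi y * psi y) <= `|d y| * psi y.
   apply: le_trans (ler_norm _) _; rewrite normrM ler_wpM2l// normrM (ger0_norm q0).
   by rewrite ler_piMl.
  apply: le_trans u1 _.
  have u2 : 0 <= (eta * `|d y| - psi y) ^+ 2 by exact: sqr_ge0.
  have u3 : psi y ^+ 2 <= psi y by rewrite expr2 ler_piMr.
  rewrite -(@ler_pM2l _ eta)// mulrDr (mulrA eta eta^-1) divff ?gt_eqF// mul1r.
  have -> : eta * (eta * d y ^+ 2) = (eta * `|d y|) ^+ 2 by rewrite exprMn real_normK ?num_real// mulrA.
  have u4 : 0 <= (eta * `|d y|) ^+ 2 by exact: sqr_ge0.
  nra.
 have hB : \sum_j z j y * partial j (fun x => phi x * psi x) y <=
   M * S * psi y + M * \sum_j `|partial j psi y|.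
  rewrite /S -mulrA mulr_suml !mulr_sumr -big_split/=; apply: ler_sum => j _.
  rewrite (partialM _ _ sp ss); apply: le_trans (ler_norm _) _; rewrite normrM -mulrDr.
  apply: ler_pM => //; first exact: zM.
  apply: le_trans (ler_normD _ _) _; rewrite addrC !normrM (ger0_norm q0).
  apply: lerD; first by rewrite mulrC ler_wpM2r.
  by rewrite ler_piMl.
 by rewrite /G; move: hA hB; rewrite mulrDl; lra.
apply: le_trans (Rint_le mO (flux_intR hd t2) IG le1) _.
rewrite (RintD mO IG1 (intRD mO IG2 IG4)) (RintD mO IG2 IG4) !RintZ// -/D2.
have b3 : ∫ y, (\sum_j `|partial j psi y|) <= n%:R * (C2 * (C1 * c)).
 rewrite Rint_sum//; apply: (@le_trans _ _ (\sum_(j < n) C2 * (C1 * c))).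
  by apply: ler_sum => j _; apply: le_trans (Idp j) _; rewrite ler_wpM2l.
 by rewrite sumr_const card_ord mulr_natl.
have b2 : ∫ y, psi y <= C2 * (dl * (C1 * c)).
 by apply: le_trans Ip _; rewrite ler_wpM2l.
have b4 : (eta^-1 + M * S) * ∫ y, psi y <= eta.
 apply: (@le_trans _ _ ((eta^-1 + M * S) * (C2 * (dl * (C1 * c))))).
  by rewrite ler_wpM2l// addr_ge0 ?mulr_ge0 ?invr_ge0// ltW.
 have -> : (eta^-1 + M * S) * (C2 * (dl * (C1 * c))) = eta * (a / (a + 1)).
  by rewrite /dl /a; ring.
 by rewrite ler_piMr ?(ltW eta0)// ler_pdivrMr ?mul1r ?lerDl// ltr_wpDl.
have b5 : M * ∫ y, (\sum_j `|partial j psi y|) <= C * M * h + eta * (C * M).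
 apply: (@le_trans _ _ (M * (n%:R * (C2 * (C1 * c))))); first by rewrite ler_wpM2l.
 by rewrite /C /c le_eqVlt; apply/orP; left; apply/eqP; ring.
lra.
Qed.

End boundary_flux.

Section flux_density.
Hypothesis bdoo : (sn dO < +oo)%E.

(** [flux_le] bounds the variation measure of the flux by C M times the surface measure on open
    sets, hence on Borel sets. Both measures of [riesz_measures] then have bounded densities, with
    bounds C M and 2 C M, and the difference of the densities is at most 2 C M in absolute value. *)
Lemma flux_density : exists2 C, 0 <= C & forall d z M, 0 <= M -> flux_data d z M ->
 (forall phi, test O phi -> flux d z phi = 0) ->
 exists g : V -> R, [/\ mfun setT g, forall x, `|g x| <= C * M &
  forall phi, test setT phi ->
   flux d z phi = \int[sn]_(x in dO) (phi x * g x)].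
have [C C0 hC] := flux_le bdoo.
exists (2 * C); first by rewrite mulr_ge0.
move=> d z M M0 hd fl0.
have CM0 : 0 <= C * M by rewrite mulr_ge0.
pose H (U : set V) : R := fine (hausdorff n.-1 (U `&` dO)).
have H0 U : 0 <= H U by apply: fine_ge0; exact: outer_measure_ge0.
have HE U : (bd_measure U = (H U)%:E)%E.
 rewrite bd_measureE fineK// ge0_fin_numE ?outer_measure_ge0//; apply: le_lt_trans bdoo.
 by apply: le_outer_measure; exact: subIsetr.
have L1 U p : test U p -> (forall x, `|p x| <= 1) -> `|flux d z p| <= C * M * H U.
 move=> tp p1; rewrite ler_norml; apply/andP; split; last exact: hC.
 rewrite lerNl -mulN1r -(fluxZ (-1) hd tp); apply: hC => //; first exact: testZ.
 by move=> x; rewrite mulN1r normrN.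
have L0 p (B : R) : test setT p -> (forall x, `|p x| <= B) ->
  `|flux d z p| <= C * M * H setT * B.
 move=> tp pB; have := le_trans (normr_ge0 _) (pB 0); rewrite le_eqVlt => /orP[/eqP B0|B0].
  have p0 x : p x = 0 by apply/eqP; rewrite -normr_le0 B0.
  rewrite (_ : p = fun x => 0 * p x); last by apply/funext => x; rewrite p0 mulr0.
  by rewrite (fluxZ _ hd tp) mul0r normr0 -B0 mulr0.
 rewrite -ler_pdivrMr// -{1}(ger0_norm (ltW B0)) -normf_div.
 rewrite mulrC -(fluxZ B^-1 hd tp); apply: L1; first exact: testZ.
 by move=> x; rewrite normrM normfV (ger0_norm (ltW B0)) mulrC ler_pdivrMr// mul1r.
have [mu [W [mu1 mu2 Wmu fluxE]]] := riesz_measures openT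
 (fun p q tp tq => fluxD hd tp tq) (fun c p tp => fluxZ c hd tp) L0.
have bdfin : (bd_measure setT < +oo)%E by rewrite HE ltry.
have muH U : open U -> (mu U <= (C * M)%:E * bd_measure U)%E.
 move=> oU; rewrite HE -EFinM; apply: mu2 => // p; rewrite setIT => tp p1.
 exact: le_trans (ler_norm _) (L1 _ _ tp p1).
have muB := le_measure_open bdfin CM0 muH.
have WB B : measurable B -> (W B <= (2 * (C * M))%:E * bd_measure B)%E.
 move=> mBo; apply: le_trans (Wmu B mBo) _; rewrite EFinM -muleA.
 by rewrite lee_wpmul2l ?muB// lee_fin.
have [g [mg g01 gE]] := bounded_density bdfin CM0 muB.
have CM20 : 0 <= 2 * (C * M) by rewrite mulr_ge0.
have [g' [mg' g'01 g'E]] := bounded_density bdfin CM20 WB.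
have Ib (k : R) (f : V -> R) p : mfun setT f -> (forall x, 0 <= f x <= k) ->
  test setT p -> intR (bd_measure) setT (fun x => p x * f x).
 move=> mf f01 tp; have [B _ pB] := test_bounded tp.
 apply: (intRM measurableT (test_meas tp) (fun x _ => pB x)).
 apply: (intR_bounded measurableT bdfin mf (M := k)) => x _.
 by have /andP[? ?] := f01 x; rewrite ger0_norm.
exists (fun x => g' x - g x); split.
- exact: mfunB.
- move=> x; have /andP[a1 a2] := g01 x; have /andP[b1 b2] := g'01 x.
 rewrite ler_norml -mulrA; apply/andP; split; lra.
- move=> p tp; have [B _ pB] := test_bounded tp.
 have mp := test_meas (D := setT) tp.
 rewrite fluxE// (gE p B mp pB) (g'E p B mp pB).
 rewrite Rint_bd; last by apply: mfunM => //; exact: mfunB.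
 rewrite -(RintB measurableT (Ib _ _ _ mg' g'01 tp) (Ib _ _ _ mg g01 tp)).
 by apply: Rint_eq => x _; rewrite mulrBr.
Qed.

End flux_density.

(** * Admissible fields and their fluxes *)

Definition clip (M : R) (z : mxfield) : mxfield :=
 fun x => \matrix_(i, j) Num.max (- M) (Num.min (z x i j) M).

Definition ae_bounded (z : mxfield) (M : R) : Prop :=
 {ae leb, forall x, O x -> enorm (z x) <= M}.

Lemma clip_le M z x i j : 0 <= M -> `|clip M z x i j| <= M.
move=> M0; rewrite mxE ler_norml le_max lexx/= ge_max.
by rewrite (le_trans _ M0) ?oppr_le0//= ge_min lexx orbT.
Qed.

(** The bound on z holds almost everywhere only, while [flux_data] wants it everywhere; clipping
    changes z on a null set. *)
Lemma clip_ae M z : ae_bounded z M ->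
 {ae leb, forall x, O x -> clip M z x = z x}.
apply: filterS => x zM Ox; apply/matrixP => i j; rewrite mxE.
have := le_trans (coord_enorm (z x) i j) (zM Ox).
rewrite ler_norml => /andP[z1 z2].
by rewrite (min_l z2) max_r.
Qed.

Lemma clip_meas M z i j : mfun O z ->
 mfun O (fun x => clip M z x i j).
move=> /(meas_mxP mO)/(_ i j) mz; rewrite /clip.
rewrite (_ : (fun x => _) = (fun x => Num.max (- M) (Num.min (z x i j) M))).
 apply: measurable_maxr; first exact: mcst.
 by apply: measurable_minr => //; exact: mcst.
by apply/funext => x; rewrite mxE.
Qed.

Lemma X2_meas z i j : X2 z -> mfun O (fun x => z x i j).
by move=> [[mz _] _ _]; exact: (meas_mxP mO z).1. Qed.

Lemma X2_wdiv z : X2 z ->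
 inL2 (div z) /\ is_weak_div O z (div z).
by move=> [_ _ ex]; exact: (the_spec (fun _ => 0) ex).
Qed.

Lemma wdiv_L1 z i : X2 z -> intO (fun x => div z x 0 i).
move=> /X2_wdiv[L2 _]; exact: ((in_L1P leb mO _).1 (in_L2_L1 mO Ooo L2)).
Qed.

Lemma X2_intR z i j : X2 z -> intO (fun x => z x i j).
move=> [[mz [M hM]] _ _]; have mzc := (meas_mxP mO z).1 mz.
pose M' := Num.max M 0.
have hM' : ae_bounded z M' by apply: filterS hM => x h Ox; rewrite le_max h.
have M'0 : 0 <= M' by rewrite le_max lexx orbT.
have : intO (fun x => clip M' z x i j).
 by apply: (intR_bounded mO Ooo (clip_meas _ _ _ mz) (M := M')) => x _; exact: clip_le.
apply: (intR_ae mO) => //.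
by apply: filterS (clip_ae hM') => x h Ox; rewrite h.
Qed.

Definition divrow z (i : 'I_m) : V -> R := fun x => div z x 0 i.
Definition row_of (z : mxfield) (i : 'I_m) : 'I_n -> V -> R := fun j x => z x i j.

Lemma flux_ae d (z z' : 'I_n -> V -> R) phi : intO d -> smooth phi ->
 (forall j, mfun O (z j)) -> (forall j, mfun O (z' j)) ->
 {ae leb, forall x, O x -> forall j, z j x = z' j x} ->
 flux d z phi = flux d z' phi.
move=> Id sp mz mz' zz'.
have h (y : 'I_n -> V -> R) : (forall j, mfun O (y j)) ->
  mfun O (fun x => d x * phi x + \sum_j y j x * partial j phi x).
 move=> my; apply: measurable_funD.
  apply: mfunM; first exact: intR_meas Id.
  by apply: cont_meas; exact: smooth_cont.
 apply: measurable_sum => j; apply: mfunM => //.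
 by apply: cont_meas; apply: smooth_cont; exact: sm_partial.
apply: (Rint_ae mO (h _ mz) (h _ mz')).
apply: filterS zz' => x e Ox; congr (_ + _); apply: eq_bigr => j _; by rewrite e.
Qed.

Lemma X2_flux z M i : X2 z -> 0 <= M -> ae_bounded z M ->
 [/\ flux_data (divrow z i) (row_of (clip M z) i) M,
   forall phi, smooth phi -> flux (divrow z i) (row_of (clip M z) i) phi =
    flux (divrow z i) (row_of z i) phi &
   forall phi, test O phi ->
    flux (divrow z i) (row_of (clip M z) i) phi = 0].
move=> Xz M0 zM; have [[mz _] _ _] := Xz; have [L2 wd] := X2_wdiv Xz.
have fe phi : smooth phi -> flux (divrow z i) (row_of (clip M z) i) phi =
  flux (divrow z i) (row_of z i) phi.
 move=> sp; apply: flux_ae => //.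
 - exact: wdiv_L1.
 - by move=> j; exact: clip_meas.
 - by move=> j; exact: X2_meas.
 - by apply: filterS (clip_ae zM) => x e Ox j; rewrite /row_of e.
have hd : flux_data (divrow z i) (row_of (clip M z) i) M.
 split.
 - exact: wdiv_L1.
 - by have [_ h] := (in_L2P leb mO _).1 L2 0 i.
 - by move=> j; exact: clip_meas.
 - by move=> j x _; exact: clip_le.
split => // phi tp; rewrite fe; last exact: test_smooth tp.
have e := wd phi tp i.
have Id : intO (fun x => divrow z i x * phi x) by apply: intR_testr tp => //; exact: wdiv_L1.
have Iz : intO (fun x => \sum_j row_of z i j x * partial j phi x).
 apply: intR_sum => // j _; apply: intR_testr (test_partial j tp) => //; exact: X2_intR.
rewrite /flux (RintD mO Id Iz) {2}/Rintegral e fineN -/(Rintegral _ _ _).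
by rewrite subrr.
Qed.

Definition fluxm z (P : field) : R :=
 \sum_i flux (divrow z i) (row_of z i) (fun x => P x 0 i).

Lemma wdiv_mxdot_intR z (P : field) : X2 z ->
 inL2 P -> intO (fun x => mxdot (div z x) (P x)).
move=> Xz P2; have [L2 _] := X2_wdiv Xz.
apply: intR_mxdot => // i j.
have [m1 i1] := (in_L2P leb mO _).1 L2 i j; have [m2 i2] := (in_L2P leb mO _).1 P2 i j.
exact: intR_prod.
Qed.

Lemma X2_mxdot_intR z (G : mxfield) : X2 z ->
 (forall i j, intO (fun x => G x i j)) ->
 intO (fun x => mxdot (z x) (G x)).
move=> Xz IG; apply: intR_mxdot => // i j.
have [[mz [M hM]] _ _] := Xz.
pose M' := Num.max M 0.
have hM' : ae_bounded z M' by apply: filterS hM => x h Ox; rewrite le_max h.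
have M'0 : 0 <= M' by rewrite le_max lexx orbT.
have : intO (fun x => clip M' z x i j * G x i j).
 apply: (intRM mO (clip_meas _ _ _ mz) (M := M')) => // x _; exact: clip_le.
apply: (intR_ae mO).
 by apply: mfunM; [exact: X2_meas|exact: intR_meas (IG i j)].
by apply: filterS (clip_ae hM') => x h Ox; rewrite h.
Qed.

Lemma smooth_field_L2 (P : field) : smooth_field P -> inL2 P.
move=> sP; apply/(in_L2P leb mO) => i j; rewrite (ord1 i); split.
 by apply: cont_meas; exact: smooth_cont (sP j).
apply: smooth_intR bO; last exact: mO.
rewrite (_ : (fun x => _) = fun x => P x 0 j * P x 0 j); last by apply/funext => x; rewrite expr2.
exact: smoothM.
Qed.

Lemma fluxmE z (P : field) : X2 z -> smooth_field P ->
 fluxm z P = ∫ x, (mxdot (div z x) (P x) + mxdot (z x) (jac P x)).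
move=> Xz sP; rewrite /fluxm /flux -Rint_sum//.
 apply: Rint_eq => x _; rewrite big_split/=; congr (_ + _).
  by rewrite /mxdot big_ord1.
 by apply: eq_bigr => i _; apply: eq_bigr => j _; rewrite mxE.
move=> i _; apply: (intRD mO).
 have [L2 _] := X2_wdiv Xz.
 have [m1 i1] := (in_L2P leb mO _).1 L2 0 i.
 have [m2 i2] := (in_L2P leb mO _).1 (smooth_field_L2 sP) 0 i.
 exact: intR_prod.
apply: intR_sum => // j _.
have [B _ pB] : exists2 B, 0 <= B & forall x, O x -> `|partial j (fun x => P x 0 i) x| <= B.
 exact: smooth_bounded bO (sm_partial j (sP i)).
apply: (intR_eq mO (f := fun x => partial j (fun x => P x 0 i) x * row_of z i j x)).
 by move=> x _; rewrite mulrC.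
apply: (intRM mO _ pB); last exact: X2_intR.
by apply: cont_meas; apply: smooth_cont; exact: sm_partial.
Qed.

(** The field with all components 1 is smooth and equals its trace, which is integrable with
    constant positive norm. This takes m > 0; without components all pairings are 0 and m = 0 is
    treated apart. *)
Lemma bd_finite : (0 < m)%N -> (sn dO < +oo)%E.
move=> m_gt0; pose u : field := fun=> const_mx 1.
have su : smooth_field u by move=> i; rewrite (_ : (fun x => _) = fun=> 1); [exact: smooth_cst|apply/funext => x; rewrite mxE].
have [mu1 fin1] := trace_L1 tr_trace (smooth_BVA su).
have ae1 := trace_C1 tr_trace (smooth_field_C1 su).
pose c := enorm (const_mx 1 : 'rV[R]_m).
have c0 : 0 < c.
 rewrite lt_neqAle enorm_ge0 andbT; apply/eqP => /esym/enorm_eq0 /matrixP/(_ 0 (Ordinal m_gt0)).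
 by rewrite !mxE => /eqP; rewrite oner_eq0.
have : (\int[sn]_(x in dO) (cst c%:E x) < +oo)%E.
 apply: le_lt_trans fin1; apply: (ae_ge0_le_integral mB).
 - by move=> x _; rewrite lee_fin ltW.
 - exact: mcst.
 - by move=> x _; rewrite expr1 lee_fin enorm_ge0.
 - by apply/mEFinP; apply: measurable_funX; exact: (enorm_meas mB mu1).
 - by apply: ae_mono ae1 => x e bx; rewrite (e bx) expr1 lexx.
rewrite (integral_cst _ mB); case E : (sn dO) => [r| |].
- by move=> _; exact: ltry.
- by rewrite gt0_muley// lte_fin.
- by [].
Qed.

Section test_density.
Hypothesis bdoo : (sn dO < +oo)%E.

Lemma bd_plateau : exists2 chi : V -> R, test setT chi &
 forall x, closure O x -> chi x = 1.
by have [chi [tc _ c1]] := test_plateau (compact_closure bO) openT (fun x _ => I); exists chi.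
Qed.

Lemma smooth_intR_bd phi : smooth phi -> intR sn dO phi.
move=> sp; have [chi tc c1] := bd_plateau.
apply: (intR_eq mB _ (test_intR_bd bdoo (testM tc sp))) => x; rewrite bdE// => -[cx _].
by rewrite c1// mul1r.
Qed.

Lemma test_field_dense_bd (h : bdfield) (e : R) : inLb h -> 0 < e ->
 exists2 P : field, forall i, test setT (fun x => P x 0 i) &
  \int[sn]_(x in dO) enorm (h x - P x) <= e.
move=> h1 e0.
have hc := (in_L1P sn mB h).1 h1.
have e0' : 0 < e / m.+1%:R by rewrite divr_gt0.
have /choice[p hp] : forall i, exists p : V -> R, test setT p /\
  \int[sn]_(x in dO) `|h x 0 i - p x| <= e / m.+1%:R.
 by move=> i; have [p tp hp] := test_dense_bd bdoo (hc 0 i) e0'; exists p.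
pose P : field := fun x => \row_i p i x.
have PE i : (fun x => P x 0 i) = p i by apply/funext => x; rewrite mxE.
exists P; first by move=> i; rewrite PE; have [] := hp i.
have Ip i : intR sn dO (p i) by have [tp _] := hp i; exact: test_intR_bd tp.
have Id i : intR sn dO (fun x => `|h x 0 i - p i x|).
 by apply: intR_norm; exact: (intRB mB (hc 0 i) (Ip i)).
have IS : intR sn dO (fun x => \sum_i `|h x 0 i - p i x|) by exact: intR_sum.
have le x : enorm (h x - P x) <= \sum_i `|h x 0 i - p i x|.
 apply: le_trans (enorm_le_sum _) _; rewrite big_ord1; apply: ler_sum => i _.
 by rewrite !mxE.
have mP : mfun (dO : set (surface_type R n)) (fun x => h x - P x).
 apply/(meas_mxP mB) => i j; rewrite (ord1 i).
 rewrite (_ : (fun x => _) = fun x => h x 0 j - p j x); last by apply/funext => x; rewrite !mxE.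
 exact: intR_meas (intRB mB (hc 0 j) (Ip j)).
apply: (@le_trans _ _ (\int[sn]_(x in dO) \sum_i `|h x 0 i - p i x|)).
 apply: (Rint_le mB) => //; apply: (intR_le mB _ IS) => [|x _].
  exact: enorm_meas.
 by rewrite ger0_norm ?enorm_ge0.
rewrite Rint_sum//; apply: (@le_trans _ _ (\sum_(i < m) e / m.+1%:R)).
 by apply: ler_sum => i _; have [] := hp i.
rewrite sumr_const card_ord -[leLHS]mulr_natl mulrCA ler_piMr ?(ltW e0)// ler_pdivrMr// mul1r.
by rewrite ler_nat.
Qed.

(** Smooth fields need not have compact support; multiplying by a plateau function that is 1 on the
    closure changes neither side. *)
Lemma flux_density_field : exists2 C, 0 <= C & forall z M, X2 z -> 0 <= M ->
 ae_bounded z M ->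
 exists g : field, [/\ forall i, mfun setT (fun x => g x 0 i),
  forall i x, `|g x 0 i| <= C * M &
  forall P, smooth_field P ->
   fluxm z P = \int[sn]_(x in dO) mxdot (P x) (g x)].
have [C C0 hC] := flux_density bdoo.
exists C => // z M Xz M0 zM.
have /choice[g hg] : forall i, exists g : V -> R, [/\ mfun setT g,
  forall x, `|g x| <= C * M & forall phi, smooth phi ->
  flux (divrow z i) (row_of z i) phi =
   \int[sn]_(x in dO) (phi x * g x)].
 move=> i; have [hd fe f0] := X2_flux i Xz M0 zM.
 have [g [mg gM gE]] := hC _ _ _ M0 hd f0; exists g; split => // phi sp.
 have [chi tc c1] := bd_plateau.
 rewrite -fe// (flux_ext _ _ (psi := fun x => chi x * phi x)); last first.
  by move=> x Ox; rewrite c1 ?mul1r//; exact: subset_closure.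
 rewrite gE; last exact: testM.
 by apply: Rint_eq => x; rewrite bdE// => -[cx _]; rewrite c1// mul1r.
pose G : field := fun x => \row_i g i x.
have GE i : (fun x => G x 0 i) = g i by apply/funext => x; rewrite mxE.
exists G; split.
- by move=> i; rewrite GE; have [] := hg i.
- by move=> i x; rewrite mxE; have [_ + _] := hg i; apply.
- move=> P sP; rewrite /fluxm.
 under eq_bigr => i _ do (have [_ _ ->] := hg i; last exact: sP).
 rewrite -Rint_sum//.
  by apply: Rint_eq => x _; rewrite /mxdot big_ord1; apply: eq_bigr => i _; rewrite mxE.
 move=> i _; have [mg gM _] := hg i.
 apply: (intR_eq mB (f := fun x => g i x * P x 0 i)); first by move=> x _; rewrite mulrC.
 apply: (intRM mB _ (fun x _ => gM x)); last exact: smooth_intR_bd (sP i).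
 by apply: surface_meas; [exact: meas_bd|exact: mfunTS].
Qed.

End test_density.

Lemma weak_gradientE (phi : field) (G : mxfield) p i j :
 is_weak_gradient O phi G -> test O p ->
 ∫ x, (phi x 0 i * partial j p x) =
 - ∫ x, (G x i j * p x).
by move=> wG tp; rewrite /Rintegral (wG p tp i j) fineN. Qed.

Lemma W11_BVA (phi : field) (G : mxfield) : in_L leb O 1 phi -> in_L leb O 1 G ->
 is_weak_gradient O phi G -> BVA phi.
move=> /(comps_L1P) p1 /(in_L1P leb mO) G1 wG.
pose C (i : 'I_m) (j : 'I_n) : R := \sum_k \sum_l `|A (delta_mx i j) k l| * ∫ x, `|G x k l|.
have C0 i j : 0 <= C i j.
 by apply: sumr_ge0 => k _; apply: sumr_ge0 => l _; rewrite mulr_ge0// Rint_ge0.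
have CC i j : C i j <= \sum_i' \sum_j' C i' j'.
 rewrite (bigD1 i)//= (bigD1 j)//= -addrA lerDl addr_ge0//; first exact: sumr_ge0.
 by apply: sumr_ge0 => i' _; apply: sumr_ge0.
apply: (BVA_bounded (C := \sum_i \sum_j C i j) p1) => i j p M tp pM.
have M0 : 0 <= M by apply: le_trans (pM 0).
suff -> : Adist i j phi p = \sum_k \sum_l (A (delta_mx i j) k l * ∫ x, (G x k l * p x)).
 apply: (@le_trans _ _ (C i j * M)); last by rewrite ler_wpM2r.
 rewrite /C mulr_suml; apply: le_trans (ler_norm_sum _ _ _) _; apply: ler_sum => k _.
 rewrite mulr_suml; apply: le_trans (ler_norm_sum _ _ _) _; apply: ler_sum => l _.
 rewrite normrM -mulrA ler_wpM2l//.
 have Ip := intR_testr (G1 k l) tp.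
 rewrite mulrC -(RintZ mO M (intR_norm (G1 k l))).
 apply: Rint_norm_le => //; first by apply: (intRZ mO); exact: intR_norm.
 by move=> x _; rewrite normrM mulrC ler_wpM2r.
have It k l : intO (fun x => phi x 0 k * partial l p x).
 exact: intR_testr (p1 k) (test_partial l tp).
rewrite /Adist (@Rint_eq _ _ _ leb O _ (fun x => \sum_k \sum_l (A (delta_mx i j) k l * (phi x 0 k * partial l p x)))); last first.
 move=> x _; rewrite (A_entry) /mxdot; apply: eq_bigr => k _; apply: eq_bigr => l _.
 by rewrite !mxE.
rewrite Rint_sum//; last by move=> k _; apply: intR_sum => // l _; exact: intRZ.
rewrite -sumrN; apply: eq_bigr => k _; rewrite Rint_sum//; last by move=> l _; exact: intRZ.
rewrite -sumrN; apply: eq_bigr => l _; rewrite RintZ// (weak_gradientE _ _ wG tp).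
by rewrite mulrN opprK.
Qed.

Lemma X2_pair_split z M (P : field) (G : mxfield) : X2 z -> 0 <= M -> ae_bounded z M ->
 (forall i, intO (fun x => divrow z i x * P x 0 i)) ->
 (forall i j, intO (fun x => G x i j)) ->
 ∫ x, (mxdot (div z x) (P x) + mxdot (z x) (G x)) =
 \sum_i ∫ x, (divrow z i x * P x 0 i) +
 \sum_i \sum_j ∫ x, (clip M z x i j * G x i j).
move=> Xz M0 zM IP IG; have [[mz _] _ _] := Xz.
have IdP : intO (fun x => mxdot (div z x) (P x)).
 by apply: intR_mxdot => // i j; rewrite (ord1 i); exact: IP.
rewrite (RintD mO IdP (X2_mxdot_intR Xz IG)); congr (_ + _).
 rewrite -Rint_sum//; apply: Rint_eq => x _; by rewrite /mxdot big_ord1.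
rewrite (sum_mxdot_int); last first.
 by move=> i j; apply: (intRM mO (clip_meas _ _ _ mz) (fun x _ => clip_le _ _ _ _ M0)).
apply: (Rint_ae mO).
- exact: intR_meas (X2_mxdot_intR Xz IG).
- apply: mxdot_meas => //; apply/(meas_mxP mO) => i j; first exact: clip_meas.
 exact: intR_meas (IG i j).
- by apply: filterS (clip_ae zM) => x e Ox; rewrite e.
Qed.

Lemma enorm_int_cvg (h_ : nat -> bdfield) (h g : bdfield) (B : R) : 0 <= B ->
 (forall k, inLb (h_ k)) -> inLb h ->
 mfun (dO : set (surface_type R n)) g ->
 {ae sn, forall x, dO x -> enorm (g x) <= B} ->
 (fun k => \int[sn]_(x in dO) (enorm (h_ k x - h x))%:E)%E @ \oo --> 0%E ->
 (fun k => \int[sn]_(x in dO) mxdot (h_ k x) (g x)) @ \oo -->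
  \int[sn]_(x in dO) mxdot (h x) (g x).
move=> B0 h_1 h1 mg gB hc.
have d1 k : inLb (fun x => h_ k x - h x).
 have a := (in_L1P sn mB _).1 (h_1 k); have b := (in_L1P sn mB _).1 h1.
 apply/(in_L1P sn mB) => i j; apply: (intR_eq mB _ (intRB mB (a i j) (b i j))).
 by move=> x _; rewrite !mxE.
apply/cvgrPdist_le => e e0.
have e0' : 0 < e / (B + 1) by rewrite divr_gt0// ltr_wpDl.
have [N _ hN] := cvge0_lt e0' hc.
exists N => // k /= Nk.
have [I1 _] := mxdot_Linf mB B0 (h_1 k) mg gB.
have [I2 _] := mxdot_Linf mB B0 h1 mg gB.
have [_ le3] := mxdot_Linf mB B0 (d1 k) mg gB.
rewrite distrC -(RintB mB I1 I2).
under Rint_eq => x _ do rewrite -mxdotBl.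
apply: le_trans le3 _.
have : \int[sn]_(x in dO) enorm (h_ k x - h x) <= e / (B + 1).
 have Ie := in_L1_enorm mB (d1 k); rewrite -lee_fin -(EFin_Rint mB Ie); exact/ltW/hN.
move=> le4; apply: le_trans (ler_wpM2l B0 le4) _.
by rewrite mulrCA ler_piMr ?(ltW e0)// ler_pdivrMr ?mul1r ?lerDl// ltr_wpDl.
Qed.

(** The divergence lies in L^2 and is paired with the weak L^2 convergence of the approximations; z
    is bounded and is paired with the L^1 convergence of their Jacobians. *)
Lemma fluxm_fapprox_cvg (S : smoothing O) z (phi : field) (G : mxfield) :
 X2 z -> in_L leb O 1 phi -> inL2 phi ->
 in_L leb O 1 G -> is_weak_gradient O phi G ->
 (fun k => fluxm z (fapprox S k phi)) @ \oo -->
 ∫ x, (mxdot (div z x) (phi x) + mxdot (z x) (G x)).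
move=> Xz p1 p2 G1 wG.
have [[mz [M0 hM0]] _ _] := Xz.
pose M := Num.max M0 0.
have zM : ae_bounded z M by apply: filterS hM0 => x h Ox; rewrite le_max h.
have M_0 : 0 <= M by rewrite le_max lexx orbT.
have p1c := (comps_L1P phi).1 p1.
have G1c := (in_L1P leb mO G).1 G1.
have [L2 _] := X2_wdiv Xz.
have dP (P : field) : inL2 P -> forall i, intO (fun x => divrow z i x * P x 0 i).
 move=> P2 i; have [m1 i1] := (in_L2P leb mO _).1 L2 0 i.
 have [m2 i2] := (in_L2P leb mO _).1 P2 0 i.
 exact: intR_prod.
rewrite (X2_pair_split Xz M_0 zM (dP _ p2) G1c).
have sk k := fapprox_smooth S k p1c.
apply: (cvg_ext (u := fun k => \sum_i ∫ x, (divrow z i x * fapprox S k phi x 0 i) +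
 \sum_i \sum_j ∫ x, (clip M z x i j * jac (fapprox S k phi) x i j))).
 move=> k; rewrite (fluxmE Xz (sk k)) (X2_pair_split Xz M_0 zM) //.
  by apply: dP; exact: smooth_field_L2.
 by move=> i j; exact: smooth_jac_intR.
apply: cvgD.
 apply: cvg_bigsum => i.
 have [m1 i1] := (in_L2P leb mO _).1 L2 0 i.
 have [m2 i2] := (in_L2P leb mO _).1 p2 0 i.
 have := sm_approx_L2_weak oO Ooo S (p1c i) i2 m1 i1.
 apply: cvg_ext => k; apply: Rint_eq => x _; by rewrite /divrow mxE.
apply: cvg_bigsum => i.
apply: cvg_bigsum => j.
apply: (@L1_cvg_weak (fun k x => jac (fapprox S k phi) x i j) (fun x => G x i j) (fun x => clip M z x i j) M).
- by move=> k; exact: smooth_jac_intR.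
- exact: G1c.
- exact: clip_meas.
- by move=> x _; exact: clip_le.
- exact: M_0.
- exact: fapprox_partial_cvg.
Qed.

(** * Existence of the normal trace *)

Section normal_trace_density.
Hypothesis bdoo : (sn dO < +oo)%E.

(* Both sides are continuous for strict convergence, and they agree on smooth fields. *)
Lemma flux_density_normal_trace z (g : field) (B : R) : X2 z ->
 (forall i, mfun setT (fun x => g x 0 i)) ->
 (forall i x, `|g x 0 i| <= B) ->
 (forall P, smooth_field P ->
  fluxm z P = \int[sn]_(x in dO) mxdot (P x) (g x)) ->
 is_normal_trace O tr z g.
move=> Xz mg gB gE.
have mg' : mfun (dO : set (surface_type R n)) g.
 apply/(meas_mxP mB) => i j; rewrite (ord1 i).
 by apply: surface_meas; [exact: meas_bd|exact: mfunTS].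
pose B' := (1 * m)%:R * Num.max B 0.
have B'0 : 0 <= B' by rewrite mulr_ge0// le_max lexx orbT.
have gB' x : enorm (g x) <= B'.
 by apply: enorm_le_entries => i j; rewrite (ord1 i) le_max gB.
have gae : {ae sn, forall x, dO x -> enorm (g x) <= B'}.
 by apply: aeW => x _; exact: gB'.
split; first by split => //; exists B'.
move=> phi G p1 p2 G1 wG.
have bphi := W11_BVA p1 G1 wG.
have [S] := smoothing_ex oO bO lO.
have p1c := (comps_L1P phi).1 p1.
have G1c := (in_L1P leb mO G).1 G1.
have sk k := fapprox_smooth S k p1c.
have bk k := fapprox_BVA S k p1c.
have t1 k := trace_L1 tr_trace (bk k).
have t2 := trace_L1 tr_trace bphi.
have Id := wdiv_mxdot_intR Xz p2.
have Iz := X2_mxdot_intR Xz G1c.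
have [It _] := mxdot_Linf mB B'0 t2 mg' gae.
rewrite (EFin_Rint mO (intRD mO Id Iz)) (EFin_Rint mB It); congr EFin.
have c1 := fluxm_fapprox_cvg S Xz p1 p2 G1 wG.
have c2 := enorm_int_cvg B'0 t1 t2 mg' gae (trace_strict tr_trace bk bphi
 (fapprox_cvg S p1c) (fapprox_Avar_cvg S bphi)).
apply: (lim_unique c1 c2) => k; rewrite gE//.
have [Ik _] := mxdot_Linf mB B'0 (t1 k) mg' gae.
have ae1 := trace_C1 tr_trace (smooth_field_C1 (sk k)).
have msk : mfun (dO : set (surface_type R n)) (fapprox S k phi).
 apply/(meas_mxP mB) => i j; rewrite (ord1 i).
 exact: intR_meas (smooth_intR_bd bdoo (sk k j)).
apply: (Rint_ae mB).
- exact: mxdot_meas.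
- exact: intR_meas Ik.
- by apply: ae_mono ae1 => x e bx; rewrite e.
Qed.

Lemma normal_trace_ex z : X2 z -> exists g, is_normal_trace O tr z g.
move=> Xz; have [[mz [M0 hM0]] _ _] := Xz.
pose M := Num.max M0 0.
have zM : ae_bounded z M by apply: filterS hM0 => x h Ox; rewrite le_max h.
have M_0 : 0 <= M by rewrite le_max lexx orbT.
have [C C0 hC] := flux_density_field bdoo.
have [g [mg gM gE]] := hC z M Xz M_0 zM.
by exists g; exact: flux_density_normal_trace mg gM gE.
Qed.

End normal_trace_density.

Lemma normal_trace_spec z : X2 z ->
 is_normal_trace O tr z (normal_trace O tr z).
move=> Xz; apply: (the_spec (fun _ => 0)).
(* For m = 0 no field bounds the measure of the boundary, but every pairing is an empty sum. *)
have [m0|m0] := posnP m; last first.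
 exact: (normal_trace_ex (bd_finite m0) Xz).
have no (i : 'I_m) : False by have := leq_ltn_trans (leq0n _) (ltn_ord i); rewrite m0.
have dot0 p (x y : 'M[R]_(m, p)) : mxdot x y = 0.
 by rewrite /mxdot big1// => i _; case: (no i).
have dot0' (x y : 'rV[R]_m) : mxdot x y = 0.
 rewrite /mxdot big1// => i _; rewrite big1// => j _; by case: (no j).
exists (fun=> 0); split.
 split; first exact: mcst.
 by exists 0; apply: aeW => x _; rewrite enorm0.
move=> phi G _ _ _ _.
rewrite (eq_integral (cst 0%E)) ?integral0; last by move=> x _; rewrite dot0 dot0' addr0.
by rewrite (eq_integral (cst 0%E)) ?integral0// => x _; rewrite dot0'.
Qed.

(** * Linearity of the divergence and the boundary pairing *)

Lemma in_L2_comps (v : field) i : inL2 v ->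
 [/\ mfun O (fun x => v x 0 i), intO (fun x => v x 0 i ^+ 2) &
   intO (fun x => v x 0 i)].
move=> v2; have [h1 h2] := (in_L2P leb mO v).1 v2 0 i; split => //.
exact: ((in_L1P leb mO v).1 (in_L2_L1 mO Ooo v2)).
Qed.

Lemma is_weak_divP (z : mxfield) (dz : field) :
 (forall i j, intO (fun x => z x i j)) -> (forall i, intO (fun x => dz x 0 i)) ->
 is_weak_div O z dz <-> (forall phi, test O phi -> forall i,
  \sum_j ∫ x, (z x i j * partial j phi x) =
   - ∫ x, (dz x 0 i * phi x)).
move=> Iz Idz.
have I1 phi i j : test O phi -> intO (fun x => z x i j * partial j phi x).
 by move=> tp; exact: intR_testr (Iz i j) (test_partial j tp).
have I2 phi i : test O phi -> intO (fun x => dz x 0 i * phi x).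
 by move=> tp; exact: intR_testr (Idz i) tp.
have E phi i : test O phi ->
  (∫ x, (\sum_j z x i j * partial j phi x)%:E =
  (\sum_j ∫ x, (z x i j * partial j phi x))%:E)%E.
 move=> tp; rewrite -(Rint_sum mO) ?EFin_Rint//; first by apply: intR_sum => // j _; exact: I1.
 by move=> j _; exact: I1.
split=> h phi tp i; have := h phi tp i; rewrite E// (EFin_Rint mO (I2 _ _ tp)).
 by move=> [].
by move=> ->.
Qed.

(** [wdiv] is a choice among weak divergences; by the lemma of du Bois-Reymond any two agree almost
    everywhere, which makes it linear up to null sets. *)
Lemma wdiv_unique (z : mxfield) (dz : field) : X2 z -> inL2 dz ->
 is_weak_div O z dz -> {ae leb, forall x, O x -> div z x = dz x}.
move=> Xz d2 wd; have [L2 wd'] := X2_wdiv Xz.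
have Iz i j := X2_intR i j Xz.
have Id i : intO (fun x => dz x 0 i) by have [] := in_L2_comps i d2.
have Id' i := wdiv_L1 i Xz.
have h1 := (is_weak_divP Iz Id).1 wd.
have h2 := (is_weak_divP Iz Id').1 wd'.
have ae i : {ae leb, forall x, O x -> div z x 0 i - dz x 0 i = 0}.
 have [_ I2 _] := in_L2_comps i (in_L2_lin mO 1 (-1) L2 d2).
 apply: (du_bois_reymond oO Ooo (intRB mO (Id' i) (Id i))) => [|p tp].
  by apply: (intR_eq mO _ I2) => x _; rewrite !mxE; ring.
 under Rint_eq => x _ do rewrite mulrBl.
 rewrite (RintB mO (intR_testr (Id' i) tp) (intR_testr (Id i) tp)).
 by have := h1 _ tp i; rewrite h2// => /oppr_inj ->; rewrite subrr.
have := ae_forall ae.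
by apply: filterS => x h Ox; apply/rowP => i; apply/eqP; rewrite -subr_eq0; apply/eqP; exact: h.
Qed.

Lemma X2_comb (a b : R) (z z' : mxfield) : X2 z -> X2 z' ->
 X2 (fun x => a *: z x + b *: z' x) /\
 {ae leb, forall x, O x -> div (fun x => a *: z x + b *: z' x) x =
  a *: div z x + b *: div z' x}.
move=> Xz Xz'.
have [L2 wd] := X2_wdiv Xz; have [L2' wd'] := X2_wdiv Xz'.
have Iz i j := X2_intR i j Xz; have Iz' i j := X2_intR i j Xz'.
have Id i := wdiv_L1 i Xz; have Id' i := wdiv_L1 i Xz'.
pose Z x := a *: z x + b *: z' x.
pose dZ x := a *: div z x + b *: div z' x.
have ZE i j : (fun x => Z x i j) = fun x => a * z x i j + b * z' x i j.
 by apply/funext => x; rewrite !mxE.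
have dZE i : (fun x => dZ x 0 i) = fun x => a * div z x 0 i + b * div z' x 0 i.
 by apply/funext => x; rewrite !mxE.
have IZ i j : intO (fun x => Z x i j).
 by rewrite ZE; apply: (intRD mO); exact: (intRZ mO).
have IdZ i : intO (fun x => dZ x 0 i).
 by rewrite dZE; apply: (intRD mO); exact: (intRZ mO).
have dZ2 : inL2 dZ by exact: in_L2_lin.
have wZ : is_weak_div O Z dZ.
 apply/(is_weak_divP IZ IdZ) => phi tp i.
 have h := (is_weak_divP Iz Id).1 wd phi tp i.
 have h' := (is_weak_divP Iz' Id').1 wd' phi tp i.
 rewrite (@Rint_eq _ _ _ leb O _ (fun x => a * (div z x 0 i * phi x) + b * (div z' x 0 i * phi x))); last first.
  by move=> x _; rewrite !mxE mulrDl !mulrA.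
 have I1 := intR_testr (Id i) tp; have I2 := intR_testr (Id' i) tp.
 have e := RintD mO (intRZ mO a I1) (intRZ mO b I2).
 have e1 := RintZ mO a I1; have e2 := RintZ mO b I2.
 transitivity (a * \sum_j ∫ x, (z x i j * partial j phi x) +
   b * \sum_j ∫ x, (z' x i j * partial j phi x)); last first.
  rewrite h h' !mulrN -opprD; congr (- _).
  by apply/esym; exact: (etrans e (f_equal2 +%R e1 e2)).
 rewrite !mulr_sumr -big_split/=; apply: eq_bigr => j _.
 have J1 := intR_testr (Iz i j) (test_partial j tp).
 have J2 := intR_testr (Iz' i j) (test_partial j tp).
 have e3 := RintD mO (intRZ mO a J1) (intRZ mO b J2).
 apply: etrans (etrans e3 (f_equal2 +%R (RintZ mO a J1) (RintZ mO b J2))).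
 by apply: Rint_eq => x _; rewrite !mxE mulrDl !mulrA.
have XZ : X2 Z.
 split; last by exists dZ.
  split; first by apply/(meas_mxP mO) => i j; exact: intR_meas (IZ i j).
  have [[_ [M hM]] _ _] := Xz; have [[_ [M' hM']] _ _] := Xz'.
  exists (`|a| * M + `|b| * M'); apply: filterS2 hM hM' => x h h' Ox.
  by apply: le_trans (enorm_tri _ _) _; rewrite !enormZ lerD// ler_wpM2l// ?h ?h'.
 have [_ Az _] := Xz; have [_ Az' _] := Xz'.
 by apply: filterS2 Az Az' => x h h' Ox; rewrite linearD !linearZ/= h// h'.
by split => //; exact: wdiv_unique.
Qed.

Lemma fluxm_comb (a b : R) (z z' : mxfield) P : X2 z -> X2 z' ->
 smooth_field P ->
 fluxm (fun x => a *: z x + b *: z' x) P = a * fluxm z P + b * fluxm z' P.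
move=> Xz Xz' sP; have [XZ dZ] := X2_comb a b Xz Xz'.
have P2 := smooth_field_L2 sP.
have IJ i j := smooth_jac_intR i j sP.
have J (y : mxfield) : X2 y -> intO (fun x => mxdot (div y x) (P x) + mxdot (y x) (jac P x)).
 by move=> Xy; apply: (intRD mO); [exact: (wdiv_mxdot_intR Xy P2)|exact: (X2_mxdot_intR Xy IJ)].
rewrite (fluxmE XZ sP) (fluxmE Xz sP) (fluxmE Xz' sP) -(RintZ mO a (J _ Xz)) -(RintZ mO b (J _ Xz')).
rewrite -(RintD mO (intRZ mO a (J _ Xz)) (intRZ mO b (J _ Xz'))).
apply: (Rint_ae mO).
- exact: intR_meas (J _ XZ).
- exact: intR_meas (intRD mO (intRZ mO a (J _ Xz)) (intRZ mO b (J _ Xz'))).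
apply: filterS dZ => x e Ox; rewrite e// !mxdotDl !mxdotZl; ring.
Qed.

Definition nflux (z : mxfield) (h : bdfield) : R :=
 \int[sn]_(x in dO) mxdot (h x) (normal_trace O tr z x).

Lemma normal_trace_Linf z : X2 z -> exists B,
 [/\ 0 <= B, mfun (dO : set (surface_type R n)) (normal_trace O tr z) &
  {ae sn, forall x, dO x -> enorm (normal_trace O tr z x) <= B}].
move=> Xz; have [[mt [B hB]] _] := normal_trace_spec Xz.
exists (Num.max B 0); split => //; first by rewrite le_max lexx orbT.
by apply: ae_mono hB => x h bx; rewrite le_max h.
Qed.

Lemma nflux_intR z h : X2 z -> inLb h ->
 intR sn dO (fun x => mxdot (h x) (normal_trace O tr z x)).
move=> Xz h1; have [B [B0 mt hB]] := normal_trace_Linf Xz.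
by have [] := mxdot_Linf mB B0 h1 mt hB.
Qed.

Lemma smooth_weak_gradient (P : field) : smooth_field P -> is_weak_gradient O P (jac P).
move=> sP phi tp i j.
have I0 : intO (fun x => P x 0 i) by exact: (smooth_field_L1 sP).
have I1 : intO (fun x => P x 0 i * partial j phi x) by exact: intR_testr (test_partial j tp).
have I2 : intO (fun x => jac P x i j * phi x).
 by apply: (intR_testr _ tp); exact: smooth_jac_intR.
rewrite (EFin_Rint mO I1) (EFin_Rint mO I2) -EFinN; congr EFin.
apply/eqP; rewrite -addr_eq0 -(RintD mO I1 I2); apply/eqP.
rewrite -(test_int_partial j mO (@subset_refl _ O) (testM tp (sP i))).
apply: Rint_eq => x _; rewrite (partialM _ _ (test_smooth tp) (sP i)) mxE; ring.
Qed.

Lemma nflux_tr_smooth z P : X2 z -> smooth_field P ->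
 nflux z (tr P) = fluxm z P.
move=> Xz sP; rewrite (fluxmE Xz sP).
have [_ /(_ P (jac P))] := normal_trace_spec Xz.
have P2 := smooth_field_L2 sP.
have Pl1 : in_L leb O 1 P by exact: in_L2_L1.
have IJ i j := smooth_jac_intR i j sP.
have J1 : in_L leb O 1 (jac P) by apply/(in_L1P leb mO).
move=> /(_ Pl1 P2 J1 (smooth_weak_gradient sP)).
have t1 := trace_L1 tr_trace (smooth_BVA sP).
rewrite (EFin_Rint mO (intRD mO (wdiv_mxdot_intR Xz P2) (X2_mxdot_intR Xz IJ))).
by rewrite (EFin_Rint mB (nflux_intR Xz t1)) => -[->].
Qed.

Lemma nflux_smooth z P : X2 z -> smooth_field P ->
 inLb P -> nflux z P = fluxm z P.
move=> Xz sP P1; rewrite -nflux_tr_smooth//.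
have t1 := trace_L1 tr_trace (smooth_BVA sP).
apply: (Rint_ae mB).
- exact: intR_meas (nflux_intR Xz P1).
- exact: intR_meas (nflux_intR Xz t1).
- by apply: ae_mono (trace_C1 tr_trace (smooth_field_C1 sP)) => x e bx; rewrite e.
Qed.

Lemma in_L1_sub_bd (h h' : bdfield) : inLb h ->
 inLb h' -> inLb (fun x => h x - h' x).
move=> /(in_L1P sn mB) a /(in_L1P sn mB) b.
apply/(in_L1P sn mB) => i j; apply: (intR_eq mB _ (intRB mB (a i j) (b i j))).
by move=> x _; rewrite !mxE.
Qed.

Lemma eq_approx (a b C : R) : 0 <= C -> (forall e, 0 < e -> `|a - b| <= C * e) -> a = b.
move=> C0 h; apply/eqP; rewrite -subr_eq0 -normr_le0; apply/ler_addgt0Pr => e e0.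
rewrite add0r; have := h (e / (C + 1)); rewrite divr_gt0 ?ltr_wpDl// => /(_ isT).
move=> /le_trans; apply; rewrite mulrCA ler_piMr ?(ltW e0)//.
by rewrite ler_pdivrMr ?mul1r ?lerDl// ltr_wpDl.
Qed.

(** * The boundary pairing as a uniform limit of fluxes *)

Section normal_pairing_approximation.
Hypothesis bdoo : (sn dO < +oo)%E.

Lemma test_field_L1_bd (P : field) : smooth_field P -> inLb P.
by move=> sP; apply/(in_L1P sn mB) => i j; rewrite (ord1 i); exact: (smooth_intR_bd bdoo (sP j)).
Qed.

(** Smooth fields are dense in L^1 of the boundary, and on them the pairing is the flux. P does not
    depend on z and the error depends on z only through M, so linearity and limits in z pass from
    [fluxm] to [nflux]. *)
Lemma nflux_approx_fin : exists2 C, 0 <= C & forall h e, inLb h -> 0 < e ->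
 exists2 P : field, smooth_field P & forall z M, X2 z -> 0 <= M ->
  ae_bounded z M -> `|nflux z h - fluxm z P| <= C * M * e.
have [C C0 hC] := flux_density_field bdoo.
exists ((1 * m)%:R * C); first by rewrite mulr_ge0.
move=> h e h1 e0.
have dense e' : 0 < e' -> exists2 P : field, smooth_field P &
  \int[sn]_(x in dO) enorm (h x - P x) <= e'.
 move=> e'0; have [P tP hP] := test_field_dense_bd bdoo h1 e'0.
 by exists P => // i; exact: test_smooth (tP i).
have [P sP hP] := dense e e0.
exists P => // z M Xz M0 zM.
have [g [mg gM gE]] := hC z M Xz M0 zM.
have mg' : mfun (dO : set (surface_type R n)) g.
 apply/(meas_mxP mB) => i j; rewrite (ord1 i).
 by apply: surface_meas; [exact: meas_bd|exact: mfunTS].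
have gB x : enorm (g x) <= (1 * m)%:R * (C * M).
 by apply: enorm_le_entries => i j; rewrite (ord1 i) gM.
have gae : {ae sn, forall x, dO x -> enorm (g x) <= (1 * m)%:R * (C * M)}.
 by apply: aeW => x _; exact: gB.
have CM0 : 0 <= (1 * m)%:R * (C * M) by rewrite !mulr_ge0.
have close (Q : field) : smooth_field Q ->
  `|\int[sn]_(x in dO) mxdot (h x) (g x) - fluxm z Q| <=
  (1 * m)%:R * (C * M) * \int[sn]_(x in dO) enorm (h x - Q x).
 move=> sQ; have Q1 := test_field_L1_bd sQ.
 have [I1 _] := mxdot_Linf mB CM0 h1 mg' gae.
 have [I2 _] := mxdot_Linf mB CM0 Q1 mg' gae.
 have [_ le3] := mxdot_Linf mB CM0 (in_L1_sub_bd h1 Q1) mg' gae.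
 rewrite (gE Q sQ) -(RintB mB I1 I2).
 by under Rint_eq => x _ do rewrite -mxdotBl.
have [B [B0 mt hB]] := normal_trace_Linf Xz.
have close' (Q : field) : smooth_field Q ->
  `|nflux z h - fluxm z Q| <= B * \int[sn]_(x in dO) enorm (h x - Q x).
 move=> sQ; have Q1 := test_field_L1_bd sQ.
 have [_ le3] := mxdot_Linf mB B0 (in_L1_sub_bd h1 Q1) mt hB.
 rewrite -(nflux_smooth Xz sQ Q1) /nflux -(RintB mB (nflux_intR Xz h1) (nflux_intR Xz Q1)).
 by under Rint_eq => x _ do rewrite -mxdotBl.
(* The chosen normal trace has a bound B without relation to M. By density of smooth fields it gives
   the same pairing as g, which is bounded by C M. *)
have eq : nflux z h = \int[sn]_(x in dO) mxdot (h x) (g x).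
 apply: (@eq_approx _ _ (B + (1 * m)%:R * (C * M))); first by rewrite addr_ge0.
 move=> e' e'0; have [Q sQ hQ] := dense e' e'0.
 rewrite -(subrK (fluxm z Q) (nflux z h)) -addrA.
 apply: le_trans (ler_normD _ _) _; rewrite mulrDl lerD//.
  by apply: le_trans (close' Q sQ) _; rewrite ler_wpM2l.
 by rewrite distrC; apply: le_trans (close Q sQ) _; rewrite ler_wpM2l.
rewrite eq; apply: le_trans (close P sP) _; rewrite -!mulrA !ler_wpM2l//.
Qed.

End normal_pairing_approximation.

Lemma nflux_approx : exists2 C, 0 <= C & forall h e, inLb h -> 0 < e ->
 exists2 P : field, smooth_field P & forall z M, X2 z -> 0 <= M ->
  ae_bounded z M -> `|nflux z h - fluxm z P| <= C * M * e.
have [m0|m0] := posnP m; last first.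
 exact: (nflux_approx_fin (bd_finite m0)).
have no (i : 'I_m) : False by have := leq_ltn_trans (leq0n _) (ltn_ord i); rewrite m0.
exists 0 => // h e _ _; exists (fun=> 0).
 by move=> i; case: (no i).
move=> z M _ _ _; rewrite !mul0r /nflux /fluxm big1 ?subr0; last by move=> i; case: (no i).
rewrite (@Rint_eq _ _ _ sn dO _ (fun=> 0)) ?Rint0 ?normr0// => x _.
by rewrite /mxdot big1// => i _; rewrite big1// => j; case: (no j).
Qed.

Lemma X2_ae_bounded z : X2 z -> exists2 M, 0 <= M & ae_bounded z M.
move=> [[_ [M hM]] _ _]; exists (Num.max M 0); first by rewrite le_max lexx orbT.
by apply: filterS hM => x h Ox; rewrite le_max h.
Qed.

Lemma nflux_comb (a b : R) z z' h : X2 z -> X2 z' ->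
 inLb h ->
 nflux (fun x => a *: z x + b *: z' x) h = a * nflux z h + b * nflux z' h.
move=> Xz Xz' h1; have [XZ _] := X2_comb a b Xz Xz'.
have [C C0 hC] := nflux_approx.
have [M M0 zM] := X2_ae_bounded Xz; have [M' M'0 zM'] := X2_ae_bounded Xz'.
have [N N0 ZN] := X2_ae_bounded XZ.
apply: (@eq_approx _ _ (C * N + (`|a| * (C * M) + `|b| * (C * M')))).
 by rewrite !addr_ge0 ?mulr_ge0.
move=> e e0; have [P sP hP] := hC h e h1 e0.
have k1 := hP _ _ XZ N0 ZN; have k2 := hP _ _ Xz M0 zM; have k3 := hP _ _ Xz' M'0 zM'.
rewrite (fluxm_comb a b Xz Xz' sP) in k1.
set X := nflux _ h in k1 *; set Y := nflux z h in k2 *; set W := nflux z' h in k3 *.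
have -> : X - (a * Y + b * W) = (X - (a * fluxm z P + b * fluxm z' P)) -
  (a * (Y - fluxm z P) + b * (W - fluxm z' P)) by ring.
apply: le_trans (ler_normB _ _) _; rewrite mulrDl lerD// mulrDl.
by apply: le_trans (ler_normD _ _) _; rewrite !normrM -!mulrA lerD// ler_wpM2l// ?mulrA.
Qed.

Lemma nflux_cvg (z_ : nat -> mxfield) z M h : 0 <= M ->
 (forall k, X2 (z_ k)) -> X2 z ->
 (forall k, ae_bounded (z_ k) M) -> ae_bounded z M ->
 (forall P, smooth_field P -> (fun k => fluxm (z_ k) P) @ \oo --> fluxm z P) ->
 inLb h ->
 (fun k => nflux (z_ k) h) @ \oo --> nflux z h.
move=> M0 Xk Xz kM zM fc h1; have [C C0 hC] := nflux_approx.
have CM0 : 0 <= C * M by rewrite mulr_ge0.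
apply/cvgrPdist_le => e e0.
have e3 : 0 < e / 2 / (2 * (C * M) + 1) by rewrite !divr_gt0// ltr_wpDl// mulr_ge0.
have [P sP hP] := hC h _ h1 e3.
have e2 : 0 < e / 2 by rewrite divr_gt0.
have /cvgrPdist_le/(_ _ e2) := fc P sP.
apply: filterS => k hk.
have k1 := hP _ _ (Xk k) M0 (kM k); have k2 := hP _ _ Xz M0 zM.
move: hk k1 k2; move: (nflux z h) (nflux (z_ k) h) (fluxm z P) (fluxm (z_ k) P) => p q s t hk k1 k2.
have -> : p - q = (p - s) + ((s - t) - (q - t)) by ring.
apply: le_trans (ler_normD _ _) _; apply: le_trans (lerD k2 (ler_normB _ _)) _.
apply: le_trans (lerD (lexx _) (lerD hk k1)) _.
have : (2 * (C * M)) * (e / 2 / (2 * (C * M) + 1)) <= e / 2.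
 rewrite mulrCA ler_piMr ?(ltW e2)// ler_pdivrMr ?mul1r ?lerDl// ltr_wpDl// mulr_ge0//.
by move=> h'; lra.
Qed.

Lemma nflux0 z h : X2 z -> (forall P, smooth_field P -> fluxm z P = 0) ->
 inLb h -> nflux z h = 0.
move=> Xz f0 h1; have [C C0 hC] := nflux_approx.
have [M M0 zM] := X2_ae_bounded Xz.
apply: (@eq_approx _ _ (C * M)); first by rewrite mulr_ge0.
move=> e e0; have [P sP hP] := hC h e h1 e0.
by have := hP _ _ Xz M0 zM; rewrite f0// subr0.
Qed.

(** * The pairing measure and the Gauss-Green formula *)

Section gauss_green.

Definition pairdist (z : mxfield) (w : field) (phi : V -> R) : R :=
 - ∫ x, (phi x * mxdot (div z x) (w x) +
   mxdot (z x) (tensor (w x) (grad phi x))).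

Lemma pairdist_intR z w phi : X2 z -> inL2 w -> test O phi ->
 intO (fun x => phi x * mxdot (div z x) (w x)) /\
 intO (fun x => mxdot (z x) (tensor (w x) (grad phi x))).
move=> Xz w2 tp; split; first exact: (intR_testl oO tp (wdiv_mxdot_intR Xz w2)).
apply: (X2_mxdot_intR Xz) => i j; apply: (tensor_grad_intR) => // k.
by have [] := in_L2_comps k w2.
Qed.

Variable S : smoothing O.
Local Notation J := (fun k w => jac (fapprox S k w)).

Lemma fapprox_L2_weak w (g : field) : inL2 w -> inL2 g ->
 (fun k => ∫ x, mxdot (g x) (fapprox S k w x)) @ \oo -->
  ∫ x, mxdot (g x) (w x).
move=> w2 g2.
have wc : comps_L1 w by move=> i; have [] := in_L2_comps i w2.
have E (v : field) : inL2 v -> ∫ x, mxdot (g x) (v x) =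
  \sum_i ∫ x, (g x 0 i * v x 0 i).
 move=> v2; rewrite -(Rint_sum mO).
  by apply: Rint_eq => x _; rewrite /mxdot big_ord1.
 move=> i _; have [a1 a2 _] := in_L2_comps i g2; have [b1 b2 _] := in_L2_comps i v2.
 exact: intR_prod.
rewrite E//; apply: (cvg_ext (u := fun k => \sum_i ∫ x, (g x 0 i * fapprox S k w x 0 i))).
 by move=> k; rewrite E//; apply: smooth_field_L2 => //; exact: fapprox_smooth.
apply: cvg_bigsum => i.
have [a1 a2 _] := in_L2_comps i g2; have [b1 b2 b3] := in_L2_comps i w2.
have := sm_approx_L2_weak oO Ooo S b3 b2 a1 a2.
by apply: cvg_ext => k; apply: Rint_eq => x _; rewrite mxE.
Qed.

(** The field phi P has compact support in [O], so its flux vanishes; as A z = z, the symmetric A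
    can then be moved onto the Jacobian of P. *)
Lemma smooth_pairdist z P phi : X2 z -> smooth_field P -> test O phi ->
 pairdist z P phi = ∫ x, mxdot (phi x *: A (jac P x)) (z x).
move=> Xz sP tp; have P2 := smooth_field_L2 sP.
have [I1 I2] := pairdist_intR Xz P2 tp.
have sJ i j := smooth_jac_intR i j sP.
have I3 : intO (fun x => mxdot (z x) (phi x *: jac P x)).
 apply: (X2_mxdot_intR Xz) => i j.
 rewrite (_ : (fun x => _) = fun x => phi x * jac P x i j); last by apply/funext => x; rewrite mxE.
 exact: (intR_testl oO tp (sJ i j)).
have I4 : intO (fun x => mxdot (phi x *: A (jac P x)) (z x)).
 have : intO (fun x => mxdot (z x) (phi x *: A (jac P x))).
  apply: (X2_mxdot_intR Xz) => i j.
  rewrite (_ : (fun x => _) = fun x => phi x * A (jac P x) i j); last by apply/funext => x; rewrite mxE.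
  exact: (intR_testl oO tp (smooth_Ajac_intR i j sP)).
 by apply: (intR_eq mO) => x _; rewrite mxdotC.
have -> : ∫ x, mxdot (phi x *: A (jac P x)) (z x) =
  ∫ x, mxdot (z x) (phi x *: jac P x).
 apply: (Rint_ae mO); [exact: intR_meas I4|exact: intR_meas I3|].
 have [_ Az _] := Xz; apply: filterS Az => x e Ox.
 by rewrite mxdotC -[in RHS](e Ox) A_sym linearZ.
pose Q : field := fun x => phi x *: P x.
have QE i : (fun x => Q x 0 i) = fun x => phi x * P x 0 i by apply/funext => x; rewrite mxE.
have tQ i : test O (fun x => Q x 0 i) by rewrite QE; exact: (testM tp (sP i)).
have sQ : smooth_field Q by move=> i; exact: test_smooth (tQ i).
have fQ : fluxm z Q = 0.
 have [M M0 zM] := X2_ae_bounded Xz.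
 rewrite /fluxm big1// => i _; have [_ fe f0] := X2_flux i Xz M0 zM.
 by rewrite -fe//; exact: f0.
apply/eqP; rewrite eq_sym -subr_eq0 /pairdist opprK -(RintD mO I3 (intRD mO I1 I2)) -fQ.
rewrite (fluxmE Xz sQ); apply/eqP; apply: Rint_eq => x _.
rewrite /Q !mxdotZr addrCA -(mxdotZr _ (z x) (jac P x)) -(mxdotDr (z x)); congr (_ + mxdot _ _).
apply/matrixP => i j; rewrite !mxE QE (partialM _ _ (test_smooth tp) (sP i)); ring.
Qed.

Lemma fapprox_pairdist z w phi : X2 z -> inL2 w ->
 test O phi ->
 (fun k => pairdist z (fapprox S k w) phi) @ \oo --> pairdist z w phi.
move=> Xz w2 tp.
have wc : comps_L1 w by move=> i; have [] := in_L2_comps i w2.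
have [d2 _] := X2_wdiv Xz; have [M M0 zM] := X2_ae_bounded Xz; have [[mz _] _ _] := Xz.
have sk k := fapprox_smooth S k wc.
have k2 k := smooth_field_L2 (sk k).
pose g : field := fun x => phi x *: div z x.
have g2 : inL2 g.
 apply/(in_L2P leb mO) => i j; rewrite (ord1 i).
 have [a1 a2 _] := in_L2_comps j d2.
 rewrite (_ : (fun x => g x 0 j) = fun x => phi x * div z x 0 j); last by apply/funext => x; rewrite mxE.
 split; first by apply: mfunM => //; exact: test_meas tp.
 have := intR_testl oO (testM tp (test_smooth tp)) a2.
 by apply: (intR_eq mO) => x _; rewrite mxE exprMn expr2.
have E (v : field) : inL2 v -> pairdist z v phi =
  - (∫ x, mxdot (g x) (v x) +
   \sum_i \sum_j ∫ x, ((clip M z x i j * partial j phi x) * v x 0 i)).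
 move=> v2; have [I1 I2] := pairdist_intR Xz v2 tp.
 rewrite /pairdist (RintD mO I1 I2); congr (- (_ + _)).
  by apply: Rint_eq => x _; rewrite mxdotZl.
 have vc : comps_L1 v by move=> i; have [] := in_L2_comps i v2.
 rewrite [RHS](_ : _ = \sum_i \sum_j ∫ x, (clip M z x i j * tensor (v x) (grad phi x) i j)); last first.
  apply: eq_bigr => i _; apply: eq_bigr => j _; apply: Rint_eq => x _; rewrite !mxE; ring.
 have I5 i j := tensor_grad_intR i j vc tp.
 rewrite (sum_mxdot_int); last first.
  by move=> i j; apply: (intRM mO (clip_meas _ _ _ mz) (fun x _ => clip_le _ _ _ _ M0)).
 apply: (Rint_ae mO); first exact: intR_meas I2.
  apply: mxdot_meas => //; apply/(meas_mxP mO) => i j; first exact: clip_meas.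
  exact: intR_meas (I5 i j).
 by apply: filterS (clip_ae zM) => x e Ox; rewrite e.
rewrite E//; apply: (cvg_ext (u := fun k => - (∫ x, mxdot (g x) (fapprox S k w x) +
   \sum_i \sum_j ∫ x, ((clip M z x i j * partial j phi x) * fapprox S k w x 0 i)))).
 by move=> k; rewrite E.
apply: cvgN; apply: cvgD; first exact: fapprox_L2_weak.
apply: cvg_bigsum => i.
apply: cvg_bigsum => j.
have [B B0 hB] := test_bounded (test_partial j tp).
apply: (@L1_cvg_weak (fun k x => fapprox S k w x 0 i) (fun x => w x 0 i) (fun x => clip M z x i j * partial j phi x) (M * B)).
- by move=> k; exact: (fapprox_L1 S k wc).
- exact: wc.
- by apply: mfunM; [exact: clip_meas|exact: test_meas (test_partial j tp)].
- by move=> x _; rewrite normrM ler_pM// clip_le.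
- exact: mulr_ge0.
- exact: fapprox_comp_cvg.
Qed.

Lemma smooth_mul_mxdot P theta z (M : R) : smooth_field P -> smooth theta -> X2 z ->
 0 <= M -> ae_bounded z M ->
 [/\ intO (fun x => mxdot (theta x *: A (jac P x)) (z x)),
   intO (fun x => `|theta x| * enorm (A (jac P x))) &
 `|∫ x, mxdot (theta x *: A (jac P x)) (z x)| <=
  M * ∫ x, (`|theta x| * enorm (A (jac P x)))].
move=> sP st Xz M0 zM; have [[mz _] _ _] := Xz.
have [B B0 hB] := smooth_bounded bO st.
have h1 : in_L leb O 1 (fun x => theta x *: A (jac P x)).
 apply/(in_L1P leb mO) => i j.
 rewrite (_ : (fun x => _) = fun x => theta x * A (jac P x) i j); last by apply/funext => x; rewrite mxE.
 apply: (intRM mO _ hB); last exact: (smooth_Ajac_intR i j sP).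
 by apply: cont_meas; exact: smooth_cont.
have [I1 le] := mxdot_Linf mO M0 h1 mz zM; split => //.
 by apply: (intR_eq mO _ (in_L1_enorm mO h1)) => x _; rewrite enormZ.
by under [X in _ <= _ * X]Rint_eq => x _ do rewrite -enormZ.
Qed.

(** The bound passes to the limit from the smooth approximations, whose mass exceeds the variation
    of w by at most the remainder, eventually at most 1. *)
Lemma pairdist_bounded z w : X2 z -> BVA w -> inL2 w ->
 exists2 C, 0 <= C & forall phi (B : R), test O phi -> (forall x, `|phi x| <= B) ->
  `|pairdist z w phi| <= C * B.
move=> Xz bw w2; have [M M0 zM] := X2_ae_bounded Xz.
have wc : comps_L1 w := BVA_comps bw.
pose C : R := `|fine (Avar w)|.
have C0 : 0 <= C by exact: normr_ge0.
exists (M * (C + 1)); first by rewrite mulr_ge0// addr_ge0.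
move=> phi B tp hB; have B0 : 0 <= B by apply: le_trans (hB 0).
have c1 := fapprox_pairdist Xz w2 tp.
have c2 := frem_cvg S wc.
have /cvgrPdist_le/(_ 1 ltr01)[N _ hN] := c2.
apply: (cvg_norm_le c1 (N := N)) => k Nk.
have sk := fapprox_smooth S k wc.
rewrite (smooth_pairdist Xz sk tp).
have [_ I2 le] := smooth_mul_mxdot sk (test_smooth tp) Xz M0 zM.
have s1 : smooth (fun _ : V => 1 : R) by exact: smooth_cst.
have [_ I3 _] := smooth_mul_mxdot sk s1 Xz M0 zM.
have I3' : intO (fun x => enorm (A (jac (fapprox S k w) x))).
 by apply: (intR_eq mO _ I3) => x _; rewrite normr1 mul1r.
apply: le_trans le _; rewrite -mulrA ler_wpM2l//.
apply: (@le_trans _ _ (∫ x, (B * enorm (A (jac (fapprox S k w) x))))).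
 apply: (Rint_le mO I2 (intRZ mO B I3')) => x _.
 by rewrite ler_wpM2r ?enorm_ge0.
rewrite (RintZ mO B I3') mulrC ler_wpM2r//.
apply: le_trans (fapprox_Avar_le S k bw) _; rewrite lerD//.
 exact: ler_norm.
by have := hN k Nk; rewrite sub0r normrN => /(le_trans (ler_norm _)).
Qed.

Lemma pairing_ex z w : X2 z -> BVA w -> inL2 w ->
 exists nu, represents_pairing O z w nu.
move=> Xz bw w2; have [C C0 hC] := pairdist_bounded Xz bw w2.
have wc : comps_L1 w := BVA_comps bw.
have LD p q : test O p -> test O q ->
  pairdist z w (fun x => p x + q x) = pairdist z w p + pairdist z w q.
 move=> tp tq; have [p1 p2] := pairdist_intR Xz w2 tp; have [q1 q2] := pairdist_intR Xz w2 tq.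
 rewrite /pairdist -opprD -(RintD mO (intRD mO p1 p2) (intRD mO q1 q2)); congr (- _).
 apply: Rint_eq => x _; rewrite tensor_gradD; [|exact: test_smooth tp|exact: test_smooth tq].
 rewrite mxdotDr; ring.
have LZ c p : test O p -> pairdist z w (fun x => c * p x) = c * pairdist z w p.
 move=> tp; have [p1 p2] := pairdist_intR Xz w2 tp.
 rewrite /pairdist mulrN -(RintZ mO c (intRD mO p1 p2)); congr (- _).
 apply: Rint_eq => x _; rewrite tensor_gradZ; last exact: test_smooth tp.
 rewrite mxdotZr; ring.
have [_ [nu [_ _ _ hnu]]] := riesz oO LD LZ hC.
exists nu => phi tp; have [p1 p2] := pairdist_intR Xz w2 tp.
rewrite hnu// /pairdist (EFin_Rint mO (intRD mO p1 p2)) //.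
Qed.

Lemma fapprox_nflux_cvg z w : X2 z -> BVA w ->
 (fun k => fluxm z (fapprox S k w)) @ \oo --> nflux z (tr w).
move=> Xz bw; have wc : comps_L1 w := BVA_comps bw.
have [B [B0 mt hB]] := normal_trace_Linf Xz.
have bk k := fapprox_BVA S k wc.
have t1 k := trace_L1 tr_trace (bk k).
have t2 := trace_L1 tr_trace bw.
have c2 := enorm_int_cvg B0 t1 t2 mt hB (trace_strict tr_trace bk bw
 (fapprox_cvg S wc) (fapprox_Avar_cvg S bw)).
apply: cvg_ext c2 => k; apply: (nflux_tr_smooth Xz).
exact: fapprox_smooth.
Qed.

(** For the approximations, which are smooth up to the boundary, this is the definition of the
    normal trace. Cutoffs tending to 1 recover the total mass of the pairing, and the two limits may
    be exchanged because [fapprox_no_boundary_mass] is uniform in k. *)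
Lemma gauss_green z w : X2 z -> BVA w -> inL2 w ->
 pairing O z w O =
 (nflux z (tr w) - ∫ x, mxdot (w x) (div z x))%:E.
move=> Xz bw w2; have wc : comps_L1 w := BVA_comps bw.
have [M M0 zM] := X2_ae_bounded Xz.
have [d2 _] := X2_wdiv Xz.
have rp : represents_pairing O z w (pairing O z w).
 exact: (the_spec (czero : {charge set _ -> \bar R}) (pairing_ex Xz bw w2)).
set nu := pairing O z w in rp *.
have sk k := fapprox_smooth S k wc.
have chE phi : test O phi -> chint nu O phi = pairdist z w phi.
 move=> tp; have [p1 p2] := pairdist_intR Xz w2 tp.
 by rewrite /chint rp// (EFin_Rint mO (intRD mO p1 p2)).
set T := nflux _ _ - _.
pose L1 k := ∫ x, mxdot (1 *: A (jac (fapprox S k w) x)) (z x).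
have s1 : smooth (fun _ : V => 1 : R) by exact: smooth_cst.
have cT : L1 @ \oo --> T.
 have c1 := fapprox_nflux_cvg Xz bw; have c2 := fapprox_L2_weak w2 d2.
 rewrite /T; under Rint_eq => x _ do rewrite mxdotC.
 apply: cvg_ext (cvgB c1 c2) => k.
 have k2 := smooth_field_L2 (sk k).
 have IJ i j := smooth_jac_intR i j (sk k).
 have Iz := X2_mxdot_intR Xz IJ.
 have [I4 _ _] := smooth_mul_mxdot (sk k) s1 Xz M0 zM.
 rewrite fctE (fluxmE Xz (sk k)) (RintD mO (wdiv_mxdot_intR Xz k2) Iz) addrAC subrr add0r.
 apply: (Rint_ae mO); [exact: intR_meas Iz|exact: intR_meas I4|].
 have [_ Az _] := Xz; apply: filterS Az => x e Ox.
 by rewrite scale1r A_sym e// mxdotC.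
have [theta [tt t01 t1]] := test_to_open oO.
suff fineE : fine (nu O) = T.
 by rewrite -fineE fineK//; exact: fin_num_measure.
apply: (@eq_approx _ _ M M0) => e e0.
have [K [cK KO [N hN]]] := fapprox_no_boundary_mass S bw e0.
have [chi [tc c01 c1]] := test_plateau cK oO KO.
(* 1 - th is (1 - theta) (1 - chi): thus th is 1 on K for every j and still tends to 1 on all of
   [O]. *)
pose th j x := theta j x + chi x - theta j x * chi x.
have tth j : test O (th j).
 by apply: testB; [exact: testD (tt j) tc|exact: testM (tt j) (test_smooth tc)].
have th01 j x : 0 <= th j x <= 1.
 have /andP[a1 a2] := t01 j x; have /andP[b1 b2] := c01 x.
 have p1 : 0 <= (1 - theta j x) * (1 - chi x) by rewrite mulr_ge0 ?subr_ge0.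
 have p2 : 0 <= theta j x * (1 - chi x) by rewrite mulr_ge0 ?subr_ge0.
 by rewrite /th; apply/andP; split; lra.
have thK j x : K x -> th j x = 1 by move=> Kx; rewrite /th c1// mulr1 addrAC subrr add0r.
have thc x : O x -> th ^~ x @ \oo --> (1 : R).
 move=> Ox; rewrite (_ : (1 : R) = 1 + chi x - 1 * chi x); last by ring.
 by apply: cvgB; [apply: cvgD; [exact: t1|exact: cvg_cst]|apply: cvgM; [exact: t1|exact: cvg_cst]].
have cnu : (fun j => chint nu O (th j)) @ \oo --> fine (nu O).
 rewrite -(chint_indic nu mO mO (@subset_refl _ _)).
 apply: (@chint_dom _ _ _ nu O th \1_O 1 mO).
  move=> j; split; first exact: test_meas (tth j).
  by move=> x _; have /andP[h1 h2] := th01 j x; rewrite ger0_norm.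
 by move=> x Ox; rewrite indicE mem_set//; exact: thc.
have cl j : `|chint nu O (th j) - T| <= M * e.
 rewrite (chE _ (tth j)).
 have cc : (fun k => pairdist z (fapprox S k w) (th j) - L1 k) @ \oo --> pairdist z w (th j) - T.
  by apply: cvgB; [exact: (fapprox_pairdist Xz w2 (tth j))|exact: cT].
 apply: (cvg_norm_le cc (N := N)) => k Nk.
 rewrite (smooth_pairdist Xz (sk k) (tth j)) distrC.
 have sth := test_smooth (tth j).
 have s2 : smooth (fun x => 1 - th j x) by exact: (smoothB s1 sth).
 have [I1 _ _] := smooth_mul_mxdot (sk k) s1 Xz M0 zM.
 have [I2 _ _] := smooth_mul_mxdot (sk k) sth Xz M0 zM.
 have [_ _ le] := smooth_mul_mxdot (sk k) s2 Xz M0 zM.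
 rewrite /L1 -(RintB mO I1 I2).
 under Rint_eq => x _ do rewrite -mxdotBl -scalerBl.
 apply: le_trans le _; rewrite ler_wpM2l//.
 apply: le_trans (hN (th j) k Nk (tth j) (th01 j) (thK j)).
 rewrite le_eqVlt; apply/orP; left; apply/eqP; apply: Rint_eq => x _.
 by rewrite ger0_norm// subr_ge0; have /andP[] := th01 j x.
have cc : (fun j => chint nu O (th j) - T) @ \oo --> fine (nu O) - T.
 by apply: cvgB; [exact: cnu|exact: cvg_cst].
by apply: (cvg_norm_le cc (N := 0%N)) => j _; exact: cl.
Qed.

End gauss_green.

(** * Closedness of the bounded admissible fields *)

Section X2_closed.

Variables (y_ : nat -> mxfield) (z : mxfield) (dz : field) (M : R).
Hypotheses (M0 : 0 <= M) (Xy : forall k, X2 (y_ k)).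
Hypothesis by_ : forall k, ae_bounded (y_ k) M.
Hypotheses (z2 : inL2 z) (d2 : inL2 dz).
Hypothesis yz : {ae leb, forall x, O x -> forall i j, (fun k => y_ k x i j) @ \oo --> z x i j}.
Hypothesis dyz : (fun k => ipO (fun x => div (y_ k) x - dz x)
 (fun x => div (y_ k) x - dz x)) @ \oo --> (0 : R).

Let by_all : {ae leb, forall x, forall k, O x -> enorm (y_ k x) <= M}.
by apply/ae_foralln => k; exact: by_. Qed.

Lemma X2_limit_bounded : ae_bounded z M.
apply: ae_mono2 yz by_all => x h1 h2 Ox.
rewrite -(@ler_pXn2r _ 2)// ?nnegrE ?enorm_ge0// enorm_sqr.
apply: le_trans (ler_norm _) (cvg_norm_le (N := 0) (mxdot_cvg (h1 Ox)) _) => k _.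
by rewrite -enorm_sqr ger0_norm ?sqr_ge0// ler_pXn2r// ?nnegrE ?enorm_ge0// h2.
Qed.

Lemma X2_limit_proj : {ae leb, forall x, O x -> A (z x) = z x}.
have : {ae leb, forall x, forall k, O x -> A (y_ k x) = y_ k x}.
 by apply/ae_foralln => k; have [_ h _] := Xy k.
apply: ae_mono2 yz => x h1 h2 Ox; apply/matrixP => i j.
have c1 : (fun k => A (y_ k x) i j) @ \oo --> A (z x) i j.
 rewrite (A_entry) /mxdot; under eq_fun do rewrite (A_entry) /mxdot.
 apply: cvg_bigsum => a.
 apply: cvg_bigsum => b.
 by apply: cvgM; [exact: cvg_cst|exact: h1].
have c2 : (fun k => A (y_ k x) i j) @ \oo --> z x i j.
 by under eq_fun do rewrite h2//; exact: h1.
exact: (cvg_unique _ c1 c2).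
Qed.

Lemma X2_limit_weak (G : mxfield) : (forall i j, intO (fun x => G x i j)) ->
 intO (fun x => mxdot (z x) (G x)) /\
 (fun k => ∫ x, mxdot (y_ k x) (G x)) @ \oo -->
  ∫ x, mxdot (z x) (G x).
move=> IG; have [mz _] := z2.
have mG : mfun O G.
 by apply/(meas_mxP mO) => i j; exact: intR_meas (IG i j).
apply: (Rint_dom_ae mO (g := fun x => M * enorm (G x))).
- by move=> k; apply: mxdot_meas => //; have [[]] := Xy k.
- exact: mxdot_meas.
- by apply: (intRZ mO); exact: enorm_intR.
- apply: ae_mono yz => x h Ox.
 apply: cvg_bigsum => a.
 apply: cvg_bigsum => b.
 by apply: cvgM; [exact: h|exact: cvg_cst].
- apply: ae_mono by_all => x h k Ox; apply: le_trans (CS_norm _ _) _.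
 by rewrite ler_wpM2r ?enorm_ge0// h.
Qed.

Lemma X2_limit_wdiv_weak (P : field) : smooth_field P ->
 (fun k => ∫ x, mxdot (div (y_ k) x) (P x)) @ \oo -->
  ∫ x, mxdot (dz x) (P x).
move=> sP; apply: (ip_cvg mO) => //; last exact: smooth_field_L2.
by move=> k; have [] := X2_wdiv (Xy k).
Qed.

Lemma X2_limit_entry (psi : V -> R) i j : intO psi ->
 intO (fun x => z x i j * psi x) /\
 (fun k => ∫ x, (y_ k x i j * psi x)) @ \oo -->
  ∫ x, (z x i j * psi x).
move=> Ip; pose G x : 'M[R]_(m, n) := psi x *: delta_mx i j.
have e (y : 'M[R]_(m, n)) x : mxdot y (G x) = y i j * psi x.
 by rewrite mxdotZr mxdotC mxdot_delta mulrC.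
have IG a b : intO (fun x => G x a b).
 apply: (intR_eq mO (f := fun x => (delta_mx i j : 'M[R]_(m, n)) a b * psi x)).
  by move=> x _; rewrite !mxE mulrC.
 exact: (intRZ mO).
have [I1 c1] := X2_limit_weak IG; split.
 by apply: (intR_eq mO _ I1) => x _; rewrite e.
by move: c1; under eq_fun do under Rint_eq => x _ do rewrite e; under Rint_eq => x _ do rewrite e.
Qed.

Lemma X2_limit : X2 z /\ {ae leb, forall x, O x -> div z x = dz x}.
have I1 (i : 'I_m) (j : 'I_n) : intO (fun x => z x i j).
 have [I _] := X2_limit_entry i j (intR_cst mO 1 Ooo).
 by apply: (intR_eq mO _ I) => x _; rewrite mulr1.
have I2 i : intO (fun x => dz x 0 i) by have [] := in_L2_comps i d2.
have wd : is_weak_div O z dz.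
 apply/(is_weak_divP I1 I2) => phi tp i.
 have c1 : (fun k => \sum_j ∫ x, (y_ k x i j * partial j phi x)) @ \oo -->
   \sum_j ∫ x, (z x i j * partial j phi x).
  apply: cvg_bigsum => j.
  apply: (X2_limit_entry i j _).2; apply: smooth_intR bO; last exact: mO.
  by apply: sm_partial; exact: test_smooth tp.
 pose P : field := fun x => phi x *: delta_mx 0 i.
 have sP : smooth_field P.
  move=> a; have -> : (fun x => P x 0 a) = (fun x => (delta_mx 0 i : 'rV[R]_m) 0 a * phi x).
   by apply/funext => x; rewrite !mxE mulrC.
  by apply: smoothZ; exact: test_smooth tp.
 have e (v : 'rV[R]_m) x : mxdot v (P x) = v 0 i * phi x.
  by rewrite mxdotZr mxdotC mxdot_delta mulrC.
 have c2 := X2_limit_wdiv_weak sP.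
 have c3 : (fun k => \sum_j ∫ x, (y_ k x i j * partial j phi x)) @ \oo -->
   - ∫ x, (dz x 0 i * phi x).
  rewrite (@Rint_eq _ _ _ leb O (fun x => dz x 0 i * phi x) (fun x => mxdot (dz x) (P x))); last first.
   by move=> x _; rewrite e.
  rewrite (_ : (fun k => _) = (fun k => - ∫ x, mxdot (div (y_ k) x) (P x))).
   exact: cvgN.
  apply/funext => k; have [_ wk] := X2_wdiv (Xy k).
  rewrite ((is_weak_divP (fun i j => X2_intR i j (Xy k)) (fun i => wdiv_L1 i (Xy k))).1 wk phi tp i).
  by congr (- _); apply: Rint_eq => x _; rewrite e.
 exact: (cvg_unique _ c1 c3).
have Xz : X2 z.
 split; last by exists dz.
 - by split; [have [] := z2|exists M; exact: X2_limit_bounded].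
 - exact: X2_limit_proj.
by split => //; exact: (wdiv_unique Xz d2 wd).
Qed.

Lemma X2_limit_fluxm (P : field) : smooth_field P ->
 (fun k => fluxm (y_ k) P) @ \oo --> fluxm z P.
move=> sP; have [Xz dE] := X2_limit.
have P2 := smooth_field_L2 sP.
have IJ i j := smooth_jac_intR i j sP.
have e (y : mxfield) : X2 y -> fluxm y P =
  ∫ x, mxdot (div y x) (P x) + ∫ x, mxdot (y x) (jac P x).
 move=> X; rewrite (fluxmE X sP).
 exact: (RintD mO (wdiv_mxdot_intR X P2) (X2_mxdot_intR X IJ)).
rewrite e//; under eq_fun do rewrite e//.
apply: cvgD; last exact: (X2_limit_weak IJ).2.
have -> : ∫ x, mxdot (div z x) (P x) = ∫ x, mxdot (dz x) (P x).
 have [w2 _] := X2_wdiv Xz; apply: (ip_ae mO w2 d2 P2 P2 dE).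
 by apply: aeW.
exact: X2_limit_wdiv_weak.
Qed.

End X2_closed.

(** * Compactly supported admissible fields *)

Section compactly_supported_fields.
Variables (p : V -> R) (B : 'M[R]_(m, n)).
Hypotheses (tp : test O p) (AB : A B = B).

Let sp : smooth p. Proof. exact: test_smooth tp. Qed.

Lemma test_by_parts (phi : V -> R) j : smooth phi ->
 ∫ x, (p x * partial j phi x) = - ∫ x, (partial j p x * phi x).
move=> sf; apply/eqP; rewrite -subr_eq0 opprK; apply/eqP.
have I1 : intO (fun x => p x * partial j phi x).
 by apply: smooth_intR bO; [exact: smoothM sp (sm_partial j sf)|exact: mO].
have I2 : intO (fun x => partial j p x * phi x).
 by apply: smooth_intR bO; [exact: smoothM (sm_partial j sp) sf|exact: mO].
rewrite -(RintD mO I1 I2) -[RHS](test_int_partial j mO (@subset_refl _ O) (testM tp sf)).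
by apply: Rint_eq => x _; rewrite (partialM j x sp sf) [phi x * _]mulrC.
Qed.

Definition test_mxfield : mxfield := fun x => p x *: B.
Definition test_div : field := fun x => \row_i \sum_j B i j * partial j p x.

Lemma test_div_smooth : smooth_field test_div.
move=> i; have -> : (fun x => test_div x 0 i) = (fun x => \sum_j B i j * partial j p x).
 by apply/funext => x; rewrite mxE.
by apply: smooth_sum => j _; apply: smoothZ; exact: sm_partial.
Qed.

Lemma test_mxfield_X2 : X2 test_mxfield /\
 {ae leb, forall x, O x -> div test_mxfield x = test_div x}.
have d2 := smooth_field_L2 test_div_smooth.
have wd : is_weak_div O test_mxfield test_div.
 apply/(is_weak_divP).
 - move=> i j; have -> : (fun x => test_mxfield x i j) = (fun x => B i j * p x).
   by apply/funext => x; rewrite !mxE mulrC.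
  by apply: smooth_intR bO; [exact: smoothZ|exact: mO].
 - by move=> i; apply: smooth_intR bO; [exact: test_div_smooth|exact: mO].
 move=> phi tphi i; have sf := test_smooth tphi.
 have I j : intO (fun x => partial j p x * phi x).
  by apply: smooth_intR bO; [exact: smoothM (sm_partial j sp) sf|exact: mO].
 have I' j : intO (fun x => p x * partial j phi x).
  by apply: smooth_intR bO; [exact: smoothM sp (sm_partial j sf)|exact: mO].
 have -> : ∫ x, (test_div x 0 i * phi x) =
   \sum_j B i j * ∫ x, (partial j p x * phi x).
  rewrite (@Rint_eq _ _ _ leb O _ (fun x => \sum_j B i j * (partial j p x * phi x))); last first.
   by move=> x _; rewrite mxE mulr_suml; apply: eq_bigr => j _; rewrite mulrA.
  rewrite (Rint_sum mO) => [|j _]; last exact: (intRZ mO).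
  by apply: eq_bigr => j _; exact: (RintZ mO).
 rewrite -sumrN; apply: eq_bigr => j _.
 rewrite -mulrN -(test_by_parts j sf) -(RintZ mO _ (I' j)).
 by apply: Rint_eq => x _; rewrite mxE; ring.
have Xz : X2 test_mxfield.
 split; last by exists test_div.
 - split.
   apply/(meas_mxP mO) => i j.
   apply: (eq_measurable_fun (fun x => B i j * p x)); first by move=> x _; rewrite mxE mulrC.
   by apply: cont_meas; apply: smooth_cont; exact: smoothZ.
  have [M M0 hM] := test_bounded tp.
  by exists (M * enorm B); apply: aeW => x Ox; rewrite enormZ ler_wpM2r ?enorm_ge0.
 - by apply: aeW => x _; rewrite /test_mxfield linearZ/= AB.
by split => //; exact: (wdiv_unique Xz d2 wd).
Qed.

Lemma test_mxfield_fluxm (P : field) : smooth_field P -> fluxm test_mxfield P = 0.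
move=> sP; have [Xz dE] := test_mxfield_X2.
have P2 := smooth_field_L2 sP.
have IJ i j := smooth_jac_intR i j sP.
rewrite (fluxmE Xz sP).
have I i j : intO (fun x => B i j * partial j (fun y => p y * P y 0 i) x).
 apply: smooth_intR bO; last exact: mO.
 by apply: smoothZ; apply: sm_partial; exact: smoothM sp (sP i).
have I1 i : intO (fun x => \sum_j B i j * partial j (fun y => p y * P y 0 i) x).
 by apply: (intR_sum mO) => j _.
have I2 : intO (fun x => \sum_i \sum_j B i j * partial j (fun y => p y * P y 0 i) x).
 by apply: (intR_sum mO) => i _.
rewrite (Rint_ae mO (g := fun x => \sum_i \sum_j B i j * partial j (fun y => p y * P y 0 i) x)).
- rewrite (Rint_sum mO) => [|i _]; last exact: I1.
 rewrite big1// => i _; rewrite (Rint_sum mO) => [|j _]; last exact: I.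
 rewrite big1// => j _; rewrite (RintZ mO).
  by rewrite (test_int_partial j mO (@subset_refl _ O) (testM tp (sP i))) mulr0.
 apply: smooth_intR bO; last exact: mO.
 by apply: sm_partial; exact: smoothM sp (sP i).
- exact: intR_meas (intRD mO (wdiv_mxdot_intR Xz P2) (X2_mxdot_intR Xz IJ)).
- exact: intR_meas I2.
apply: ae_mono dE => x e Ox; rewrite e// /mxdot big_ord1 -big_split/=.
apply: eq_bigr => i _; rewrite mxE mulr_suml -big_split/=; apply: eq_bigr => j _.
by rewrite (partialM j x sp (sP i)) !mxE; ring.
Qed.

Lemma test_div_mxdot (v : 'rV[R]_m) x : mxdot v (test_div x) = mxdot B (tensor v (grad p x)).
rewrite /mxdot big_ord1; apply: eq_bigr => i _; rewrite mxE mulr_sumr.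
by apply: eq_bigr => j _; rewrite !mxE; ring.
Qed.

End compactly_supported_fields.

(** * The conjugate integrand and its integral functional *)

Variable f : V -> 'M[R]_(m, n) -> R.
Hypothesis f_ge0 : forall x y, closure O x -> 0 <= f x y.
Hypothesis f_borel : mfun (closure O `*` setT)
 (fun xy : V * 'M[R]_(m, n) => f xy.1 xy.2).
Hypothesis f_convex : forall x, closure O x ->
 convex_function (E := 'M[R]_(m, n)) setT (f x).
Variables c0 C0 : R.
Hypotheses (c0_gt0 : 0 < c0) (C0_gt0 : 0 < C0).
Hypothesis f_growth : forall x y, closure O x ->
 c0 * enorm (A y) <= f x y <= C0 * (1 + enorm (A y)).

Lemma proj_enorm_le (y : 'M[R]_(m, n)) : enorm (A y) <= enorm y.
have h : enorm (A y) ^+ 2 <= enorm y * enorm (A y).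
 by rewrite enorm_sqr A_sym A_idem; exact: CS.
have [->|/eqP An] := eqVneq (enorm (A y)) 0; first exact: enorm_ge0.
have p : 0 < enorm (A y) by rewrite lt_neqAle enorm_ge0 andbT eq_sym; apply/eqP.
by rewrite -(ler_pM2r p) -expr2.
Qed.

Lemma f_conv x (t : R) y y' : closure O x -> 0 <= t <= 1 ->
 f x (t *: y + (1 - t) *: y') <= t * f x y + (1 - t) * f x y'.
move=> cx /andP[t0 t1].
by have := f_convex cx (Itv01 t0 t1) (in_setT y) (in_setT y').
Qed.

(** By convexity, y + h lies between y and the far point y + t h with weight 1/t. The upper growth
    bound at the far point contributes C0 |A h| and an error K / t. *)
Lemma f_lip x y h : closure O x -> f x (y + h) <= f x y + C0 * enorm (A h).
move=> cx; apply/ler_addgt0Pr => e e0.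
pose K := C0 * (1 + enorm (A y)).
have K0 : 0 <= K by rewrite mulr_ge0 ?(ltW C0_gt0)// addr_ge0// enorm_ge0.
(* Large enough for K / t <= e, and at least 1 so that 1/t is a weight. *)
pose t := K / e + 1.
have t1 : 1 <= t by rewrite /t lerDr divr_ge0// ltW.
have t0 : 0 < t by exact: lt_le_trans ltr01 t1.
have ti : 0 <= t^-1 <= 1 by rewrite invr_ge0 (ltW t0) invf_le1.
have /andP[ti0 ti1] := ti.
have := f_conv (y + t *: h) y cx ti.
have -> : t^-1 *: (y + t *: h) + (1 - t^-1) *: y = y + h.
 rewrite scalerDr scalerA mulVf ?gt_eqF// scale1r scalerBl scale1r.
 by rewrite addrC addrA subrK.
move=> /le_trans; apply.
have /andP[_ g1] := f_growth (y + t *: h) cx.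
have h1 : enorm (A (y + t *: h)) <= enorm (A y) + t * enorm (A h).
 by rewrite linearD linearZ/=; apply: le_trans (enorm_tri _ _) _; rewrite enormZ gtr0_norm.
have h2 : t^-1 * f x (y + t *: h) <= t^-1 * (K + t * (C0 * enorm (A h))).
 rewrite ler_wpM2l//; apply: le_trans g1 _.
 by have := ler_wpM2l (ltW C0_gt0) h1; rewrite /K; lra.
have h3 : t^-1 * (K + t * (C0 * enorm (A h))) = K / t + C0 * enorm (A h).
 by rewrite mulrDr [t^-1 * (t * _)]mulrA mulVf ?gt_eqF// mul1r [t^-1 * K]mulrC.
have h4 : K / t <= e.
 rewrite ler_pdivrMr// /t mulrDr mulr1 mulrCA divff ?gt_eqF// mulr1.
 by rewrite lerDl ltW.
have h5 : (1 - t^-1) * f x y <= f x y by rewrite ler_piMl ?f_ge0// lerBlDr lerDl.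
lra.
Qed.

Lemma conj_ub x z y : ((mxdot z y - f x y)%:E <= conjugate f x z)%E.
by apply: ereal_sup_ubound; exists y. Qed.

Lemma conj_ge x z : closure O x -> ((- C0)%:E <= conjugate f x z)%E.
move=> cx; apply: le_trans (conj_ub x z 0); rewrite lee_fin mxdot0r sub0r lerN2.
by have /andP[_] := f_growth 0 cx; rewrite linear0 enorm0 addr0 mulr1.
Qed.

Lemma conj_shift_ge0 x z : closure O x -> (0 <= conjugate f x z + C0%:E)%E.
by move=> cx; rewrite -leeBlDr// sub0e -EFinN; exact: conj_ge. Qed.

Lemma conj_le x z (c : R) : (forall y, mxdot z y - f x y <= c) -> (conjugate f x z <= c%:E)%E.
by move=> h; apply: ge_ereal_sup => _ [y _ <-]; rewrite lee_fin. Qed.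

(** At y = t z the supremand is at least t |z| (|z| - C0) - C0, where A z = z is used; if |z| > C0
    this is unbounded in t. *)
Lemma conj_fin_bound x z : closure O x -> conjugate f x z \is a fin_num -> A z = z ->
 enorm z <= C0.
move=> cx fz Az; rewrite leNgt; apply/negP => lt.
have z0 : 0 < enorm z by exact: lt_trans C0_gt0 lt.
pose d := enorm z * (enorm z - C0).
have d0 : 0 < d by rewrite mulr_gt0// subr_gt0.
pose c := fine (conjugate f x z).
have hc t : 0 < t -> t * d <= c + C0.
 move=> t0; have := conj_ub x z (t *: z); rewrite -(fineK fz) lee_fin -/c.
 have /andP[_] := f_growth (t *: z) cx.
 rewrite linearZ/= Az enormZ gtr0_norm// mxdotZr -enorm_sqr /d expr2; lra.
have p : 0 < (`|c + C0| + 1) / d by rewrite divr_gt0// ltr_wpDl.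
have := hc _ p; rewrite divfK ?gt_eqF//.
by have := ler_norm (c + C0); lra.
Qed.

Lemma conj_le0 x z : closure O x -> A z = z -> enorm z <= c0 -> (conjugate f x z <= 0)%E.
move=> cx Az zc; apply: conj_le => y; rewrite subr_le0.
have /andP[g _] := f_growth y cx; apply: le_trans g.
rewrite -{1}Az A_sym; apply: le_trans (CS _ _) _.
by rewrite ler_wpM2r ?enorm_ge0.
Qed.

Lemma conj_conv x z z' (t a b : R) : 0 <= t <= 1 ->
 (conjugate f x z <= a%:E)%E -> (conjugate f x z' <= b%:E)%E ->
 (conjugate f x ((1 - t) *: z + t *: z') <= ((1 - t) * a + t * b)%:E)%E.
move=> /andP[t0 t1] za zb; apply: conj_le => y.
have h1 : mxdot z y - f x y <= a by rewrite -lee_fin; exact: le_trans (conj_ub x z y) za.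
have h2 : mxdot z' y - f x y <= b by rewrite -lee_fin; exact: le_trans (conj_ub x z' y) zb.
have t1' : 0 <= 1 - t by rewrite subr_ge0.
have := lerD (ler_wpM2l t1' h1) (ler_wpM2l t0 h2).
by rewrite mxdotDl !mxdotZl; lra.
Qed.

Lemma conj_lsc x (z_ : nat -> 'M[R]_(m, n)) (z : 'M[R]_(m, n)) (a : R) :
 (forall i j, (fun k => z_ k i j) @ \oo --> z i j) -> (a%:E < conjugate f x z)%E ->
 exists N, forall k, (N <= k)%N -> (a%:E <= conjugate f x (z_ k))%E.
move=> cz /ereal_sup_gt[_ [y _ <-]]; rewrite lte_fin => ay.
have cc : (fun k => mxdot (z_ k) y - f x y) @ \oo --> mxdot z y - f x y.
 apply: cvgB; last exact: cvg_cst.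
 apply: cvg_bigsum => i.
 apply: cvg_bigsum => j.
 by apply: cvgM; [exact: cz|exact: cvg_cst].
have [N _ hN] := cvgr_gt _ cc _ ay.
exists N => k Nk; apply: le_trans (conj_ub x (z_ k) y).
by rewrite lee_fin; apply: ltW; exact: hN.
Qed.

(** An enumeration of the rational matrices; numbers that decode to no matrix give 0. *)
Definition ratmx (k : nat) : 'M[R]_(m, n) :=
 map_mx ratr (odflt (0 : 'M[rat]_(m, n)) (choice.unpickle k)).

Lemma ratmx_dense (y : 'M[R]_(m, n)) (e : R) : 0 < e -> exists k, enorm (y - ratmx k) <= e.
move=> e0; pose e' := e / ((m * n)%:R + 1).
have e'0 : 0 < e' by rewrite divr_gt0// ltr_wpDl.
have /choice[c cP] : forall ij : 'I_m * 'I_n, exists c : rat, `|y ij.1 ij.2 - ratr c| <= e'.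
 move=> ij; have h : y ij.1 ij.2 - e' < y ij.1 ij.2 + e' by move: e'0; lra.
 have [c] := rat_in_itvoo h; rewrite in_itv/= => /andP[h1 h2].
 by exists c; rewrite ler_norml; apply/andP; split; lra.
exists (choice.pickle (\matrix_(i, j) c (i, j))); rewrite /ratmx choice.pickleK/=.
apply: le_trans (enorm_le_entries (e := e') _) _.
 by move=> i j; rewrite !mxE; exact: (cP (i, j)).
rewrite /e' mulrCA ler_piMr ?(ltW e0)// ler_pdivrMr ?mul1r ?lerDl// ltr_wpDl.
Qed.

(** By [f_lip] the supremand is continuous in y, so a dense sequence suffices. A countable supremum
    is what makes the conjugate measurable along a measurable field. *)
Lemma conj_ratmx x z : closure O x ->
 conjugate f x z = esups (fun k => (mxdot z (ratmx k) - f x (ratmx k))%:E) 0.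
move=> cx; apply/eqP; rewrite eq_le; apply/andP; split; last first.
 by apply: ge_ereal_sup => _ [k _ <-]; exact: conj_ub.
apply: ge_ereal_sup => _ [y _ <-]; apply/lee_addgt0Pr => e e0.
have K0 : 0 < enorm z + C0 by rewrite ltr_wpDl// enorm_ge0.
have [k hk] := ratmx_dense y (divr_gt0 e0 K0).
apply: (@le_trans _ _ ((mxdot z (ratmx k) - f x (ratmx k))%:E + e%:E)%E); last first.
 by rewrite leeD2r//; apply: ereal_sup_ubound; exists k.
rewrite -EFinD lee_fin.
have h1 := f_lip y (ratmx k - y) cx.
rewrite addrC subrK in h1.
have h2 : mxdot z (y - ratmx k) <= enorm z * enorm (y - ratmx k) by exact: CS.
have h3 : enorm (A (ratmx k - y)) <= enorm (y - ratmx k).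
 by apply: le_trans (proj_enorm_le _) _; rewrite -enormN opprB.
have h4 : (enorm z + C0) * enorm (y - ratmx k) <= e.
 by rewrite mulrC -ler_pdivlMr.
rewrite mxdotBr in h2.
have := ler_wpM2l (ltW C0_gt0) h3; rewrite mulrDl in h4; lra.
Qed.

Lemma conj_meas (z : mxfield) : mfun O z ->
 mfun O (fun x => conjugate f x (z x)).
move=> mz; apply: (eq_measurable_fun (fun x => esups (fun k => (mxdot (z x) (ratmx k) - f x (ratmx k))%:E) 0)).
 by move=> x; rewrite inE => Ox; rewrite conj_ratmx//; exact: subset_closure.
apply: (measurable_fun_esups (f := fun k x => (mxdot (z x) (ratmx k) - f x (ratmx k))%:E)) => k.
apply/mEFinP; apply: mfunB.
 by apply: mxdot_meas => //; exact: mcst.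
have mc : measurable (closure O) by apply: closed_meas; exact: closed_closure.
apply: (measurable_comp (F := closure O `*` setT) (f := fun xy : V * 'M[R]_(m, n) => f xy.1 xy.2) (g := fun x : V => (x, ratmx k))).
- exact: measurableX.
- by move=> _ [x Ox <-]; split => //; exact: subset_closure.
- exact: f_borel.
- by apply: mfunTS; exact: measurable_pair2.
Qed.

Definition conj_val (z : mxfield) (x : V) : R := fine (conjugate f x (z x)).
Definition conj_int (z : mxfield) : R := ∫ x, conj_val z x.

Lemma Z_ae_fin z : in_Z A O f z ->
 {ae leb, forall x, O x -> conjugate f x (z x) \is a fin_num}.
by move=> [_ Iz]; exact: integrable_ae. Qed.

Lemma Z_conj_intR z : in_Z A O f z -> intO (conj_val z).
move=> Zz; have [[[mz _] _ _] Iz] := Zz; have [mc fin] := integrableP _ _ _ Iz.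
have mcv : mfun O (EFin \o conj_val z).
 by apply/mEFinP; apply: mcomp.
have ae : ae_eq leb O (fun x => conjugate f x (z x)) (EFin \o conj_val z).
 by apply: ae_mono (Z_ae_fin Zz) => x h Ox; rewrite /= fineK// h.
apply/integrableP; split => //.
have e : (∫ x, `|(EFin \o conj_val z) x| = ∫ x, `|conjugate f x (z x)|)%E.
 apply: ae_eq_integral => //; try by apply: mcomp.
 by apply: ae_mono ae => x h Ox; rewrite h.
by rewrite e.
Qed.

Lemma Z_conj_integral z : in_Z A O f z ->
 (∫ x, conjugate f x (z x) = (conj_int z)%:E)%E.
move=> Zz; have [[[mz _] _ _] Iz] := Zz; have [mc fin] := integrableP _ _ _ Iz.
rewrite -(EFin_Rint mO (Z_conj_intR Zz)); apply: ae_eq_integral => //.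
 exact: measurable_int (Z_conj_intR Zz).
by apply: ae_mono (Z_ae_fin Zz) => x h Ox; rewrite /= fineK// h.
Qed.

Lemma Z_ae_bounded z : in_Z A O f z -> ae_bounded z C0.
move=> Zz; have [[_ Az _] _] := Zz.
apply: ae_mono2 Az (Z_ae_fin Zz) => x h1 h2 Ox.
by apply: (conj_fin_bound (subset_closure Ox)); [exact: h2|exact: h1].
Qed.

Lemma Z_shift z : in_Z A O f z ->
 (∫ x, (conjugate f x (z x) + C0%:E) = (conj_int z + C0 * fine (leb O))%:E)%E.
move=> Zz; have [_ Iz] := Zz.
rewrite integralD//; last exact: intR_cst mO C0 Ooo.
by rewrite (Z_conj_integral Zz) (EFin_Rint mO (intR_cst mO C0 Ooo)) Rint_cst.
Qed.

(* The shift by C0 makes the conjugate nonnegative, so that an upper bound on its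
 integral suffices. *)
Lemma Z_intro z (c : R) : X2 z ->
 (∫ x, (conjugate f x (z x) + C0%:E) <= (c + C0 * fine (leb O))%:E)%E ->
 in_Z A O f z /\ conj_int z <= c.
move=> Xz le; have [[mz _] _ _] := Xz.
have mc := conj_meas mz.
have ms : mfun O (fun x => conjugate f x (z x) + C0%:E)%E.
 by apply: emeasurable_funD => //; exact: mcst.
have s0 x : O x -> (0 <= conjugate f x (z x) + C0%:E)%E.
 by move=> Ox; apply: conj_shift_ge0; exact: subset_closure.
have Is : leb.-integrable O (fun x => conjugate f x (z x) + C0%:E)%E.
 apply/integrableP; split => //.
 apply: le_lt_trans (ltry (c + C0 * fine (leb O))); apply: le_trans le.
 rewrite le_eqVlt; apply/orP; left; apply/eqP.
 by apply: eq_integral => x; rewrite inE => Ox; rewrite gee0_abs// s0.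
have Zz : in_Z A O f z.
 split => //.
 have := integrableB mO Is (intR_cst mO C0 Ooo).
 apply: eq_integrable => // x _ /=.
 by rewrite addeK.
split => //; move: le; rewrite (Z_shift Zz) lee_fin; lra.
Qed.

Lemma Z_comb z z' (t : R) : 0 <= t <= 1 -> in_Z A O f z -> in_Z A O f z' ->
 in_Z A O f (fun x => (1 - t) *: z x + t *: z' x) /\
 conj_int (fun x => (1 - t) *: z x + t *: z' x) <= (1 - t) * conj_int z + t * conj_int z'.
move=> t01 Zz Zz'; have [Xz _] := Zz; have [Xz' _] := Zz'.
have [Xt _] := X2_comb (1 - t) t Xz Xz'.
apply: (Z_intro Xt); have [[mt _] _ _] := Xt.
pose g x := ((1 - t) * conj_val z x + t * conj_val z' x) + C0.
have I1 := intRZ mO (1 - t) (Z_conj_intR Zz).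
have I2 := intRZ mO t (Z_conj_intR Zz').
have Ig : intO g := intRD mO (intRD mO I1 I2) (intR_cst mO C0 Ooo).
have eg : ∫ x, g x = (1 - t) * conj_int z + t * conj_int z' + C0 * fine (leb O).
 rewrite (RintD mO (intRD mO I1 I2) (intR_cst mO C0 Ooo)) (RintD mO I1 I2).
 by rewrite (RintZ mO _ (Z_conj_intR Zz)) (RintZ mO _ (Z_conj_intR Zz')) (Rint_cst _ mO).
rewrite -eg -(EFin_Rint mO Ig).
have v0 (y : mxfield) x : O x -> - C0 <= conj_val y x.
 move=> Ox; have := conj_ge (y x) (subset_closure Ox); rewrite /conj_val.
 by case: (conjugate f x (y x)) => [r||] //= _; rewrite oppr_le0 ltW.
have /andP[t0 t1] := t01; have t1' : 0 <= 1 - t by rewrite subr_ge0.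
apply: ae_ge0_le_integral => //.
- by move=> x Ox; apply: conj_shift_ge0; exact: subset_closure.
- apply: emeasurable_funD; [exact: (conj_meas mt)|exact: mcst].
- move=> x Ox; rewrite lee_fin /g.
 by have := ler_wpM2l t1' (v0 z x Ox); have := ler_wpM2l t0 (v0 z' x Ox); lra.
- exact: measurable_int Ig.
- apply: ae_mono2 (Z_ae_fin Zz) (Z_ae_fin Zz') => x h1 h2 Ox.
 rewrite /g EFinD leeD2r//; apply: conj_conv => //.
  by rewrite /conj_val fineK// h1.
 by rewrite /conj_val fineK// h2.
Qed.

(** Fatou's lemma for the conjugate shifted by C0, which is lower semicontinuous as a supremum of
    affine functions. *)
Lemma Z_lsc (z_ : nat -> mxfield) z (c_ : nat -> R) c : (forall k, in_Z A O f (z_ k)) ->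
 X2 z ->
 {ae leb, forall x, O x -> forall i j, (fun k => z_ k x i j) @ \oo --> z x i j} ->
 (forall k, conj_int (z_ k) <= c_ k) -> c_ @ \oo --> c ->
 in_Z A O f z /\ conj_int z <= c.
move=> Zk Xz ae hc cc; apply: (Z_intro Xz); have [[mz _] _ _] := Xz.
have s0 (y : mxfield) x : O x -> (0 <= conjugate f x (y x) + C0%:E)%E.
 by move=> Ox; apply: conj_shift_ge0; exact: subset_closure.
have ms (y : mxfield) : mfun O y -> mfun O (fun x => conjugate f x (y x) + C0%:E)%E.
 by move=> my; apply: emeasurable_funD; [exact: conj_meas|exact: mcst].
apply: (@fatou_le _ _ _ leb O mO (fun k x => conjugate f x (z_ k x) + C0%:E)%E _ (fun k => c_ k + C0 * fine (leb O))).
- by move=> k; apply: ms; have [[[mk _] _ _] _] := Zk k.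
- exact: ms.
- by move=> k x Ox; exact: s0.
- by move=> x Ox; exact: s0.
- apply: ae_mono ae => x h Ox a ag.
 have ag' : ((a - C0)%:E < conjugate f x (z x))%E.
  by rewrite EFinB lteBlDr.
 have [N hN] := conj_lsc (h Ox) ag'.
 exists N => k Nk; have := hN k Nk.
 by rewrite EFinB leeBlDr.
- by move=> k; rewrite (Z_shift (Zk k)) lee_fin lerD2r.
- by apply: cvgD => //; exact: cvg_cst.
Qed.

(** * The dual functional *)

Variable u1 : bdfield.
Hypothesis u1_L1 : inLb u1.
Local Notation Z := (in_Z A O f).
Local Notation F := (F_dual A O f tr u1).

Definition gain (z : mxfield) : R := - conj_int z + nflux z u1.

Lemma Z_X2 z : Z z -> X2 z. Proof. by case. Qed.

Lemma div_L2 z : X2 z -> inL2 (div z).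
by move=> Xz; have [] := X2_wdiv Xz. Qed.

Lemma ae_bounded_L2 (z : mxfield) (M : R) : 0 <= M -> mfun O z ->
 ae_bounded z M ->
 inL2 z /\ ipO z z <= M ^+ 2 * fine (leb O).
move=> M0 mz bz.
have le : (∫ x, (enorm (z x) ^+ 2)%:E <= (M ^+ 2 * fine (leb O))%:E)%E.
 rewrite -(Rint_cst leb mO) -(EFin_Rint mO (intR_cst mO _ Ooo)).
 apply: ae_ge0_le_integral => //.
 - by move=> x _; rewrite lee_fin sqr_ge0.
 - by apply/mEFinP; apply: measurable_funX; exact: enorm_meas.
 - by move=> x _; rewrite lee_fin sqr_ge0.
 - by apply: ae_mono bz => x h Ox; rewrite lee_fin ler_pXn2r ?nnegrE ?enorm_ge0// h.
have z2 : inL2 z by split => //; exact: le_lt_trans le (ltry _).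
split => //; rewrite -lee_fin -(EFin_Rint mO (ip_intR mO z2 z2)).
by under eq_integral do rewrite -enorm_sqr.
Qed.

Lemma Z_L2 z : Z z -> inL2 z /\ ipO z z <= C0 ^+ 2 * fine (leb O).
move=> Zz; have [[[mz _] _ _] _] := Zz.
by apply: ae_bounded_L2 => //; [exact: ltW|exact: (Z_ae_bounded Zz)].
Qed.

Lemma F_term z (w : field) : Z z -> inL2 w ->
 (∫ x, (- conjugate f x (z x) - (mxdot (w x) (div z x))%:E) +
 \int[sn]_(x in dO) (mxdot (normal_trace O tr z x) (u1 x))%:E)%E =
 (gain z - ipO w (div z))%:E.
move=> Zz w2; have Xz := Z_X2 Zz; have [[[mz _] _ _] Iz] := Zz.
have I1 := Z_conj_intR Zz; have I2 := ip_intR mO w2 (div_L2 Xz).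
have I : intO (fun x => - conj_val z x - mxdot (w x) (div z x)).
 exact: (intRB mO (intRN I1) I2).
have e1 : (∫ x, (- conjugate f x (z x) - (mxdot (w x) (div z x))%:E))%E =
  (- conj_int z - ipO w (div z))%:E.
 rewrite -(RintN mO I1) -(RintB mO (intRN I1) I2) -(EFin_Rint mO I).
 apply: ae_eq_integral => //.
 - apply: emeasurable_funB; last exact: measurable_int I2.
  by apply: mcomp => //; exact: measurable_int Iz.
 - exact: measurable_int I.
 - apply: ae_mono (Z_ae_fin Zz) => x h Ox.
  by rewrite EFinB EFinN /conj_val fineK// h.
have e2 : (\int[sn]_(x in dO) (mxdot (normal_trace O tr z x) (u1 x))%:E =
  (nflux z u1)%:E)%E.
 rewrite -(EFin_Rint (surface_meas_bd) (nflux_intR Xz u1_L1)).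
 by apply: eq_integral => x _; rewrite mxdotC.
by rewrite e1 e2 -EFinD /gain; congr (_%:E); ring.
Qed.

Lemma F_ge z (w : field) : Z z -> inL2 w -> ((gain z - ipO w (div z))%:E <= F w)%E.
by move=> Zz w2; apply: ereal_sup_ubound; exists z => //; exact: F_term. Qed.

Lemma F_le (w : field) (c : R) : inL2 w ->
 (forall z, Z z -> gain z - ipO w (div z) <= c) -> (F w <= c%:E)%E.
by move=> w2 h; apply: ge_ereal_sup => _ [z Zz <-]; rewrite F_term// lee_fin h.
Qed.

Lemma Z_small z : X2 z -> (forall x, A (z x) = z x) -> (forall x, enorm (z x) <= c0) ->
 Z z /\ conj_int z <= 0.
move=> Xz Az zc; have [[mz _] _ _] := Xz.
apply: (Z_intro Xz).
rewrite add0r -(Rint_cst leb mO) -(EFin_Rint mO (intR_cst mO C0 Ooo)).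
apply: ge0_le_integral => //.
- by move=> x Ox; apply: (conj_shift_ge0); exact: subset_closure.
- apply: emeasurable_funD; last exact: mcst.
 exact: (conj_meas mz).
- move=> x Ox; rewrite -[leRHS]add0e leeD2r//.
 by apply: (conj_le0); [exact: subset_closure|exact: Az|exact: zc].
Qed.

Lemma zero_Z : Z (fun=> 0).
have X0 : X2 (fun=> 0).
 split.
 - by split; [exact: mcst|exists 0; apply: aeW => x _; rewrite enorm0].
 - by apply: aeW => x _; rewrite linear0.
 - exists (fun=> 0); split.
   split; first exact: mcst.
   by under eq_integral do rewrite enorm0 expr0n/=; rewrite integral0 ltry.
  move=> phi _ i.
  under eq_integral do [under eq_bigr do rewrite !mxE mul0r]; rewrite ?big1//.
  under [in RHS]eq_integral do rewrite !mxE mul0r.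
  by rewrite !integral0 oppe0.
by have [] := Z_small X0 (fun=> linear0 _) _ => // x; rewrite enorm0 ltW.
Qed.

Lemma gain_comb z z' (t : R) : 0 <= t <= 1 -> Z z -> Z z' ->
 (1 - t) * gain z + t * gain z' <= gain (fun x => (1 - t) *: z x + t *: z' x).
move=> t01 Zz Zz'.
have [_ h] := Z_comb t01 Zz Zz'.
have h' := nflux_comb (1 - t) t (Z_X2 Zz) (Z_X2 Zz') u1_L1.
move: h; rewrite /gain h'.
move: (conj_int _) (conj_int z) (conj_int z') (nflux z _) (nflux z' _).
move=> a b b' c c' h.
rewrite -subr_ge0 (_ : _ - _ = (1 - t) * b + t * b' - a) ?subr_ge0//.
ring.
Qed.

(** * From the subdifferential to attainment *)

Section subdifferential.
Variables u r : field.
Hypotheses (u2 : inL2 u) (r2 : inL2 r).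
Variable Fu : R.
Hypothesis F_u : F u = Fu%:E.
Hypothesis ur : subdifferential O F u r.

(** The defect: how far z is from attaining the supremum at u. *)
Let dfc z : R := Fu - gain z + ipO u (div z).
(** The residual r + div z, in the shape of a linear combination so that [in_L2_lin] and [ip_linr]
    apply to it. *)
Let res (z : mxfield) : field := fun x => 1 *: div z x + 1 *: r x.

Lemma dfc_ge0 z : Z z -> 0 <= dfc z.
move=> Zz; have := F_ge Zz u2; rewrite F_u lee_fin /dfc.
by rewrite -subr_ge0; congr (is_true (0 <= _)); ring.
Qed.

Lemma res_L2 z : Z z -> inL2 (res z).
by move=> Zz; apply: (in_L2_lin mO) => //; exact: div_L2 (Z_X2 Zz). Qed.

Lemma dfc_mix (t : R) z z' : 0 <= t <= 1 -> Z z -> Z z' ->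
 [/\ Z (fun x => (1 - t) *: z x + t *: z' x),
  dfc (fun x => (1 - t) *: z x + t *: z' x) <= (1 - t) * dfc z + t * dfc z' &
  {ae leb, forall x, O x -> res (fun x => (1 - t) *: z x + t *: z' x) x =
   (1 - t) *: res z x + t *: res z' x}].
move=> t01 Zz Zz'; have g := gain_comb t01 Zz Zz'.
have [Zw _] := Z_comb t01 Zz Zz'.
have [Xw dw] := X2_comb (1 - t) t (Z_X2 Zz) (Z_X2 Zz').
have d2 := div_L2 (Z_X2 Zz); have d2' := div_L2 (Z_X2 Zz').
split => //.
- rewrite /dfc.
 have -> : ipO u (div (fun x => (1 - t) *: z x + t *: z' x)) =
   (1 - t) * ipO u (div z) + t * ipO u (div z').
  rewrite -(ip_linr mO _ _ d2 d2' u2).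
  by apply: (ip_ae mO u2 u2 (div_L2 Xw) (in_L2_lin mO (1 - t) t d2 d2')) => //; exact: aeW.
 rewrite -subr_ge0; move: g; rewrite -subr_ge0.
 move: (gain (fun _ => _)) (gain z) (gain z') (ipO _ _) (ipO _ _) => a b b' c c' h.
 by rewrite (_ : _ - _ = a - ((1 - t) * b + t * b'))//; ring.
- apply: ae_mono dw => x e Ox; rewrite /res e//; apply/matrixP => i j; rewrite !mxE; ring.
Qed.

(** The hypothesis bounds every term of the supremum at u + g, so F(u + g) <= F(u) + <g, r> - c,
    while the subdifferential inequality gives F(u + g) >= F(u) + <g, r>. *)
Lemma dfc_support (g : field) (c : R) : inL2 g ->
 (forall z, Z z -> c <= dfc z + ipO g (res z)) -> c <= 0.
move=> g2 h; pose w x := 1 *: u x + 1 *: g x.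
have w2 : inL2 w by exact: in_L2_lin.
have Fw : (F w <= (Fu + ipO g r - c)%:E)%E.
 apply: F_le => // z Zz; have := h z Zz; have d2 := div_L2 (Z_X2 Zz).
 rewrite /dfc (ip_linl mO 1 1 u2 g2 d2) (ip_linr mO 1 1 d2 r2 g2).
 move: (gain z) (ip _ _ _ _) (ip _ _ _ _) (ip _ _ _ _) => a b b' b'' h'.
 rewrite -subr_ge0; move: h'; rewrite -subr_ge0; congr (is_true (0 <= _)); ring.
have := ur w2; rewrite F_u.
have -> : (∫ x, (mxdot (r x) (w x - u x))%:E = (ipO g r)%:E)%E.
 rewrite -(EFin_Rint mO (ip_intR mO g2 r2)); apply: eq_integral => x _.
 by rewrite /w !scale1r addrC addKr mxdotC.
move=> h1; have := le_trans h1 (leeB Fw (lexx Fu%:E)).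
rewrite -EFinB lee_fin -subr_ge0 => h2.
by rewrite -oppr_ge0; move: h2; congr (is_true (0 <= _)); ring.
Qed.

Let energy z := dfc z + 2^-1 * ipO (res z) (res z).

Let energy_ge0 z : Z z -> 0 <= energy z.
by move=> Zz; rewrite addr_ge0 ?dfc_ge0// mulr_ge0 ?ip_ge0// invr_ge0. Qed.

Lemma energy_mix (t : R) z z' : 0 <= t <= 1 -> Z z -> Z z' ->
 energy (fun x => (1 - t) *: z x + t *: z' x) <= (1 - t) * dfc z + t * dfc z' +
  2^-1 * ((1 - t) ^+ 2 * ipO (res z) (res z) + 2 * (1 - t) * t * ipO (res z) (res z')
   + t ^+ 2 * ipO (res z') (res z')).
move=> t01 Zz Zz'; have [Zw dw vw] := dfc_mix t01 Zz Zz'.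
have q2 := res_L2 Zz; have q2' := res_L2 Zz'; have h2 := in_L2_lin mO (1 - t) t q2 q2'.
rewrite -(ip_sqr_lin mO _ _ q2 q2') -(ip_ae mO (res_L2 Zw) h2 (res_L2 Zw) h2 vw vw).
by rewrite lerD2r.
Qed.

Let energies := [set energy z | z in Z].
Let m0 := inf energies.

Let energies_inf : has_inf energies.
split; first by exists (energy (fun=> 0)), (fun=> 0) => //; exact: zero_Z.
by exists 0 => _ [z Zz <-]; exact: energy_ge0.
Qed.

Let m0_le z : Z z -> m0 <= energy z.
by move=> Zz; apply: ge_inf; [exact: energies_inf.2|exists z]. Qed.

Let near k z := Z z /\ energy z <= m0 + k.+1%:R^-1.

Lemma near_ex k : exists z, near k z.
have k0 : 0 < k.+1%:R^-1 :> R by rewrite invr_gt0.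
by have [_ [z Zz <-] /ltW h] := inf_adherent k0 energies_inf; exists z.
Qed.

(** The energy is convex and quadratic in the residual, so comparing the midpoint with the infimum
    forces the residuals of near-minimisers together. *)
Lemma near_mid k z z' : near k z -> near k z' ->
 near k (fun x => (1 - 2^-1) *: z x + 2^-1 *: z' x) /\
 ipO (fun x => res z x - res z' x) (fun x => res z x - res z' x) <= 8 * k.+1%:R^-1.
move=> [Zz dz] [Zz' dz']; have [Zw _ _] := dfc_mix (@half01 R) Zz Zz'.
have := ip_ge0 leb O (fun x => res z x - res z' x).
rewrite (ip_sqr_sub mO (res_L2 Zz) (res_L2 Zz')) => pos.
have [h1 h2] := energy_midpoint (energy_mix (@half01 R) Zz Zz') (m0_le Zw) dz dz' pos.
by split => //; split => //; exact: Zw.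
Qed.

(** The energy controls residuals but not the fields. Among the fields of energy within 1/(k+1) of
    the infimum, one of nearly least L^2 norm is taken; the parallelogram identity for that norm
    makes these Cauchy, and the pointwise bound C0 on Z bounds the norms. *)
Lemma near_minimal : exists z_ : nat -> mxfield, (forall k, near k (z_ k)) /\
 forall e : R, 0 < e -> exists N, forall k l, (N <= k)%N -> (N <= l)%N ->
  ipO (fun x => z_ k x - z_ l x) (fun x => z_ k x - z_ l x) <= e.
have [] := minimizing_cauchy (P := near) (Phi := fun z => ipO z z)
 (dist := fun z z' => ipO (fun x => z x - z' x) (fun x => z x - z' x))
 (B := C0 ^+ 2 * fine (leb O)).
- by move=> k l z kl [Zz dz]; split => //; apply: le_trans dz _; rewrite lerD2l lef_pV2 ?posrE// ler_nat.
- by move=> k z _; exact: ip_ge0.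
- by move=> k; have [z nz] := near_ex k; exists z => //; have [Zz _] := nz; exact: (Z_L2 Zz).2.
- move=> k z z' nz nz'; exists (fun x => (1 - 2^-1) *: z x + 2^-1 *: z' x).
  exact: (near_mid nz nz').1.
 have [[Zz _] [Zz' _]] := (nz, nz').
 have [[z2 _] [z2' _]] := (Z_L2 Zz, Z_L2 Zz').
 have := ip_ge0 leb O (fun x => z x - z' x).
 rewrite (ip_sqr_lin mO _ _ z2 z2') (ip_sqr_sub mO z2 z2'); exact: parallelogram_le.
- by move=> z_ [nz cau]; exists z_.
Qed.

Lemma energy_minimizer : exists z g, [/\ Z z, inL2 g,
 {ae leb, forall x, O x -> div z x = g x - r x} & dfc z + 2^-1 * ipO g g <= m0].
have [z_ [nz cau]] := near_minimal; have Zk k : Z (z_ k) by have [] := nz k.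
have [z [s [z2 sk ae _]]] := L2_complete mO Ooo (fun k => (Z_L2 (Zk k)).1) cau.
(* The residuals are Cauchy as a whole sequence, so they converge along the subsequence already
   chosen for the fields. *)
have [|g [_ [g2 _ _ gl]]] := L2_complete mO Ooo (fun k => res_L2 (Zk k)).
 move=> e e0; have e8 : 0 < e / 8 by rewrite divr_gt0.
 have [N _ hN] := cvgr_le 0 (@cvg_harmonic R) _ e8; exists N => k l Nk Nl.
 have mono j : (N <= j)%N -> near N (z_ j).
  move=> Nj; have [Zj dj] := nz j; split => //; apply: le_trans dj _.
  by rewrite lerD2l lef_pV2 ?posrE// ler_nat.
 apply: le_trans (near_mid (mono _ Nk) (mono _ Nl)).2 _.
 by rewrite mulrC -ler_pdivlMr//; exact: hN N (leqnn N).
pose y_ k := z_ (s k); have Zy k : Z (y_ k) by exact: Zk.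
have Xy k : X2 (y_ k) := Z_X2 (Zy k).
have by_ k : ae_bounded (y_ k) C0 := Z_ae_bounded (Zy k).
have cg : (fun k => ip leb O (fun x => res (y_ k) x - g x) (fun x => res (y_ k) x - g x)) @ \oo --> (0 : R).
 apply/cvgrPdist_le => e e0; have [N hN] := gl e e0; exists N => // k Nk.
 by rewrite /= sub0r normrN ger0_norm ?ip_ge0//; apply: hN; exact: leq_trans Nk (sk k).
pose dz : field := fun x => g x - r x; have d2 : inL2 dz := in_L2_diff mO g2 r2.
have dyz : (fun k => ip leb O (fun x => div (y_ k) x - dz x)
  (fun x => div (y_ k) x - dz x)) @ \oo --> (0 : R).
 apply: cvg_ext cg => k; apply: Rint_eq => x _.
 by rewrite /res /dz !scale1r opprB addrA [div _ _ + _ - _]addrAC.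
have M0 : 0 <= C0 := ltW C0_gt0.
have [Xz dE] := X2_limit M0 Xy by_ z2 d2 ae dyz.
have fl P sP := X2_limit_fluxm M0 Xy by_ z2 d2 ae dyz (P := P) sP.
have bz := X2_limit_bounded M0 by_ ae.
have c1 := nflux_cvg M0 Xy Xz by_ bz fl u1_L1.
have c2 : (fun k => ipO u (div (y_ k))) @ \oo --> ipO u dz.
 rewrite ipC; under eq_fun do rewrite ipC.
 exact: (ip_cvg mO (fun k => div_L2 (Xy k)) d2 u2 dyz).
have c3 := ip_sqr_cvg mO (fun k => res_L2 (Zy k)) g2 cg.
(* The energy bound solved for [conj_int]: all other terms converge, so lower semicontinuity of the
   conjugate integral is enough to pass to the limit. *)
pose c_ k := m0 + k.+1%:R^-1 - 2^-1 * ipO (res (y_ k)) (res (y_ k)) - Fu + nflux (y_ k) u1 - ipO u (div (y_ k)).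
have [Zz cz] : Z z /\ conj_int z <= m0 + 0 - 2^-1 * ipO g g - Fu + nflux z u1 - ipO u dz.
 apply: (Z_lsc Zy Xz ae (c_ := c_)).
  move=> k; have [_ h] := nz (s k).
  have {}h : energy (y_ k) <= m0 + k.+1%:R^-1.
   by apply: le_trans h _; rewrite lerD2l lef_pV2 ?posrE// ler_nat ltnS.
  rewrite /energy /dfc /gain -subr_ge0 in h; rewrite /c_ -subr_ge0; move: h.
  by congr (is_true (0 <= _)); ring.
 apply: cvgB => //; apply: cvgD => //; apply: cvgB; last exact: cvg_cst.
 apply: cvgB; last by apply: cvgM => //; exact: cvg_cst.
 by apply: cvgD; [exact: cvg_cst|exact: (@cvg_harmonic R)].
exists z, g; split => //; rewrite /dfc.
have -> : ipO u (div z) = ipO u dz.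
 by apply: (ip_ae mO u2 u2 (div_L2 Xz) d2 _ dE); exact: aeW.
rewrite addr0 -subr_ge0 in cz; rewrite /gain -subr_ge0; move: cz.
by congr (is_true (0 <= _)); ring.
Qed.

(* The optimality condition of the minimiser [z], tested with the direction [g] in
 the subdifferential inequality, forces both terms of the energy to vanish. *)
Lemma subdifferential_attained : exists z, [/\ Z z,
 {ae leb, forall x, O x -> r x = - div z x} & Fu = gain z + ipO u r].
have [z [g [Zz g2 dE min]]] := energy_minimizer; have Xz := Z_X2 Zz.
have resE : {ae leb, forall x, O x -> res z x = g x}.
 by apply: ae_mono dE => x e Ox; rewrite /res e// !scale1r subrK.
have gE z' : Z z' -> ipO (res z) (res z') = ipO g (res z').
 move=> Zz'; apply: (ip_ae mO (res_L2 Zz) g2 (res_L2 Zz') (res_L2 Zz') resE); exact: aeW.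
have ggE : ipO (res z) (res z) = ipO g g := ip_ae mO (res_L2 Zz) g2 (res_L2 Zz) g2 resE resE.
have opt z' : Z z' -> dfc z + ipO g g <= dfc z' + ipO g (res z').
 move=> Zz'; rewrite -subr_ge0.
 apply: (@first_order_ge0 _ _ (2^-1 * (ipO g g - 2 * ipO g (res z') + ipO (res z') (res z')))).
 move=> t t01; have [Zw _ _] := dfc_mix t01 Zz Zz'.
 have := le_trans min (le_trans (m0_le Zw) (energy_mix t01 Zz Zz')); rewrite ggE gE//.
 move: (dfc z) (dfc z') (ipO g g) (ipO g _) (ipO _ _) => a a' b c e.
 by rewrite -subr_ge0; congr (is_true (0 <= _)); field.
have d0 := dfc_ge0 Zz; have gg0 := ip_ge0 leb O g.
have s0 := dfc_support g2 opt.
have dz0 : dfc z = 0 by apply/eqP; rewrite eq_le d0 andbT; apply: le_trans s0; rewrite lerDl.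
have g0 : ipO g g = 0 by apply/eqP; rewrite eq_le gg0 andbT; apply: le_trans s0; rewrite lerDr.
have ae0 := ip_eq0 mO g2 g0.
have dr : {ae leb, forall x, O x -> r x = - div z x}.
 by apply: ae_mono2 dE ae0 => x e e0 Ox; rewrite e// e0// sub0r opprK.
exists z; split => //.
have -> : ipO u r = - ipO u (div z).
 rewrite /ip -(RintN mO (ip_intR mO u2 (div_L2 Xz))).
 apply: (Rint_ae mO (intR_meas (ip_intR mO u2 r2)) (intR_meas (intRN (ip_intR mO u2 (div_L2 Xz))))).
 by apply: ae_mono dr => x h Ox; rewrite h// mxdotC mxdotNl mxdotC.
apply/eqP; rewrite -subr_eq0 -dz0 /dfc; apply/eqP; ring.
Qed.

End subdifferential.

(** The fields are p s A(delta_ij) with p a test function. Compact support removes the boundary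
    term, so [Fu] bounds s times an entry of A Du at p; both signs of s together bound its absolute
    value. *)
Lemma F_fin_BVA (u : field) (Fu : R) : inL2 u -> F u = Fu%:E -> BVA u.
move=> u2 F_u.
have cu : comps_L1 u by move=> i; have [_ _] := in_L2_comps i u2.
pose C : R := `|Fu| / c0.
have C_ge0 : 0 <= C by rewrite divr_ge0// ltW.
apply: (BVA_bounded (C := C) cu) => i j p M tp pM.
have key (M' s : R) : 0 < M' -> (forall x, `|p x| <= M') -> `|s| = c0 / M' ->
  s * Adist i j u p <= Fu.
 move=> M'0 hM sE; pose B : 'M[R]_(m, n) := s *: A (delta_mx i j).
 have AB : A B = B by rewrite linearZ/= A_idem.
 have [Xz dE] := test_mxfield_X2 tp AB.
 have Az x : A (test_mxfield p B x) = test_mxfield p B x by rewrite linearZ/= AB.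
 have d1 : enorm (delta_mx i j : 'M[R]_(m, n)) = 1.
  by rewrite /enorm mxdot_delta mxE !eqxx sqrtr1.
 have zc x : enorm (test_mxfield p B x) <= c0.
  rewrite !enormZ sE; have h := proj_enorm_le (delta_mx i j).
  rewrite d1 in h.
  have k0 : 0 <= c0 / M' by rewrite divr_ge0// ltW.
  apply: (@le_trans _ _ (M' * (c0 / M'))); last by rewrite mulrC divfK// gt_eqF.
  by apply: ler_pM => //; [exact: mulr_ge0 k0 (enorm_ge0 _)|rewrite ler_piMr].
 have [Zz cz] := Z_small Xz Az zc.
 have n0 := nflux0 Xz (fun P sP => test_mxfield_fluxm tp AB sP) u1_L1.
 have := F_ge Zz u2.
 rewrite F_u lee_fin /gain n0 addr0.
 have d2 : inL2 (test_div p B) := smooth_field_L2 (test_div_smooth B tp).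
 have -> : ipO u (div (test_mxfield p B)) = - (s * Adist i j u p).
  have -> : ipO u (div (test_mxfield p B)) = ipO u (test_div p B).
   by apply: (ip_ae mO u2 u2 (div_L2 Xz) d2 _ dE); exact: aeW.
  rewrite /Adist mulrN opprK -(RintZ mO s (Adist_intR i j cu tp)).
  by apply: Rint_eq => x _; rewrite test_div_mxdot /B mxdotZl -(A_entry).
 rewrite opprK => h; apply: le_trans h; rewrite lerDr oppr_ge0; exact: cz.
apply/ler_addgt0Pr => e e0.
have M0 : 0 <= M by exact: le_trans (normr_ge0 _) (pM 0).
(* M may be 0; the enlargement makes c0 / M' a legitimate scaling and costs at most e. *)
pose M' := M + e / (C + 1).
have C1 : 0 < C + 1 by rewrite ltr_wpDl.
have M'0 : 0 < M' by rewrite ltr_wpDl// divr_gt0.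
have hM x : `|p x| <= M' by apply: le_trans (pM x) _; rewrite lerDl divr_ge0// ltW.
have k0 : 0 < c0 / M' by rewrite divr_gt0.
have h1 := key _ (c0 / M') M'0 hM (gtr0_norm k0).
have h2 := key _ (- (c0 / M')) M'0 hM (etrans (normrN _) (gtr0_norm k0)).
apply: (@le_trans _ _ (C * M')).
 rewrite -(ler_pM2l k0) (_ : c0 / M' * (C * M') = `|Fu|); last first.
  by rewrite /C; field; rewrite !gt_eqF.
 apply: le_trans (ler_norm Fu); rewrite -[X in X * _](gtr0_norm k0) -normrM ler_norml h1 andbT.
 by rewrite lerNl -mulNr.
rewrite mulrDr lerD2l mulrCA ler_piMr ?(ltW e0)// ler_pdivrMr// mul1r lerDl//.
Qed.

(** * Attainment and the pairing conditions *)

Variables u r : field.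
Hypotheses (u2 : inL2 u) (r2 : inL2 r).

Definition pairing_rhs (z : mxfield) (w : field) : \bar R :=
 ((- (∫ x, conjugate f x (z x))) + pairing O z w O
 - (\int[sn]_(x in dO) (mxdot (normal_trace O tr z x) (tr w x - u1 x))%:E))%E.

Definition div_eq (z : mxfield) := {ae leb, forall x, O x -> r x = - div z x}.

Lemma ip_div (z : mxfield) (w : field) : X2 z -> inL2 w -> div_eq z ->
 ipO w (div z) = - ipO w r.
move=> Xz w2 e; have d2 := div_L2 Xz.
rewrite /ip -(RintN mO (ip_intR mO w2 r2)); apply: (Rint_ae mO).
- exact: intR_meas (ip_intR mO w2 d2).
- exact: intR_meas (intRN (ip_intR mO w2 r2)).
by apply: ae_mono e => x h Ox; rewrite h// [in RHS]mxdotC mxdotNl opprK mxdotC.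
Qed.

Lemma pairing_rhsE z w : Z z -> div_eq z -> BVA w -> inL2 w ->
 pairing_rhs z w = (gain z + ipO w r)%:E.
move=> Zz e bw w2; have Xz := Z_X2 Zz; have [S] := smoothing_ex oO bO lO.
have t1 := trace_L1 tr_trace bw.
have I1 := nflux_intR Xz t1.
have I2 := nflux_intR Xz u1_L1.
rewrite /pairing_rhs; have -> : (\int[sn]_(x in dO) (mxdot (normal_trace O tr z x) (tr w x - u1 x))%:E =
  (nflux z (tr w) - nflux z u1)%:E)%E.
 rewrite /nflux -(RintB mB I1 I2) -(EFin_Rint mB (intRB mB I1 I2)).
 by apply: eq_integral => x _; rewrite mxdotC mxdotBl.
rewrite (Z_conj_integral Zz) (gauss_green S Xz bw w2).
have -> : ∫ x, mxdot (w x) (div z x) = - ipO w r := ip_div Xz w2 e.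
by rewrite -EFinN -!EFinD /gain; congr (_%:E); ring.
Qed.

Lemma L2_diff_ip (w : field) : inL2 w ->
 (∫ x, (mxdot (w x - u x) (r x))%:E = (ipO w r - ipO u r)%:E)%E.
move=> w2; rewrite -(ip_subr mO w2 u2 r2).
by rewrite -(EFin_Rint mO (ip_intR mO (in_L2_diff mO w2 u2) r2)).
Qed.

Lemma dual_le (z : mxfield) (w : field) : Z z -> div_eq z -> inL2 w ->
 ((gain z + ipO w r)%:E <= F w)%E.
move=> Zz e w2; have := F_ge Zz w2.
by rewrite ip_div// ?opprK//; exact: Z_X2 Zz.
Qed.

(** The instance w = 0 already says F u <= gain z + <u, r>, and it excludes F u = +oo, for which the
    right-hand side would be -oo. *)
Lemma pairing_le_attained (z : mxfield) : Z z -> div_eq z ->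
 (forall w, BVA w -> inL2 w ->
  ((∫ x, (mxdot (w x - u x) (r x))%:E) <= pairing_rhs z w - F u)%E) ->
 F u = (gain z + ipO u r)%:E.
move=> Zz e h; pose P0 : field := fun=> 0; have s0 : smooth_field P0.
 move=> i; have -> : (fun x => P0 x 0 i) = (fun=> 0) by apply/funext => x; rewrite mxE.
 exact: smooth_cst.
have b0 := smooth_BVA s0; have z2 := smooth_field_L2 s0.
have := h _ b0 z2; rewrite (L2_diff_ip z2) (pairing_rhsE Zz e b0 z2).
have -> : ipO P0 r = 0.
 rewrite /ip -[RHS](Rint0 leb O); apply: Rint_eq => x _.
 by rewrite mxdotC mxdot0r.
have := dual_le Zz e u2; case: (F u) => [Fu| |]//=.
rewrite -EFinB !lee_fin sub0r addr0 => h1 h2; congr (_%:E); apply/eqP.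
rewrite eq_le h1 andbT -subr_ge0; move: h2; rewrite -subr_ge0.
by congr (is_true (0 <= _)); ring.
Qed.

Lemma attained_pairing_eq (z : mxfield) (w : field) : Z z -> div_eq z ->
 F u = (gain z + ipO u r)%:E -> BVA w -> inL2 w ->
 (∫ x, (mxdot (w x - u x) (r x))%:E = pairing_rhs z w - F u)%E.
move=> Zz e -> bw w2; rewrite (L2_diff_ip w2) (pairing_rhsE Zz e bw w2) -EFinB.
by congr (_%:E); ring.
Qed.

Lemma attained_subdifferential (z : mxfield) : Z z -> div_eq z ->
 F u = (gain z + ipO u r)%:E -> subdifferential O F u r.
move=> Zz e Fu w w2; have -> : (∫ x, (mxdot (r x) (w x - u x))%:E =
  (ipO w r - ipO u r)%:E)%E.
 by rewrite -(L2_diff_ip w2); apply: eq_integral => x _; rewrite mxdotC.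
have := dual_le Zz e w2; rewrite Fu; case: (F w) => [Fw| |]//=; last by move=> _; rewrite addye// leey.
rewrite -EFinB !lee_fin => h; rewrite -subr_ge0; move: h; rewrite -subr_ge0.
by congr (is_true (0 <= _)); ring.
Qed.

(** Testing with w = u gives 0 <= F u - F u, which fails at +oo by the convention +oo - +oo = -oo;
    the zero field excludes -oo. *)
Lemma subdifferential_fin : subdifferential O F u r -> exists Fu : R, F u = Fu%:E.
move=> /(_ _ u2) h.
have := F_ge
 (zero_Z) u2.
have e : (∫ x, (mxdot (r x) (u x - u x))%:E = 0)%E.
 by under eq_integral do rewrite subrr mxdot0r; rewrite integral0.
by move: h; rewrite e; case: (F u) => [Fu _ _| |]//; exists Fu.
Qed.

End boundary_value_problem.

Theorem theorem5p4 (R : realType) (m n : nat) (n_gt0 : (0 < n)%N)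
    (Omega : set 'rV[R]_n) (Omega_open : open Omega)
    (Omega_bounded : bounded_set Omega)
    (Omega_lipschitz : lipschitz_boundary Omega)
    (A : {linear 'M[R]_(m, n) -> 'M[R]_(m, n)})
    (A_sym : forall y y', mxdot (A y) y' = mxdot y (A y'))
    (A_idem : forall y, A (A y) = A y)
    (A_elliptic : C_elliptic A)
    (tr : ('rV[R]_n -> 'rV[R]_m) -> surface_type R n -> 'rV[R]_m)
    (tr_trace : trace_operator A Omega tr)
    (f : 'rV[R]_n -> 'M[R]_(m, n) -> R)
    (f_ge0 : forall x y, closure Omega x -> 0 <= f x y)
    (f_borel : measurable_fun (closure Omega `*` setT)
                 (fun xy : 'rV[R]_n * 'M[R]_(m, n) => f xy.1 xy.2))
    (f_convex : forall x, closure Omega x ->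
                  convex_function (E := 'M[R]_(m, n)) setT (f x))
    (c0 C0 : R) (c0_gt0 : 0 < c0) (C0_gt0 : 0 < C0)
    (f_growth : forall x y, closure Omega x ->
                  c0 * enorm (A y) <= f x y <= C0 * (1 + enorm (A y)))
    (u1 : surface_type R n -> 'rV[R]_m)
    (u1_L1 : in_L (surface n) (bd Omega) 1 u1)
    (u r : 'rV[R]_n -> 'rV[R]_m)
    (u_L2 : in_L (lebesgue_rV n) Omega 2 u)
    (r_L2 : in_L (lebesgue_rV n) Omega 2 r) :
  let leb := lebesgue_rV n in
  let F := F_dual A Omega f tr u1 in
  let eq_Ndiv z := {ae leb, forall x, Omega x -> r x = - wdiv Omega z x} in
  let rhs z w :=
    ((- (\int[leb]_(x in Omega) conjugate f x (z x)))
     + pairing Omega z w Omega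
     - (\int[surface n]_(x in bd Omega)
          (mxdot (normal_trace Omega tr z x) (tr w x - u1 x))%:E))%E in
  [<->
    (* a *) subdifferential Omega F u r;
    (* b *) exists z, [/\ in_Z A Omega f z, eq_Ndiv z &
      forall w, in_BVA Omega A w -> in_L leb Omega 2 w ->
        ((\int[leb]_(x in Omega) (mxdot (w x - u x) (r x))%:E) <= rhs z w - F u)%E];
    (* c *) exists z, [/\ in_Z A Omega f z, eq_Ndiv z &
      forall w, in_BVA Omega A w -> in_L leb Omega 2 w ->
        ((\int[leb]_(x in Omega) (mxdot (w x - u x) (r x))%:E) = rhs z w - F u)%E];
    (* d *) in_BVA Omega A u /\
      exists z, [/\ in_Z A Omega f z, eq_Ndiv z & F u = rhs z u]].
Proof.
move=> leb F eq_Ndiv rhs.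
have attained z : in_Z A Omega f z -> eq_Ndiv z ->
  F u = (gain Omega tr f u1 z + ip (lebesgue_rV n) Omega u r)%:E ->
  forall w, in_BVA Omega A w -> in_L leb Omega 2 w ->
    ((\int[leb]_(x in Omega) (mxdot (w x - u x) (r x))%:E) = rhs z w - F u)%E.
  move=> Zz e Fu w bw w2.
  exact: (attained_pairing_eq A_sym Omega_open Omega_bounded n_gt0 Omega_lipschitz tr_trace u1_L1 u_L2 r_L2 Zz e Fu bw w2).
have le_attained z : in_Z A Omega f z -> eq_Ndiv z ->
  (forall w, in_BVA Omega A w -> in_L leb Omega 2 w ->
    ((\int[leb]_(x in Omega) (mxdot (w x - u x) (r x))%:E) <= rhs z w - F u)%E) ->
  F u = (gain Omega tr f u1 z + ip (lebesgue_rV n) Omega u r)%:E.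
  exact: (pairing_le_attained A_sym Omega_open Omega_bounded n_gt0 Omega_lipschitz tr_trace u1_L1 u_L2 r_L2).
tfae.
- move=> ur; have [Fu FuE] := subdifferential_fin A_sym A_idem Omega_open Omega_bounded n_gt0 Omega_lipschitz tr_trace f_ge0 f_borel f_convex c0_gt0 C0_gt0 f_growth u1_L1 u_L2 ur.
  have [z [Zz e Fz]] := subdifferential_attained A_sym A_idem Omega_open Omega_bounded n_gt0 Omega_lipschitz tr_trace f_ge0 f_borel f_convex c0_gt0 C0_gt0 f_growth u1_L1 u_L2 r_L2 FuE ur.
  have FzE : F u = (gain Omega tr f u1 z + ip (lebesgue_rV n) Omega u r)%:E by rewrite -Fz.
  by exists z; split => // w bw w2; rewrite (attained z Zz e FzE w bw w2).
- move=> [z [Zz e h]]; have Fz := le_attained z Zz e h.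
  by exists z; split => // w bw w2; exact: attained.
- move=> [z [Zz e h]].
  have Fz : F u = (gain Omega tr f u1 z + ip (lebesgue_rV n) Omega u r)%:E.
    by apply: le_attained => // w bw w2; rewrite h.
  (* Condition (c) makes F u finite, and only then is the trace of u available for the right-hand
     side at w = u. *)
  have bu := F_fin_BVA A_sym A_idem Omega_open Omega_bounded n_gt0 Omega_lipschitz tr_trace f_ge0 f_borel f_convex c0_gt0 C0_gt0 f_growth u1_L1 u_L2 Fz.
  split => //; exists z; split => //; rewrite Fz.
  by rewrite -(pairing_rhsE A_sym Omega_open Omega_bounded n_gt0 Omega_lipschitz tr_trace u1_L1 r_L2 Zz e bu u_L2).
- move=> [bu [z [Zz e Fz]]].
  apply: (attained_subdifferential A_sym Omega_open Omega_bounded n_gt0 Omega_lipschitz tr_trace u1_L1 u_L2 r_L2 Zz e).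
  exact: etrans Fz (pairing_rhsE A_sym Omega_open Omega_bounded n_gt0 Omega_lipschitz tr_trace u1_L1 r_L2 Zz e bu u_L2).
Qed.
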